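(* Let $n\geq 2$ and let $\Omega\subset\mathbb{R}^{n}$ be an open bounded smooth domain. Then there exists a smooth map $F:\overline{\Omega}\rightarrow\mathbb{R}^{n}$ satisfying \[ \left\{ \begin{array}{l} \operatorname{rank}\left(F(x),\partial_{1}F(x),\cdots,\partial_{n}F(x)\right)=n\quad\text{for any }x\in\overline{\Omega},\\ \frac{\partial F}{\partial\nu}=0\quad\text{on }\partial\Omega, \end{array} \right. \] if and only if $\overline{\Omega}$ is diffeomorphic to $\overline{B}_{1}$ or to $\overline{B}_{2}\setminus B_{1}$.
   Context: A domain is a connected open set; ''smooth domain'' means that the boundary $\partial\Omega$ is smooth ($C^\infty$), so that $\overline{\Omega}$ is a compact smooth manifold with boundary. Smooth means $C^\infty$ (up to the boundary, for maps on $\overline{\Omega}$), and diffeomorphic means diffeomorphic as smooth manifolds with boundary. $\nu$ denotes the outer unit normal of $\partial\Omega$, $\frac{\partial F}{\partial \nu}$ the (componentwise) normal derivative, and $\partial_i F$ the partial derivative in the $i$-th coordinate. $\left(F(x),\partial_{1}F(x),\cdots,\partial_{n}F(x)\right)$ is the $n\times(n+1)$ matrix with these vectors of $\mathbb{R}^n$ as columns. $B_{1}$ and $B_{2}$ are the open balls in $\mathbb{R}^n$ centered at zero with radius $1$ and $2$ respectively. *)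

(* Defs.v *)
From HB Require Import structures.
From mathcomp Require Import all_boot all_order all_algebra.
From mathcomp Require Import all_classical all_reals all_analysis.

Set Implicit Arguments.
Unset Strict Implicit.
Unset Printing Implicit Defensive.
Import Order.TTheory GRing.Theory Num.Theory.
Import numFieldNormedType.Exports.
Local Open Scope classical_set_scope.
Local Open Scope ring_scope.

(* The library norm on row vectors is the sup norm: it gives the usual topology
   of R^n, but balls and unit normals require the Euclidean norm. *)
Definition enorm (R : realType) (n : nat) (x : 'rV[R]_n) : R :=
  Num.sqrt (\sum_(i < n) x 0 i ^+ 2).

Definition eball0 (R : realType) (n : nat) (r : R) : set 'rV[R]_n :=
  [set x | enorm x < r].
Arguments eball0 {R} n r.

Definition boundary (T : topologicalType) (A : set T) : set T :=
  closure A `\` interior A.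

(* i :: s stands for the operator d_i applied after the operator of s. *)
Fixpoint iter_partial (R : realType) (n : nat) (V : normedModType R)
    (s : seq 'I_n) (f : 'rV[R]_n -> V) : 'rV[R]_n -> V :=
  if s is i :: s' then 'D_(delta_mx 0 i) (iter_partial s' f) else f.

(* C^infinity on U, meant for U open: f is a total function, but the values of
   its derivatives at points of an open U depend only on f restricted to U. *)
Definition smooth_on_open (R : realType) (n : nat) (V : normedModType R)
    (U : set 'rV[R]_n) (f : 'rV[R]_n -> V) : Prop :=
  forall (s : seq 'I_n) (x : 'rV[R]_n), U x ->
    {for x, continuous (iter_partial s f)} /\
    forall i : 'I_n, derivable (iter_partial s f) x (delta_mx 0 i).

(* Smoothness of the restriction of f to an arbitrary subset A of R^n: local
   existence of smooth extensions. For A the closure of a smooth domain this is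
   smoothness up to the boundary, i.e. smoothness on the manifold with
   boundary A. The values of f outside A are irrelevant. *)
Definition smooth_on (R : realType) (n : nat) (V : normedModType R)
    (A : set 'rV[R]_n) (f : 'rV[R]_n -> V) : Prop :=
  forall x, A x -> exists (U : set 'rV[R]_n) (g : 'rV[R]_n -> V),
    [/\ open U, U x, smooth_on_open U g & {in A `&` U, f =1 g}].

Definition diffeomorphic (R : realType) (n : nat) (A B : set 'rV[R]_n) : Prop :=
  exists f g : 'rV[R]_n -> 'rV[R]_n,
    [/\ smooth_on A f, smooth_on B g,
        (forall x, A x -> B (f x) /\ g (f x) = x) &
        (forall y, B y -> A (g y) /\ f (g y) = y)].

Definition gradient (R : realType) (n : nat) (rho : 'rV[R]_n -> R)
    (x : 'rV[R]_n) : 'rV[R]_n :=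
  \row_(i < n) 'D_(delta_mx 0 i) rho x.

Definition local_defining_function (R : realType) (n : nat)
    (Omega : set 'rV[R]_n) (x : 'rV[R]_n) (rho : 'rV[R]_n -> R) : Prop :=
  exists U : set 'rV[R]_n,
    [/\ open U, U x, smooth_on_open U rho,
        (forall y, U y -> gradient rho y != 0) &
        (forall y, U y -> (Omega y <-> rho y < 0))].

(* As usual, a domain is nonempty (the library's [connected] holds of set0). *)
Definition bounded_smooth_domain (R : realType) (n : nat)
    (Omega : set 'rV[R]_n) : Prop :=
  [/\ Omega !=set0, open Omega, connected Omega, bounded_set Omega &
      forall x, boundary Omega x ->
        exists rho, local_defining_function Omega x rho].

(* The normalized gradient does not depend on the defining function, so for
   x on the boundary of a smooth domain there is exactly one such nu. *)
Definition outer_unit_normal (R : realType) (n : nat)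
    (Omega : set 'rV[R]_n) (x nu : 'rV[R]_n) : Prop :=
  exists2 rho, local_defining_function Omega x rho &
    nu = (enorm (gradient rho x))^-1 *: gradient rho x.

(* Derivative along v at a point x of the closure of Omega of a map smooth up
   to the boundary: the continuous extension to the closure of the derivative
   in Omega. For x in Omega this is 'D_v F x; for x on the boundary it is
   'D_v G x for any smooth local extension G of F. *)
Definition derive_closure (R : realType) (n : nat) (V : normedModType R)
    (Omega : set 'rV[R]_n) (F : 'rV[R]_n -> V) (v x : 'rV[R]_n) : V :=
  lim ('D_v F y @[y --> within Omega (nbhs x)]).

(* The n x (n+1) matrix with columns F x, d_1 F x, ..., d_n F x. *)
Definition value_jacobian (R : realType) (n : nat) (Omega : set 'rV[R]_n)
    (F : 'rV[R]_n -> 'rV[R]_n) (x : 'rV[R]_n) : 'M[R]_(n, 1 + n) :=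
  row_mx (F x)^T
    (\matrix_(i, j) derive_closure Omega F (delta_mx 0 j) x 0 i).

(* Main.v *)
(* Necessity. After multiplication by a positive function F extends to all of R^n,
   with dF/dnu parallel to F on the boundary. The rank condition says that off its
   zeros, which are nondegenerate, F / |F| is a submersion to the sphere. Its fibres
   are orbits of the smooth field w = F adj(DF), which has 'D_w F = det(DF) F, is
   transverse to the boundary, and has a source or a sink at each zero of F. Since
   n >= 2, the domain minus the zeros is connected, and so all orbits in it have
   the same fate; as some orbit reaches the boundary, up to time reversal they all
   leave forwards. Backwards either all come from a single zero of F, and F / |F|
   together with a function of the exit time gives a diffeomorphism to the ball;
   or all reach the boundary as well, there are no zeros, and the domain is a
   product of an interval with a compact section that F / |F| maps to the sphere
   by a covering. For n >= 3 the covering is trivial, and for n = 2 a root of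
   F / |F| trivializes it: the domain is an annulus.

   Sufficiency. For a diffeomorphism phi to the model let d be 1 - |phi|^2, or
   (|phi|^2 - 1) (4 - |phi|^2). Then F = phi + e (1 - exp(-d / e)) v has zero normal
   derivative if v = - Dphi (grad d) / (|grad d|^2 + d). Along the correction by
   grad d (x) v the value phi restores the rank, because grad d is pulled back from
   a radial covector, and the other terms are negligible for small e. *)

From HB Require Import structures.
From mathcomp Require Import all_boot all_order all_algebra.
From mathcomp Require Import all_classical all_reals all_analysis.
From mathcomp Require Import ring lra.
Require Import Defs.
Set Implicit Arguments.
Unset Strict Implicit.
Unset Printing Implicit Defensive.
Import Order.TTheory GRing.Theory Num.Theory.
Import numFieldNormedType.Exports.
Local Open Scope classical_set_scope.
Local Open Scope ring_scope.

(** * Smooth functions *)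

Section Calc.
Context {R : realType}.

(** Smooth dependence of a flow on its initial point is never proved in general. For the kernel
    field it comes from charts: along an orbit [F] only changes by a positive factor, so [F] divided
    by a linear form of [F] gives all coordinates but one, and the last one, a function with
    derivative 1 along the field, is a primitive along lines. For the auxiliary fields Lipschitz
    dependence, from Gronwall's inequality, is enough. The charts also replace Poincare-Bendixson
    arguments: two points of a small box on one ray of [F] differ by a flow time below 1, so an
    orbit that comes back to the box later than that is periodic. Hence an orbit that stays in the
    domain is periodic or converges to a sink, and both alternatives, like leaving the domain, are
    open; this is what connectedness of the punctured domain acts on. For the converse the obstacle
    is that any repair of the normal derivative has a derivative that is not small at the boundary.
    The chosen correction is of size [e], and in its derivative everything is of size [e] except one
    rank one term. *)

Lemma differential_bound (V W : normedModType R) (f : V -> W) (x : V)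
    (df : {linear V -> W}) : continuous df ->
  (forall e : R, 0 < e -> \forall h \near (0 : V), `|f (h + x) - f x - df h| <= e * `|h|) ->
  differentiable f x /\ 'd f x = df :> (V -> W).
Proof.
move=> cdf H.
have E : f \o shift x = cst (f x) + df +o_ 0 id.
  apply/eqaddoP => _/posnumP[e].
  have := H e%:num [gt0 of e%:num].
  apply: filterS => h; rewrite /=.
  by rewrite !fctE /= opprD addrA.
have D := diff_unique cdf E.
split => //.
by apply/diff_locallyP; rewrite D.
Qed.

Lemma is_derive_line (V W : normedModType R) (f : V -> W) (y v : V) (t : R) :
  derivable f (y + t *: v) v ->
  is_derive (t : R) (1 : R) (fun s : R => f (y + s *: v)) ('D_v f (y + t *: v)).
Proof.
have E : (fun h : R => h^-1 *: (((fun s : R => f (y + s *: v)) \o shift t) (h *: (1 : R)) - f (y + t *: v)))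
    = (fun h : R => h^-1 *: ((f \o shift (y + t *: v)) (h *: v) - f (y + t *: v))).
  rewrite funeqE => h; congr (_ *: (_ - _)); rewrite /=; congr (f _).
  by rewrite [_%:A]mulr1 scalerDl addrCA.
by move=> df; apply: DeriveDef; rewrite /derivable /derive E.
Qed.

(** Both signs of [a] occur, since an increment along a coordinate may go either way; the
    intermediate point is located only by its absolute value. *)
Lemma MVT0 (g dg : R -> R) (a : R) :
  (forall t, `|t| <= `|a| -> is_derive t (1 : R) g (dg t)) ->
  exists2 c, `|c| <= `|a| & g a - g 0 = dg c * a.
Proof.
move=> H.
have [a0|a0] := leP 0 a.
  have [||c] := @MVT_segment R g dg 0 a a0.
  - move=> x; rewrite in_itv /= => /andP[x0 xa]; apply: H.
    by rewrite !ger0_norm // ltW.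
  - apply: derivable_within_continuous => x; rewrite in_itv /= => /andP[x0 xa].
    by have [] : is_derive x (1 : R) g (dg x) by apply: H; rewrite !ger0_norm.
  rewrite in_itv /= subr0 => /andP[c0 ca] E; exists c => //.
  by rewrite !ger0_norm.
have [||c] := @MVT_segment R g dg a 0 (ltW a0).
- move=> x; rewrite in_itv /= => /andP[x0 xa]; apply: H.
  by rewrite !ler0_norm ?lerN2 // ltW.
- apply: derivable_within_continuous => x; rewrite in_itv /= => /andP[x0 xa].
  by have [] : is_derive x (1 : R) g (dg x) by apply: H; rewrite !ler0_norm ?lerN2 // ltW.
rewrite in_itv /= => /andP[c0 ca] E; exists c; last by rewrite -opprB E sub0r mulrN opprK.
by rewrite !ler0_norm ?lerN2 // ltW.
Qed.

Lemma derive_comp (V W Z : normedModType R) (f : V -> W) (g : W -> Z) (x v : V) :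
  differentiable f x -> differentiable g (f x) ->
  'D_v (fun y => g (f y)) x = 'D_('D_v f x) g (f x).
Proof.
move=> df dg; rewrite -[LHS]/('D_v (g \o f) x) deriveE; last exact: differentiable_comp.
by rewrite diff_comp //= -(deriveE v df) -deriveE.
Qed.

Lemma deriveZv (V W : normedModType R) (f : V -> W) (x v : V) (c : R) :
  differentiable f x -> 'D_(c *: v) f x = c *: 'D_v f x.
Proof. by move=> df; rewrite !deriveE // linearZ. Qed.

Lemma near_continuous (V W : normedModType R) (f g : V -> W) (x : V) :
  (\near x, f x = g x) -> {for x, continuous f} -> {for x, continuous g}.
Proof.
move=> fg cf; rewrite /prop_for /continuous_at -(nbhs_singleton fg).
by apply: cvg_trans cf; apply: near_eq_cvg; apply: filterS fg => y.
Qed.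

Lemma near_open (V : normedModType R) (P : V -> Prop) (x : V) :
  (\near x, P x) -> exists U : set V, [/\ open U, U x & forall y, U y -> P y].
Proof. move=> H; have : nbhs x P by []; by rewrite nbhsE => -[U [oU Ux] HU]; exists U. Qed.

Lemma open_near (V : normedModType R) (U : set V) (x : V) : open U -> U x ->
  \forall y \near x, U y.
Proof. by move=> oU Ux; apply: open_nbhs_nbhs. Qed.

Lemma near_differentiable (V W : normedModType R) (f g : V -> W) (x : V) :
  (\near x, f x = g x) -> differentiable f x -> differentiable g x.
Proof.
move=> fg /diff_locallyP [cd /eqaddoP E].
suff : differentiable g x /\ 'd g x = 'd f x :> (V -> W) by case.
apply: differential_bound => // e e0.
have := E e e0; rewrite /= => H.
have fg0 := nbhs_singleton fg.
have fgs : \forall h \near (0 : V), f (h + x) = g (h + x).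
  by move: fg; rewrite (near_shift 0) /=; apply: filterS => h; rewrite /= subr0.
apply: filterS2 fgs H => h <-.
by rewrite !fctE /= opprD addrA fg0.
Qed.

End Calc.

Section Cn.
Context {R : realType}.
Variable V : normedModType R.

(** Directional derivatives replace iterated differentials, so the recursion stays among scalar
    functions. Differentiability is asked near [x], not only at [x]: the rules of calculus then hold
    as identities of germs and can be differentiated again. *)
Fixpoint Cn (k : nat) (f : V -> R) (x : V) : Prop :=
  if k is k'.+1 then (\forall y \near x, differentiable f y) /\
     forall v, Cn k' ('D_v f) x
  else {for x, continuous f}.

Definition smo (f : V -> R) (x : V) := forall k, Cn k f x.
(** The neighbourhood inside [Cn k] may shrink as [k] grows, so [smo] at a point need not persist
    nearby; [sm] does, by construction. *)
Definition sm (f : V -> R) (x : V) := \forall y \near x, smo f y.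

End Cn.

Section SmoothAlgebra.
Context {R : realType} {V : normedModType R}.
Implicit Types (f g : V -> R) (x v : V).

Lemma CnS k f x : Cn k.+1 f x -> Cn k f x.
Proof.
elim: k f x => [|k IH] f x.
  by move=> [/nbhs_singleton df _] /=; apply: differentiable_continuous.
by move=> [df H]; split=> // v; apply: IH.
Qed.

Lemma Cn_le k l f x : (k <= l)%N -> Cn l f x -> Cn k f x.
Proof.
elim: l => [|l IH]; first by rewrite leqn0 => /eqP ->.
rewrite leq_eqVlt => /orP[/eqP -> //|kl /CnS]; exact: IH.
Qed.

Lemma Cn_eq k f g x : (\near x, f x = g x) -> Cn k f x -> Cn k g x.
Proof.
elim: k f g x => [|k IH] f g x fg /=.
  exact: near_continuous.
move=> [df Df]; split.
  have fg' := near_join fg.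
  apply: filterS2 fg' df => y; exact: near_differentiable.
move=> v; apply: IH (Df v).
have fg' := near_join fg.
by apply: filterS fg' => y fgy; apply: near_eq_derive.
Qed.

Lemma Cn_der k f x v : Cn k.+1 f x -> Cn k ('D_v f) x.
Proof. by move=> /= [_]; apply. Qed.

Lemma Cn_cst k (c : R) x : Cn k (cst c : V -> R) x.
Proof.
elim: k c => [|k IH] c; first exact: cvg_cst.
split; first by near=> y; apply: differentiable_cst.
move=> v; apply: Cn_eq (IH 0); near=> y.
by rewrite derive_cst.
Unshelve. all: by end_near. Qed.

Lemma CnD k f g x : Cn k f x -> Cn k g x -> Cn k (fun y => f y + g y) x.
Proof.
elim: k f g => [|k IH] f g; first by move=> cf cg; apply: cvgD.
move=> [df Df] [dg Dg]; split.
  by apply: filterS2 df dg => y; apply: differentiableD.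
move=> v; apply: Cn_eq (IH _ _ (Df v) (Dg v)).
apply: filterS2 df dg => y dfy dgy.
by rewrite -[RHS]/('D_v (f \+ g) y) deriveD //; apply: diff_derivable.
Qed.

Lemma CnM k f g x : Cn k f x -> Cn k g x -> Cn k (fun y => f y * g y) x.
Proof.
elim: k f g => [|k IH] f g; first by move=> cf cg; apply: cvgM.
move=> Hf Hg; have [df Df] := Hf; have [dg Dg] := Hg; split.
  by apply: filterS2 df dg => y; apply: differentiableM.
move=> v.
have H1 := IH _ _ (CnS Hf) (Dg v); have H2 := IH _ _ (CnS Hg) (Df v).
apply: Cn_eq (CnD H1 H2).
apply: filterS2 df dg => y dfy dgy.
rewrite -[RHS]/('D_v (f * g) y) deriveM //; apply: diff_derivable => //.
Qed.

Lemma CnN k f x : Cn k f x -> Cn k (fun y => - f y) x.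
Proof.
move=> H; apply: Cn_eq (CnM (Cn_cst k (-1) x) H).
by near=> y; rewrite /cst mulN1r.
Unshelve. all: by end_near. Qed.

Lemma CnB k f g x : Cn k f x -> Cn k g x -> Cn k (fun y => f y - g y) x.
Proof. by move=> H1 H2; apply: CnD => //; apply: CnN. Qed.

Lemma Cn_sum k (I : Type) (r : seq I) (P : pred I) (F : I -> V -> R) x :
  (forall i, P i -> Cn k (F i) x) -> Cn k (fun y => \sum_(i <- r | P i) F i y) x.
Proof.
move=> H; elim: r => [|i r IH].
  by apply: Cn_eq (Cn_cst k 0 x); near=> y; rewrite big_nil.
case Pi : (P i).
  apply: Cn_eq (CnD (H i Pi) IH); near=> y; by rewrite big_cons Pi.
by apply: Cn_eq IH; near=> y; rewrite big_cons Pi.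
Unshelve. all: by end_near. Qed.

Lemma Cn_prod k (I : Type) (r : seq I) (P : pred I) (F : I -> V -> R) x :
  (forall i, P i -> Cn k (F i) x) -> Cn k (fun y => \prod_(i <- r | P i) F i y) x.
Proof.
move=> H; elim: r => [|i r IH].
  by apply: Cn_eq (Cn_cst k 1 x); near=> y; rewrite big_nil.
case Pi : (P i).
  apply: Cn_eq (CnM (H i Pi) IH); near=> y; by rewrite big_cons Pi.
by apply: Cn_eq IH; near=> y; rewrite big_cons Pi.
Unshelve. all: by end_near. Qed.

Lemma Cn_comp1 k (h : R -> R) f x : Cn k h (f x) -> Cn k f x ->
  Cn k (fun y => h (f y)) x.
Proof.
elim: k h f => [|k IH] h f.
  by move=> ch cf; apply: (@continuous_comp _ _ _ f h).
move=> Hh Hf; have [dh Dh] := Hh; have [df Df] := Hf.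
have cf : {for x, continuous f} by have := Cn_le (leq0n _) Hf.
have dhf : \forall y \near x, differentiable h (f y) by exact: (cf _ dh).
split.
  apply: filterS2 dhf df => y dhy dfy.
  by apply: (@differentiable_comp _ _ _ _ f h).
move=> v.
have H1 := IH _ _ (Dh 1) (CnS Hf).
apply: Cn_eq (CnM (Df v) H1).
apply: filterS2 dhf df => y dhy dfy.
rewrite [RHS]derive_comp //.
have <- : 'D_v f y *: (1 : R) = 'D_v f y by exact: mulr1.
by rewrite deriveZv // [_%:A]mulr1.
Qed.

Lemma CnV k f x : f x != 0 -> Cn k f x -> Cn k (fun y => (f y)^-1) x.
Proof.
elim: k f => [|k IH] f fx.
  by move=> cf; apply: cvgV.
move=> Hf; have [df Df] := Hf.
have cf : {for x, continuous f} by have := Cn_le (leq0n _) Hf.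
have fn0 : \forall y \near x, f y != 0.
  have := cf (fun z => z != 0); apply; exact: open_neq.
split.
  by apply: filterS2 fn0 df => y ? ?; apply: differentiableV.
move=> v.
have H1 := IH _ fx (CnS Hf).
apply: Cn_eq (CnM (CnN (CnM H1 H1)) (Df v)).
apply: filterS2 fn0 df => y fy dfy.
rewrite -[RHS]/('D_v (fun z => (f z)^-1) y) deriveV //; last exact: diff_derivable.
by rewrite -[RHS]/( _ * _) expr2 invfM.
Qed.

End SmoothAlgebra.

Section Multi.
Context {R : realType} {V : normedModType R}.

Lemma differentiable_rowP m (f : V -> 'rV[R]_m) x :
  (forall j, differentiable (fun y => f y 0 j) x) -> differentiable f x.
Proof.
move=> H.
have -> : f = \sum_(j < m) (fun y => f y 0 j *: (delta_mx 0 j : 'rV[R]_m)).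
  by rewrite funeqE => y; rewrite fct_sumE; exact: row_sum_delta.
by apply: differentiable_sum => j; apply: differentiableZl.
Qed.

Lemma differentiable_row m (f : V -> 'rV[R]_m) x j :
  differentiable f x -> differentiable (fun y => f y 0 j) x.
Proof.
move=> df; apply: (@differentiable_comp _ _ _ _ f (fun u : 'rV[R]_m => u 0 j)) => //.
exact: differentiable_coord.
Qed.

Lemma derive_row m (f : V -> 'rV[R]_m) x v j : differentiable f x ->
  'D_v f x 0 j = 'D_v (fun y => f y 0 j) x.
Proof.
by move=> df; rewrite derive_mx ?mxE //; apply: diff_derivable.
Qed.

Lemma derive_comp_row m (f : V -> 'rV[R]_m) (g : 'rV[R]_m -> R) x v :
  differentiable f x -> differentiable g (f x) ->
  'D_v (fun y => g (f y)) x =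
    \sum_(j < m) 'D_v (fun y => f y 0 j) x * 'D_(delta_mx 0 j) g (f x).
Proof.
move=> df dg; rewrite -[LHS]/('D_v (g \o f) x) deriveE; last exact: differentiable_comp.
rewrite diff_comp //= -(deriveE v df) {1}(row_sum_delta ('D_v f x)) linear_sum.
by apply: eq_bigr => j _; rewrite linearZ -deriveE // derive_row.
Qed.

Lemma near_row_continuous m (f : V -> 'rV[R]_m) x :
  (forall j, {for x, continuous (fun y => f y 0 j)}) -> {for x, continuous f}.
Proof.
move=> H; apply/cvgrPdist_le => e e0.
have : \forall y \near x, forall j, `|f x 0 j - f y 0 j| <= e.
  apply: filter_forall => j.
  by have /cvgrPdist_le /(_ e e0) := H j.
apply: filterS => y Hy.
rewrite /Num.Def.normr /= mx_normrE; apply: bigmax_le; first exact: ltW.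
by move=> [i j] _; rewrite !mxE ord1; apply: Hy.
Qed.

(** Induction on [k] through the chain rule: each directional derivative is a sum of products of a
    derivative of a component of [f] and a partial derivative of [g] composed with the same [f]. *)
Lemma Cn_comp k m (f : V -> 'rV[R]_m) (g : 'rV[R]_m -> R) x :
  Cn k g (f x) -> (forall j, Cn k (fun y => f y 0 j) x) ->
  Cn k (fun y => g (f y)) x.
Proof.
elim: k g => [|k IH] g.
  move=> cg cf; apply: (@continuous_comp _ _ _ f g) => //.
  exact: near_row_continuous.
move=> Hg Hf; have [dg Dg] := Hg.
have cf : {for x, continuous f}.
  by apply: near_row_continuous => j; exact: (Cn_le (leq0n _) (Hf j)).
have df : \forall y \near x, differentiable f y.
  have : \forall y \near x, forall j, differentiable (fun y => f y 0 j) y.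
    by apply: filter_forall => j; have [] := Hf j.
  by apply: filterS => y; exact: differentiable_rowP.
have dgf : \forall y \near x, differentiable g (f y) by exact: (cf _ dg).
split.
  apply: filterS2 dgf df => y dgy dfy.
  by apply: (@differentiable_comp _ _ _ _ f g).
move=> v.
suff H : Cn k (fun y => \sum_(j < m) 'D_v (fun y => f y 0 j) y * 'D_(delta_mx 0 j) g (f y)) x.
  apply: Cn_eq H; apply: filterS2 dgf df => y dgy dfy.
  by rewrite derive_comp_row.
apply: Cn_sum => j _; apply: CnM; first exact: Cn_der.
by apply: (IH _ (Dg _)) => i; exact: CnS.
Qed.

End Multi.

Section ContinuouslyDifferentiable.
Context {R : realType}.

Lemma Cn_coord k m (j : 'I_m) (x : 'rV[R]_m) : Cn k (fun y : 'rV[R]_m => y 0 j) x.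
Proof.
case: k => [|k]; first exact: coord_continuous.
split; first by near=> y; apply: differentiable_coord.
move=> v; apply: Cn_eq (Cn_cst k (v 0 j) x); near=> y.
rewrite -[RHS]/('D_v (fun y => (id : 'rV[R]_m -> 'rV[R]_m) y 0 j) y) -derive_row.
  by rewrite derive_id.
exact: (@ex_diff _ _ _ _ _ id).
Unshelve. all: by end_near. Qed.

(* telescoping along the coordinates and the mean value theorem *)
Lemma C1_differentiable n (f : 'rV[R]_n -> R) (x : 'rV[R]_n) :
  (forall i : 'I_n, \forall y \near x, derivable f y (delta_mx 0 i)) ->
  (forall i : 'I_n, {for x, continuous ('D_(delta_mx 0 i) f)}) ->
  differentiable f x.
Proof.
move=> df cf.
pose L (h : 'rV[R]_n) : R := \sum_(i < n) h 0 i * 'D_(delta_mx 0 i) f x.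
have Ladd : linear L.
  move=> a u v; rewrite /L scaler_sumr -big_split /=; apply: eq_bigr => i _.
  by rewrite !mxE mulrDl -mulrA.
pose LL := GRing.isLinear.Build _ _ _ _ L Ladd.
pose Ll : {linear 'rV[R]_n -> R} := HB.pack L LL.
have cL : continuous Ll.
  move=> u; rewrite /Ll /= /L.
  apply: (@Cn_sum _ _ 0%N _ _ _ (fun i (h : 'rV[R]_n) => h 0 i * 'D_(delta_mx 0 i) f x)).
  by move=> i _; apply: CnM; [exact: (Cn_coord 0) | exact: (Cn_cst 0)].
suff : differentiable f x /\ 'd f x = Ll :> (_ -> _) by case.
apply: differential_bound => // e e0.
(* Each of the [n] coordinate steps may cost this much; the successor keeps the constant meaningful
   for [n = 0]. *)
have n0 : 0 < e / (n.+1)%:R :> R by rewrite divr_gt0.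
have : \forall y \near x, forall i : 'I_n, derivable f y (delta_mx 0 i) /\
    `|'D_(delta_mx 0 i) f x - 'D_(delta_mx 0 i) f y| <= e / (n.+1)%:R.
  apply: (@filter_forall 'rV[R]_n 'I_n (fun i y => derivable f y (delta_mx 0 i) /\
    `|'D_(delta_mx 0 i) f x - 'D_(delta_mx 0 i) f y| <= e / (n.+1)%:R) (nbhs x)) => i.
  have /cvgrPdist_le /(_ _ n0) H2 := cf i.
  by apply: filterS2 (df i) H2.
move=> /nbhs_ballP [d /= d0 Hd].
have Hn : nbhs (0 : 'rV[R]_n) (fun h => `|h| < d) by exact: (@nbhs0_lt R 'rV[R]_n d d0).
apply: filterS Hn => h hd.
(* [hh k + x] leads from [x] to [h + x] by switching on one coordinate of [h] at a time. *)
pose hh k : 'rV[R]_n := \row_j (if (j < k)%N then h 0 j else 0).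
have step : forall i : 'I_n, `|f (hh i.+1 + x) - f (hh i + x) - 'D_(delta_mx 0 i) f x * h 0 i| <= e / n.+1%:R * `|h|.
  move=> i.
  have E1 : hh i.+1 = h 0 i *: delta_mx 0 i + hh i.
    apply/rowP => j; rewrite !mxE eqxx /= ltnS leq_eqVlt.
    have [->|ji] := eqVneq j i; first by rewrite eqxx ltnn /= mulr1 addr0.
    by rewrite (negbTE (_ : nat_of_ord j != i)) // ?mulr0 ?add0r.
  have hi : `|h 0 i| <= `|h|.
    rewrite [leRHS]/Num.Def.normr /= mx_normrE.
    by apply: (le_trans _ (le_bigmax _ _ (0, i))).
  have inb (t : R) : `|t| <= `|h 0 i| -> ball x d (hh i + x + t *: delta_mx 0 i).
    move=> t1; rewrite -ball_normE /ball_ /=.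
    rewrite !opprD addrA [x + _]addrC addrNK -opprD normrN; apply: le_lt_trans hd.
    rewrite [leLHS]/Num.Def.normr /= mx_normrE; apply: bigmax_le => //= -[a j] _ /=.
    rewrite !mxE ord1 eqxx /=.
    have hj : `|h 0 j| <= `|h|.
      rewrite [leRHS]/Num.Def.normr /= mx_normrE.
      by apply: (le_trans _ (le_bigmax _ _ (0, j))).
    have [->|ji] := eqVneq j i; last first.
      by rewrite mulr0 addr0; case: ifP => // _; rewrite normr0.
    by rewrite ltnn add0r mulr1 (le_trans t1).
  have [c] := @MVT0 R (fun s => f (hh i + x + s *: delta_mx 0 i))
     (fun s => 'D_(delta_mx 0 i) f (hh i + x + s *: delta_mx 0 i)) (h 0 i)
     (fun t ht => is_derive_line ((Hd _ (inb t ht)) i).1).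
  rewrite scale0r addr0 [hh i + x + h 0 i *: _]addrAC [hh i + _ *: _]addrC -E1 => ch ->.
  rewrite -mulrBl normrM; apply: ler_pM => //.
  by rewrite distrC; apply: ((Hd _ (inb c ch)) i).2.
have E : f (h + x) - f x - L h = \sum_(i < n) (f (hh i.+1 + x) - f (hh i + x) - 'D_(delta_mx 0 i) f x * h 0 i).
  rewrite sumrB; congr (_ - _); last by apply: eq_bigr => i _; rewrite mulrC.
  pose G k := f (hh k + x).
  transitivity (G n - G 0%N).
    rewrite /G; congr (f _ - f _).
      by congr (_ + _); apply/rowP => j; rewrite mxE ltn_ord.
    by rewrite -[LHS]add0r; congr (_ + _); apply/rowP => j; rewrite !mxE.
  by rewrite -(telescope_sumr _ (leq0n n)) big_mkord.
rewrite E.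
apply: le_trans (ler_norm_sum _ _ _) _.
apply: le_trans (ler_sum _ (fun i _ => step i)) _.
rewrite sumr_const card_ord -[_ *+ n]mulr_natr mulrAC ler_wpM2r //.
rewrite -mulrA ler_piMr //; first exact: ltW.
by rewrite mulrC ler_pdivrMr // mul1r ler_nat.
Qed.

End ContinuouslyDifferentiable.

Section Sm.
Context {R : realType} {V : normedModType R}.
Implicit Types (f g : V -> R) (x v : V).

Lemma smo_continuous f x : smo f x -> {for x, continuous f}.
Proof. by move=> /(_ 0%N). Qed.

Lemma smo_near_differentiable f x : smo f x -> \forall y \near x, differentiable f y.
Proof. by move=> /(_ 1%N) []. Qed.

Lemma smo_differentiable f x : smo f x -> differentiable f x.
Proof. by move=> /smo_near_differentiable /nbhs_singleton. Qed.

Lemma smo_der f x v : smo f x -> smo ('D_v f) x.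
Proof. by move=> H k; apply: Cn_der. Qed.

Lemma smo_eq f g x : (\near x, f x = g x) -> smo f x -> smo g x.
Proof. by move=> fg H k; apply: Cn_eq (H k). Qed.

Lemma sm_smo f x : sm f x -> smo f x.
Proof. exact: nbhs_singleton. Qed.

Lemma sm_near f x : sm f x -> \forall y \near x, sm f y.
Proof. exact: near_join. Qed.

Lemma sm_open (U : set V) f : open U -> (forall x, U x -> smo f x) ->
  forall x, U x -> sm f x.
Proof.
by move=> oU H x Ux; apply: filterS (open_nbhs_nbhs (conj oU Ux)) => y; exact: H.
Qed.

Lemma sm_continuous f x : sm f x -> {for x, continuous f}.
Proof. by move=> /sm_smo /smo_continuous. Qed.

Lemma sm_differentiable f x : sm f x -> differentiable f x.
Proof. by move=> /sm_smo /smo_differentiable. Qed.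

Lemma sm_eq f g x : (\near x, f x = g x) -> sm f x -> sm g x.
Proof.
by move=> fg; apply: filterS2 (near_join fg) => y; exact: smo_eq.
Qed.

Lemma sm_der f x v : sm f x -> sm ('D_v f) x.
Proof. by apply: filterS => y; exact: smo_der. Qed.

Lemma sm_cst (c : R) x : sm (fun _ : V => c) x.
Proof. by near=> y => k; exact: (Cn_cst k c). Unshelve. all: by end_near. Qed.

Lemma smD f g x : sm f x -> sm g x -> sm (fun y => f y + g y) x.
Proof. by apply: filterS2 => y H1 H2 k; apply: CnD. Qed.

Lemma smM f g x : sm f x -> sm g x -> sm (fun y => f y * g y) x.
Proof. by apply: filterS2 => y H1 H2 k; apply: CnM. Qed.

Lemma smN f x : sm f x -> sm (fun y => - f y) x.
Proof. by apply: filterS => y H1 k; apply: CnN. Qed.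

Lemma smB f g x : sm f x -> sm g x -> sm (fun y => f y - g y) x.
Proof. by apply: filterS2 => y H1 H2 k; apply: CnB. Qed.

Lemma sm_sum (I : Type) (r : seq I) (P : pred I) (F : I -> V -> R) x :
  (forall i, P i -> sm (F i) x) -> sm (fun y => \sum_(i <- r | P i) F i y) x.
Proof.
move=> H; elim: r => [|i r IH].
  by apply: sm_eq (sm_cst 0 x); near=> y; rewrite big_nil.
case Pi : (P i).
  apply: sm_eq (smD (H i Pi) IH); near=> y; by rewrite big_cons Pi.
by apply: sm_eq IH; near=> y; rewrite big_cons Pi.
Unshelve. all: by end_near. Qed.

Lemma smX f n x : sm f x -> sm (fun y => f y ^+ n) x.
Proof.
move=> H; elim: n => [|n IH]; first exact: (sm_cst 1).
by apply: sm_eq (smM H IH); near=> y; rewrite exprS.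
Unshelve. all: by end_near. Qed.

Lemma smV f x : f x != 0 -> sm f x -> sm (fun y => (f y)^-1) x.
Proof.
move=> fx H; have cf := sm_continuous H.
have fn0 : \forall y \near x, f y != 0.
  have := cf (fun z => z != 0); apply; exact: open_neq.
by apply: filterS2 fn0 H => y ? H1 k; apply: CnV.
Qed.

Lemma sm_comp1 (h : R -> R) f x : sm h (f x) -> sm f x -> sm (fun y => h (f y)) x.
Proof.
move=> H1 H2; have cf := sm_continuous H2.
have H3 : \forall y \near x, smo h (f y) by exact: (cf _ H1).
by apply: filterS2 H3 H2 => y a b k; apply: Cn_comp1.
Qed.

Definition smv m (f : V -> 'rV[R]_m) x := forall j, sm (fun y => f y 0 j) x.

Lemma smv_continuous m (f : V -> 'rV[R]_m) x : smv f x -> {for x, continuous f}.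
Proof. by move=> H; apply: near_row_continuous => j; exact: sm_continuous. Qed.

Lemma smv_differentiable m (f : V -> 'rV[R]_m) x : smv f x -> differentiable f x.
Proof. by move=> H; apply: differentiable_rowP => j; exact: sm_differentiable. Qed.

Lemma smv_near m (f : V -> 'rV[R]_m) x : smv f x -> \forall y \near x, smv f y.
Proof.
move=> H; apply: (@filter_forall V 'I_m (fun j y => sm (fun y => f y 0 j) y) (nbhs x)).
by move=> j; exact: sm_near.
Qed.

Lemma smv_eq m (f g : V -> 'rV[R]_m) x : (\near x, f x = g x) -> smv f x -> smv g x.
Proof. by move=> fg H j; apply: sm_eq (H j); apply: filterS fg => y ->. Qed.

Lemma sm_comp m (f : V -> 'rV[R]_m) (g : 'rV[R]_m -> R) x :
  sm g (f x) -> smv f x -> sm (fun y => g (f y)) x.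
Proof.
move=> H1 H2; have cf := smv_continuous H2.
have H3 : \forall y \near x, smo g (f y) by exact: (cf _ H1).
have H4 := smv_near H2.
by apply: filterS2 H3 H4 => y a b k; apply: Cn_comp => // j; exact: sm_smo.
Qed.

Lemma smvZ m (c : V -> R) (f : V -> 'rV[R]_m) x :
  sm c x -> smv f x -> smv (fun y => c y *: f y) x.
Proof.
move=> H1 H2 j; apply: sm_eq (smM H1 (H2 j)); near=> y; by rewrite mxE.
Unshelve. all: by end_near. Qed.

Lemma smvD m (f g : V -> 'rV[R]_m) x :
  smv f x -> smv g x -> smv (fun y => f y + g y) x.
Proof.
move=> H1 H2 j; apply: sm_eq (smD (H1 j) (H2 j)); near=> y; by rewrite mxE.
Unshelve. all: by end_near. Qed.

Lemma smvB m (f g : V -> 'rV[R]_m) x :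
  smv f x -> smv g x -> smv (fun y => f y - g y) x.
Proof.
move=> H1 H2 j; apply: sm_eq (smB (H1 j) (H2 j)); near=> y; by rewrite !mxE.
Unshelve. all: by end_near. Qed.

Lemma smv_cst m (c : 'rV[R]_m) x : smv (fun _ : V => c) x.
Proof. by move=> j; exact: sm_cst. Qed.

End Sm.

(** * Comparison with the notions of smoothness of the statement *)

Section Links.
Context {R : realType}.

Lemma smv_comp (V : normedModType R) m p (f : V -> 'rV[R]_m) (g : 'rV[R]_m -> 'rV[R]_p) x :
  smv g (f x) -> smv f x -> smv (fun y => g (f y)) x.
Proof. by move=> H1 H2 j; apply: (sm_comp (H1 j)). Qed.

Lemma sm_coord m (j : 'I_m) (x : 'rV[R]_m) : sm (fun y : 'rV[R]_m => y 0 j) x.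
Proof. by near=> y => k; exact: (Cn_coord k). Unshelve. all: by end_near. Qed.

Lemma smv_id m (x : 'rV[R]_m) : smv (fun y => y) x.
Proof. by move=> j; exact: sm_coord. Qed.

Lemma sm_id (x : R) : sm (fun y : R => y) x.
Proof.
near=> y => k; elim: k => [|k _]; first exact: cvg_id.
split; first by near=> z; apply: ex_diff.
by move=> v; apply: Cn_eq (Cn_cst k v y); near=> z; rewrite derive_id.
Unshelve. all: by end_near. Qed.

(** [iter_partial] applies the head of the list last, whereas the induction on [Cn] differentiates
    the given function first. *)
Lemma iter_partial_rcons n (V : normedModType R) s i (f : 'rV[R]_n -> V) :
  iter_partial (rcons s i) f = iter_partial s ('D_(delta_mx 0 i) f).
Proof. by elim: s => //= j s ->. Qed.

Lemma derive_delta n (f : 'rV[R]_n -> R) x v : differentiable f x ->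
  'D_v f x = \sum_(i < n) v 0 i * 'D_(delta_mx 0 i) f x.
Proof.
move=> df; rewrite deriveE // {1}(row_sum_delta v) linear_sum.
by apply: eq_bigr => j _; rewrite linearZ -deriveE.
Qed.

(** Continuous partial derivatives give differentiability, and a derivative in any direction is then
    a combination of partial ones with constant coefficients, to which the induction applies. *)
Lemma smooth_on_open_smo n (U : set 'rV[R]_n) (f : 'rV[R]_n -> R) : open U ->
  smooth_on_open U f -> forall x, U x -> smo f x.
Proof.
move=> oU; suff H k : forall f, smooth_on_open U f -> forall x, U x -> Cn k f x.
  by move=> sf x Ux k; exact: H.
elim: k => [|k IH] {}f sf x Ux; first by have [] := sf [::] x Ux.
have df y : U y -> differentiable f y.
  move=> Uy; apply: C1_differentiable => i.
    apply: filterS (open_nbhs_nbhs (conj oU Uy)) => z Uz.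
    by have [_ /(_ i)] := sf [::] z Uz.
  by have [] := sf [:: i] y Uy.
have nU := open_nbhs_nbhs (conj oU Ux).
split; first by apply: filterS nU; exact: df.
move=> v.
have H : Cn k (fun y => \sum_(i < n) v 0 i * 'D_(delta_mx 0 i) f y) x.
  apply: Cn_sum => i _; apply: CnM; first exact: Cn_cst.
  have sD : smooth_on_open U ('D_(delta_mx 0 i) f).
    by move=> s y Uy; have := sf (rcons s i) y Uy; rewrite iter_partial_rcons.
  exact: (IH _ sD x Ux).
by apply: Cn_eq H; apply: filterS nU => y /df dy; rewrite [RHS]derive_delta.
Qed.

Lemma smo_smooth_on_open n (U : set 'rV[R]_n) (f : 'rV[R]_n -> R) :
  (forall x, U x -> smo f x) -> smooth_on_open U f.
Proof.
move=> H s x Ux; have : smo (iter_partial s f) x.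
  by elim: s => [|i s IH] /=; [exact: H|exact: smo_der].
move=> K; split; first exact: smo_continuous.
by move=> i; apply: diff_derivable; exact: smo_differentiable.
Qed.

Lemma smooth_on_open_row n m (U : set 'rV[R]_n) (F : 'rV[R]_n -> 'rV[R]_m) : open U ->
  smooth_on_open U F -> forall x, U x -> forall j, smo (fun y => F y 0 j) x.
Proof.
move=> oU sF x Ux j.
have E s : forall y, U y -> iter_partial s F y 0 j = iter_partial s (fun y => F y 0 j) y.
  elim: s => [//|i s IH] y Uy /=.
  rewrite derive_mx; last by have [_] := sF s y Uy; apply.
  rewrite mxE; apply: near_eq_derive.
  by apply: filterS (open_nbhs_nbhs (conj oU Uy)) => z; exact: IH.
apply: (smooth_on_open_smo oU) => // s y Uy.
have [c d] := sF s y Uy.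
have nE : {near y, (fun y => iter_partial s F y 0 j) =1 iter_partial s (fun y => F y 0 j)}.
  by apply: filterS (open_nbhs_nbhs (conj oU Uy)) => z; exact: E.
split.
  have c' : {for y, continuous (fun y => iter_partial s F y 0 j)}.
    apply: (@continuous_comp _ _ _ (iter_partial s F) (fun u : 'rV[R]_m => u 0 j)) => //.
    exact: coord_continuous.
  exact: near_continuous nE c'.
move=> i; apply: near_eq_derivable nE _.
by have /derivable_mxP := d i; apply.
Qed.

Lemma row_smooth_on_open n m (U : set 'rV[R]_n) (F : 'rV[R]_n -> 'rV[R]_m) : open U ->
  (forall x, U x -> forall j, smo (fun y => F y 0 j) x) -> smooth_on_open U F.
Proof.
move=> oU sF.
have sj j : smooth_on_open U (fun y => F y 0 j).
  by apply: smo_smooth_on_open => x Ux; exact: sF.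
have E s : (forall y, U y -> forall j, iter_partial s F y 0 j = iter_partial s (fun y => F y 0 j) y) /\
   (forall y, U y -> forall i, derivable (iter_partial s F) y (delta_mx 0 i)).
  elim: s => [|i s [IH1 IH2]] /=.
    split=> // y Uy i; apply/derivable_mxP => a j; rewrite ord1.
    by have [_] := sj j [::] y Uy; apply.
  have E y : U y -> forall j, 'D_(delta_mx 0 i) (iter_partial s F) y 0 j =
     'D_(delta_mx 0 i) (iter_partial s (fun y0 => F y0 0 j)) y.
    move=> Uy j; rewrite derive_mx; last exact: IH2.
    rewrite mxE; apply: near_eq_derive.
    by apply: filterS (open_nbhs_nbhs (conj oU Uy)) => z Uz; exact: IH1.
  split; first exact: E.
  move=> y Uy k; apply/derivable_mxP => a j; rewrite ord1.
  have [_ /(_ k)] := sj j (i :: s) y Uy.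
  apply: near_eq_derivable.
  by apply: filterS (open_nbhs_nbhs (conj oU Uy)) => z Uz /=; rewrite E.
move=> s x Ux; have [E1 E2] := E s; split; last exact: E2.
apply: near_row_continuous => j.
have [c _] := sj j s x Ux.
apply: near_continuous c.
by apply: filterS (open_nbhs_nbhs (conj oU Ux)) => z Uz; rewrite E1.
Qed.

(** Smoothness on a set is used in this form from here on: local extensions are germs with smooth
    components. *)
Lemma smooth_on_rowP n m (A : set 'rV[R]_n) (F : 'rV[R]_n -> 'rV[R]_m) :
  smooth_on A F <-> forall x, A x -> exists2 G : 'rV[R]_n -> 'rV[R]_m,
    smv G x & \forall y \near x, A y -> F y = G y.
Proof.
split=> H x Ax.
  have [U [G [oU Ux sG FG]]] := H x Ax; exists G.
    move=> j; apply: (sm_open oU) Ux => y Uy; exact: (smooth_on_open_row oU).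
  apply: filterS (open_nbhs_nbhs (conj oU Ux)) => y Uy Ay.
  by apply: FG; rewrite inE.
have [G /smv_near sG FG] := H x Ax.
have [U [oU Ux HU]] := near_open (filterI sG FG).
exists U, G; split => //.
  apply: row_smooth_on_open => // y Uy j; apply: sm_smo.
  by have [] := HU _ Uy.
by move=> y; rewrite inE => -[Ay Uy]; apply: (HU _ Uy).2.
Qed.

End Links.

(** * Elementary functions and a smooth step *)

Section OneVar.
Context {R : realType}.

(** On the line every direction [v] is [v *: 1], so a single derivative controls all of them. *)
Lemma CnS_1 k (h : R -> R) x : (\forall y \near x, derivable h y 1) ->
  Cn k ('D_1 h) x -> Cn k.+1 h x.
Proof.
move=> dh Dh; split; first by apply: filterS dh => y /derivable1_diffP.
move=> v; apply: Cn_eq (CnM (Cn_cst k v x) Dh).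
apply: filterS dh => y /derivable1_diffP dy.
have {2}-> : v = v *: (1 : R) by exact/esym/mulr1.
by rewrite deriveZv.
Qed.

Lemma sm_T (V : normedModType R) (f : V -> R) x : (forall y, smo f y) -> sm f x.
Proof. by move=> H; near=> y; exact: H. Unshelve. all: by end_near. Qed.

Lemma near_neq0 (V : normedModType R) (f : V -> R) x : {for x, continuous f} ->
  f x != 0 -> \forall y \near x, f y != 0.
Proof.
move=> cf fx; have H : nbhs (f x) [set z : R | z != 0] := open_nbhs_nbhs (conj (@open_neq _ _) fx).
exact: (cf _ H).
Qed.

Lemma gt0_near (x : R) : 0 < x -> \forall y \near x, 0 < y.
Proof. by move=> x0; apply: open_near x0; exact: open_gt. Qed.

Lemma near_gt0 (V : normedModType R) (f : V -> R) x : {for x, continuous f} ->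
  0 < f x -> \forall y \near x, 0 < f y.
Proof.
move=> cf fx; have H : nbhs (f x) [set z : R | 0 < z] := gt0_near fx.
exact: (cf _ H).
Qed.

Lemma sm_expR (x : R) : sm (@expR R) x.
Proof.
apply: sm_T => {x} y k; elim: k y => [|k IH] y; first exact: continuous_expR.
apply: CnS_1; first by near=> z; apply: derivable_expR.
by rewrite derive_expR.
Unshelve. all: by end_near. Qed.

Lemma sm_sqrt (x : R) : 0 < x -> sm (@Num.sqrt R) x.
Proof.
move=> x0; apply: filterS (gt0_near x0) => {x0} y y0 k.
elim: k => [|k IH]; first exact: sqrt_continuous.
have y0' := gt0_near y0.
apply: CnS_1.
  by apply: filterS y0' => z z0; have [] := is_derive1_sqrt z0.
have sn : 2 * Num.sqrt y != 0 by rewrite mulf_neq0 // gt_eqF // sqrtr_gt0.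
apply: Cn_eq (@CnV _ _ k (fun z => 2 * Num.sqrt z) y sn (CnM (Cn_cst k 2 y) IH)).
by apply: filterS y0' => z z0; rewrite derive_sqrt.
Qed.

Lemma sm_sin_cos (x : R) : sm (@sin R) x /\ sm (@cos R) x.
Proof.
have H k : forall y, Cn k (@sin R) y /\ Cn k (@cos R) y.
  elim: k => [|k IH] y; first by split; [exact: continuous_sin|exact: continuous_cos].
  split; apply: CnS_1.
  - by near=> z; apply: ex_derive.
  - by apply: Cn_eq (IH y).2; near=> z; rewrite derive_val.
  - by near=> z; apply: ex_derive.
  - by apply: Cn_eq (CnN (IH y).1); near=> z; rewrite derive_val.
by split; near=> y => k; have [] := H k y.
Unshelve. all: by end_near. Qed.

(* The powers of [x^-1] make the family closed under differentiation. *)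
Definition flat (m : nat) (x : R) : R :=
  if 0 < x then x^-1 ^+ m * expR (- x^-1) else 0.

Lemma flat_ge0 m x : 0 <= flat m x.
Proof.
by rewrite /flat; case: ifP => // x0; rewrite mulr_ge0 ?expR_ge0 ?exprn_ge0 // invr_ge0 ltW.
Qed.

Lemma flat_gt0 m x : 0 < x -> 0 < flat m x.
Proof. by move=> x0; rewrite /flat x0 mulr_gt0 ?expR_gt0 // exprn_gt0 // invr_gt0. Qed.

Lemma flat_le0 m x : x <= 0 -> flat m x = 0.
Proof. by rewrite leNgt /flat => /negbTE ->. Qed.

(** At [x^-1] the exponential exceeds the term of degree [m.+1] of its series. Hence the whole
    family vanishes at 0 at least linearly, which gives the derivative 0 there. *)
Lemma flat_bound m x : flat m x <= (m.+1)`!%:R * `|x|.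
Proof.
have [x0|x0] := leP x 0; first by rewrite flat_le0 // mulr_ge0.
rewrite /flat x0 gtr0_norm // expRN.
rewrite ler_pdivrMr ?expR_gt0 //.
have f0 : (0 : R) < (m.+1)`!%:R by rewrite ltr0n fact_gt0.
have xi : 0 <= x^-1 by rewrite invr_ge0 ltW.
have H := expR_ge1Dxn m xi.
have {}H : x^-1 ^+ m.+1 / (m.+1)`!%:R <= expR x^-1.
  by apply: le_trans H; rewrite lerDr.
apply: le_trans (_ : (m.+1)`!%:R * x * (x^-1 ^+ m.+1 / (m.+1)`!%:R) <= _); last first.
  by rewrite ler_pM2l // mulr_gt0.
rewrite exprSr !mulrA le_eqVlt; apply/orP; left; apply/eqP.
field; rewrite !gt_eqF //=.
Qed.

Lemma is_derive_flat m x :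
  is_derive x (1 : R) (flat m) (flat m.+2 x - m%:R * flat m.+1 x).
Proof.
have [x0|x0|<-] := ltgtP 0 x.
- have E : \near x, x^-1 ^+ m * expR (- x^-1) = flat m x.
    by apply: filterS (gt0_near x0) => y y0; rewrite /flat y0.
  apply: (near_eq_is_derive E).
  have xn0 : x != 0 by rewrite gt_eqF.
  have dV : is_derive x (1 : R) (fun y : R => y^-1) (- x^-2).
    apply: is_derive_eq (is_deriveV xn0 (is_derive_id x 1)) _.
    by rewrite -[LHS]/(_ * _) mulr1.
  have dE : is_derive x (1 : R) (fun y : R => expR (- y^-1)) (expR (- x^-1) * x^-2).
    have dN : is_derive x (1 : R) (fun y : R => - y^-1) (x^-2).
      by apply: is_derive_eq (is_deriveN dV) _; rewrite opprK.
    have := @is_derive1_comp R (@expR R) (fun y => - y^-1) x _ _ (is_derive_expR _) dN.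
    by [].
  have dX : is_derive x (1 : R) (fun y : R => y^-1 ^+ m) (m%:R * x^-1 ^+ m.-1 * - x^-2).
    have -> : (fun y : R => y^-1 ^+ m) = (fun y : R => y^-1) ^+ m.
      by apply/funext => y; rewrite exprfctE.
    exact: (@is_deriveX _ _ (fun y : R => y^-1) m x 1 _ dV).
  apply: is_derive_eq (is_deriveM dX dE) _.
  rewrite /flat x0 -![_ *: _]/(_ * _) /=.
  case: m {E dX} => [|m] /=; rewrite ?expr0 ?exprS; field; rewrite ?expf_neq0 //.
- have E : \near x, 0 = flat m x.
    apply: filterS (open_near (open_lt (y := 0)) x0) => y y0.
    by rewrite flat_le0 // ltW.
  apply: (near_eq_is_derive E).
  by rewrite !flat_le0 ?ltW // mulr0 subr0; apply: is_derive_cst.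
- rewrite !flat_le0 // mulr0 subr0.
  have L : (fun h : R => h^-1 *: ((flat m \o shift 0) (h *: (1:R)) - flat m 0)) @ 0^' --> (0 : R).
    apply/cvgrPdist_le => e e0; near=> h.
    rewrite sub0r normrN /= addr0 [h%:A]mulr1 (flat_le0 m (lexx 0)) subr0.
    rewrite -[_ *: _]/(_ * _).
    (* The difference quotient at 0 is again a member of the family, so its limit is controlled by
       [flat_bound]. *)
    have -> : h^-1 * flat m h = flat m.+1 h.
      rewrite /flat; case: ifP; last by rewrite mulr0.
      by rewrite exprS mulrA.
    rewrite ger0_norm ?flat_ge0 //; apply: le_trans (flat_bound _ _) _.
    rewrite mulrC -ler_pdivlMr ?ltr0n ?fact_gt0 //.
    near: h; apply: dnbhs0_le; by rewrite divr_gt0 ?ltr0n ?fact_gt0.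
  apply: DeriveDef; first by apply/cvg_ex; exists 0.
  exact: cvg_lim L.
Unshelve. all: by end_near. Qed.

Lemma sm_flat m x : sm (flat m) x.
Proof.
apply: sm_T => {x} y k; elim: k m y => [|k IH] m y.
  by apply: differentiable_continuous; apply/derivable1_diffP; have [] := is_derive_flat m y.
apply: CnS_1; first by near=> z; have [] := is_derive_flat m z.
apply: Cn_eq (CnB (IH m.+2 y) (CnM (Cn_cst k m%:R y) (IH m.+1 y))).
by near=> z; have [_ ->] := is_derive_flat m z.
Unshelve. all: by end_near. Qed.

(** The standard smooth transition function: 0 up to 0, 1 from 1 on, and nondecreasing. *)
Definition step (x : R) : R := flat 0 x / (flat 0 x + flat 0 (1 - x)).

Lemma step_den x : 0 < flat 0 x + flat 0 (1 - x).
Proof.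
have [x0|x0] := ltP 0 x.
  by rewrite ltr_wpDr ?flat_ge0 ?flat_gt0.
by rewrite ltr_wpDl ?flat_ge0 // flat_gt0 // subr_gt0 (le_lt_trans x0).
Qed.

Lemma step_le0 x : x <= 0 -> step x = 0.
Proof. by move=> x0; rewrite /step (flat_le0 _ x0) mul0r. Qed.

Lemma step_ge1 x : 1 <= x -> step x = 1.
Proof.
move=> x1; have x0 : 0 < x by rewrite (lt_le_trans _ x1).
rewrite /step (flat_le0 0 (x := 1 - x)) ?subr_le0 // addr0 divff //.
by rewrite gt_eqF // flat_gt0.
Qed.

Lemma step_ge0 x : 0 <= step x.
Proof. by rewrite /step divr_ge0 ?flat_ge0 // ltW // step_den. Qed.

Lemma step_le1 x : step x <= 1.
Proof. by rewrite /step ler_pdivrMr ?step_den // mul1r lerDl flat_ge0. Qed.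

Lemma sm_step x : sm step x.
Proof.
have s1 : sm (fun y : R => flat 0 (1 - y)) x.
  apply: (sm_comp1 (f := fun y : R => 1 - y)); first exact: sm_flat.
  by apply: smB; [exact: sm_cst|exact: sm_id].
apply: smM; first exact: sm_flat.
apply: smV; first by rewrite gt_eqF // step_den.
by apply: smD => //; exact: sm_flat.
Qed.

(** The derivative of [flat 0] is [flat 2], so in the quotient rule only nonnegative terms remain.
    The sign matters where [step] blends two radial functions on the ball. *)
Lemma step_derive_ge0 x : 0 <= 'D_1 step x.
Proof.
have d1 := is_derive_flat 0 x.
have dl : is_derive x (1 : R) (fun y : R => 1 - y) (-1).
  have -> : (fun y : R => 1 - y) = cst 1 - id by [].
  by apply: is_derive_eq; rewrite sub0r.
have d2 := @is_derive1_comp R (flat 0) (fun y => 1 - y) x _ _ (is_derive_flat 0 _) dl.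
rewrite /= !mul0r !subr0 in d1 d2.
have dn : flat 0 x + flat 0 (1 - x) != 0 by rewrite gt_eqF // step_den.
have dD : is_derive x (1 : R) (fun y => flat 0 y + flat 0 (1 - y)) (flat 2 x + flat 2 (1 - x) * -1).
  exact: (is_deriveD d1 d2).
have dV := @is_deriveV R (fun y : R => flat 0 y + flat 0 (1 - y)) x _ 1 dn dD.
have [_ E] := is_deriveM d1 dV.
have -> : step = (flat 0 * (fun y => (flat 0 y + flat 0 (1 - y))^-1)) by [].
rewrite E -![_ *: _]/(_ * _).
set a := flat 0 x in dn *; set b := flat 0 (1 - x) in dn *.
set a' := flat 2 x; set b' := flat 2 (1 - x).
have -> : a * (- (a + b) ^- 2 * (a' + b' * -1)) + (a + b)^-1 * a' =
  (a * b' + b * a') / (a + b) ^+ 2 by field.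
by rewrite divr_ge0 ?sqr_ge0 // addr_ge0 // mulr_ge0 // flat_ge0.
Qed.

End OneVar.

Section Det.
Context {R : realType} {V : normedModType R}.

Lemma Cn_det k n (M : V -> 'M[R]_n) x :
  (forall i j, Cn k (fun y => M y i j) x) -> Cn k (fun y => \det (M y)) x.
Proof.
move=> H; apply: (@Cn_sum _ _ k _ _ _ (fun s y => (-1) ^+ perm.odd_perm s * \prod_i M y i (perm.fun_of_perm s i))) => s _.
by apply: CnM; [exact: Cn_cst|apply: Cn_prod => i _; exact: H].
Qed.

Lemma Cn_adj k n (M : V -> 'M[R]_n) x :
  (forall i j, Cn k (fun y => M y i j) x) ->
  forall i j, Cn k (fun y => \adj (M y) i j) x.
Proof.
move=> H i j.
apply: Cn_eq (CnM (Cn_cst k ((-1) ^+ (j + i)) x)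
  (Cn_det (M := fun y => row' j (col' i (M y))) _)).
  by near=> y; rewrite !mxE /cofactor.
by move=> a b; apply: Cn_eq (H (lift j a) (lift i b)); near=> y; rewrite !mxE.
Unshelve. all: by end_near. Qed.

Lemma Cn_inv k n (M : V -> 'M[R]_n) x : \det (M x) != 0 ->
  (forall i j, Cn k (fun y => M y i j) x) ->
  forall i j, Cn k (fun y => invmx (M y) i j) x.
Proof.
move=> dM H i j.
have cd := Cn_det H.
have nd : \forall y \near x, \det (M y) != 0.
  by apply: (@near_neq0 _ _ (fun y => \det (M y)) x _ dM); exact: (Cn_le (leq0n k) cd).
apply: Cn_eq (CnM (@CnV _ _ k (fun y => \det (M y)) x dM cd) (Cn_adj H i j)).
by apply: filterS nd => y dy; rewrite /invmx unitmxE unitfE dy [RHS]mxE.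
Qed.

Lemma sm_Cn_mx n (M : V -> 'M[R]_n) x :
  (forall i j, sm (fun y => M y i j) x) ->
  \forall y \near x, forall k i j, Cn k (fun y => M y i j) y.
Proof.
move=> H.
have : \forall y \near x, forall ij : 'I_n * 'I_n, smo (fun y => M y ij.1 ij.2) y.
  apply: (@filter_forall V _ (fun ij y => smo (fun y => M y ij.1 ij.2) y) (nbhs x)) => -[i j].
  exact: H.
by apply: filterS => y Hy k i j; exact: (Hy (i, j)).
Qed.

Lemma sm_det n (M : V -> 'M[R]_n) x :
  (forall i j, sm (fun y => M y i j) x) -> sm (fun y => \det (M y)) x.
Proof. by move=> /sm_Cn_mx; apply: filterS => y H k; exact: Cn_det. Qed.

Lemma sm_adj n (M : V -> 'M[R]_n) x :
  (forall i j, sm (fun y => M y i j) x) -> forall i j, sm (fun y => \adj (M y) i j) x.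
Proof. by move=> /sm_Cn_mx H i j; apply: filterS H => y H k; exact: Cn_adj. Qed.

Lemma sm_inv n (M : V -> 'M[R]_n) x : \det (M x) != 0 ->
  (forall i j, sm (fun y => M y i j) x) -> forall i j, sm (fun y => invmx (M y) i j) x.
Proof.
move=> dM H i j.
have nd : \forall y \near x, \det (M y) != 0.
  by apply: (@near_neq0 _ _ (fun y => \det (M y)) x _ dM); exact: sm_continuous (sm_det H).
by apply: filterS2 nd (sm_Cn_mx H) => y dy Hy k; exact: Cn_inv.
Qed.

End Det.


(** * The inverse function theorem *)

Section IFT.
Context {R : realType} {n : nat}.
Local Notation rV := 'rV[R]_n.

Lemma coord_le_norm (x : rV) i : `|x 0 i| <= `|x|.
Proof.
rewrite [leRHS]/Num.Def.normr /= mx_normrE.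
by apply: (le_trans _ (le_bigmax _ _ (0, i))).
Qed.

Lemma norm_leP (x : rV) (c : R) : 0 <= c -> (forall i, `|x 0 i| <= c) -> `|x| <= c.
Proof.
move=> c0 H; rewrite [leLHS]/Num.Def.normr /= mx_normrE; apply: bigmax_le => //.
by move=> [a i] _; rewrite ord1; exact: H.
Qed.

Lemma segment_ball (a x y : rV) (r t : R) : `|a - x| < r -> `|a - y| < r -> 0 <= t <= 1 ->
  `|a - (x + t *: (y - x))| < r.
Proof.
move=> ax ay /andP[t0 t1].
have -> : a - (x + t *: (y - x)) = (1 - t) *: (a - x) + t *: (a - y).
  by apply/rowP => i; rewrite !mxE; ring.
have := ler_normD ((1 - t) *: (a - x)) (t *: (a - y)).
rewrite !normrZ (ger0_norm t0) (@ger0_norm _ (1 - t)) ?subr_ge0 // => H.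
apply: le_lt_trans H _.
have [->|tn] := eqVneq t 0; first by rewrite subr0 mul1r mul0r addr0.
have tp : 0 < t by rewrite lt_neqAle eq_sym tn.
have -> : r = (1 - t) * r + t * r by ring.
apply: ler_ltD; last by rewrite ltr_pM2l.
by rewrite ler_wpM2l ?subr_ge0 // ltW.
Qed.

(** The mean value theorem on the segment. The factor [n] arises because the derivative in the
    direction [y - x] is a sum over coordinates, each at most the sup norm of [y - x]. *)
Lemma mvt_ball (f : rV -> R) (a : rV) (r K : R) : 0 <= K ->
  (forall x, `|a - x| < r -> differentiable f x) ->
  (forall x i, `|a - x| < r -> `|'D_(delta_mx 0 i) f x| <= K) ->
  forall x y, `|a - x| < r -> `|a - y| < r -> `|f y - f x| <= n%:R * K * `|y - x|.
Proof.
move=> K0 df Df x y ax ay.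
have dl (t : R) : 0 <= t <= 1 -> is_derive t (1 : R) (fun s => f (x + s *: (y - x))) ('D_(y - x) f (x + t *: (y - x))).
  move=> t01; apply: is_derive_line; apply: diff_derivable; apply: df.
  exact: segment_ball.
have [||c] := @MVT_segment R (fun s => f (x + s *: (y - x))) (fun t => 'D_(y - x) f (x + t *: (y - x))) 0 1 ler01.
- by move=> t; rewrite in_itv /= => /andP[t0 t1]; apply: dl; rewrite !ltW.
- by apply: derivable_within_continuous => t; rewrite in_itv /= => /dl; case.
rewrite in_itv /= => c01; rewrite scale0r addr0 scale1r [x + _]addrC subrK subr0 mulr1 => ->.
have ac := segment_ball ax ay c01.
rewrite derive_delta; last exact: df.
apply: le_trans (ler_norm_sum _ _ _) _.
have -> : n%:R * K * `|y - x| = \sum_(i < n) (`|y - x| * K).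
  by rewrite sumr_const card_ord -mulr_natl; ring.
apply: ler_sum => i _; rewrite normrM ler_pM //; first exact: coord_le_norm.
exact: Df.
Qed.

(** The transpose of the usual Jacobian: rows are indexed by the direction of differentiation, so
    that directions act as row vectors from the left. *)
Definition jac (f : rV -> rV) (x : rV) : 'M[R]_n :=
  \matrix_(i, j) 'D_(delta_mx 0 i) (fun y => f y 0 j) x.

Lemma jacE (f : rV -> rV) (x v : rV) : differentiable f x -> 'D_v f x = v *m jac f x.
Proof.
move=> df; apply/rowP => j; rewrite derive_row // derive_delta; last exact: differentiable_row.
by rewrite mxE; apply: eq_bigr => i _; rewrite mxE.
Qed.

Lemma sm_jac (f : rV -> rV) (x : rV) i j : smv f x -> sm (fun y => jac f y i j) x.
Proof.
move=> sf; apply: sm_eq (sm_der (delta_mx 0 i) (sf j)); near=> y; by rewrite mxE.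
Unshelve. all: by end_near. Qed.

Lemma mulmx_norm (M : 'M[R]_n) : exists2 C : R, 0 < C & forall v : rV, `|v *m M| <= C * `|v|.
Proof.
have H i j : `|M i j| <= \sum_i \sum_j `|M i j|.
  rewrite (bigD1 i) //= (bigD1 j) //= -addrA lerDl addr_ge0 //.
    by apply: sumr_ge0.
  by apply: sumr_ge0 => k _; apply: sumr_ge0.
set C := \sum_i _ in H.
have C0 : 0 <= C by apply: sumr_ge0 => k _; apply: sumr_ge0.
exists (n%:R * C + 1); first by rewrite ltr_wpDl // mulr_ge0.
move=> v; apply: norm_leP => [|j]; first by rewrite mulr_ge0 // addr_ge0 // mulr_ge0.
rewrite mxE; apply: le_trans (ler_norm_sum _ _ _) _.
apply: le_trans (_ : \sum_(i < n) C * `|v| <= _).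
  by apply: ler_sum => i _; rewrite normrM mulrC ler_pM // coord_le_norm.
have -> : \sum_(i < n) C * `|v| = n%:R * C * `|v|.
  by rewrite sumr_const card_ord -[LHS]mulr_natl mulrA.
by rewrite ler_wpM2r // lerDl.
Qed.

Lemma mulmx_continuous (M : 'M[R]_n) : continuous (fun v : rV => v *m M).
Proof.
move=> v; apply: near_row_continuous => j.
suff H : Cn 0 (fun y : rV => \sum_k y 0 k * M k j) v.
  by apply: near_continuous H; near=> y; rewrite mxE.
by apply: Cn_sum => k _; apply: CnM; [exact: Cn_coord|exact: Cn_cst].
Unshelve. all: by end_near. Qed.

Lemma derive_mulmx (M : 'M[R]_n) (x h : rV) :
  differentiable (fun v : rV => v *m M) x /\ 'D_h (fun v : rV => v *m M) x = h *m M.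
Proof.
have c : continuous (mulmxr M : rV -> rV) := @mulmx_continuous M.
have d : differentiable (fun v : rV => v *m M) x := linear_differentiable x c.
by split=> //; rewrite deriveE // (diff_lin x c).
Qed.

Lemma near_ballP (V : normedModType R) (P : V -> Prop) (x : V) : (\near x, P x) ->
  exists2 r : R, 0 < r & forall y, `|x - y| < r -> P y.
Proof.
move=> /nbhs_ballP [r /= r0 H]; exists r => // y xy; apply: H.
by rewrite -ball_normE.
Qed.

Lemma ball_nearP (V : normedModType R) (P : V -> Prop) (x : V) (r : R) : 0 < r ->
  (forall y, `|x - y| < r -> P y) -> \near x, P x.
Proof.
by move=> r0 H; apply/nbhs_ballP; exists r => //= y; rewrite -ball_normE; exact: H.
Qed.

Lemma cont_normB (V W : normedModType R) (f : V -> W) (x : V) (c : W) :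
  {for x, continuous f} -> {for x, continuous (fun y => `|f y - c|)}.
Proof. by move=> cf; apply: cvg_norm; apply: cvgB => //; exact: cvg_cst. Qed.

Lemma dist_lt_near (V : normedModType R) (c x : V) (r : R) : `|c - x| < r ->
  \forall z \near x, `|c - z| < r.
Proof.
move=> cx; apply: (@ball_nearP _ _ _ (r - `|c - x|)); first by rewrite subr_gt0.
move=> z Hz; rewrite -(subrK x c) -addrA.
by apply: le_lt_trans (ler_normD _ _) _; rewrite -ltrBrDl.
Qed.

Lemma differentiable_boundP (V W : normedModType R) (f : V -> W) (x : V) :
  differentiable f x -> forall e : R, 0 < e ->
  \forall h \near (0 : V), `|f (h + x) - f x - 'D_h f x| <= e * `|h|.
Proof.
move=> df e e0; have /diff_locallyP [_ /eqaddoP /(_ e e0)] := df.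
by apply: filterS => h; rewrite /= !fctE /= opprD addrA deriveE.
Qed.

(** Compactness of closed balls. In the inverse function theorem the minimum replaces the iteration
    of a contraction. *)
Lemma min_ball (f : rV -> R) (a : rV) (s : R) : 0 <= s ->
  (forall x, `|a - x| <= s -> {for x, continuous f}) ->
  exists2 c, `|a - c| <= s & forall x, `|a - x| <= s -> f c <= f x.
Proof.
move=> s0 cf; pose A : set rV := [set x | `|a - x| <= s].
have cA : compact A.
  apply: bounded_closed_compact; last exact: closed_closed_ball_.
  exists (`|a| + s); split; first by rewrite realE addr_ge0.
  move=> M HM x /= Ax; apply: ltW; apply: le_lt_trans HM.
  rewrite -(subrK a x) addrC; apply: le_trans (ler_normD _ _) _.
  by rewrite lerD2l distrC.
have [||c] := @EVT_min_rV R n f A _ cA.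
- by exists a; rewrite /A /= subrr normr0.
- by apply: continuous_in_subspaceT => x; rewrite inE => /cf.
by rewrite inE => Ac Hc; exists c => // x Ax; apply: Hc; rewrite inE.
Qed.

(** [phi], the identity minus the linearly corrected [f], contracts by 1/2 near [a]. This makes [f]
    injective with a Lipschitz inverse; for surjectivity, the residual at a point where it is
    minimal could otherwise be halved. The predicate [P] carries along whatever else must hold on
    the domain of the chart. *)
Theorem inverse_function (P : rV -> Prop) (f : rV -> rV) (a : rV) :
  (\near a, P a) -> smv f a -> \det (jac f a) != 0 ->
  exists (A B : set rV) (g : rV -> rV),
   [/\ open A, A a, open B & forall x, A x -> [/\ P x, smv f x & \det (jac f x) != 0]] /\
   [/\ forall x, A x -> B (f x) /\ g (f x) = x,
       forall y, B y -> A (g y) /\ f (g y) = y &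
       forall y, B y -> smv g y /\ forall v, 'D_v g y = v *m invmx (jac f (g y))].
Proof.
move=> nP sf dJ.
pose Ji := invmx (jac f a).
have Ju : jac f a \in unitmx by rewrite unitmxE unitfE.
pose phi (x : rV) : rV := x - f x *m Ji.
have sphi x : smv f x -> smv phi x.
  move=> sfx; apply: smvB; first exact: smv_id.
  move=> j; apply: sm_eq (sm_sum (index_enum _) (P := xpredT) (F := fun k y => f y 0 k * Ji k j) _).
    by near=> y; rewrite mxE.
  by move=> k _; apply: smM; [exact: sfx|exact: sm_cst].
have Dphi x v : differentiable f x -> 'D_v phi x = v - v *m jac f x *m Ji.
  move=> dfx; have [dm Dm] := derive_mulmx Ji (f x) ('D_v f x).
  have dc : differentiable (fun y => f y *m Ji) x.
    by apply: (@differentiable_comp _ _ _ _ f (fun u => u *m Ji)).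
  rewrite -[phi]/(id - (fun y => f y *m Ji)) deriveB; last 2 first.
  - exact: derivable_id.
  - exact: diff_derivable.
  rewrite derive_id (@derive_comp _ _ _ _ f (fun u => u *m Ji)) //.
  by rewrite Dm jacE.
(* [mvt_ball] costs a factor [n], so this bound on the partial derivatives yields the Lipschitz
   constant 1/2. *)
have K0 : 0 < (2 * n.+1%:R)^-1 :> R by rewrite invr_gt0 mulr_gt0.
have [r r0 Hr] : exists2 r : R, 0 < r & forall x, `|a - x| < r ->
    [/\ P x, smv f x, \det (jac f x) != 0 &
        forall ij : 'I_n * 'I_n, `|'D_(delta_mx 0 ij.1) (fun y => phi y 0 ij.2) x| <= (2 * n.+1%:R)^-1].
  apply: near_ballP.
  have n1 : \forall x \near a, forall ij : 'I_n * 'I_n, `|'D_(delta_mx 0 ij.1) (fun y => phi y 0 ij.2) x| <= (2 * n.+1%:R)^-1.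
    apply: (@filter_forall rV _ (fun (ij : 'I_n * 'I_n) x => `|'D_(delta_mx 0 ij.1) (fun y => phi y 0 ij.2) x| <= (2 * n.+1%:R)^-1) (nbhs a)) => -[i j].
    have s1 := sm_der (delta_mx 0 i) (sphi a sf j).
    have /cvgrPdist_le /(_ _ K0) := sm_continuous s1.
    apply: filterS => x /=.
    rewrite -[X in `|X - _|]derive_row; last exact: smv_differentiable (sphi a sf).
    rewrite Dphi; last exact: smv_differentiable.
    by rewrite -mulmxA mulmxV // mulmx1 subrr mxE sub0r normrN.
  have n2 : \near a, \det (jac f a) != 0.
    apply: (@near_neq0 R rV (fun x => \det (jac f x)) a _ dJ).
    by apply: sm_continuous; apply: sm_det => i j; exact: sm_jac.
  apply: filterS3 n1 (filterI nP n2) (smv_near sf) => x H1 [H2 H3] H4.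
  by split.
have df x : `|a - x| < r -> differentiable f x by move=> /Hr [_ ? _ _]; exact: smv_differentiable.
have contr x y : `|a - x| < r -> `|a - y| < r -> `|phi y - phi x| <= 2^-1 * `|y - x|.
  move=> ax ay; apply: norm_leP => [|j]; first by rewrite mulr_ge0.
  rewrite mxE [X in _ + X]mxE.
  apply: le_trans (@mvt_ball (fun y => phi y 0 j) a r (2 * n.+1%:R)^-1 (ltW K0) _ _ x y ax ay) _.
  - move=> z /Hr [_ sz _ _]; apply: sm_differentiable; exact: sphi.
  - by move=> z i /Hr [_ _ _ /(_ (i, j))].
  apply: ler_wpM2r => //; rewrite ler_pdivrMr; last by rewrite mulr_gt0.
  by rewrite mulrA mulVf // mul1r ler_nat.
have fhE x : f x *m Ji = x - phi x by rewrite /phi opprB addrC subrK.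
have [C C0 HC] := mulmx_norm Ji.
have lip x y : `|a - x| < r -> `|a - y| < r -> `|y - x| <= 2 * `|(f y - f x) *m Ji|.
  move=> ax ay; have := contr x y ax ay.
  have -> : (f y - f x) *m Ji = (y - x) - (phi y - phi x).
    by rewrite mulmxBl !fhE; apply/rowP => i; rewrite !mxE; ring.
  have := lerB_dist (y - x) (phi y - phi x).
  set u := `|y - x|; set v := `|phi y - phi x|; set w := `|_ - _|.
  by move=> h1 h2; lra.
pose s := r / 2.
have s0 : 0 < s by rewrite divr_gt0.
have sr : s < r by rewrite /s; lra.
pose B : set rV := [set y | `|f a *m Ji - y *m Ji| < s / 2].
have oB : open B.
  rewrite openE => y /= By.
  have c1 := @mulmx_continuous Ji y.
  have n1 : nbhs (y *m Ji) [set z | `|f a *m Ji - z| < s / 2].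
    exact: (@dist_lt_near rV).
  exact: (c1 _ n1).
have ex y : B y -> exists x, `|a - x| < s /\ f x = y.
  move=> By.
  have cF x : `|a - x| <= s -> {for x, continuous (fun x => `|f x *m Ji - y *m Ji|)}.
    move=> ax.
    have dfx : differentiable f x by apply: df; exact: le_lt_trans sr.
    have [dm _] := derive_mulmx Ji (f x) 0.
    have c1 : {for x, continuous (fun x => f x *m Ji)}.
      apply: differentiable_continuous.
      exact: (@differentiable_comp _ _ _ _ f (fun u => u *m Ji) x dfx dm).
    exact: (@cont_normB rV rV).
  have [x ax Hx] := min_ball (ltW s0) cF.
  have axr : `|a - x| < r by exact: le_lt_trans sr.
  (* One simplified Newton step from the minimum [x]. The residual at [x'] is [phi x' - phi x] up to
     sign, hence at most half of the residual at [x]; by minimality both vanish. *)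
  pose x' := x - (f x *m Ji - y *m Ji).
  have aa : `|a - a| < r by rewrite subrr normr0.
  have inb : `|a - x'| < s.
    have -> : a - x' = (phi a - phi x) + (f a *m Ji - y *m Ji).
      by rewrite /x' !fhE; apply/rowP => i; rewrite !mxE; ring.
    apply: le_lt_trans (ler_normD _ _) _.
    have := contr x a axr aa; move: ax By; rewrite /B /= => h1 h2 h3; lra.
  have ax'r : `|a - x'| < r by exact: lt_trans sr.
  have := Hx x' (ltW inb).
  have -> : f x' *m Ji - y *m Ji = - (phi x' - phi x).
    by rewrite (fhE x') {1}/x' (fhE x); apply/rowP => i; rewrite !mxE; ring.
  rewrite normrN => h1; have := contr x x' axr ax'r.
  have -> : x' - x = - (f x *m Ji - y *m Ji) by rewrite /x' addrC addKr.
  rewrite normrN => h2.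
  have h3 : `|f x *m Ji - y *m Ji| = 0.
    by apply/eqP; rewrite eq_le normr_ge0 andbT; move: h1 h2; set u := `|_|; set v := `|_|; lra.
  have E : f x *m Ji = y *m Ji by apply: subr0_eq; apply: normr0_eq0.
  have x'x : x' = x by rewrite /x' E subrr subr0.
  exists x; rewrite -{1}x'x; split => //.
  by rewrite -(mulmxK (_ : Ji \in unitmx) (f x)) ?unitmx_inv // E mulmxK ?unitmx_inv.
pose g y := xget 0 [set x | `|a - x| < s /\ f x = y].
have gP y : B y -> `|a - g y| < s /\ f (g y) = y.
  by move=> /ex [x Hx]; apply: (@xgetPex _ 0 [set x | `|a - x| < s /\ f x = y]); exists x.
have gPr y : B y -> `|a - g y| < r by move=> /gP [? _]; exact: lt_trans sr.
pose A : set rV := [set x | `|a - x| < s /\ B (f x)].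
exists A, B, g.
have gA y : B y -> A (g y) by move=> By; have [h1 h2] := gP y By; split; rewrite ?h2.
split; first split.
- rewrite openE => x [/= ax Bx].
  have n1 : \forall z \near x, `|a - z| < s by exact: dist_lt_near.
  have n2 : nbhs (f x) B by exact: (@open_near R rV).
  have cfx : {for x, continuous f}.
    by apply: differentiable_continuous; apply: df; exact: lt_trans sr.
  exact: filterI n1 (cfx _ n2).
- by split; rewrite /B /= subrr normr0 // divr_gt0.
- exact: oB.
- by move=> x [ax _]; have [? ? ? _] := Hr x (lt_trans ax sr); split.
split.
- move=> x [ax Bx]; split=> //.
  have [h1 h2] := gP _ Bx.
  apply/eqP; rewrite -subr_eq0 -normr_le0.
  have axr : `|a - x| < r by exact: lt_trans sr.
  by have := lip x (g (f x)) axr (gPr _ Bx); rewrite h2 subrr mul0mx normr0 mulr0.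
- by move=> y By; split; [exact: gA|have [] := gP y By].
have glip y y' : B y -> B y' -> `|g y' - g y| <= 2 * C * `|y' - y|.
  move=> By By'; apply: le_trans (lip _ _ (gPr _ By) (gPr _ By')) _.
  by rewrite (gP _ By).2 (gP _ By').2 -mulrA ler_pM2l.
have Dg y : B y -> differentiable g y /\ forall v, 'D_v g y = v *m invmx (jac f (g y)).
  move=> By; set x0 := g y; set J := jac f x0.
  have [_ sfx dJx _] := Hr _ (gPr _ By); rewrite -/x0 -/J in sfx dJx.
  have Jux : J \in unitmx by rewrite unitmxE unitfE.
  have [C' C'0 HC'] := mulmx_norm (invmx J).
  suff [H1 H2] : differentiable g y /\ 'd g y = mulmxr (invmx J) :> (rV -> rV).
    by split=> // v; rewrite deriveE // H2.
  apply: differential_bound; first exact: mulmx_continuous.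
  move=> e e0.
  (* [C'] bounds the inverse Jacobian and [2 * C] is the Lipschitz constant of [g]. *)
  have e'0 : 0 < e / (C' * (2 * C)) by rewrite divr_gt0 // !mulr_gt0.
  have dfx := smv_differentiable sfx.
  have [d d0 Hd] := near_ballP (differentiable_boundP dfx e'0).
  have nB : \forall h \near (0 : rV), B (h + y).
    have [q q0 Hq] := near_ballP (open_near oB By).
    apply: (@ball_nearP _ _ _ q q0) => h; rewrite sub0r normrN => hq; apply: Hq.
    by rewrite opprD addrCA subrr addr0 normrN.
  have nd : \forall h \near (0 : rV), `|h| < d / (2 * C).
    apply: (@ball_nearP _ _ _ (d / (2 * C))); first by rewrite divr_gt0 // mulr_gt0.
    by move=> h; rewrite sub0r normrN.
  apply: filterS2 nB nd => h Bh hd.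
  pose k := g (h + y) - x0.
  have kh : `|k| <= 2 * C * `|h| by have := glip _ _ By Bh; rewrite addrK.
  have kd : `|0 - k| < d.
    by rewrite sub0r normrN; apply: le_lt_trans kh _; rewrite mulrC -ltr_pdivlMr // mulr_gt0.
  have := Hd k kd; rewrite /k subrK (gP _ Bh).2 (gP _ By).2 addrK jacE // -/J -/k => He.
  have -> : g (h + y) - g y - mulmxr (invmx J) h = - ((h - k *m J) *m invmx J).
    by rewrite /= mulmxBl mulmxK // opprB.
  rewrite normrN; apply: le_trans (HC' _) _.
  apply: le_trans (ler_wpM2l (ltW C'0) He) _.
  apply: le_trans (ler_wpM2l (ltW C'0) (ler_wpM2l (ltW e'0) kh)) _.
  rewrite le_eqVlt; apply/orP; left; apply/eqP; field.
  by rewrite !gt_eqF.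
(* Bootstrap: the derivative of [g] is the inverse Jacobian of [f] composed with [g], so it is as
   regular as [g] itself. *)
have CnG k : forall y, B y -> forall j, Cn k (fun z => g z 0 j) y.
  elim: k => [|k IH] y By j.
    by apply: differentiable_continuous; apply: differentiable_row; exact: (Dg y By).1.
  split.
    by apply: filterS (open_near oB By) => z Bz; apply: differentiable_row; exact: (Dg z Bz).1.
  move=> v.
  have [_ sfx dJx _] := Hr _ (gPr _ By).
  have H : Cn k (fun z => \sum_i v 0 i * invmx (jac f (g z)) i j) y.
    apply: Cn_sum => i _; apply: CnM; first exact: Cn_cst.
    apply: (@Cn_inv _ _ k n (fun z => jac f (g z))) => // p q.
    apply: (@Cn_comp _ _ k n g (fun x => jac f x p q)); last exact: IH.
    exact: (sm_smo (sm_jac p q sfx)).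
  apply: Cn_eq H; apply: filterS (open_near oB By) => z Bz.
  by rewrite -derive_row; [rewrite (Dg z Bz).2 mxE|exact: (Dg z Bz).1].
move=> y By; split; last exact: (Dg y By).2.
by move=> j; apply: (sm_open oB) By => z Bz k; exact: CnG.
Unshelve. all: by end_near. Qed.

End IFT.

(** * Flows of compactly supported fields *)

Section Antiderivative.
Context {R : realType}.

Lemma is_deriveD_ (V : normedModType R) (f g : R -> V) (x : R) a b :
  is_derive x (1 : R) f a -> is_derive x (1 : R) g b ->
  is_derive x (1 : R) (fun y => f y + g y) (a + b).
Proof. by move=> H1 H2; apply: is_deriveD. Qed.

Lemma is_deriveB_ (V : normedModType R) (f g : R -> V) (x : R) a b :
  is_derive x (1 : R) f a -> is_derive x (1 : R) g b ->
  is_derive x (1 : R) (fun y => f y - g y) (a - b).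
Proof. by move=> H1 H2; apply: is_deriveB. Qed.

Lemma is_deriveN_ (V : normedModType R) (f : R -> V) (x : R) a :
  is_derive x (1 : R) f a -> is_derive x (1 : R) (fun y => - f y) (- a).
Proof. by move=> H1; apply: is_deriveN. Qed.

Lemma is_deriveM_ (f g : R -> R) (x a b : R) :
  is_derive x (1 : R) f a -> is_derive x (1 : R) g b ->
  is_derive x (1 : R) (fun y => f y * g y) (f x * b + g x * a).
Proof. by move=> H1 H2; apply: is_deriveM. Qed.

Lemma is_derive_lin (V : normedModType R) (f : R -> V) (c s t : R) a :
  is_derive (c * t + s) (1 : R) f a ->
  is_derive t (1 : R) (fun y => f (c * y + s)) (c *: a).
Proof.
move=> [df <-].
have dl : is_derive t (1 : R) (fun y : R => c * y + s) c.
  have d1 : is_derive t (1 : R) (fun y : R => c * y) c.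
    have := is_deriveM_ (is_derive_cst c t 1) (is_derive_id t 1).
    by rewrite mulr0 addr0 mulr1.
  by have := is_deriveD_ d1 (is_derive_cst s t 1); rewrite addr0.
have dlt : differentiable (fun y : R => c * y + s) t by apply/derivable1_diffP; case: dl.
have dft : differentiable f (c * t + s) by apply/derivable1_diffP.
apply: DeriveDef.
  apply/derivable1_diffP.
  by apply: (@differentiable_comp _ _ _ _ (fun y : R => c * y + s) f).
rewrite (@derive_comp R _ _ _ (fun y : R => c * y + s) f) //.
case: dl => _ ->.
have <- : c *: (1 : R) = c by exact: mulr1.
by rewrite deriveZv // [_%:A]mulr1.
Qed.

Lemma is_derive_dirP (V W : normedModType R) (f : V -> W) (x v : V) l :
  is_derive (0 : R) (1 : R) (fun e : R => f (e *: v + x)) l -> is_derive x v f l.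
Proof.
have E : (fun h : R => h^-1 *: (((fun e : R => f (e *: v + x)) \o shift 0) (h *: (1 : R)) - f (0 *: v + x)))
    = (fun h : R => h^-1 *: ((f \o shift x) (h *: v) - f x)).
  rewrite funeqE => h; rewrite /= scale0r add0r addr0.
  by rewrite [_%:A]mulr1.
move=> [d D]; move: d D; rewrite /derivable /derive E => d D.
exact: DeriveDef.
Qed.

Lemma quad_derive (g : R -> R) (l K : R) :
  (forall e, `|e| <= 1 -> `|g e - g 0 - e * l| <= K * `|e| ^+ 2) ->
  is_derive (0 : R) (1 : R) g l.
Proof.
move=> H.
have L : (fun h : R => h^-1 *: ((g \o shift 0) (h *: (1:R)) - g 0)) @ 0^' --> (l : R).
  apply/cvgrPdist_le => e e0; near=> h.
  rewrite /= addr0 [h%:A]mulr1 distrC -[_ *: _]/(_ * _).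
  have h0 : h != 0 by near: h; exact: nbhs_dnbhs_neq.
  have h1 : `|h| <= 1 by near: h; apply: dnbhs0_le.
  have -> : h^-1 * (g h - g 0) - l = h^-1 * (g h - g 0 - h * l) by field.
  rewrite normrM normfV ler_pdivrMl ?normr_gt0 //.
  apply: le_trans (H h h1) _.
  have h2 : `|h| <= e / (`|K| + 1).
    by near: h; apply: dnbhs0_le; rewrite divr_gt0 // ltr_wpDl.
  apply: le_trans (_ : (`|K| + 1) * `|h| ^+ 2 <= _).
    by rewrite ler_wpM2r ?sqr_ge0 // (le_trans (ler_norm _)) // lerDl.
  rewrite expr2 mulrCA ler_wpM2l // mulrC -ler_pdivlMr // ltr_wpDl //.
apply: DeriveDef; first by apply/cvg_ex; exists l.
exact: cvg_lim L.
Unshelve. all: by end_near. Qed.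

Lemma cont_distP (V W : normedModType R) (f : V -> W) (x : V) :
  {for x, continuous f} <-> forall e : R, 0 < e -> \forall y \near x, `|f x - f y| < e.
Proof. by split=> [/cvgrPdist_lt //|H]; apply/cvgrPdist_lt. Qed.

Lemma derive_le (f df dg g : R -> R) (t : R) : 0 <= t ->
  (forall s, 0 <= s <= t -> is_derive s (1 : R) f (df s)) ->
  (forall s, 0 <= s <= t -> is_derive s (1 : R) g (dg s)) ->
  (forall s, 0 <= s <= t -> df s <= dg s) -> f t - f 0 <= g t - g 0.
Proof.
move=> t0 Hf Hg H.
have D s : 0 <= s <= t -> is_derive s (1 : R) (fun s => g s - f s) (dg s - df s).
  by move=> hs; apply: is_deriveB_; [exact: Hg|exact: Hf].
have [||c] := @MVT_segment R (fun s => g s - f s) (fun s => dg s - df s) 0 t t0.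
- by move=> s; rewrite in_itv /= => /andP[? ?]; apply: D; rewrite !ltW.
- by apply: derivable_within_continuous => s; rewrite in_itv /= => /D; case.
rewrite in_itv /= => hc E.
have : 0 <= (g t - f t) - (g 0 - f 0) by rewrite E mulr_ge0 ?subr_ge0 // H.
by move=> h; lra.
Qed.

Lemma derive_norm_le (f df g dg : R -> R) (t : R) :
  (forall s, `|s| <= `|t| -> is_derive s (1 : R) f (df s)) ->
  (forall s, 0 <= s <= `|t| -> is_derive s (1 : R) g (dg s)) ->
  (forall s, `|s| <= `|t| -> `|df s| <= dg `|s|) -> `|f t - f 0| <= g `|t| - g 0.
Proof.
wlog t0 : f df t / 0 <= t => [W|] Hf Hg H.
  have [t0|t0] := leP 0 t; first exact: (W f df).
  have := W (fun s => f (-1 * s + 0)) (fun s => -1 * df (-1 * s + 0)) (- t).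
  rewrite !normrN !addr0 !mulN1r opprK oppr0; apply => //.
  - by rewrite oppr_ge0 ltW.
  - move=> s hs; have := @is_derive_lin R f (-1) 0 s (df (-1 * s + 0)).
    by apply; apply: Hf; rewrite mulN1r addr0 normrN.
  - by move=> s hs; rewrite mulN1r normrN; rewrite (le_trans (H _ _)) ?mulN1r ?addr0 ?normrN.
move: Hf Hg H; rewrite (ger0_norm t0) => Hf Hg H.
have hs s : 0 <= s <= t -> `|s| <= t by move=> /andP[? ?]; rewrite ger0_norm.
rewrite ler_norml; apply/andP; split.
  rewrite lerNl opprB.
  have := @derive_le (fun s => - f s) (fun s => - df s) dg g t t0.
  rewrite opprK addrC; apply => //.
    by move=> s /hs ?; apply: is_deriveN_; exact: Hf.
  move=> s hs'; have := H s (hs s hs'); rewrite ler_norml => /andP[h _].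
  by rewrite lerNl; move: h; rewrite ger0_norm //; case/andP: hs'.
have Hf' s : 0 <= s <= t -> is_derive s (1 : R) f (df s) by move=> /hs; exact: Hf.
apply: (derive_le t0 Hf' Hg) => s hs'; have := H s (hs s hs'); rewrite ler_norml => /andP[_].
by rewrite ger0_norm //; case/andP: hs'.
Qed.

Lemma derive_lip (f df : R -> R) (C t : R) :
  (forall s, `|s| <= `|t| -> is_derive s (1 : R) f (df s)) ->
  (forall s, `|s| <= `|t| -> `|df s| <= C) -> `|f t - f 0| <= C * `|t|.
Proof.
move=> Hf H.
have := @derive_norm_le f df (fun s => C * s) (fun=> C) t Hf.
rewrite mulr0 subr0; apply => // s _.
have := is_deriveM_ (is_derive_cst C s 1) (is_derive_id s 1).
by rewrite mulr0 addr0 mulr1.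
Qed.

Lemma derive0_cst (f df : R -> R) (t : R) :
  (forall s, `|s| <= `|t| -> is_derive s (1 : R) f (df s)) ->
  (forall s, `|s| <= `|t| -> df s = 0) -> f t = f 0.
Proof.
move=> Hf H; apply/eqP; rewrite -subr_eq0 -normr_le0.
have := @derive_lip f df 0 t Hf; rewrite mul0r; apply => s hs.
by rewrite H // normr0.
Qed.

(** The fundamental theorem is applied on each [[-A, A]]. Primitives vanishing at 0 agree wherever
    both are defined, so the value at [t] may be taken from [A = |t| + 1]. *)
Lemma antiderivative (g : R -> R) : continuous g ->
  exists G : R -> R, G 0 = 0 /\ forall t, is_derive t (1 : R) G (g t).
Proof.
move=> cg.
have loc (A : R) : exists G : R -> R, 0 < A -> G 0 = 0 /\ forall t, `|t| < A -> is_derive t (1 : R) G (g t).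
  pose F (x : R) := (\int[@lebesgue_measure R]_(t in [set` `[(- A), x]]) (g t))%R.
  exists (fun x => F x - F 0) => A0; split; first by rewrite subrr.
  move=> t; rewrite ltr_norml => /andP[t1 t2].
  have ig : (@lebesgue_measure R).-integrable `[(- A), A] (EFin \o g).
    apply: continuous_compact_integrable; first exact: segment_compact.
    exact: continuous_subspaceT.
  have [d1 d2] := @continuous_FTC1_closed R g (- A) t A t2 ig t1 (cg t).
  have dF : is_derive t (1 : R) F (g t).
    by apply: DeriveDef; [exact: d1|rewrite -derive1E d2].
  by have := is_deriveB_ dF (is_derive_cst (F 0) t 1); rewrite subr0.
have [GG HG] := choice loc.
exists (fun t => GG (`|t| + 1) t).
have pos (t : R) : 0 < `|t| + 1 by rewrite ltr_wpDl.
have agree (A t : R) : `|t| < A -> GG (`|t| + 1) t = GG A t.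
  move=> tA; have A0 : 0 < A by exact: le_lt_trans tA.
  have [h1 h2] := HG A A0; have [h3 h4] := HG (`|t| + 1) (pos t).
  apply/eqP; rewrite -subr_eq0.
  have -> : GG (`|t| + 1) t - GG A t = GG (`|t| + 1) 0 - GG A 0.
    apply: (@derive0_cst (fun s => GG (`|t| + 1) s - GG A s) (fun s => g s - g s) t).
      move=> s st.
      have st1 : `|s| < `|t| + 1 by rewrite (le_lt_trans st) // ltrDl.
      exact: (is_deriveB_ (h4 _ st1) (h2 _ (le_lt_trans st tA))).
    by move=> s _; rewrite subrr.
  by rewrite h1 h3 subrr.
split; first by have [] := HG _ (pos 0); rewrite normr0.
move=> t.
have A0 : 0 < `|t| + 1 := pos t.
have [_ h2] := HG (`|t| + 1) A0.
have tA : `|t| < `|t| + 1 by rewrite ltrDl.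
apply: near_eq_is_derive (h2 t tA).
have := @dist_lt_near R R^o 0 t (`|t| + 1).
rewrite sub0r normrN => /(_ tA).
by apply: filterS => s; rewrite sub0r normrN => /agree.
Qed.

(** The sign of [c] is free: a negative [c] gives exponential decay, which is how sinks are
    treated. *)
Lemma gronwall (E dE : R -> R) (c t : R) : 0 <= t ->
  (forall s, 0 <= s <= t -> is_derive s (1 : R) E (dE s)) ->
  (forall s, 0 <= s <= t -> dE s <= c * E s) -> E t <= expR (c * t) * E 0.
Proof.
move=> t0 HE H.
have de (s : R) : is_derive s (1 : R) (fun s => expR (- c * s)) (- c * expR (- c * s)).
  have := @is_derive_lin _ (@expR R) (- c) 0 s (expR (- c * s + 0)) (is_derive_expR _).
  by rewrite addr0; under eq_fun do rewrite addr0.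
have D s : 0 <= s <= t -> is_derive s (1 : R) (fun s => expR (- c * s) * E s)
    (expR (- c * s) * dE s + E s * (- c * expR (- c * s))).
  by move=> hs; exact: (is_deriveM_ (de s) (HE s hs)).
have := @derive_le (fun s => expR (- c * s) * E s) _ (fun=> 0) (fun=> 0) t t0 D.
rewrite subrr mulr0 expR0 mul1r subr_le0 mulNr expRN => K.
rewrite mulrC -ler_pdivrMr ?expR_gt0 // mulrC; apply: K => s hs.
have -> : expR (- c * s) * dE s + E s * (- c * expR (- c * s)) = expR (- c * s) * (dE s - c * E s) by ring.
by rewrite pmulr_rle0 ?expR_gt0 // subr_le0 H.
Qed.

End Antiderivative.

(** * Compactly supported functions and primitives along a direction *)

Section CompactSupport.
Context {R : realType} {n : nat}.
Local Notation rV := 'rV[R]_n.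

Definition csupp (f : rV -> R) := exists M : R, forall x, M < `|x| -> f x = 0.

Lemma csupp_der f v : csupp f -> csupp ('D_v f).
Proof.
move=> [M HM]; exists M => x xM.
rewrite (@near_eq_derive R rV R f (fun=> 0)); first by rewrite derive_cst.
have [r r0 Hr] : exists2 r : R, 0 < r & forall y, `|x - y| < r -> M < `|y|.
  exists (`|x| - M); first by rewrite subr_gt0.
  move=> y xy; have := lerB_dist x (x - y); rewrite subKr; lra.
by apply: (@ball_nearP R rV _ x r r0) => y /Hr; exact: HM.
Qed.

Lemma csupp_bounded f : csupp f -> (forall x, {for x, continuous f}) ->
  exists2 C : R, 0 <= C & forall x, `|f x| <= C.
Proof.
move=> [M HM] cf; pose s := `|M|.
have cF x : `|0 - x| <= s -> {for x, continuous (fun x => - `|f x - 0|)}.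
  by move=> _; apply: (@CnN R rV 0%N); exact: (@cont_normB R rV R f x 0 (cf x)).
have [c _ Hc] := min_ball (normr_ge0 M) cF.
exists `|f c| => // x.
have [xM|xM] := leP `|x| s.
  have := Hc x; rewrite sub0r normrN xM => /(_ isT).
  by rewrite lerN2 !subr0.
rewrite HM ?normr0 //; exact: le_lt_trans (ler_norm _) xM.
Qed.

Lemma csupp_lip f : csupp f -> (forall x, smo f x) ->
  exists2 L : R, 0 <= L & forall x y, `|f y - f x| <= L * `|y - x|.
Proof.
move=> cf sf.
have H i : exists C : R, 0 <= C /\ forall x, `|'D_(delta_mx 0 i) f x| <= C.
  have [|C C0 HC] := csupp_bounded (csupp_der (delta_mx 0 i) cf).
    by move=> x; apply: smo_continuous; apply: smo_der.
  by exists C.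
have [C HC] := choice H.
have S0 : 0 <= \sum_i C i by apply: sumr_ge0 => i _; have [] := HC i.
exists (n%:R * \sum_i C i); first by rewrite mulr_ge0.
move=> x y; apply: (@mvt_ball R n f x (`|x - y| + 1)) => //.
- by move=> z _; exact: smo_differentiable.
- move=> z i _; apply: le_trans ((HC i).2 z) _.
  rewrite (bigD1 i) //= lerDl; apply: sumr_ge0 => j _; by have [] := HC j.
- by rewrite subrr normr0 ltr_wpDl.
- by rewrite ltrDl.
Qed.

Lemma csupp_lip_row (W : rV -> rV) : (forall j, csupp (fun x => W x 0 j)) ->
  (forall x j, smo (fun x => W x 0 j) x) ->
  (exists2 L : R, 0 <= L & forall x y, `|W y - W x| <= L * `|y - x|) /\
  (exists2 C : R, 0 <= C & forall x, `|W x| <= C).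
Proof.
move=> cW sW; split.
  have H i : exists C : R, 0 <= C /\ forall x y, `|W y 0 i - W x 0 i| <= C * `|y - x|.
    by have [L L0 HL] := csupp_lip (cW i) (fun x => sW x i); exists L.
  have [C HC] := choice H.
  have S0 : 0 <= \sum_i C i by apply: sumr_ge0 => i _; have [] := HC i.
  exists (\sum_i C i) => // x y; apply: norm_leP => [|i]; first by rewrite mulr_ge0.
  rewrite !mxE; apply: le_trans ((HC i).2 x y) _; rewrite ler_wpM2r //.
  rewrite (bigD1 i) //= lerDl; apply: sumr_ge0 => j _; by have [] := HC j.
have H i : exists C : R, 0 <= C /\ forall x, `|W x 0 i| <= C.
  have [|L L0 HL] := csupp_bounded (cW i); last by exists L.
  by move=> x; apply: smo_continuous.
have [C HC] := choice H.
have S0 : 0 <= \sum_i C i by apply: sumr_ge0 => i _; have [] := HC i.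
exists (\sum_i C i) => // x; apply: norm_leP => // i.
apply: le_trans ((HC i).2 x) _.
rewrite (bigD1 i) //= lerDl; apply: sumr_ge0 => j _; by have [] := HC j.
Qed.

(** [P h z] integrates [h] along the line through [z] in the direction [a], starting on the
    hyperplane [sg = 0]. Its derivative along [v] is [P] of a derivative of [h], taken in the
    component of [v] in the hyperplane, plus a multiple of [h z]; so the class of all [P h] is
    closed under differentiation up to smooth terms, and smoothness follows by induction. *)
Theorem directional_primitive (k : rV -> R) (a : rV) (sg : {linear rV -> R}) :
  sg a = 1 -> csupp k -> (forall x, smo k x) ->
  exists2 P : rV -> R, (forall x, smo P x) & forall x, 'D_a P x = k x.
Proof.
move=> sga ck sk.
have sgE v : sg v = \sum_i v 0 i * sg (delta_mx 0 i).
  by rewrite {1}(row_sum_delta v) linear_sum; apply: eq_bigr => i _; rewrite linearZ.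
have sgc x : {for x, continuous sg}.
  suff H : Cn 0 (fun v : rV => \sum_i v 0 i * sg (delta_mx 0 i)) x.
    by apply: near_continuous H; near=> y; rewrite sgE.
  by apply: Cn_sum => i _; apply: CnM; [exact: Cn_coord|exact: Cn_cst].
(* A single choice serves all functions and all base points, so that [A] becomes one operator;
   nothing is promised for discontinuous functions. *)
have ex (kp : (rV -> R) * rV) : exists G : R -> R, (forall x, {for x, continuous kp.1}) ->
    G 0 = 0 /\ forall t, is_derive t (1 : R) G (kp.1 (kp.2 + t *: a)).
  have [c|nc] := pselect (forall x, {for x, continuous kp.1}); last by exists (fun=> 0).
  have [|G HG] := @antiderivative R (fun t => kp.1 (kp.2 + t *: a)); last by exists G.
  move=> t.
  have d : derivable (fun t : R => kp.2 + t *: a) t 1.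
    by have [] := @is_derive_line R rV rV id kp.2 a t (@derivable_id R rV _ _).
  have ct : {for t, continuous (fun t : R => kp.2 + t *: a)}.
    by apply: differentiable_continuous; apply/derivable1_diffP.
  exact: (@continuous_comp R rV R (fun t : R => kp.2 + t *: a) kp.1 t ct (c _)).
have [AA HA] := choice ex.
pose A (h : rV -> R) p := AA (h, p).
pose good (h : rV -> R) := csupp h /\ forall x, smo h x.
have gc h : good h -> forall x, {for x, continuous h}.
  by move=> [_ sh] x; exact: smo_continuous.
have A0 h p : good h -> A h p 0 = 0 by move=> /gc gh; exact: (HA (h, p) gh).1.
have AD h p t : good h -> is_derive t (1 : R) (A h p) (h (p + t *: a)).
  by move=> /gc gh; exact: (HA (h, p) gh).2.
have gder h v : good h -> good ('D_v h).
  by move=> [c1 c2]; split; [exact: csupp_der|move=> x; exact: smo_der].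
pose P (h : rV -> R) (z : rV) := A h (z - sg z *: a) (sg z).
have lipA h : good h -> exists2 L : R, 0 <= L & forall p q s, `|A h q s - A h p s| <= L * `|q - p| * `|s|.
  move=> gh; have [L L0 HL] := csupp_lip gh.1 gh.2; exists L => // p q s.
  have := @derive_lip R (fun s => A h q s - A h p s) (fun s => h (q + s *: a) - h (p + s *: a)) (L * `|q - p|) s.
  rewrite !A0 // subrr subr0; apply.
    by move=> t _; apply: is_deriveB_; exact: AD.
  move=> t _; apply: le_trans (HL _ _) _.
  by rewrite opprD addrACA subrr addr0.
have bndA h : good h -> exists2 C : R, 0 <= C & forall p s t, `|A h p t - A h p s| <= C * `|t - s|.
  move=> gh; have [C C0 HC] := csupp_bounded gh.1 (gc h gh); exists C => // p s t.
  have := @derive_lip R (fun r => A h p (1 * r + s)) (fun r => 1 * h (p + (1 * r + s) *: a)) C (t - s).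
  rewrite mulr0 add0r mul1r subrK; apply.
    by move=> r _; apply: is_derive_lin; exact: AD.
  by move=> r _; rewrite mul1r.
(* Differentiation under the integral sign: moving the base point along [b] changes [A h] by
   [e * A ('D_b h)] up to a term of order [e ^+ 2]. *)
have secA h b : good h -> exists2 C : R, 0 <= C & forall p s (e : R),
    `|A h (p + e *: b) s - A h p s - e * A ('D_b h) p s| <= C * `|e| ^+ 2 * `|s|.
  move=> gh; have gb := gder h b gh; have [L L0 HL] := csupp_lip gb.1 gb.2.
  exists (L * `|b|) => [|p s e]; first by rewrite mulr_ge0.
  have := @derive_lip R (fun s => A h (p + e *: b) s - A h p s - e * A ('D_b h) p s)
    (fun s => h (p + e *: b + s *: a) - h (p + s *: a) - e * 'D_b h (p + s *: a)) (L * `|b| * `|e| ^+ 2) s.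
  rewrite !A0 // mulr0 !subr0; apply.
    move=> t _; apply: is_deriveB_; first by apply: is_deriveB_; exact: AD.
    have := is_deriveM_ (is_derive_cst e t 1) (AD _ p t gb).
    by rewrite mulr0 addr0.
  move=> t _; set q := p + t *: a.
  have -> : p + e *: b + t *: a = q + e *: b by rewrite addrAC.
  have [c ce] := @MVT0 R (fun s => h (q + s *: b)) (fun s => 'D_b h (q + s *: b)) e
    (fun s _ => is_derive_line (diff_derivable (smo_differentiable (gh.2 (q + s *: b))))).
  rewrite scale0r addr0 => ->.
  rewrite [_ * e]mulrC -mulrBr normrM.
  apply: le_trans (ler_wpM2l (normr_ge0 e) (HL _ _)) _.
  rewrite addrC addKr normrZ expr2.
  have h1 : 0 <= `|b| by []. have h2 : 0 <= `|e| by []. have h3 : 0 <= `|c| by [].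
  have h4 : `|c| * `|b| <= `|e| * `|b| by rewrite ler_wpM2r.
  have h5 : L * (`|c| * `|b|) <= L * (`|e| * `|b|) by rewrite ler_wpM2l.
  have := ler_wpM2l h2 h5; congr (_ <= _); ring.
have Pc h z : good h -> {for z, continuous (P h)}.
  move=> gh; have [L L0 HL] := lipA h gh; have [C C0 HC] := bndA h gh.
  apply/(@cont_distP R rV R) => e e0.
  have sgs : forall y, smo sg y.
    move=> y j; apply: Cn_eq (@Cn_sum R rV j _ (index_enum _) xpredT (fun i v => v 0 i * sg (delta_mx 0 i)) y _).
      by near=> u; rewrite sgE.
    by move=> i _; apply: CnM; [exact: Cn_coord|exact: Cn_cst].
  pose c (y : rV) := L * `|(y - sg y *: a) - (z - sg z *: a)| * `|sg y - 0| + C * `|sg y - sg z|.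
  have c1 : {for z, continuous c}.
    have ca : {for z, continuous (fun y : rV => y - sg y *: a)}.
      apply: (@smv_continuous R rV n (fun y : rV => y - sg y *: a)).
      apply: smvB; first exact: smv_id.
      by apply: smvZ; [exact: sm_T|exact: smv_cst].
    have cb := @cont_normB R rV rV _ z (z - sg z *: a) ca.
    have cc := @cont_normB R rV R _ z (sg z) (sgc z).
    have cd := @cont_normB R rV R _ z 0 (sgc z).
    apply: (@CnD R rV 0%N); apply: (@CnM R rV 0%N) => //; last exact: (@Cn_cst R rV 0%N).
    by apply: (@CnM R rV 0%N) => //; exact: (@Cn_cst R rV 0%N).
  have /(@cont_distP R rV R) /(_ e e0) := c1.
  have c0 : c z = 0 by rewrite /c !subrr !normr0 !mulr0 mul0r addr0.
  apply: filterS => y; rewrite c0 sub0r normrN => H.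
  apply: le_lt_trans H; apply: le_trans (ler_norm _).
  rewrite distrC /P /c subr0.
  set p := z - _; set q := y - _.
  have -> : A h q (sg y) - A h p (sg z) = (A h q (sg y) - A h p (sg y)) + (A h p (sg y) - A h p (sg z)) by ring.
  by apply: le_trans (ler_normD _ _) _; rewrite lerD.
have Pder h z v : good h -> is_derive z v (P h) (P ('D_(v - sg v *: a) h) z + sg v * h z).
  move=> gh; set b := v - sg v *: a; set p := z - sg z *: a; set s := sg z.
  have gb := gder h b gh.
  have [C1 C10 H1] := secA h b gh; have [C2 C20 H2] := bndA _ gb.
  apply: is_derive_dirP.
  have E : (fun e : R => P h (e *: v + z)) =
     (fun e => (A h (p + e *: b) (sg v * e + s) - A h p (sg v * e + s)) + A h p (sg v * e + s)).
    rewrite funeqE => e; rewrite subrK /P.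
    have h1 : sg (e *: v + z) = sg v * e + s.
      by rewrite linearD linearZ /= -[e *: sg v]/(e * sg v) mulrC.
    rewrite h1; congr (A h _ _).
    by rewrite /p /b; apply/rowP => i; rewrite !mxE /s; ring.
  rewrite E.
  have zE : z = p + s *: a by rewrite subrK.
  have d3 : is_derive (0 : R) (1 : R) (fun e => A h p (sg v * e + s)) (sg v * h z).
    have := @is_derive_lin R R (A h p) (sg v) s 0 _ (AD h p (sg v * 0 + s) gh).
    by rewrite mulr0 add0r -zE.
  apply: (is_deriveD_ _ d3).
  apply: (@quad_derive _ _ _ (C1 * (`|sg v| + `|s|) + C2 * `|sg v|)) => e e1.
  rewrite mulr0 add0r scale0r addr0 subrr subr0.
  set s' := sg v * e + s.
  have hs' : `|s'| <= `|sg v| + `|s|.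
    apply: le_trans (ler_normD _ _) _; rewrite lerD2r normrM.
    by rewrite ler_piMr.
  have -> : P ('D_b h) z = A ('D_b h) p s by [].
  have -> : A h (p + e *: b) s' - A h p s' - e * A ('D_b h) p s =
    (A h (p + e *: b) s' - A h p s' - e * A ('D_b h) p s') + e * (A ('D_b h) p s' - A ('D_b h) p s) by ring.
  apply: le_trans (ler_normD _ _) _.
  rewrite mulrDl lerD //.
    apply: le_trans (H1 _ _ _) _.
    by rewrite mulrAC; apply: ler_wpM2r; [rewrite sqr_ge0|rewrite ler_wpM2l].
  rewrite normrM; apply: le_trans (ler_wpM2l (normr_ge0 e) (H2 _ _ _)) _.
  have -> : s' - s = sg v * e by rewrite addrK.
  rewrite normrM le_eqVlt; apply/orP; left; apply/eqP; ring.
have PCn m : forall h z, good h -> Cn m (P h) z.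
  elim: m => [|m IH] h z gh; first exact: Pc.
  have E v y : 'D_v (P h) y = P ('D_(v - sg v *: a) h) y + sg v * h y.
    by have [] := Pder h y v gh.
  split; last first.
    move=> v; apply: Cn_eq (CnD (IH _ z (gder h (v - sg v *: a) gh)) (CnM (Cn_cst m (sg v) z) (gh.2 z m))).
    by near=> y; rewrite E.
  near=> y; apply: C1_differentiable => i.
    by near=> u; have [] := Pder h u (delta_mx 0 i) gh.
  have H := CnD (IH _ y (gder h (delta_mx 0 i - sg (delta_mx 0 i) *: a) gh)) (CnM (Cn_cst m (sg (delta_mx 0 i)) y) (gh.2 y m)).
  apply: near_continuous (Cn_le (leq0n m) H).
  by near=> u; rewrite E.
have gk : good k by [].
exists (P k); first by move=> x m; exact: PCn.
move=> x; have [_ ->] := Pder k x a gk.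
rewrite sga scale1r subrr mul1r.
(* For [v = a] the component in the hyperplane is 0, and ['D_0 k] vanishes identically. *)
suff -> : P ('D_0 k) x = 0 by rewrite add0r.
have g0 := gder k 0 gk.
set p := x - sg x *: a.
have -> : P ('D_0 k) x = A ('D_0 k) p 0.
  apply: (@derive0_cst R (A ('D_0 k) p) (fun t => 'D_0 k (p + t *: a)) (sg x)).
    by move=> s _; exact: AD.
  by move=> s _; rewrite derive0.
exact: A0.
Unshelve. all: by end_near. Qed.

End CompactSupport.

(** * Global solutions of ordinary differential equations *)

Section Picard.
Context {R : realType}.

(** Subtracting and adding [2 * B * 2^-1 ^+ k] gives an increasing and a decreasing sequence with
    every term of the first below every term of the second; completeness enters only through a
    supremum. *)
Lemma geometric_limit (u : nat -> R) (B : R) : 0 <= B ->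
  (forall k, `|u k.+1 - u k| <= B * 2^-1 ^+ k) ->
  exists l, forall k, `|l - u k| <= 2 * B * 2^-1 ^+ k.
Proof.
move=> B0 H.
pose v k := u k - 2 * B * 2^-1 ^+ k; pose w k := u k + 2 * B * 2^-1 ^+ k.
have p2 k : 0 <= B * 2^-1 ^+ k by rewrite mulr_ge0 // exprn_ge0.
have vS k : v k <= v k.+1.
  have := H k; rewrite ler_norml => /andP[h _]; have := p2 k.
  rewrite /v exprS; set q := B * _ in h *.
  have -> : 2 * B * (2^-1 * 2^-1 ^+ k) = q by rewrite /q; field.
  have -> : 2 * B * 2^-1 ^+ k = 2 * q by rewrite mulrA.
  by move=> h'; lra.
have wS k : w k.+1 <= w k.
  have := H k; rewrite ler_norml => /andP[_ h]; have := p2 k.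
  rewrite /w exprS; set q := B * _ in h *.
  have -> : 2 * B * (2^-1 * 2^-1 ^+ k) = q by rewrite /q; field.
  have -> : 2 * B * 2^-1 ^+ k = 2 * q by rewrite mulrA.
  by move=> h'; lra.
have vmono k m : v k <= v (k + m)%N.
  by elim: m => [|m IH]; [rewrite addn0|rewrite addnS (le_trans IH)].
have wmono k m : w (k + m)%N <= w k.
  by elim: m => [|m IH]; [rewrite addn0|rewrite addnS (le_trans _ IH)].
have vw k : v k <= w k by rewrite lerD2l; have := p2 k; rewrite -mulrA => h; lra.
have vwm k m : v k <= w m.
  apply: le_trans (vmono k m) _; apply: le_trans (vw _) _.
  by rewrite addnC wmono.
exists (sup (range v)) => k.
have hs : has_sup (range v).
  split; first by exists (v 0%N), 0%N.
  by exists (w 0%N) => _ [m _ <-].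
rewrite ler_distl; apply/andP; split.
  by apply: sup_upper_bound => //; exists k.
by apply: ge_sup; [case: hs|move=> _ [m _ <-]; exact: vwm].
Qed.

Lemma sum_const_ord m (c : R) : \sum_(j < m) c = m%:R * c.
Proof. by rewrite sumr_const card_ord mulr_natl. Qed.

Lemma half_ge0 k : 0 <= 2^-1 ^+ k :> R.
Proof. by rewrite exprn_ge0 // invr_ge0. Qed.

Context {n : nat}.
Local Notation rV := 'rV[R]_n.

Lemma is_derive_rowP (g : R -> rV) (t : R) (v : rV) :
  is_derive t (1 : R) g v <-> forall j, is_derive t (1 : R) (fun s => g s 0 j) (v 0 j).
Proof.
split=> [[d <-] j|H].
  apply: DeriveDef; first by have /derivable_mxP := d; apply.
  by rewrite derive_mx // mxE.
have d : derivable g t 1.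
  by apply/derivable_mxP => i j; rewrite ord1; have [] := H j.
apply: DeriveDef => //; apply/rowP => j; rewrite derive_mx // mxE.
by have [_] := H j.
Qed.

Lemma is_derive_continuous (V : normedModType R) (g : R -> V) (t : R) v :
  is_derive t (1 : R) g v -> {for t, continuous g}.
Proof.
by move=> [d _]; apply: differentiable_continuous; apply/derivable1_diffP.
Qed.

Lemma antiderivative_row (g : R -> rV) : continuous g ->
  exists G : R -> rV, G 0 = 0 /\ forall t, is_derive t (1 : R) G (g t).
Proof.
move=> cg.
have H j : exists G : R -> R, G 0 = 0 /\ forall t, is_derive t (1 : R) G (g t 0 j).
  apply: (@antiderivative R (fun t => g t 0 j)) => t.
  apply: (@continuous_comp _ _ _ g (fun u : rV => u 0 j)); first exact: cg.
  exact: coord_continuous.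
have [G HG] := choice H.
exists (fun t => \row_j G j t); split.
  by apply/rowP => j; rewrite !mxE; have [] := HG j.
move=> t; apply/is_derive_rowP => j.
have -> : (fun s => (\row_j G j s) 0 j) = G j by rewrite funeqE => s; rewrite mxE.
by have [_] := HG j.
Qed.

Lemma derive_row_lip (g dg : R -> rV) (C t : R) : 0 <= C ->
  (forall s, `|s| <= `|t| -> is_derive s (1 : R) g (dg s)) ->
  (forall s, `|s| <= `|t| -> `|dg s| <= C) -> `|g t - g 0| <= C * `|t|.
Proof.
move=> C0 Hg H; apply: norm_leP => [|j]; first by rewrite mulr_ge0.
rewrite !mxE; apply: (@derive_lip R (fun s => g s 0 j) (fun s => dg s 0 j)).
  by move=> s /Hg /is_derive_rowP.
by move=> s /H; apply: le_trans; exact: coord_le_norm.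
Qed.

(* Gronwall through the sum of squares, as the sup norm is not differentiable. *)
Lemma ode_gronwall (W : rV -> rV) (L : R) (g1 g2 : R -> rV) (t : R) : 0 <= L ->
  (forall x y, `|W y - W x| <= L * `|y - x|) ->
  (forall s, `|s| <= `|t| -> is_derive s (1 : R) g1 (W (g1 s))) ->
  (forall s, `|s| <= `|t| -> is_derive s (1 : R) g2 (W (g2 s))) ->
  `|g2 t - g1 t| ^+ 2 <= n%:R * expR (2 * n%:R * L * `|t|) * `|g2 0 - g1 0| ^+ 2.
Proof.
wlog t0 : W g1 g2 t / 0 <= t => [Wl|] L0 HW H1 H2.
  have [t0|t0] := leP 0 t; first exact: (Wl W).
  have R' (g : R -> rV) : (forall s, `|s| <= `|t| -> is_derive s (1 : R) g (W (g s))) ->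
     forall s, `|s| <= `|- t| -> is_derive s (1 : R) (fun s => g (-1 * s + 0)) (- W (g (-1 * s + 0))).
    move=> Hg s; rewrite normrN => hs.
    have := @is_derive_lin R rV g (-1) 0 s (W (g (-1 * s + 0))).
    by rewrite scaleN1r; apply; apply: Hg; rewrite mulN1r addr0 normrN.
  have := Wl (fun x => - W x) (fun s => g1 (-1 * s + 0)) (fun s => g2 (-1 * s + 0)) (- t).
  rewrite !addr0 mulr0 mulN1r opprK normrN; apply => //.
  - by rewrite oppr_ge0 ltW.
  - by move=> x y; rewrite opprK addrC -normrN opprD opprK addrC.
  - by rewrite -normrN; exact: R'.
  - by rewrite -normrN; exact: R'.
move: H1 H2; rewrite (ger0_norm t0) => H1 H2.
pose E s := \sum_j (g2 s 0 j - g1 s 0 j) ^+ 2.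
pose dE s := \sum_j (2 * (g2 s 0 j - g1 s 0 j) * (W (g2 s) 0 j - W (g1 s) 0 j)).
have E0 s : `|g2 s - g1 s| ^+ 2 <= E s.
  have Ej j : `|g2 s 0 j - g1 s 0 j| <= Num.sqrt (E s).
    rewrite -sqrtr_sqr ler_sqrt; last by apply: sumr_ge0 => i _; exact: sqr_ge0.
    by rewrite /E (bigD1 j) //= lerDl; apply: sumr_ge0 => i _; exact: sqr_ge0.
  have En : `|g2 s - g1 s| <= Num.sqrt (E s).
    by apply: norm_leP => [|j]; rewrite ?sqrtr_ge0 // !mxE.
  have := lerXn2r 2 _ _ En; rewrite !nnegrE normr_ge0 sqrtr_ge0 => /(_ isT isT).
  by rewrite sqr_sqrtr //; apply: sumr_ge0 => i _; exact: sqr_ge0.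
have En s : E s <= n%:R * `|g2 s - g1 s| ^+ 2.
  have -> : n%:R * `|g2 s - g1 s| ^+ 2 = \sum_(j < n) `|g2 s - g1 s| ^+ 2.
    by rewrite sum_const_ord.
  apply: ler_sum => j _; rewrite -real_normK ?num_real // lerXn2r ?nnegrE //.
  by have := coord_le_norm (g2 s - g1 s) j; rewrite !mxE.
have hs s : 0 <= s <= t -> `|s| <= t by move=> /andP[? ?]; rewrite ger0_norm.
have dEs s : 0 <= s <= t -> is_derive s (1 : R) E (dE s).
  move=> /hs st.
  have Dj j : is_derive s (1 : R) (fun s => (g2 s 0 j - g1 s 0 j) ^+ 2)
     (2 * (g2 s 0 j - g1 s 0 j) * (W (g2 s) 0 j - W (g1 s) 0 j)).
    have /is_derive_rowP /(_ j) d1 := H1 s st; have /is_derive_rowP /(_ j) d2 := H2 s st.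
    have d := is_deriveB_ d2 d1; have := is_deriveM_ d d.
    have -> : (fun y => (g2 y 0 j - g1 y 0 j) * (g2 y 0 j - g1 y 0 j)) = (fun s => (g2 s 0 j - g1 s 0 j) ^+ 2).
      by rewrite funeqE => y; rewrite expr2.
    by congr (is_derive _ _ _ _); ring.
  have -> : E = \sum_j (fun s => (g2 s 0 j - g1 s 0 j) ^+ 2).
    by rewrite funeqE => y; rewrite fct_sumE.
  exact: (is_derive_sum (fun j => Dj j)).
have bd s : 0 <= s <= t -> dE s <= (2 * n%:R * L) * E s.
  move=> st; rewrite /dE.
  apply: le_trans (_ : \sum_(j < n) (2 * L * E s) <= _).
    apply: ler_sum => j _; apply: le_trans (ler_norm _) _.
    rewrite !normrM (ger0_norm (ler0n _ 2)) -!mulrA ler_pM2l // mulrC.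
    have h1 := coord_le_norm (g2 s - g1 s) j; rewrite !mxE in h1.
    have h2 := coord_le_norm (W (g2 s) - W (g1 s)) j; rewrite !mxE in h2.
    apply: le_trans (ler_pM (normr_ge0 _) (normr_ge0 _) h2 h1) _.
    apply: le_trans (ler_wpM2r (normr_ge0 _) (HW _ _)) _.
    by rewrite -mulrA -expr2 ler_wpM2l.
  by rewrite sum_const_ord !mulrA [n%:R * 2]mulrC.
apply: le_trans (E0 t) _.
apply: le_trans (gronwall t0 dEs bd) _.
apply: le_trans (ler_wpM2l (expR_ge0 _) (En 0)) _.
by rewrite le_eqVlt; apply/orP; left; apply/eqP; set u := expR _; ring.
Qed.

(** Picard iteration on the whole line at once: increments are measured against an exponential
    weight, so neither short time intervals nor gluing are required. The bound on [W] starts the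
    iteration. *)
Lemma ode_exists (W : rV -> rV) (L C : R) (x : rV) : 0 < L -> 0 <= C ->
  (forall x y, `|W y - W x| <= L * `|y - x|) -> (forall x, `|W x| <= C) ->
  exists g : R -> rV, g 0 = x /\ forall t, is_derive t (1 : R) g (W (g t)).
Proof.
move=> L0 C0 HW HC.
have Wc y : {for y, continuous W}.
  apply/(@cont_distP R rV rV) => e e0.
  apply: (@ball_nearP R rV _ y (e / L)); first by rewrite divr_gt0.
  by move=> z Hz; apply: le_lt_trans (HW z y) _; rewrite mulrC -ltr_pdivlMr.
(* The Picard operator is chosen on all maps; its value on a discontinuous one is irrelevant. *)
have ex (g : R -> rV) : exists G : R -> rV, (continuous g ->
    G 0 = x /\ forall t, is_derive t (1 : R) G (W (g t))).
  have [cg|ncg] := pselect (continuous g); last by exists (fun=> 0).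
  have [|G [G0 HG]] := @antiderivative_row (fun t => W (g t)).
    by move=> t; exact: (@continuous_comp R rV rV g W t (cg t) (Wc _)).
  exists (fun t => x + G t); split; first by rewrite G0 addr0.
  move=> t; have := is_deriveD_ (is_derive_cst x t 1) (HG t).
  by rewrite add0r.
have [I HI] := choice ex.
pose g k := iter k I (fun=> x).
have gc k : continuous (g k).
  elim: k => [|k IH]; first by move=> t; exact: cvg_cst.
  by move=> t; apply: is_derive_continuous ((HI _ IH).2 t).
have g0 k : g k 0 = x by case: k => [|k] //; exact: (HI _ (gc k)).1.
have gD k t : is_derive t (1 : R) (g k.+1) (W (g k t)) := (HI _ (gc k)).2 t.
(* Relative to this weight the Picard operator contracts by 1/2: the primitive of [L * ex2] is
   [ex2 / 2]. *)
pose ex2 (s : R) : R := expR (2 * L * s).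
have dex (c s : R) : is_derive s (1 : R) (fun s => c / (2 * L) * ex2 s) (c * ex2 s).
  have h1 := @is_derive_lin _ _ (@expR R) (2 * L) 0 s _ (is_derive_expR _).
  have h2 : is_derive s (1 : R) ex2 (2 * L * ex2 s).
    have E : (fun y : R => expR (2 * L * y + 0)) = ex2 by rewrite funeqE => y; rewrite addr0.
    by rewrite E addr0 in h1.
  have := is_deriveM_ (is_derive_cst (c / (2 * L)) s 1) h2.
  rewrite mulr0 addr0; congr (is_derive _ _ _ _).
  by rewrite /cst; field; rewrite gt_eqF.
have cmp (u du : R -> R) (c t : R) : 0 <= c -> (forall s, is_derive s (1 : R) u (du s)) ->
    (forall s, `|du s| <= c * ex2 `|s|) -> `|u t - u 0| <= c / (2 * L) * ex2 `|t|.
  move=> c0 Hu Hb.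
  apply: le_trans (@derive_norm_le R u du (fun s => c / (2 * L) * ex2 s) (fun s => c * ex2 s) t _ _ _) _ => //.
  by rewrite gerBl mulr_ge0 ?expR_ge0 // divr_ge0 // mulr_ge0 // ltW.
have ex2ge1 t : 1 <= ex2 `|t|.
  by rewrite -expR0 ler_expR !mulr_ge0 // ltW.
pose B0 := C / (2 * L).
have B0p : 0 <= B0 by rewrite divr_ge0 // mulr_ge0 // ltW.
have Bk k : 0 <= B0 * 2^-1 ^+ k := mulr_ge0 B0p (half_ge0 k).
have Be k t : 0 <= B0 * 2^-1 ^+ k * ex2 t := mulr_ge0 (Bk k) (expR_ge0 _).
have B2e k t : 0 <= 2 * B0 * 2^-1 ^+ k * ex2 t.
  by have := mulr_ge0 (ler0n R 2) (Be k t); rewrite !mulrA.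
have LB k : 0 <= L * (B0 * 2^-1 ^+ k) := mulr_ge0 (ltW L0) (Bk k).
have LB2 k : 0 <= L * (2 * B0 * 2^-1 ^+ k).
  apply: mulr_ge0 (ltW L0) _.
  by have := mulr_ge0 (ler0n R 2) (Bk k); rewrite !mulrA.
have incr k t : `|g k.+1 t - g k t| <= B0 * 2^-1 ^+ k * ex2 `|t|.
  elim: k t => [|k IH] t.
    rewrite expr0 mulr1 /=; apply: norm_leP => [|j]; first by rewrite mulr_ge0 ?expR_ge0.
    rewrite !mxE.
    have -> : x 0 j = g 1%N 0 0 j by rewrite g0.
    apply: (cmp (fun t => g 1%N t 0 j) (fun t => W (g 0%N t) 0 j)) => //.
      by move=> s; have /is_derive_rowP := gD 0%N s; apply.
    move=> s; apply: le_trans (coord_le_norm _ _) _.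
    by apply: le_trans (HC _) _; rewrite ler_peMr.
  apply: norm_leP => [|j]; first exact: Be.
  rewrite !mxE.
  have -> : g k.+2 t 0 j - g k.+1 t 0 j = (g k.+2 t 0 j - g k.+1 t 0 j) - (g k.+2 0 0 j - g k.+1 0 0 j).
    by rewrite !g0 subrr subr0.
  have c0 := LB k.
  have -> : B0 * 2^-1 ^+ k.+1 = L * (B0 * 2^-1 ^+ k) / (2 * L).
    by rewrite exprS; field; rewrite gt_eqF.
  apply: (cmp (fun t => g k.+2 t 0 j - g k.+1 t 0 j) (fun t => W (g k.+1 t) 0 j - W (g k t) 0 j)) => //.
    move=> s; have /is_derive_rowP /(_ j) d1 := gD k.+1 s; have /is_derive_rowP /(_ j) d2 := gD k s.
    exact: is_deriveB_.
  move=> s; have := coord_le_norm (W (g k.+1 s) - W (g k s)) j; rewrite !mxE => h.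
  apply: le_trans h _; apply: le_trans (HW _ _) _.
  by rewrite -mulrA ler_pM2l.
have lim (tj : R * 'I_n) : exists l, forall k, `|l - g k tj.1 0 tj.2| <= 2 * (B0 * ex2 `|tj.1|) * 2^-1 ^+ k.
  apply: geometric_limit; first by rewrite mulr_ge0 ?expR_ge0.
  move=> k; have := coord_le_norm (g k.+1 tj.1 - g k tj.1) tj.2; rewrite !mxE => h.
  by apply: le_trans h _; apply: le_trans (incr k tj.1) _; rewrite mulrAC.
have [l Hl] := choice lim.
pose gam t : rV := \row_j l (t, j).
have Hg k t : `|gam t - g k t| <= 2 * B0 * 2^-1 ^+ k * ex2 `|t|.
  apply: norm_leP => [|j]; first exact: B2e.
  rewrite !mxE; apply: le_trans (Hl (t, j) k) _ => /=.
  by rewrite le_eqVlt; apply/orP; left; apply/eqP; ring.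
have half (e c : R) : 0 < e -> 0 <= c -> exists k, c * 2^-1 ^+ k < e.
  move=> e0 c0.
  have [k Hk] : exists k : nat, c / e < k%:R.
    by exists (Num.bound (c / e)); apply: archi_boundP; rewrite divr_ge0 // ltW.
  exists k; rewrite exprVn ltr_pdivrMr ?exprn_gt0 //.
  rewrite ltr_pdivrMr // in Hk; apply: lt_le_trans Hk _.
  by rewrite mulrC ler_pM2l // -natrX ler_nat ltnW // ltn_expl.
have glip k s t : `|g k t - g k s| <= C * `|t - s|.
  case: k => [|k]; first by rewrite /= subrr normr0 mulr_ge0.
  have := @derive_row_lip (fun r => g k.+1 (1 * r + s)) (fun r => 1 *: W (g k (1 * r + s))) C (t - s) C0.
  rewrite mulr0 add0r mul1r subrK; apply.
    by move=> r _; apply: is_derive_lin; exact: gD.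
  by move=> r _; rewrite scale1r.
have gamlip s t : `|gam t - gam s| <= C * `|t - s|.
  apply/ler_addgt0Pl => e e0.
  have p0 : 0 < ex2 `|t| + ex2 `|s| by rewrite addr_gt0 ?expR_gt0.
  have [k Hk] := half _ _ (divr_gt0 e0 p0) (mulr_ge0 (ler0n _ 2) B0p).
  rewrite ltr_pdivlMr // mulrDr in Hk.
  have h1 := Hg k t; have h2 := Hg k s; have h3 := glip k s t.
  have -> : gam t - gam s = (gam t - g k t) - (gam s - g k s) + (g k t - g k s).
    by apply/rowP => i; rewrite !mxE; ring.
  apply: le_trans (ler_normD _ _) _; have := ler_normB (gam t - g k t) (gam s - g k s).
  by move=> h4; lra.
have gamc : continuous gam.
  move=> t; apply/(@cont_distP R R rV) => e e0.
  apply: (@ball_nearP R R^o _ t (e / (C + 1))); first by rewrite divr_gt0 // ltr_wpDl.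
  move=> s; rewrite ltr_pdivlMr ?ltr_wpDl // => Hs; apply: le_lt_trans (gamlip s t) _.
  apply: le_lt_trans Hs; by rewrite mulrC ler_wpM2l // lerDl.
have [J0 JD] := HI _ gamc.
(* Both sides are within [B0 * 2^-1 ^+ k * ex2 |t|] of [g k.+1 t], for every [k]. *)
have IE t : I gam t = gam t.
  apply/eqP; rewrite -subr_eq0 -normr_le0; apply/ler_addgt0Pl => e e0; rewrite addr0.
  have p0 : 0 < ex2 `|t| by rewrite expR_gt0.
  have [k Hk] := half _ _ (divr_gt0 e0 p0) (mulr_ge0 (ler0n _ 4) B0p).
  rewrite ltr_pdivlMr // in Hk.
  have h1 : `|I gam t - g k.+1 t| <= B0 * 2^-1 ^+ k * ex2 `|t|.
    apply: norm_leP => [|j]; first exact: Be.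
    rewrite !mxE.
    have -> : I gam t 0 j - g k.+1 t 0 j = (I gam t 0 j - g k.+1 t 0 j) - (I gam 0 0 j - g k.+1 0 0 j).
      by rewrite !g0 J0 subrr subr0.
    have c0 := LB2 k.
    have -> : B0 * 2^-1 ^+ k = L * (2 * B0 * 2^-1 ^+ k) / (2 * L) by field; rewrite gt_eqF.
    apply: (cmp (fun t => I gam t 0 j - g k.+1 t 0 j) (fun t => W (gam t) 0 j - W (g k t) 0 j)) => //.
      move=> s; have /is_derive_rowP /(_ j) d1 := JD s; have /is_derive_rowP /(_ j) d2 := gD k s.
      exact: is_deriveB_.
    move=> s; have := coord_le_norm (W (gam s) - W (g k s)) j; rewrite !mxE => h.
    apply: le_trans h _; apply: le_trans (HW _ _) _.
    by rewrite -mulrA ler_pM2l.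
  have h2 := Hg k.+1 t; rewrite exprS in h2.
  have -> : I gam t - gam t = (I gam t - g k.+1 t) - (gam t - g k.+1 t).
    by apply/rowP => i; rewrite !mxE; ring.
  apply: le_trans (ler_normB _ _) _.
  set q := 2^-1 ^+ k * ex2 `|t|.
  have e1 : B0 * 2^-1 ^+ k * ex2 `|t| = B0 * q by rewrite mulrA.
  have e2 : 2 * B0 * (2^-1 * 2^-1 ^+ k) * ex2 `|t| = B0 * q by rewrite /q; field.
  have e3 : 4 * B0 * 2^-1 ^+ k * ex2 `|t| = 4 * (B0 * q) by rewrite /q; ring.
  rewrite e1 in h1; rewrite e2 in h2; rewrite e3 in Hk.
  have q0 : 0 <= B0 * q by rewrite -e1.
  by lra.
have IEf : I gam = gam by rewrite funeqE.
by exists gam; split; [rewrite -IEf|move=> t; rewrite -{1}IEf].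
Qed.

(** Uniqueness is Gronwall's inequality with equal initial values, and the group law follows from
    it. In the final estimate only one of the two times is bounded: the difference is split at
    [Phi s y], and the variation in time is controlled by the supremum of the field. *)
Theorem flow_exists (W : rV -> rV) : (forall j, csupp (fun x => W x 0 j)) ->
  (forall x j, smo (fun x => W x 0 j) x) ->
  exists Phi : R -> rV -> rV,
  [/\ forall x, Phi 0 x = x,
      forall t x, is_derive t (1 : R) (Phi^~ x) (W (Phi t x)),
      forall s t x, Phi (s + t) x = Phi s (Phi t x),
      forall (g : R -> rV) t, (forall s, `|s| <= `|t| -> is_derive s (1 : R) g (W (g s))) ->
        g t = Phi t (g 0) &
      forall T, exists2 K : R, 0 < K & forall s t x y, `|s| <= T ->
         `|Phi t y - Phi s x| <= K * (`|t - s| + `|y - x|)].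
Proof.
move=> cW sW.
have [[L L0 HL] [C C0 HC]] := csupp_lip_row cW sW.
have L1 : 0 < L + 1 by rewrite ltr_wpDl.
have HL1 x y : `|W y - W x| <= (L + 1) * `|y - x|.
  by apply: le_trans (HL x y) _; rewrite ler_wpM2r // lerDl.
have ex x := @ode_exists W (L + 1) C x L1 C0 HL1 HC.
have [P HP] := choice ex.
have uniq (g : R -> rV) t : (forall s, `|s| <= `|t| -> is_derive s (1 : R) g (W (g s))) ->
    g t = P (g 0) t.
  move=> Hg; have := @ode_gronwall W L (P (g 0)) g t L0 HL (fun s _ => (HP (g 0)).2 s) Hg.
  rewrite (HP _).1 subrr normr0 expr0n mulr0 => h.
  apply/eqP; rewrite -subr_eq0 -normr_eq0 -sqrf_eq0 eq_le h /=.
  by rewrite sqr_ge0.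
exists (fun t x => P x t); split.
- by move=> x; exact: (HP x).1.
- by move=> t x; exact: (HP x).2.
- move=> s t x.
  have := @uniq (fun r => P x (1 * r + t)) s; rewrite mulr0 add0r mul1r; apply.
  move=> r _; have := @is_derive_lin R rV (P x) 1 t r _ ((HP x).2 (1 * r + t)).
  by rewrite scale1r.
- exact: uniq.
move=> T.
pose K := Num.sqrt (n%:R * expR (2 * n%:R * L * T)).
exists (K + C + 1); first by rewrite ltr_wpDl // addr_ge0 // sqrtr_ge0.
move=> s t x y sT.
have K0 : 0 <= K by rewrite sqrtr_ge0.
have T0 : 0 <= T by exact: le_trans sT.
have h1 : `|P y s - P x s| <= K * `|y - x|.
  have := @ode_gronwall W L (P x) (P y) s L0 HL (fun r _ => (HP x).2 r) (fun r _ => (HP y).2 r).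
  rewrite !(HP _).1 => h.
  have h' : `|P y s - P x s| ^+ 2 <= (K * `|y - x|) ^+ 2.
    apply: le_trans h _; rewrite exprMn ler_wpM2r ?sqr_ge0 //.
    rewrite sqr_sqrtr ?mulr_ge0 ?expR_ge0 // ler_wpM2l // ler_expR.
    by rewrite ler_wpM2l // !mulr_ge0.
  by move: h'; rewrite ler_sqr ?nnegrE ?mulr_ge0.
have h2 : `|P y t - P y s| <= C * `|t - s|.
  have := @derive_row_lip (fun r => P y (1 * r + s)) (fun r => 1 *: W (P y (1 * r + s))) C (t - s) C0.
  rewrite mulr0 add0r mul1r subrK; apply.
    by move=> r _; apply: is_derive_lin; exact: (HP y).2.
  by move=> r _; rewrite scale1r.
have -> : P y t - P x s = (P y t - P y s) + (P y s - P x s).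
  by apply/rowP => i; rewrite !mxE; ring.
apply: le_trans (ler_normD _ _) _.
have a0 : 0 <= `|t - s| by []. have b0 : 0 <= `|y - x| by [].
have := mulr_ge0 K0 a0; have := mulr_ge0 C0 b0.
by move=> h3 h4; lra.
Qed.

End Picard.

(** * Euclidean inner product and bump functions *)

Section Dot.
Context {R : realType} {n : nat}.
Local Notation rV := 'rV[R]_n.
Implicit Types u v : rV.

Definition dot u v : R := \sum_i u 0 i * v 0 i.

Lemma dotC u v : dot u v = dot v u.
Proof. by apply: eq_bigr => i _; rewrite mulrC. Qed.

Lemma dotDl u v w : dot (u + v) w = dot u w + dot v w.
Proof. by rewrite /dot -big_split; apply: eq_bigr => i _; rewrite mxE mulrDl. Qed.

Lemma dotZl a u v : dot (a *: u) v = a * dot u v.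
Proof. by rewrite /dot mulr_sumr; apply: eq_bigr => i _; rewrite mxE mulrA. Qed.

Lemma dotDr u v w : dot u (v + w) = dot u v + dot u w.
Proof. by rewrite !(dotC u) dotDl. Qed.

Lemma dotZr a u v : dot u (a *: v) = a * dot u v.
Proof. by rewrite !(dotC u) dotZl. Qed.

Lemma dot0l v : dot 0 v = 0.
Proof. by rewrite -(scale0r v) dotZl mul0r. Qed.

Lemma dot0r v : dot v 0 = 0.
Proof. by rewrite dotC dot0l. Qed.

Lemma dotNl u v : dot (- u) v = - dot u v.
Proof. by rewrite -scaleN1r dotZl mulN1r. Qed.

Lemma dotNr u v : dot u (- v) = - dot u v.
Proof. by rewrite dotC dotNl dotC. Qed.

Lemma dot_ge0 u : 0 <= dot u u.
Proof. by apply: sumr_ge0 => i _; rewrite -expr2 sqr_ge0. Qed.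

Lemma dot_eq0 u : (dot u u == 0) = (u == 0).
Proof.
apply/idP/idP => [|/eqP ->]; last by rewrite dot0l.
rewrite psumr_eq0; last by move=> i _; rewrite -expr2 sqr_ge0.
move=> /allP H; apply/eqP/rowP => i; rewrite mxE.
by have := H i (mem_index_enum i); rewrite -expr2 sqrf_eq0 => /eqP.
Qed.

Lemma dot_gt0 u : (0 < dot u u) = (u != 0).
Proof. by rewrite lt_neqAle dot_ge0 andbT eq_sym dot_eq0. Qed.

Lemma dot_mulmx u v : u *m v^T = (dot u v)%:M.
Proof. by apply/matrixP => i j; rewrite !ord1 !mxE eqxx mulr1n; apply: eq_bigr => k _; rewrite mxE. Qed.

Lemma cauchy_schwarz u v : dot u v ^+ 2 <= dot u u * dot v v.
Proof.
have [->|v0] := eqVneq v 0; first by rewrite !dot0r expr0n mulr0.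
have vp : 0 < dot v v by rewrite dot_gt0.
have := dot_ge0 (dot v v *: u - dot u v *: v).
have -> : dot (dot v v *: u - dot u v *: v) (dot v v *: u - dot u v *: v) =
    dot v v * (dot u u * dot v v - dot u v ^+ 2).
  by rewrite !(dotDl, dotDr, dotNl, dotNr, dotZl, dotZr) (dotC v u); ring.
by rewrite pmulr_rge0 // subr_ge0.
Qed.

Lemma sm_dot (V : normedModType R) (f g : V -> rV) x :
  smv f x -> smv g x -> sm (fun y => dot (f y) (g y)) x.
Proof. by move=> sf sg; apply: sm_sum => i _; apply: smM. Qed.

Lemma derive_rowE (V : normedModType R) (f : V -> rV) (x v : V) j : differentiable f x ->
  'D_v (fun y => f y 0 j) x = 'D_v f x 0 j.
Proof. by move=> df; rewrite derive_row. Qed.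

Lemma deriveM_ (V : normedModType R) (f g : V -> R) (x v : V) :
  differentiable f x -> differentiable g x ->
  'D_v (fun y => f y * g y) x = 'D_v f x * g x + f x * 'D_v g x.
Proof.
move=> df dg; rewrite -[LHS]/('D_v (f * g) x) deriveM; try exact: diff_derivable.
by rewrite -![_ *: _]/(_ * _) addrC mulrC.
Qed.

Lemma deriveD_ (V W : normedModType R) (f g : V -> W) (x v : V) :
  differentiable f x -> differentiable g x ->
  'D_v (fun y => f y + g y) x = 'D_v f x + 'D_v g x.
Proof. by move=> df dg; rewrite -[LHS]/('D_v (f + g) x) deriveD //; apply: diff_derivable. Qed.

Lemma derive_cst_ (V W : normedModType R) (c : W) (x v : V) : 'D_v (fun _ : V => c) x = 0.
Proof. exact: derive_cst. Qed.

Lemma deriveV_ (V : normedModType R) (f : V -> R) (x v : V) :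
  differentiable f x -> f x != 0 -> 'D_v (fun y => (f y)^-1) x = - (f x)^-2 * 'D_v f x.
Proof. by move=> df f0; rewrite deriveV //; apply: diff_derivable. Qed.

Lemma derive_scale (V : normedModType R) (c : V -> R) (f : V -> rV) (x v : V) :
  differentiable c x -> differentiable f x ->
  differentiable (fun y => c y *: f y) x /\
  'D_v (fun y => c y *: f y) x = 'D_v c x *: f x + c x *: 'D_v f x.
Proof.
move=> dc df.
have E j : (fun y => (c y *: f y) 0 j) = (fun y => c y * f y 0 j).
  by rewrite funeqE => y; rewrite mxE.
have dd : differentiable (fun y => c y *: f y) x.
  apply: differentiable_rowP => j; rewrite E.
  by apply: (@differentiableM _ _ c (fun y => f y 0 j)) => //; exact: differentiable_row.
split=> //; apply/rowP => j; rewrite derive_row // E deriveM_ //; last exact: differentiable_row.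
by rewrite derive_rowE // !mxE.
Qed.

Lemma derive_dot (V : normedModType R) (f g : V -> rV) (x v : V) :
  differentiable f x -> differentiable g x ->
  'D_v (fun y => dot (f y) (g y)) x = dot ('D_v f x) (g x) + dot (f x) ('D_v g x).
Proof.
move=> df dg.
have -> : (fun y => dot (f y) (g y)) = \sum_i (fun y => f y 0 i * g y 0 i).
  by rewrite funeqE => y; rewrite fct_sumE.
have dj j : differentiable (fun y => f y 0 j * g y 0 j) x.
  by apply: (@differentiableM _ _ (fun y => f y 0 j) (fun y => g y 0 j)); exact: differentiable_row.
rewrite derive_sum; last by move=> i; apply: diff_derivable.
rewrite /dot -big_split; apply: eq_bigr => i _ /=.
by rewrite deriveM_ ?derive_rowE //; exact: differentiable_row.
Qed.

End Dot.

Section Bump.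
Context {R : realType} {n : nat}.
Local Notation rV := 'rV[R]_n.

(** The sup norm is not smooth, so the cut-off is a function of the Euclidean square; a point at sup
    distance at least [r] has Euclidean distance at least [r], one coordinate being already that
    large. *)
Lemma bump_exists (z0 : rV) (r : R) : 0 < r -> exists chi : rV -> R,
  [/\ forall z, smo chi z, forall z, 0 <= chi z, \forall z \near z0, chi z = 1 &
      forall z, r <= `|z0 - z| -> chi z = 0].
Proof.
move=> r0; pose q (z : rV) := dot (z - z0) (z - z0).
have sq z : sm q z by apply: sm_dot; apply: smvB; [exact: smv_id|exact: smv_cst|exact: smv_id|exact: smv_cst].
(* Equal to 2 at the centre, so at least 1 nearby, and at most 0 from Euclidean distance [r] on. *)
pose arg (z : rV) := 2 - 2 / r ^+ 2 * q z.
have sa z : sm arg z by apply: smB; [exact: sm_cst|apply: smM; [exact: sm_cst|]].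
exists (fun z => step (arg z)); split.
- by move=> z; apply: sm_smo; apply: sm_comp1 => //; exact: sm_step.
- by move=> z; exact: step_ge0.
- have a0 : 0 < arg z0 - 1 by rewrite /arg /q subrr dot0l mulr0 subr0; lra.
  have c : {for z0, continuous (fun z => arg z - 1)}.
    by apply: sm_continuous; apply: smB => //; exact: sm_cst.
  by apply: filterS (near_gt0 c a0) => z h; rewrite step_ge1 //; lra.
- move=> z hz; rewrite step_le0 // /arg subr_le0.
  have r2 : 0 < r ^+ 2 by rewrite exprn_gt0.
  rewrite mulrAC ler_pdivlMr // ler_pM2l //.
  have [i Hi] : exists i, r <= `|(z - z0) 0 i|.
    apply: contrapT => /forallNP H.
    suff : `|z - z0| < r by rewrite distrC ltNge hz.
    have [n0|] := posnP n; first by subst n; rewrite thinmx0 normr0.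
    rewrite [X in X < _]/Num.Def.normr /= mx_normrE => n0; apply: bigmax_lt => // -[a i] _ /=.
    by rewrite ord1 ltNge; apply/negP; exact: H.
  rewrite /q /dot (bigD1 i) //= -expr2.
  apply: (@le_trans _ _ ((z - z0) 0 i ^+ 2)).
    by rewrite -[leRHS]real_normK ?num_real // lerXn2r ?nnegrE // ltW.
  by rewrite lerDl; apply: sumr_ge0 => j _; rewrite -expr2 sqr_ge0.
Qed.

Lemma bump_mul (chi k : rV -> R) (z0 : rV) (r r' : R) : r < r' ->
  (forall z, smo chi z) -> (forall z, r <= `|z0 - z| -> chi z = 0) ->
  (forall z, `|z0 - z| < r' -> sm k z) -> forall z, smo (fun z => chi z * k z) z.
Proof.
move=> rr sc c0 sk z.
have [h|h] := ltP `|z0 - z| r'.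
  by apply: sm_smo; apply: smM; [exact: sm_T|exact: sk].
apply: (@smo_eq R rV (fun=> 0)); last by move=> m; exact: (@Cn_cst R rV m 0).
apply: (@ball_nearP R rV _ z (r' - r)); first by rewrite subr_gt0.
move=> y hy; rewrite c0 ?mul0r //.
have := lerB_dist (z0 - z) (y - z); rewrite opprB addrA subrK (distrC y z).
by move=> h2; lra.
Qed.

Lemma csupp_bump (chi k : rV -> R) (z0 : rV) (r : R) :
  (forall z, r <= `|z0 - z| -> chi z = 0) -> csupp (fun z => chi z * k z).
Proof.
move=> c0; exists (`|z0| + r) => z hz; rewrite c0 ?mul0r //.
by have := lerB_dist z z0; rewrite distrC => h; lra.
Qed.

End Bump.

(** * The kernel field of F / |F| *)

Section Field.
Context {R : realType} {n : nat}.
Local Notation rV := 'rV[R]_n.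
Implicit Types F : rV -> rV.

(** The rank condition: the rows of [jac F x] are the partial derivatives, and only 0 is orthogonal
    to all of them and to [F x]. *)
Definition reg F (x : rV) := forall v : rV, v *m (F x)^T = 0 -> v *m (jac F x)^T = 0 -> v = 0.

(* Where F != 0 and F is regular, this field spans the kernel of the differential
   of F / |F|; unlike a normalized generator of the kernel it is smooth at the
   zeros of F, and it vanishes exactly there. *)
Definition fld F (x : rV) : rV := F x *m \adj (jac F x).

Lemma fld_jac F x : fld F x *m jac F x = \det (jac F x) *: F x.
Proof. by rewrite /fld -mulmxA mul_adj_mx mul_mx_scalar. Qed.

(** Regularity means that the matrix with rows [F x] and the partial derivatives has rank [n];
    having [n + 1] rows, it has a line as left kernel. *)
Lemma left_ker F x (p q : 'rV[R]_(1 + n)) : reg F x -> p != 0 ->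
  p *m col_mx (F x) (jac F x) = 0 -> q *m col_mx (F x) (jac F x) = 0 ->
  exists c, q = c *: p.
Proof.
move=> rg p0 pN qN; set N := col_mx _ _ in pN qN.
have rN : \rank N = n.
  rewrite -mxrank_tr; apply/eqP; rewrite -[_ == n]/(row_free N^T) -kermx_eq0.
  apply/eqP/row_matrixP => i; rewrite row0.
  have := mulmx_ker N^T => /(congr1 (row i)); rewrite row_mul row0.
  rewrite /N tr_col_mx mul_mx_row => E.
  by apply: rg; [have := congr1 lsubmx E|have := congr1 rsubmx E];
    rewrite ?row_mxKl ?row_mxKr /= => ->; apply/matrixP => a b; rewrite !mxE.
have rk : \rank (kermx N) = 1%N by rewrite mxrank_ker rN addnK.
have pk : (p <= kermx N)%MS by apply/sub_kermxP.
have qk : (q <= kermx N)%MS by apply/sub_kermxP.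
have rp : \rank p = 1%N by rewrite rank_rV p0.
have kp : (kermx N <= p)%MS by have := mxrank_leqif_sup pk => -[_ <-]; rewrite rp rk.
by apply/sub_rVP; exact: submx_trans kp.
Qed.

(** Cramer's rule in the row convention. This form decides where the field vanishes and how it
    changes under a reflection of the target. *)
Lemma fld_row F x i :
  fld F x 0 i = \det (\matrix_(a, b) if a == i then F x 0 b else jac F x a b).
Proof.
rewrite mxE (expand_det_row _ i); apply: eq_bigr => k _; rewrite !mxE eqxx; congr (_ * _).
rewrite /cofactor; congr (_ * \det _).
apply/matrixP => a b; rewrite !mxE (negbTE (_ : lift i a != i)) //.
by rewrite eq_sym neq_lift.
Qed.

(** If the field vanished, so would the determinant, and a kernel vector [h0] of the Jacobian would
    give the kernel element [(0, h0)] of [left_ker]. For [i] with [h0 0 i] nonzero, the vanishing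
    Cramer determinant gives a second kernel element whose vector part has coordinate [i] equal to
    0. Proportionality of the two then forces it to be zero. *)
Lemma fld_neq0 F x : reg F x -> F x != 0 -> fld F x != 0.
Proof.
move=> rg F0; apply/eqP => w0.
have d0 : \det (jac F x) = 0.
  have := fld_jac F x; rewrite w0 mul0mx => /esym/eqP.
  by rewrite scaler_eq0 (negbTE F0) orbF => /eqP.
have /eqP/det0P [h0 h0n h0J] := d0.
have [i hi] : exists i, h0 0 i != 0.
  apply: contrapT => /forallNP H; move/eqP: h0n; apply; apply/rowP => i.
  by rewrite mxE; apply/eqP; have /negP := H i; rewrite negbK.
have := fld_row F x i; rewrite w0 mxE => /esym/eqP/det0P [h' h'n h'J].
pose p : 'rV[R]_(1 + n) := row_mx 0 h0.
pose q : 'rV[R]_(1 + n) := row_mx (h' 0 i)%:M (h' - h' 0 i *: delta_mx 0 i).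
have [||| c] := @left_ker F x p q rg.
- apply/eqP => p0; move/eqP: h0n; apply.
  by have := congr1 rsubmx p0; rewrite /p row_mxKr => ->; apply/matrixP => a b; rewrite !mxE.
- by rewrite mul_row_col mul0mx add0r.
- rewrite mul_row_col mul_scalar_mx mulmxBl -scalemxAl -rowE -h'J.
  apply/rowP => j; rewrite !mxE [in RHS](bigD1 i) //= [in X in _ + (X - _)](bigD1 i) //=.
  rewrite !mxE eqxx addrAC addrA [X in _ = _ + X](eq_bigr (fun k => h' 0 k * jac F x k j)).
    by rewrite subrr addr0.
  by move=> k ki; rewrite !mxE (negbTE ki).
move=> E.
have hi0 : h' 0 i = 0.
  have := congr1 lsubmx E; rewrite /q /p scale_row_mx !row_mxKl scaler0 => /matrixP /(_ 0 0).
  by rewrite !mxE eqxx mulr1n.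
have := congr1 rsubmx E; rewrite /q /p scale_row_mx !row_mxKr hi0 scale0r subr0 => E2.
have : h' 0 i = c * h0 0 i by rewrite E2 mxE.
rewrite hi0 => /esym/eqP; rewrite mulf_eq0 (negbTE hi) orbF => /eqP c0.
by move: h'n; rewrite E2 c0 scale0r eqxx.
Qed.

(** [(- det, fld)] and [(- mu, h)] both lie in the line of [left_ker], and the first one is not
    zero. *)
Lemma fld_span F x (h : rV) mu : reg F x -> F x != 0 -> h *m jac F x = mu *: F x ->
  exists c, h = c *: fld F x.
Proof.
move=> rg F0 hJ.
pose p : 'rV[R]_(1 + n) := row_mx (- \det (jac F x))%:M (fld F x).
pose q : 'rV[R]_(1 + n) := row_mx (- mu)%:M h.
have [||| c] := @left_ker F x p q rg.
- apply/eqP => p0; have /eqP := fld_neq0 rg F0; apply.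
  by have := congr1 rsubmx p0; rewrite /p row_mxKr => ->; apply/matrixP => a b; rewrite !mxE.
- by rewrite mul_row_col mul_scalar_mx fld_jac scaleNr addNr.
- by rewrite mul_row_col mul_scalar_mx hJ scaleNr addNr.
move=> E; exists c.
by have := congr1 rsubmx E; rewrite /q /p scale_row_mx !row_mxKr.
Qed.

Lemma sm_fld F x : smv F x -> smv (fld F) x.
Proof.
move=> sF i.
apply: sm_eq (sm_sum (index_enum _) (P := xpredT) (F := fun k y => F y 0 k * \adj (jac F y) k i) _).
  by near=> y; rewrite [RHS]mxE.
move=> k _; apply: smM; first exact: sF.
by apply: sm_adj => a b; exact: sm_jac.
Unshelve. all: by end_near. Qed.

Lemma fld0 F x : F x = 0 -> fld F x = 0.
Proof. by move=> F0; rewrite /fld F0 mul0mx. Qed.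

Lemma unit_kernel (M : 'M[R]_n) : (forall h : rV, h *m M = 0 -> h = 0) -> \det M != 0.
Proof.
move=> H; apply/negP => /det0P [h hn hM]; move/eqP: hn; apply; exact: H.
Qed.

(* F / <F, y0> is constant along the field, so together with a function
   transverse to the field it gives a chart straightening the field. *)
Definition chart F (y0 : rV) (s : rV -> R) (x : rV) : rV :=
  (dot (F x) y0)^-1 *: F x + s x *: y0.

Lemma sm_chart F y0 s x : smv F x -> sm s x -> dot (F x) y0 != 0 -> smv (chart F y0 s) x.
Proof.
move=> sF ss d0; apply: smvD; apply: smvZ => //; last exact: smv_cst.
by apply: smV => //; apply: sm_dot => //; exact: smv_cst.
Qed.

Lemma chart_derive F y0 s x h : smv F x -> sm s x -> dot (F x) y0 != 0 ->
  'D_h (chart F y0 s) x =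
    (- (dot (F x) y0)^-2 * dot ('D_h F x) y0) *: F x + (dot (F x) y0)^-1 *: 'D_h F x + 'D_h s x *: y0.
Proof.
move=> sF ss d0.
have dF := smv_differentiable sF; have ds := sm_differentiable ss.
have sl : sm (fun y => dot (F y) y0) x by apply: sm_dot => //; exact: smv_cst.
have dl := sm_differentiable sl.
have dli : differentiable (fun y => (dot (F y) y0)^-1) x by apply: sm_differentiable; exact: smV.
have dy : differentiable (fun _ : rV => y0) x by exact: differentiable_cst.
have [d1 E1] := derive_scale h dli dF; have [d2 E2] := derive_scale h ds dy.
rewrite /chart deriveD_ // E1 E2 derive_cst_ scaler0 addr0; congr (_ *: _ + _ + _).
by rewrite deriveV_ // derive_dot // derive_cst_ dot0r addr0.
Qed.

Lemma chart_fld F y0 s x : smv F x -> sm s x -> dot (F x) y0 != 0 ->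
  'D_(fld F x) (chart F y0 s) x = 'D_(fld F x) s x *: y0.
Proof.
move=> sF ss d0; rewrite chart_derive // jacE ?fld_jac; last exact: smv_differentiable.
rewrite dotZl scalerA -[X in X + _ = _]scalerDl.
have -> : - dot (F x) y0 ^- 2 * (\det (jac F x) * dot (F x) y0) + (dot (F x) y0)^-1 * \det (jac F x) = 0.
  by field.
by rewrite scale0r add0r.
Qed.

(** For [h] in the kernel, pairing with [y0] isolates ['D_h s x = 0], as the first summand of the
    chart has constant pairing 1. What remains says that [F] changes radially along [h], so [h] is a
    multiple of the field, along which [s] does vary. *)
Lemma chart_unit F y0 s x : smv F x -> sm s x -> dot (F x) y0 != 0 -> reg F x ->
  'D_(fld F x) s x != 0 -> \det (jac (chart F y0 s) x) != 0.
Proof.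
move=> sF ss d0 rg ds0.
have F0 : F x != 0 by apply: contraNneq d0 => ->; rewrite dot0l.
have y00 : y0 != 0 by apply: contraNneq d0 => ->; rewrite dot0r.
have dF := smv_differentiable sF; have ds := sm_differentiable ss.
apply: unit_kernel => h; rewrite -jacE; last by apply: smv_differentiable; exact: sm_chart.
rewrite chart_derive // => E.
have := congr1 (fun u => dot u y0) E; rewrite !dotDl !dotZl dot0l.
have -> : - dot (F x) y0 ^- 2 * dot ('D_h F x) y0 * dot (F x) y0 + (dot (F x) y0)^-1 * dot ('D_h F x) y0 = 0 by field.
rewrite add0r => /eqP; rewrite mulf_eq0 dot_eq0 (negbTE y00) orbF => /eqP Ds.
move: E; rewrite Ds scale0r addr0 => E.
have [|c hc] := @fld_span F x h (dot ('D_h F x) y0 / dot (F x) y0) rg F0.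
  rewrite -jacE //; have := congr1 (fun u => dot (F x) y0 *: u) E.
  rewrite scaler0 scalerDr !scalerA divff // scale1r => /eqP; rewrite addr_eq0 => /eqP E2.
  apply: oppr_inj; rewrite -E2 -scaleNr; congr (_ *: _); by field.
have := Ds; rewrite hc deriveZv // -[_ *: _]/(_ * _) => /eqP.
by rewrite mulf_eq0 (negbTE ds0) orbF => /eqP ->; rewrite scale0r.
Qed.

End Field.

(** * Straightening charts and short-time behaviour of the flow *)

Section Flow.
Context {R : realType} {n : nat}.
Local Notation rV := 'rV[R]_n.

(** The conclusion of [flow_exists]; in the space variable it contains Lipschitz dependence only. *)
Definition is_flow (W : rV -> rV) (Phi : R -> rV -> rV) :=
  [/\ forall x, Phi 0 x = x,
      forall t x, is_derive t (1 : R) (Phi^~ x) (W (Phi t x)),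
      forall s t x, Phi (s + t) x = Phi s (Phi t x),
      forall (g : R -> rV) t, (forall s, `|s| <= `|t| -> is_derive s (1 : R) g (W (g s))) ->
        g t = Phi t (g 0) &
      forall T, exists2 K : R, 0 < K & forall s t x y, `|s| <= T ->
         `|Phi t y - Phi s x| <= K * (`|t - s| + `|y - x|)].

Lemma nearI (x : rV) (P Q : rV -> Prop) :
  (\forall y \near x, P y) -> (\forall y \near x, Q y) -> \forall y \near x, P y /\ Q y.
Proof. exact: filterI. Qed.

Lemma is_derive_comp (V W : normedModType R) (f : V -> W) (g : R -> V) (s : R) v :
  differentiable f (g s) -> is_derive s (1 : R) g v ->
  is_derive s (1 : R) (fun r => f (g r)) ('D_v f (g s)).
Proof.
move=> df [dg <-].
have dgs : differentiable g s by apply/derivable1_diffP.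
apply: DeriveDef; last by rewrite (derive_comp _ dgs df).
by apply/derivable1_diffP; apply: (@differentiable_comp _ _ _ _ g f).
Qed.

Section OneFlow.
Variables (W : rV -> rV) (Phi : R -> rV -> rV).
Hypothesis HPhi : is_flow W Phi.

Lemma flow0 x : Phi 0 x = x. Proof. by case: HPhi. Qed.
Lemma flowD s t x : Phi (s + t) x = Phi s (Phi t x). Proof. by case: HPhi. Qed.
Lemma flow_der t x : is_derive t (1 : R) (Phi^~ x) (W (Phi t x)). Proof. by case: HPhi. Qed.
Lemma flow_uniq (g : R -> rV) t :
  (forall s, `|s| <= `|t| -> is_derive s (1 : R) g (W (g s))) -> g t = Phi t (g 0).
Proof. by case: HPhi => _ _ _ H _; exact: H. Qed.

Lemma flowK t x : Phi (- t) (Phi t x) = x.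
Proof. by rewrite -flowD addNr flow0. Qed.

Lemma flowNK t x : Phi t (Phi (- t) x) = x.
Proof. by rewrite -flowD addrN flow0. Qed.

Lemma flow_near t x (P : rV -> Prop) : (\forall y \near Phi t x, P y) ->
  exists2 d : R, 0 < d & forall s y, `|t - s| < d -> `|x - y| < d -> P (Phi s y).
Proof.
move=> /near_ballP [r r0 Hr].
have [_ _ _ _ /(_ `|t|) [K K0 HK]] := HPhi.
exists (r / (2 * K)); first by rewrite divr_gt0 // mulr_gt0.
move=> s y hs hy; apply: Hr; rewrite distrC.
apply: le_lt_trans (HK t s x y (lexx _)) _.
rewrite distrC (distrC y).
have -> : r = K * (r / (2 * K) + r / (2 * K)) by field; rewrite gt_eqF.
by rewrite ltr_pM2l // ltrD.
Qed.

Lemma flow_cont_time t x : {for t, continuous (Phi^~ x)}.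
Proof. exact: is_derive_continuous (flow_der t x). Qed.

Lemma flow_derf (V : normedModType R) (f : rV -> V) s x : differentiable f (Phi s x) ->
  is_derive s (1 : R) (fun r => f (Phi r x)) ('D_(W (Phi s x)) f (Phi s x)).
Proof. by move=> df; apply: (is_derive_comp df); exact: flow_der. Qed.

(** Compactness of the time interval makes the neighbourhood of [x] uniform in [s]. *)
Lemma flow_tube (S : set rV) (a b : R) x : open S ->
  (forall s, a <= s <= b -> S (Phi s x)) ->
  \forall y \near x, forall s, a <= s <= b -> S (Phi s y).
Proof.
move=> oS H.
have cI : compact `[a, b]%classic := @segment_compact R a b.
have := (compact_near_coveringP `[a, b]%classic).1 cI rV (nbhs x) (fun y s => S (Phi s y)) _.
case.
  move=> s; rewrite /= in_itv /= => hs.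
  have [d d0 Hd] := flow_near (open_near oS (H s hs)).
  exists ([set r | `|s - r| < d], [set y | `|x - y| < d]) => /=.
    split; first by apply: (@ball_nearP R R^o _ s d d0).
    exact: (@ball_nearP R rV _ x d d0).
  by move=> [r y] /= [h1 h2]; exact: Hd.
move=> r r0 Hr; exists r => // y hy s hs.
Qed.

Lemma flow_incr (f : rV -> R) x (a b : R) : a < b ->
  (forall s, a <= s <= b -> differentiable f (Phi s x) /\ 0 < 'D_(W (Phi s x)) f (Phi s x)) ->
  f (Phi a x) < f (Phi b x).
Proof.
move=> ab H.
have [||c] := @MVT R (fun s => f (Phi s x)) (fun s => 'D_(W (Phi s x)) f (Phi s x)) a b ab.
- move=> s; rewrite in_itv /= => /andP[h1 h2]; apply: flow_derf.
  by apply: (H s _).1; rewrite !ltW.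
- apply: derivable_within_continuous => s; rewrite in_itv /= => /H [h _].
  by case: (flow_derf h).
rewrite in_itv /= => /andP[h1 h2] E; rewrite -subr_gt0 E mulr_gt0 ?subr_gt0 //.
by apply: (H c _).2; rewrite !ltW.
Qed.

Lemma flow_fix x : W x = 0 -> forall t, Phi t x = x.
Proof.
move=> Wx t.
by refine (esym (@flow_uniq (fun=> x) t _)) => s _; rewrite Wx; exact: is_derive_cst.
Qed.

End OneFlow.

Lemma csupp_common (F : rV -> rV) : (forall j, csupp (fun x => F x 0 j)) ->
  exists2 M : R, 0 <= M & forall x, M < `|x| -> F x = 0.
Proof.
move=> cF.
have [M HM] := choice cF.
have S0 : 0 <= \sum_j `|M j| by apply: sumr_ge0.
exists (\sum_j `|M j|) => // x hx; apply/rowP => j; rewrite mxE; apply: HM.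
apply: le_lt_trans hx; apply: le_trans (ler_norm _) _.
by rewrite (bigD1 j) //= lerDl sumr_ge0.
Qed.

Lemma smooth_flow (W : rV -> rV) : (forall x, smv W x) ->
  (exists M : R, forall x, M < `|x| -> W x = 0) -> exists Phi, is_flow W Phi.
Proof.
move=> sW [M HM]; apply: flow_exists.
  by move=> j; exists M => x /HM ->; rewrite mxE.
by move=> x j; apply: sm_smo; exact: sW.
Qed.

Lemma fld_flow (F : rV -> rV) : (forall x, smv F x) -> (forall j, csupp (fun x => F x 0 j)) ->
  exists Phi, is_flow (fld F) Phi.
Proof.
move=> sF cF; apply: smooth_flow; first by move=> x; exact: sm_fld.
by have [M _ HM] := csupp_common cF; exists M => x /HM; exact: fld0.
Qed.

Definition ray (F : rV -> rV) x y := exists2 l : R, 0 < l & F y = l *: F x.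

Section FieldFlow.
Variables (F : rV -> rV) (Phi : R -> rV -> rV).
Hypotheses (sF : forall x, smv F x) (HPhi : is_flow (fld F) Phi).
Let w := fld F.

Lemma derive_fld x : 'D_(w x) F x = \det (jac F x) *: F x.
Proof. by rewrite jacE ?fld_jac //; exact: smv_differentiable. Qed.

(** Along an orbit [F] solves a linear equation with the determinant as coefficient, so it is
    multiplied by the exponential of a primitive of that coefficient. *)
Lemma flow_ray x s : ray F x (Phi s x).
Proof.
pose d s := \det (jac F (Phi s x)).
have cd : continuous d.
  move=> t; apply: (@continuous_comp R rV R (Phi^~ x) (fun y => \det (jac F y))).
    exact: (flow_cont_time HPhi).
  by apply: sm_continuous; apply: sm_det => i j; exact: sm_jac.
have [D [D0 HD]] := antiderivative cd.
have HE t : is_derive t (1 : R) (fun r => expR (- D r)) (- d t * expR (- D t)).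
  have := @is_derive1_comp R (@expR R) (fun r => - D r) t _ _ (is_derive_expR _) (is_deriveN_ (HD t)).
  by rewrite mulrC.
have E j : expR (- D s) * F (Phi s x) 0 j = F x 0 j.
  have := @derive0_cst R (fun r => expR (- D r) * F (Phi r x) 0 j)
    (fun r => expR (- D r) * (d r *: F (Phi r x)) 0 j + F (Phi r x) 0 j * (- d r * expR (- D r))) s.
  rewrite D0 oppr0 expR0 mul1r (flow0 HPhi); apply.
    move=> t _; apply: is_deriveM_ => //.
    have dF := smv_differentiable (sF (Phi t x)).
    have := flow_derf HPhi dF; rewrite -/w derive_fld.
    by move=> /is_derive_rowP.
  by move=> t _; rewrite mxE; ring.
exists (expR (D s)); first exact: expR_gt0.
apply/rowP => j; rewrite mxE -(E j) mulrA -expRD addrN expR0 mul1r //.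
Qed.

Lemma ray_neq0 x y : ray F x y -> F x != 0 -> F y != 0.
Proof. by move=> [l l0 ->] ?; rewrite scaler_eq0 negb_or gt_eqF. Qed.

Lemma ray_sym x y : ray F x y -> ray F y x.
Proof.
by move=> [l l0 E]; exists l^-1; rewrite ?invr_gt0 // E scalerA mulVf ?scale1r // gt_eqF.
Qed.

Lemma ray_trans x y z : ray F x y -> ray F y z -> ray F x z.
Proof. by move=> [l l0 E] [m m0 E']; exists (m * l); rewrite ?mulr_gt0 // E' E scalerA. Qed.

(** A linear [s] increasing along the field completes a first chart. There the field has the
    constant direction [y0] but a variable speed, which a primitive along [y0] normalizes. *)
Lemma local_time x0 : F x0 != 0 -> reg F x0 ->
  exists2 t : rV -> R, sm t x0 & \forall x \near x0, 'D_(w x) t x = 1.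
Proof.
move=> F0 rg.
pose y0 := F x0; pose s (x : rV) := dot (w x0) (x - x0).
have ss x : sm s x.
  by apply: sm_dot; [exact: smv_cst|apply: smvB; [exact: smv_id|exact: smv_cst]].
have d0 : dot (F x0) y0 != 0 by rewrite dot_eq0.
have Ds x v : 'D_v s x = dot (w x0) v.
  have di : differentiable (fun y : rV => y - x0) x.
    by apply: smv_differentiable; apply: smvB; [exact: smv_id|exact: smv_cst].
  have dc : differentiable (fun _ : rV => w x0) x by exact: differentiable_cst.
  rewrite derive_dot // derive_cst_ dot0l add0r.
  have -> : (fun y : rV => y - x0) = (id - cst x0) by [].
  rewrite deriveB; [|exact: derivable_id|exact: derivable_cst].
  by rewrite derive_id derive_cst subr0.
have Dw : 'D_(w x0) s x0 != 0 by rewrite Ds dot_eq0; exact: fld_neq0.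
have nP : \forall x \near x0, 0 < dot (F x) y0 /\ 0 < 'D_(w x) s x.
  have c1 : {for x0, continuous (fun x => dot (F x) y0)}.
    by apply: sm_continuous; apply: sm_dot => //; exact: smv_cst.
  have c2 : {for x0, continuous (fun x => 'D_(w x) s x)}.
    have -> : (fun x => 'D_(w x) s x) = (fun x => dot (w x0) (w x)) by rewrite funeqE => x; rewrite Ds.
    by apply: sm_continuous; apply: sm_dot; [exact: smv_cst|exact: sm_fld].
  have p1 : 0 < dot (F x0) y0 by rewrite dot_gt0.
  have p2 : 0 < 'D_(w x0) s x0 by rewrite Ds dot_gt0; exact: fld_neq0.
  exact: filterI (near_gt0 c1 p1) (near_gt0 c2 p2).
have scx : smv (chart F y0 s) x0 by exact: sm_chart.
have dJ := chart_unit (sF x0) (ss x0) d0 rg Dw.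
have [A [B [g [[oA Ax0 oB HA] [fA gB sg]]]]] := inverse_function nP scx dJ.
set Z := chart F y0 s in fA gB sg HA scx dJ.
pose z0 := Z x0.
have Bz0 : B z0 := (fA x0 Ax0).1.
have [r r0 Hr] := near_ballP (open_near oB Bz0).
(* In the chart the field is ['D_w s] times [y0], so the wanted function is a primitive along [y0]
   of the inverse of this factor. *)
pose k z := ('D_(w (g z)) s (g z))^-1.
have sk z : `|z0 - z| < r -> sm k z.
  move=> /Hr Bz; have [Ag _] := gB z Bz; have [[_ p2] _ _] := HA _ Ag.
  have -> : k = fun z => (dot (w x0) (w (g z)))^-1 by rewrite funeqE => y; rewrite /k Ds.
  apply: smV; first by rewrite -(Ds (g z)) gt_eqF.
  apply: sm_dot; first exact: smv_cst.
  by apply: (@smv_comp R rV n n g w); [exact: sm_fld|exact: (sg z Bz).1].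
have r2 : 0 < r / 2 by rewrite divr_gt0.
(* Primitives are available for compactly supported functions; the cut-off changes nothing near
   [z0]. *)
have [chi [sc c0 c1 cr]] := bump_exists z0 r2.
have rr : r / 2 < r by lra.
pose kk z := chi z * k z.
have skk := bump_mul rr sc cr sk.
have ckk : csupp kk := csupp_bump k cr.
pose sgf (z : rV) := (dot y0 y0)^-1 * dot z y0.
have sgl : linear sgf.
  by move=> a u v; rewrite /sgf dotDl dotZl mulrDr -[a *: _]/(a * _); ring.
pose SG : {linear rV -> R} := HB.pack sgf (GRing.isLinear.Build _ _ _ _ sgf sgl).
have sg1 : SG y0 = 1 by rewrite /SG /= /sgf mulVf.
have [P sP DP] := directional_primitive sg1 ckk skk.
exists (fun x => P (Z x)).
  by apply: (@sm_comp R rV n Z P); [exact: sm_T|exact: scx].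
have cZ := smv_continuous scx.
have nchi : \forall x \near x0, chi (Z x) = 1 by exact: (cZ _ c1).
apply: filterS2 nchi (open_near oA Ax0) => x cx Ax.
have [[p1 p2] sZ _] := HA x Ax.
rewrite (derive_comp _ (smv_differentiable sZ) (smo_differentiable (sP _))).
rewrite /Z chart_fld //; last by rewrite gt_eqF.
rewrite deriveZv; last exact: smo_differentiable.
rewrite DP -/Z /kk cx mul1r /k (fA x Ax).2.
by apply: mulfV; rewrite gt_eqF.
Qed.

(** In the chart completed by a time function the field is the constant [y0] and the flow is a
    translation for short times. Points on one ray share the first summand of the chart, so they
    differ by a translation by the difference of their times. The bound 1 is a normalization, to be
    compared with return times of at least 2. *)
Lemma timebox x0 : F x0 != 0 -> reg F x0 ->
  exists (U : set rV) (t : rV -> R) (d : R),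
   [/\ open U, U x0, 0 < d & forall x, U x -> sm t x] /\
   [/\ forall x s, U x -> `|s| < d -> smv (Phi s) x,
       forall x y, U x -> U y -> ray F x y -> y = Phi (t y - t x) x &
       forall x y, U x -> U y -> `|t y - t x| < 1].
Proof.
move=> F0 rg; have [t st Dt] := local_time F0 rg.
pose y0 := F x0.
have d0 : dot (F x0) y0 != 0 by rewrite dot_eq0.
have c1 : {for x0, continuous (fun x => dot (F x) y0)}.
  by apply: sm_continuous; apply: sm_dot => //; exact: smv_cst.
have p1 : 0 < dot (F x0) y0 by rewrite dot_gt0.
have nP : \forall x \near x0, 0 < dot (F x) y0 /\ 'D_(w x) t x = 1 /\ sm t x :=
  nearI (near_gt0 c1 p1) (nearI Dt (sm_near st)).
have scx : smv (chart F y0 t) x0 by exact: sm_chart.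
have Dw : 'D_(w x0) t x0 != 0 by rewrite (nbhs_singleton Dt) oner_neq0.
have dJ := chart_unit (sF x0) st d0 rg Dw.
have [A [B [g [[oA Ax0 oB HA] [fA gB sg]]]]] := inverse_function nP scx dJ.
set Z := chart F y0 t in fA gB sg HA scx dJ.
have Bz0 : B (Z x0) := (fA x0 Ax0).1.
have [r r0 Hr] := near_ballP (open_near oB Bz0).
have ny : 0 < `|y0| + 1 by rewrite ltr_wpDl.
pose d := r / (2 * (`|y0| + 1)).
have dp : 0 < d by rewrite divr_gt0 // mulr_gt0.
have r2 : 0 < r / 2 by rewrite divr_gt0.
(* The halves ensure that times of two points of [U] differ by less than [d] and by less than 1. *)
have nO : \forall x \near x0, [/\ A x, `|Z x0 - Z x| < r / 2 & `|t x0 - t x| < Num.min (d / 2) 2^-1].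
  have /(@cont_distP R rV rV) h1 := smv_continuous scx.
  have /(@cont_distP R rV R) h2 := sm_continuous st.
  have m0 : 0 < Num.min (d / 2) 2^-1 by rewrite lt_min divr_gt0 //= invr_gt0.
  by apply: filterS3 (open_near oA Ax0) (h1 _ r2) (h2 _ m0) => x.
have [U [oU Ux0 HU]] := near_open nO.
have move_ x s : U x -> `|s| < d -> B (Z x + s *: y0).
  move=> /HU [Ax Zx _] sd; apply: Hr.
  rewrite opprD addrA; apply: le_lt_trans (ler_normB _ _) _.
  have : `|s *: y0| <= r / 2.
    rewrite normrZ; apply: le_trans (_ : d * (`|y0| + 1) <= _).
      by apply: ler_pM => //; [exact: ltW|rewrite lerDl].
    by rewrite /d le_eqVlt; apply/orP; left; apply/eqP; field; rewrite gt_eqF.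
  by move=> h; lra.
(* A straight line in the chart, pulled back by [g], solves the equation; uniqueness identifies it
   with the orbit. *)
have flowE x s : U x -> `|s| < d -> Phi s x = g (Z x + s *: y0).
  move=> Ox sd; have [Ax _ _] := HU x Ox.
  pose c r := g (Z x + r *: y0).
  have c00 : c 0 = x by rewrite /c scale0r addr0 (fA x Ax).2.
  rewrite -{1}c00 -/(c s); apply/esym/(flow_uniq HPhi) => q qs.
  have qd : `|q| < d by exact: le_lt_trans sd.
  have Bq := move_ x q Ox qd.
  have [Ag ZgE] := gB _ Bq; have [[pg [Dg tg]] sZg dZg] := HA _ Ag.
  have [sgq Dgq] := sg _ Bq.
  have dg := smv_differentiable sgq.
  have dv := diff_derivable (v := y0) dg.
  have := is_derive_line dv; rewrite -/(c q) Dgq.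
  have -> : y0 *m invmx (jac Z (c q)) = fld F (c q).
    have uJ : jac Z (c q) \in unitmx by rewrite unitmxE unitfE.
    apply: (canLR (mulmxK uJ)).
    rewrite -jacE; last exact: smv_differentiable.
    by rewrite /Z chart_fld // ?Dg ?scale1r // gt_eqF.
  by [].
exists U, t, d; split.
  by split=> // x /HU [Ax _ _]; have [[_ [_ ]]] := HA x Ax.
split.
- move=> x s Ox sd; have [Ax _ _] := HU x Ox.
  have H : smv (fun y => g (Z y + s *: y0)) x.
    apply: (@smv_comp R rV n n (fun y => Z y + s *: y0) g); first exact: (sg _ (move_ x s Ox sd)).1.
    by apply: smvD; [have [] := HA x Ax|exact: smv_cst].
  apply: smv_eq H; apply: filterS (open_near oU Ox) => y Oy.
  by rewrite flowE.
- move=> x y Ox Oy [l l0 E]; have [Ax _ tx] := HU x Ox; have [Ay _ ty] := HU y Oy.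
  have td : `|t y - t x| < d.
    move: tx ty; rewrite !lt_min => /andP[h1 _] /andP[h2 _].
    have -> : t y - t x = (t x0 - t x) - (t x0 - t y) by ring.
    by apply: le_lt_trans (ler_normB _ _) _; lra.
  rewrite flowE // -[LHS](fA y Ay).2; congr g.
  have [[px _] _ _] := HA x Ax.
  rewrite /Z /chart E dotZl invfM scalerA -addrA -scalerDl [t x + _]addrC subrK.
  by rewrite mulrAC mulVf ?mul1r // gt_eqF.
- move=> x y /HU [_ _ tx] /HU [_ _ ty].
  move: tx ty; rewrite !lt_min => /andP[_ h1] /andP[_ h2].
  have -> : t y - t x = (t x0 - t x) - (t x0 - t y) by ring.
  by apply: le_lt_trans (ler_normB _ _) _; lra.
Qed.

(** With [rho] as last chart coordinate, the point of the zero level on the orbit of [x] is a smooth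
    function of [x], and so is the difference [th] of the times of the two points. The predicate [Q]
    is any local property wanted along the short piece of orbit. *)
Lemma crossing x0 (rho : rV -> R) (Q : rV -> Prop) : (\forall x \near x0, Q x) -> F x0 != 0 -> reg F x0 -> sm rho x0 -> rho x0 = 0 ->
  0 < 'D_(w x0) rho x0 ->
  exists (U : set rV) (th : rV -> R) (d : R),
   [/\ open U, U x0, 0 < d & th x0 = 0] /\
   forall x, U x -> [/\ sm th x, `|th x| < d, rho (Phi (th x) x) = 0,
     forall s, - d <= s -> s <= d -> Q (Phi s x) & forall s r, - d <= s -> s < r -> r <= d -> rho (Phi s x) < rho (Phi r x)].
Proof.
move=> nQ F0 rg sr r0 Dr.
have [U1 [t [d1 [[oU1 U1x0 d10 st] [_ rayE _]]]]] := timebox F0 rg.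
pose y0 := F x0.
have d0 : dot (F x0) y0 != 0 by rewrite dot_eq0.
have c1 : {for x0, continuous (fun x => dot (F x) y0)}.
  by apply: sm_continuous; apply: sm_dot => //; exact: smv_cst.
have p1 : 0 < dot (F x0) y0 by rewrite dot_gt0.
have c2 : {for x0, continuous (fun x => 'D_(w x) rho x)}.
  suff : sm (fun x => \sum_i w x 0 i * 'D_(delta_mx 0 i) rho x) x0.
    move=> /sm_continuous; apply: near_continuous.
    by apply: filterS (sm_near sr) => x sx; rewrite derive_delta //; exact: sm_differentiable.
  by apply: sm_sum => i _; apply: smM; [exact: sm_fld|exact: sm_der].
have nP : \forall x \near x0, 0 < dot (F x) y0 /\ 0 < 'D_(w x) rho x /\ sm rho x /\ U1 x :=
  nearI (near_gt0 c1 p1) (nearI (near_gt0 c2 Dr) (nearI (sm_near sr) (open_near oU1 U1x0))).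
have scx : smv (chart F y0 rho) x0 by exact: sm_chart.
have dJ := chart_unit (sF x0) sr d0 rg (lt0r_neq0 Dr).
have [A [B [g [[oA Ax0 oB HA] [fA gB sg]]]]] := inverse_function nP scx dJ.
set C := chart F y0 rho in fA gB sg HA scx dJ.
(* The chart value that the point of the zero level on the ray of [x] must have. *)
pose e0 x := (dot (F x) y0)^-1 *: F x.
have se0 x : A x -> smv e0 x.
  move=> Ax; have [[px _] _ _] := HA x Ax.
  apply: smvZ => //; apply: smV; first by rewrite gt_eqF.
  by apply: sm_dot => //; exact: smv_cst.
have e0x0 : e0 x0 = C x0 by rewrite /C /chart r0 scale0r addr0.
have Bz0 : B (C x0) := (fA x0 Ax0).1.
have nB : \forall x \near x0, B (e0 x).
  have := smv_continuous (se0 x0 Ax0) => c; apply: (c B).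
  by rewrite e0x0; apply: (@open_near R rV).
have eP x : A x -> B (e0 x) -> [/\ A (g (e0 x)), rho (g (e0 x)) = 0, ray F x (g (e0 x)) & g (e0 x) = Phi (t (g (e0 x)) - t x) x].
  move=> Ax Bx; have [Ag Eg] := gB _ Bx.
  have [[px [_ [_ U1x]]] _ _] := HA x Ax; have [[pg [_ [_ U1g]]] _ _] := HA _ Ag.
  have y00 : y0 != 0 by [].
  (* Both first summands pair to 1 with [y0], so the pairing leaves only the vanishing of [rho]. *)
  have := congr1 (fun u => dot u y0) Eg.
  rewrite /C /chart /e0 dotDl !dotZl !mulVf ?gt_eqF // => /eqP.
  rewrite -subr_eq0 addrAC subrr add0r mulf_eq0 dot_eq0 (negbTE y00) orbF => /eqP rg0.
  have ry : ray F x (g (e0 x)).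
    exists (dot (F (g (e0 x))) y0 / dot (F x) y0); first by rewrite divr_gt0.
    move: Eg; rewrite /C /chart rg0 scale0r addr0 {3}/e0 => Eg.
    by rewrite -scalerA -Eg scalerA mulfV ?scale1r // gt_eqF.
  by split=> //; exact: rayE.
have ge0x0 : g (e0 x0) = x0 by rewrite e0x0 (fA x0 Ax0).2.
pose th x := t (g (e0 x)) - t x.
have [|d dp Hd] := @flow_near _ _ HPhi 0 x0 (fun x => A x /\ Q x).
  by rewrite (flow0 HPhi); exact: nearI (open_near oA Ax0) nQ.
have th0 : th x0 = 0 by rewrite /th ge0x0 subrr.
have sth x : A x -> B (e0 x) -> sm th x.
  move=> Ax Bx; have [Ag _ _ _] := eP x Ax Bx.
  have [[_ [_ [_ U1x]]] _ _] := HA x Ax; have [[_ [_ [_ U1g]]] _ _] := HA _ Ag.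
  apply: smB; last exact: st.
  apply: (@sm_comp R rV n (fun x => g (e0 x)) t); first exact: st.
  by apply: (@smv_comp R rV n n e0 g); [exact: (sg _ Bx).1|exact: se0].
have d2 : 0 < d / 2 by rewrite divr_gt0.
have nO : \forall x \near x0, [/\ A x /\ B (e0 x), `|th x| < d / 2 & `|x0 - x| < d].
  have B0 : B (e0 x0) by rewrite e0x0.
  have /(@cont_distP R rV R) h2 := sm_continuous (sth x0 Ax0 B0).
  apply: filterS3 (nearI (open_near oA Ax0) nB) (h2 _ d2) (@ball_nearP R rV (fun x => `|x0 - x| < d) x0 d dp (fun _ h => h)) => x hx.
  by rewrite th0 sub0r normrN.
have [U [oU Ux0 HU]] := near_open nO.
exists U, th, (d / 2); split=> // x Ox.
have [[Ax Bx] thx xd] := HU x Ox.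
have [Ag rg0 _ Eg] := eP x Ax Bx.
have AQ s : - (d / 2) <= s -> s <= d / 2 -> A (Phi s x) /\ Q (Phi s x).
  by move=> h1 h2; apply: Hd => //; rewrite sub0r normrN ltr_norml; apply/andP; split; lra.
split=> //; first exact: sth.
- by rewrite /th -Eg.
- by move=> s h1 h2; have [] := AQ s h1 h2.
move=> s r h1 h2 h3; apply: (flow_incr HPhi) => // q /andP[h4 h5].
have [Aq _] := AQ q (le_trans h1 h4) (le_trans h5 h3).
have [[_ [pq [sq _]]] _ _] := HA _ Aq.
by split=> //; exact: sm_differentiable.
Qed.

End FieldFlow.
End Flow.

(** * Connectedness and compactness *)

Section Topology.
Context {R : realType}.

Lemma near_comp (V W : normedModType R) (c : V -> W) (t : V) (P : W -> Prop) :
  {for t, continuous c} -> (\forall y \near c t, P y) -> \forall u \near t, P (c u).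
Proof. by move=> cc /cc. Qed.

(** Induction on the half-line, by the infimum of the failures. The start is the case [t = 0], where
    the induction hypothesis is empty. *)
Lemma real_induction (Q : R -> Prop) :
  (forall t, 0 <= t -> (forall s, 0 <= s -> s < t -> Q s) ->
     exists2 e : R, 0 < e & forall s, t <= s -> s < t + e -> Q s) ->
  forall t, 0 <= t -> Q t.
Proof.
move=> H t t0; apply: contrapT => nQ.
pose S := [set s | 0 <= s /\ ~ Q s].
have iS : has_inf S by split; [exists t|exists 0 => s []].
have i0 : 0 <= inf S by apply: lb_le_inf; [exists t|move=> s []].
have [|e e0 He] := H (inf S) i0.
  move=> s s0 si; apply: contrapT => nQs.
  by have := ge_inf (iS.2) (conj s0 nQs : S s); rewrite leNgt si.
have [s [s0 nQs] se] := inf_adherent e0 iS.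
have is_ := ge_inf iS.2 (conj s0 nQs : S s).
by apply: nQs; apply: He.
Qed.

(* Connectedness of A with relatively open subsets described by neighbourhood
   filters of the ambient space; it passes to images, and survives the removal of
   sets of codimension at least two. *)
Definition lconn (V : normedModType R) (A : V -> Prop) := forall P : V -> Prop,
  (forall x, A x -> P x -> \forall y \near x, A y -> P y) ->
  (forall x, A x -> ~ P x -> \forall y \near x, A y -> ~ P y) ->
  forall x y, A x -> A y -> P x -> P y.

Lemma connected_lconn (V : normedModType R) (A : set V) : connected A -> lconn A.
Proof.
move=> cA P H1 H2 x y Ax Ay Px.
have op (Q : V -> Prop) : open [set x | \forall y \near x, A y -> Q y].
  by rewrite openE => z /= /near_join.
have E : A `&` [set z | P z] = A.
  apply: cA; first by exists x.
    exists [set x | \forall y \near x, A y -> P y]; first exact: op.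
    apply/seteqP; split => z /= [Az Pz]; split=> //; first exact: H1.
    exact: (nbhs_singleton Pz).
  exists (~` [set x | \forall y \near x, A y -> ~ P y]); first exact: open_closedC.
  apply/seteqP; split => z /= [Az Pz]; split=> //.
    by move=> /nbhs_singleton /(_ Az).
  by apply: contrapT => nP; apply: Pz; exact: H2.
by have : A y by []; rewrite -E => -[].
Qed.

Lemma lconn_image (V W : normedModType R) (A : V -> Prop) (f : V -> W) : lconn A ->
  (forall x, A x -> {for x, continuous f}) -> lconn (fun y => exists2 x, A x & f x = y).
Proof.
move=> cA cf P H1 H2 _ _ [x Ax <-] [y Ay <-]; apply: (cA (fun x => P (f x))) => // z Az Pz.
  have := near_comp (cf z Az) (H1 (f z) (ex_intro2 _ _ z Az erefl) Pz).
  by apply: filterS => u h Au; apply: h; exists u.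
have := near_comp (cf z Az) (H2 (f z) (ex_intro2 _ _ z Az erefl) Pz).
by apply: filterS => u h Au; apply: h; exists u.
Qed.

Lemma lconn_convex (V : normedModType R) (A : V -> Prop) :
  (forall x y, A x -> A y -> forall t : R, 0 <= t <= 1 -> A (x + t *: (y - x))) -> lconn A.
Proof.
move=> cA P H1 H2 x y Ax Ay Px.
pose c (t : R) := x + t *: (y - x).
have cc (t : R) : {for t, continuous c}.
  by apply: cvgD; [exact: cvg_cst|apply: cvgZl; exact: cvg_id].
have := @connected_lconn R^o `[0, 1]%classic (@segment_connected R 0 1).
move=> /(_ (fun t => P (c t))) H.
suff : P (c 1) by rewrite /c scale1r addrC subrK.
apply: (H _ _ 0 1); rewrite /= ?in_itv /= ?lexx ?ler01 //.
- move=> t; rewrite in_itv /= => ht Pt.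
  apply: filterS (near_comp (cc t) (H1 _ (cA x y Ax Ay t ht) Pt)) => u h hu.
  by apply: h; apply: cA => //; move: hu; rewrite in_itv.
- move=> t; rewrite in_itv /= => ht Pt.
  apply: filterS (near_comp (cc t) (H2 _ (cA x y Ax Ay t ht) Pt)) => u h hu.
  by apply: h; apply: cA => //; move: hu; rewrite in_itv.
- by rewrite /c scale0r addr0.
Qed.

(** A relatively clopen property of the complement of [K] extends across [K]: near a point of [K] it
    has one value on all of [B] minus [K], which is connected, and density of the complement keeps
    the two values apart. *)
Lemma lconn_remove (V : normedModType R) (A K : V -> Prop) : lconn A ->
  (forall x, A x -> forall B : set V, nbhs x B -> exists y, [/\ B y, A y & ~ K y]) ->
  (forall x, A x -> K x -> exists B : set V,
     [/\ nbhs x B, forall y, B y -> A y & lconn (fun y => B y /\ ~ K y)]) ->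
  lconn (fun x => A x /\ ~ K x).
Proof.
move=> cA dn loc P H1 H2 x y [Ax Kx] [Ay Ky] Px.
pose Pt (x : V) := \forall y \near x, A y -> ~ K y -> P y.
pose Qt (x : V) := \forall y \near x, A y -> ~ K y -> ~ P y.
have PQ z : A z -> Pt z \/ Qt z.
  move=> Az; have [Kz|Kz] := pselect (K z); last first.
    have [Pz|Pz] := pselect (P z); [left|right].
      by apply: filterS (H1 z (conj Az Kz) Pz) => u h Au Ku; exact: h.
    by apply: filterS (H2 z (conj Az Kz) Pz) => u h Au Ku; exact: h.
  have [B [nB BA cB]] := loc z Az Kz.
  have [y0 [By0 Ay0 Ky0]] := dn z Az B nB.
  have H1' u : B u /\ ~ K u -> P u -> \forall y \near u, B y /\ ~ K y -> P y.
    move=> [Bu Ku] Pu; apply: filterS (H1 u (conj (BA u Bu) Ku) Pu) => v h [Bv Kv].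
    by apply: h; split=> //; exact: BA.
  have H2' u : B u /\ ~ K u -> ~ P u -> \forall y \near u, B y /\ ~ K y -> ~ P y.
    move=> [Bu Ku] Pu; apply: filterS (H2 u (conj (BA u Bu) Ku) Pu) => v h [Bv Kv].
    by apply: h; split=> //; exact: BA.
  have [Py0|Py0] := pselect (P y0); [left|right]; apply: filterS nB => u Bu Au Ku.
    exact: (cB P H1' H2' y0 u).
  by move=> Pu; apply: Py0; exact: (cB P H1' H2' u y0).
have nPQ z : A z -> Pt z -> Qt z -> False.
  move=> Az Pz Qz; have [u [[h1 h2] Au Ku]] := dn z Az _ (filterI Pz Qz).
  by apply: h2 => //; exact: h1.
have : Pt y.
  apply: (cA Pt _ _ x y) => //.
  - by move=> z _ Pz; apply: filterS (near_join Pz).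
  - move=> z Az nPz; have [//|Qz] := PQ z Az.
    by apply: filterS (near_join Qz) => u Qu Au Pu; exact: (nPQ u).
  - have [//|Qx] := PQ x Ax.
    by have := nbhs_singleton Qx Ax Kx Px.
by move=> /nbhs_singleton; apply.
Qed.

End Topology.

(** * Removal of subspaces, compactness, and extension of smooth maps *)

Section Row.
Context {R : realType} {n : nat}.
Local Notation rV := 'rV[R]_n.

(** The complement in a ball of a subspace of codimension [k] through its centre. It is covered by
    the convex pieces on which one coordinate of [y *m A] has a given sign. Pieces of different
    coordinates meet, and opposite signs of one coordinate are joined through another one. *)
Lemma lconn_codim k (A : 'M[R]_(n, k)) (B : 'M[R]_(k, n)) (c : rV) (r : R) : (2 <= k)%N ->
  B *m A = 1%:M -> c *m A = 0 -> 0 < r ->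
  lconn (fun y : rV => `|c - y| < r /\ y *m A <> 0).
Proof.
move=> k2 BA cA r0 P H1 H2.
pose H (i : 'I_k) (s : bool) (y : rV) := `|c - y| < r /\ 0 < (-1) ^+ s * (y *m A) 0 i.
have HS i s y : H i s y -> `|c - y| < r /\ y *m A <> 0.
  by move=> [h1 h2]; split=> // E; move: h2; rewrite E mxE mulr0 ltxx.
have cvx i s : lconn (H i s).
  apply: lconn_convex => x y [x1 x2] [y1 y2] t t01; split; first exact: segment_ball.
  rewrite mulmxDl -scalemxAl mulmxBl.
  have -> (u v : 'rV[R]_k) : (u + t *: (v - u)) 0 i = u 0 i + t * (v 0 i - u 0 i) by rewrite !mxE.
  move: x2 y2; set a := (-1) ^+ s; set p := (x *m A) 0 i; set q := (y *m A) 0 i => x2 y2.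
  move: t01 => /andP[t0 t1].
  have [->|tn] := eqVneq t 0; first by rewrite mul0r addr0.
  have tp : 0 < t by rewrite lt_neqAle eq_sym tn.
  have -> : a * (p + t * (q - p)) = (1 - t) * (a * p) + t * (a * q) by ring.
  by apply: ltr_wpDl; [apply: mulr_ge0; [lra|exact: ltW]|exact: mulr_gt0].
have step i s x y : H i s x -> H i s y -> P x -> P y.
  apply: cvx => z Hz Pz.
    by apply: filterS (H1 z (HS _ _ _ Hz) Pz) => u h Hu; apply: h; exact: (HS i s).
  by apply: filterS (H2 z (HS _ _ _ Hz) Pz) => u h Hu; apply: h; exact: (HS i s).
(* The right inverse [B] realizes any value [v] up to scale inside the ball, since [c *m A = 0]. *)
have pt (v : 'rV[R]_k) : exists2 e : R, 0 < e & `|c - (c + e *: (v *m B))| < r /\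
    (c + e *: (v *m B)) *m A = e *: v.
  exists (r / (`|v *m B| + 1)); first by rewrite divr_gt0 // ltr_wpDl.
  split; last by rewrite mulmxDl cA add0r -scalemxAl -mulmxA BA mulmx1.
  rewrite opprD addrA subrr sub0r normrN normrZ ger0_norm; last first.
    by rewrite divr_ge0 ?ltW // ltr_wpDl.
  rewrite mulrAC ltr_pdivrMr ?ltr_wpDl // ltr_pM2l // ltrDl //.
have sg (s : bool) : (-1) ^+ s * (-1) ^+ s = 1 :> R by rewrite -expr2 sqrr_sign.
have hop i s j t x y : i != j -> H i s x -> H j t y -> P x -> P y.
  move=> ij Hx Hy Px.
  have [e e0 [h1 h2]] := pt ((-1) ^+ s *: delta_mx 0 i + (-1) ^+ t *: delta_mx 0 j).
  set m := c + e *: _ in h1 h2.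
  have : P m.
    apply: (step i s x m) => //; split=> //; rewrite h2 !mxE !eqxx /= (negbTE ij) /=.
    by rewrite mulr1 mulr0 addr0 mulrCA sg mulr1.
  apply: (step j t) => //; split=> //; rewrite h2 !mxE !eqxx /= eq_sym (negbTE ij) /=.
  by rewrite mulr1 mulr0 add0r mulrCA sg mulr1.
have ex y : `|c - y| < r /\ y *m A <> 0 -> exists i s, H i s y.
  move=> [h1 h2]; have /rV0Pn [i Hi] : y *m A != 0 by apply/eqP.
  by exists i, ((y *m A) 0 i < 0); split=> //; rewrite -normrEsign normr_gt0.
move=> x y /ex [i [s Hx]] /ex [j [t Hy]].
have [ij|] := eqVneq i j; last by move=> ij; exact: (hop i s j t).
(* The same coordinate, perhaps with opposite signs: the detour uses a second coordinate, which
   exists because [2 <= k]. *)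
have [l li] : exists l : 'I_k, l != i.
  have k1 : (1 < k)%N by [].
  have k0 : (0 < k)%N by exact: ltnW.
  have [i0|i0] := eqVneq (i : nat) 0%N; [exists (Ordinal k1)|exists (Ordinal k0)].
    by rewrite -val_eqE /= i0.
  by rewrite -val_eqE /= eq_sym.
have [e e0 [h1 h2]] := pt (delta_mx 0 l).
set m := c + e *: _ in h1 h2.
have Hm : H l false m by split=> //; rewrite h2 !mxE !eqxx mulr1 expr0 mul1r.
move=> Px; apply: (hop l false j t m) => //; first by rewrite -ij.
by apply: (hop i s l false x) => //; rewrite eq_sym.
Qed.

Lemma compact_cluster (A : set rV) (u : nat -> rV) : compact A -> (forall k, A (u k)) ->
  exists2 z, A z & forall e : R, 0 < e -> forall N, exists2 k, (N <= k)%N & `|z - u k| < e.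
Proof.
move=> cA Au.
have [|z [Az cz]] := cA (u @ \oo) _; first by exists 0%N => // k _; exact: Au.
exists z => // e e0 N.
have h1 : (u @ \oo) [set y | exists2 k, (N <= k)%N & u k = y] by exists N => // k /= h; exists k.
have h2 : nbhs z [set y | `|z - y| < e] by apply: (@ball_nearP R rV _ z e).
by have [y [[k Nk <-] h]] := cz _ _ h1 h2; exists k.
Qed.

(** Compactness as an induction principle: it yields bounds and sums of local pieces without any
    explicit finite cover. *)
Lemma compact_ind (A : set rV) (Q : set rV -> Prop) : compact A -> Q set0 ->
  (forall S T, Q S -> Q T -> Q (S `|` T)) -> (forall S T, S `<=` T -> Q T -> Q S) ->
  (forall x, A x -> exists2 U, nbhs x U & Q U) -> Q A.
Proof.
move=> cA Q0 QU QS loc.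
have /choice [U HU] x : exists U : set rV, A x -> open U /\ U x /\ Q U.
  have [Ax|nA] := pselect (A x); last by exists set0.
  have [B nB QB] := loc x Ax; have [U [oU Ux UB]] := near_open nB.
  by exists U => _; split=> //; split=> //; exact: QS QB.
have : cover_compact A by rewrite -compact_cover.
move=> /(_ _ A U (fun x Ax => (HU x Ax).1)) [].
  by move=> x Ax; exists x => //; have [_ []] := HU x Ax.
move=> D DA cov; apply: (QS _ _ cov); rewrite /cover.
have H (s : seq rV) : (forall x, x \in s -> Q (U x)) -> Q [set y | exists2 x, x \in s & U x y].
  elim: s => [|x s IH] H; first by apply: (QS _ _ _ Q0) => y [x].
  apply: (QS _ _ _ (QU _ _ (H x (mem_head _ _)) (IH _))) => [y [i]|i hi].
    by rewrite inE => /orP[/eqP->|hi] ?; [left|right; exists i].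
  by apply: H; rewrite inE hi orbT.
apply: (QS _ _ _ (H (finmap.enum_fset D) _)) => [y [i /= hi Ui]|x hx]; first by exists i.
by have /HU [_ []] : A x by have := DA x hx; rewrite inE.
Qed.

Lemma compact_locbound (A : set rV) (f : rV -> R) : compact A ->
  (forall x, A x -> exists C : R, \forall y \near x, A y -> f y <= C) ->
  exists C : R, forall x, A x -> f x <= C.
Proof.
move=> cA loc.
suff [C HC] : exists C : R, forall x, A x -> A x -> f x <= C by exists C => x Ax; exact: HC.
apply: (@compact_ind A (fun S => exists C : R, forall x, S x -> A x -> f x <= C)) => //.
- by exists 0.
- move=> S T [C HC] [D HD]; exists (Num.max C D) => x [/HC h|/HD h] /h h'; rewrite le_max h' ?orbT //.
- by move=> S T ST [C HC]; exists C => x /ST; exact: HC.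
- by move=> x /loc [C HC]; exists [set y | A y -> f y <= C] => //; exists C.
Qed.

(** The inverse function theorem applies to the local extensions [G], not to [f], which matters only
    on [A]. Compactness and injectivity make the local inverse of [G] agree on [B] with the global
    inverse. *)
Lemma diffeomorphic_local (A B : set rV) (f : rV -> rV) : compact A ->
  (forall x, A x -> B (f x)) -> (forall x y, A x -> A y -> f x = f y -> x = y) ->
  (forall y, B y -> exists2 x, A x & f x = y) ->
  (forall x, A x -> exists2 G, smv G x /\ \det (jac G x) != 0 & \forall y \near x, A y -> f y = G y) ->
  diffeomorphic A B.
Proof.
move=> cA fB fI fS loc.
have /choice [g Hg] y : exists x, B y -> A x /\ f x = y.
  have [/fS [x Ax E]|nB] := pselect (B y); first by exists x.
  by exists 0.
exists f, g; split=> //; last first.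
- by move=> x Ax; split; [exact: fB|apply: fI => //; have [] := Hg _ (fB x Ax)].
- apply/smooth_on_rowP => y By; have [Ax Ey] := Hg y By.
  have [G [sG dG] nG] := loc _ Ax.
  have [A0 [B0 [h [[oA A0x oB HA] [fA hB sh]]]]] := inverse_function nG sG dG.
  have Gy : G (g y) = y by rewrite -(nbhs_singleton nG Ax).
  have B0y : B0 y by rewrite -Gy; exact: (fA _ A0x).1.
  exists h; first exact: (sh y B0y).1.
  suff H : \forall z \near y, B z -> A0 (g z).
    apply: filterS H => z H Bz; have A0z := H Bz.
    have [Agz Ez] := Hg z Bz; have [Ptz _ _] := HA _ A0z.
    by have [_ <-] := fA _ A0z; rewrite -Ptz // Ez.
  (* Otherwise points [u k] of [B] tend to [y] while [g (u k)] stays outside [A0]. A cluster point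
     of these preimages is mapped to [y], hence equals [g y], which lies in the open set [A0]. *)
  apply: contrapT => nH.
  have /choice [u Hu] (k : nat) : exists z, `|y - z| < k.+1%:R^-1 /\ B z /\ ~ A0 (g z).
    apply: contrapT => nk; apply: nH.
    apply: (@ball_nearP R rV _ y k.+1%:R^-1); first by rewrite invr_gt0.
    by move=> z hz Bz; apply: contrapT => nz; apply: nk; exists z.
  have [z Az cz] := @compact_cluster A (g \o u) cA (fun k => (Hg _ (Hu k).2.1).1).
  have fz : f z = y.
    apply/eqP; rewrite -subr_eq0 -normr_le0; apply/ler_addgt0Pl => e e0; rewrite addr0.
    have e2 : 0 < e / 2 by rewrite divr_gt0.
    have [K [sK _] nK] := loc z Az.
    have /(@cont_distP R rV rV) /(_ _ e2) cK := smv_continuous sK.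
    have [r r0 Hr] := near_ballP (nearI cK nK).
    have [N _ HN] := near_infty_natSinv_lt (PosNum e2).
    have [k Nk zk] := cz r r0 N; have [h1 h2] := Hr _ zk.
    have [[uk [Bk _]] Nk'] := (Hu k, HN k Nk).
    have [Agk Ek] := Hg _ Bk.
    have := h2 Agk; rewrite Ek => EK; rewrite -EK in h1.
    rewrite -(nbhs_singleton nK Az) in h1.
    have -> : f z - y = (f z - u k) - (y - u k) by rewrite opprB addrA subrK.
    apply: le_trans (ler_normB _ _) _.
    have : `|y - u k| < e / 2 by apply: lt_trans uk Nk'.
    by move=> h3; lra.
  have zE : z = g y by apply: fI => //; rewrite fz Ey.
  rewrite zE in cz.
  have [r r0 Hr] := near_ballP (open_near oA A0x).
  have [k _ zk] := cz r r0 0%N.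
  by have [_ [_]] := Hu k; apply; apply: Hr.
- by apply/smooth_on_rowP => x Ax; have [G [sG _] nG] := loc x Ax; exists G.
Qed.

(** Local extensions are multiplied by bump functions and added up. The sum of the bumps is not
    normalized to 1, so the result extends a positive multiple of [F]; this preserves rays. *)
Lemma global_extension (M : set rV) (F : rV -> rV) : compact M -> smooth_on M F ->
  exists (H : rV -> rV) (b : rV -> R),
   [/\ forall x, smv H x, forall j, csupp (fun x => H x 0 j), forall x, smo b x &
       forall x, M x -> 0 < b x /\ H x = b x *: F x].
Proof.
move=> cM /smooth_on_rowP sF.
pose Q (S : set rV) := exists (H : rV -> rV) (b : rV -> R),
   [/\ (forall x, smv H x) /\ (forall j, csupp (fun x => H x 0 j)), forall x, smo b x,
       forall x, 0 <= b x, forall x, M x -> H x = b x *: F x & forall x, M x -> S x -> 0 < b x].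
suff [H [b [[h1 h2] h3 _ h4 h5]]] : Q M.
  by exists H, b; split=> // x Mx; split; [exact: h5|exact: h4].
apply: compact_ind => //.
- exists (fun=> 0), (fun=> 0); split=> //.
  + by split=> [x|j]; [exact: smv_cst|exists 0 => x _; rewrite mxE].
  + by move=> x; apply: sm_smo; exact: sm_cst.
  + by move=> x _; rewrite scale0r.
- move=> S T [H [b [[h1 h2] h3 h0 h4 h5]]] [H' [b' [[k1 k2] k3 k0 k4 k5]]].
  exists (fun x => H x + H' x), (fun x => b x + b' x); split.
  + split=> [x|j]; first exact: smvD.
    have [M1 HM1] := h2 j; have [M2 HM2] := k2 j.
    exists (Num.max M1 M2) => x; rewrite gt_max => /andP[/HM1 + /HM2 +].
    by rewrite mxE => -> ->; rewrite addr0.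
  + by move=> x; apply: sm_smo; apply: smD; exact: sm_T.
  + by move=> x; exact: addr_ge0.
  + by move=> x Mx; rewrite h4 // k4 // scalerDl.
  + by move=> x Mx [Sx|Tx]; [apply: ltr_wpDr => //; exact: h5|apply: ltr_wpDl => //; exact: k5].
- move=> S T ST [H [b [h1 h2 h3 h4 h5]]]; exists H, b; split=> // x Mx Sx.
  by apply: h5 => //; exact: ST.
- move=> x Mx; have [G sG nG] := sF x Mx.
  have [r r0 Hr] := near_ballP (nearI (smv_near sG) nG).
  have r2 : 0 < r / 2 by rewrite divr_gt0.
  have rr : r / 2 < r by lra.
  have [chi [sc c0 c1 cr]] := bump_exists x r2.
  exists [set y | chi y = 1] => //.
  exists (fun y => chi y *: G y), chi; split=> //.
  + split=> [y j|j].
      suff : forall y, smo (fun y => (chi y *: G y) 0 j) y by exact: sm_T.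
      move=> z; apply: (smo_eq (f := fun y => chi y * G y 0 j)).
        by near=> u; rewrite mxE.
      apply: (bump_mul rr sc cr) => u /Hr [h _]; exact: h.
    have [N HN] := csupp_bump (fun y => G y 0 j) cr.
    by exists N => y /HN; rewrite mxE.
  + move=> y My; have [/Hr [_ ->] //|h] := ltP `|x - y| r.
    by rewrite cr ?scale0r //; apply: le_trans h; exact: ltW.
  + by move=> y _ /= ->.
Unshelve. all: by end_near.
Qed.

End Row.

(** * Behaviour of the orbits *)

Section Dynamics.
Context {R : realType} {n : nat}.
Local Notation rV := 'rV[R]_n.

Lemma norm_dot (x : rV) (r : R) : 0 <= r -> dot x x <= r ^+ 2 -> `|x| <= r.
Proof.
move=> r0 h; apply: norm_leP => // i.
rewrite -(@ler_pXn2r _ 2) ?nnegrE // real_normK ?num_real //.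
apply: le_trans h; rewrite /dot (bigD1 i) //= -expr2 lerDl.
by apply: sumr_ge0 => j _; rewrite -expr2 sqr_ge0.
Qed.

Lemma near_lt (V : normedModType R) (f : V -> R) x d : {for x, continuous f} -> f x < d ->
  \forall y \near x, f y < d.
Proof.
move=> cf fd; have fd0 : 0 < d - f x by rewrite subr_gt0.
have /(@cont_distP R V R) /(_ _ fd0) := cf.
by apply: filterS => y; rewrite ltr_norml => /andP[h _]; lra.
Qed.

Lemma near_gt (V : normedModType R) (f : V -> R) x d : {for x, continuous f} -> d < f x ->
  \forall y \near x, d < f y.
Proof.
move=> cf fd; have fd0 : 0 < f x - d by rewrite subr_gt0.
have /(@cont_distP R V R) /(_ _ fd0) := cf.
by apply: filterS => y; rewrite ltr_norml => /andP[_ h]; lra.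
Qed.

Lemma lconn_eq (V : normedModType R) (A B : V -> Prop) : (forall x, A x <-> B x) -> lconn A -> lconn B.
Proof. by move=> H; have -> : B = A by apply/funext => x; apply/propext; split => /H. Qed.

(** [G] is a chart centred at [p] and its Euclidean square a Lyapunov function: the inequality and
    Gronwall give exponential decay, at a rate uniform on [U]. The inequality is asked only on a
    forward invariant [S], so that the lemma also serves flows that preserve a hypersurface. *)
Lemma attractor (W : rV -> rV) (Phi : R -> rV -> rV) (S N : rV -> Prop) (G : rV -> rV) p (c : R) :
  is_flow W Phi -> (forall x t, S x -> 0 <= t -> S (Phi t x)) ->
  smv G p -> G p = 0 -> \det (jac G p) != 0 -> 0 < c ->
  (\forall x \near p, S x -> dot (G x) ('D_(W x) G x) <= - c * dot (G x) (G x)) ->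
  (\forall x \near p, N x) ->
  exists U : set rV, [/\ open U, U p, forall x, U x -> N x,
    forall x t, U x -> S x -> 0 <= t -> U (Phi t x) &
    forall e : R, 0 < e -> exists T : R, forall x t, U x -> S x -> 0 <= t -> T <= t -> `|p - Phi t x| < e].
Proof.
move=> HPhi SPhi sG G0 dG c0 ineq nN.
have [A [B [g [[oA Ap oB HA] [fA gB sg]]]]] := inverse_function (nearI nN ineq) sG dG.
have B0 : B 0 by rewrite -G0; exact: (fA p Ap).1.
have g0 : g 0 = p by rewrite -G0 (fA p Ap).2.
have /(@cont_distP R rV rV) cg : {for 0, continuous g} by apply: smv_continuous; exact: (sg 0 B0).1.
rewrite g0 in cg.
have [r r0 Hr] := near_ballP (open_near oA Ap).
have ball_small (e : R) : 0 < e -> exists2 d : R, 0 < d & forall x, A x -> dot (G x) (G x) < d -> `|p - x| < e.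
  move=> e0; have [d d0 Hd] := near_ballP (cg e e0).
  exists ((d / 2) ^+ 2); first by rewrite exprn_gt0 // divr_gt0.
  move=> x Ax hx; rewrite -(fA x Ax).2; apply: Hd; rewrite sub0r normrN.
  have d2 : 0 <= d / 2 by apply: divr_ge0 => //; exact: ltW.
  have h := norm_dot d2 (ltW hx).
  by apply: le_lt_trans h _; lra.
have r2 : 0 < r / 2 by rewrite divr_gt0.
(* In the chart [E < d] confines points to distance [r / 2] from [p], so an orbit in [U] cannot
   reach distance [r]. *)
have [d d0 Hd] := ball_small _ r2.
pose E x := dot (G x) (G x).
pose U : set rV := [set x | `|p - x| < r /\ E x < d].
have UA x : U x -> A x by move=> [h _]; exact: Hr.
have EP x t : S x -> 0 <= t -> (forall s, 0 <= s <= t -> A (Phi s x)) -> E (Phi t x) <= expR (- (2 * c) * t) * E x.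
  move=> Sx t0 At.
  have := @gronwall R (fun s => E (Phi s x)) (fun s => dot ('D_(W (Phi s x)) G (Phi s x)) (G (Phi s x)) + dot (G (Phi s x)) ('D_(W (Phi s x)) G (Phi s x))) (- (2 * c)) t t0.
  rewrite (flow0 HPhi); apply => s hs.
    have [_ sGs _] := HA _ (At s hs); have dGs := smv_differentiable sGs.
    have dE : differentiable E (Phi s x) by apply: sm_differentiable; exact: sm_dot.
    by have := flow_derf HPhi dE; rewrite derive_dot.
  have [[_ Is] _ _] := HA _ (At s hs).
  have Ss : S (Phi s x) by apply: SPhi => //; case/andP: hs.
  by have := Is Ss; rewrite [dot ('D__ _ _) _]dotC /E; lra.
have E0 x : 0 <= E x by exact: dot_ge0.
have inv x t : U x -> S x -> 0 <= t -> U (Phi t x).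
  move=> Ux Sx; move: t; apply: real_induction => t t0 Ht.
  suff Ut : U (Phi t x).
    have nU : \forall y \near Phi t x, U y.
      have [h1 h2] := Ut; have [_ sGt _] := HA _ (UA _ Ut).
      have cE : {for Phi t x, continuous E} by apply: sm_continuous; exact: sm_dot.
      apply: nearI; first exact: (@dist_lt_near R rV).
      exact: near_lt.
    have [e e0 He] := flow_near HPhi nU.
    exists e => // s ts se; apply: He; last by rewrite subrr normr0.
    by rewrite distrC ger0_norm; lra.
  have pt : `|p - Phi t x| < r.
    have [->|tn] := eqVneq t 0; first by rewrite (flow0 HPhi); case: Ux.
    have tp : 0 < t by rewrite lt_neqAle eq_sym tn.
    rewrite ltNge; apply/negP => rt.
    have nr : \forall y \near Phi t x, r / 2 < `|p - y|.
      have rr : 0 < `|p - Phi t x| - r / 2 by lra.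
      apply: (@ball_nearP R rV _ _ _ rr) => y; rewrite distrC => hy.
      have : `|p - Phi t x| <= `|p - y| + `|y - Phi t x| by rewrite -{1}(subrK y p) -addrA; exact: ler_normD.
      by move=> h; lra.
    have [e e0 He] := flow_near HPhi nr.
    pose s := Num.max 0 (t - e / 2).
    have s0 : 0 <= s by rewrite le_max lexx.
    have st : s < t by rewrite gt_max tp /= ltrBlDr ltrDl divr_gt0.
    have se : t - e / 2 <= s by rewrite le_max lexx orbT.
    have := He s x; rewrite subrr normr0 ger0_norm; last by lra.
    have te : t - s < e by lra.
    move=> /(_ te e0) h; have Us := Ht s s0 st.
    by have := Hd _ (UA _ Us) Us.2; rewrite ltNge ltW.
  split=> //; have At s : 0 <= s <= t -> A (Phi s x).
    move=> /andP[s0]; rewrite le_eqVlt => /orP[/eqP->|st]; first exact: Hr.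
    exact/UA/Ht.
  apply: le_lt_trans (EP x t Sx t0 At) _.
  have [_ Ex] := Ux; apply: le_lt_trans Ex; rewrite ler_piMl // -expR0 ler_expR.
  by rewrite mulNr oppr_le0 mulr_ge0 // mulr_ge0 // ltW.
exists U; split.
- rewrite openE => x Ux; have [h1 h2] := Ux; have [_ sGt _] := HA _ (UA _ Ux).
  have cE : {for x, continuous E} by apply: sm_continuous; exact: sm_dot.
  apply: nearI; first exact: (@dist_lt_near R rV).
  exact: near_lt.
- by split; rewrite ?subrr ?normr0 // /E G0 dot0l.
- by move=> x /UA /HA [[]].
- exact: inv.
- move=> e e0; have [q q0 Hq] := ball_small e e0.
  (* From [1 + y <= expR y]: after this time the decay factor has brought [d] below [q]. *)
  exists (d / (q * (2 * c))) => x t Ux Sx t0 ht; have Ut := inv x t Ux Sx t0.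
  apply: Hq; first exact: UA.
  have c2 : 0 < 2 * c by rewrite mulr_gt0.
  have At s : 0 <= s <= t -> A (Phi s x) by move=> /andP[s0 _]; exact/UA/inv.
  apply: le_lt_trans (EP x t Sx t0 At) _.
  have [_ Ex] := Ux.
  rewrite mulNr expRN mulrC ltr_pdivrMr ?expR_gt0 //.
  have h3 : d <= q * (2 * c * t).
    by move: ht; rewrite ler_pdivrMr ?mulr_gt0 // ; lra.
  have h4 : 1 + 2 * c * t <= expR (2 * c * t) by exact: expR_ge1Dx.
  have : q * (1 + 2 * c * t) <= q * expR (2 * c * t) by rewrite ler_pM2l.
  by lra.
Qed.

(** Transversality: the sign of the derivative along the field is left open and tells whether the
    orbit leaves or enters. *)
Definition boundary_point (Om : set rV) (F : rV -> rV) x := F x != 0 /\ exists rho : rV -> R,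
  [/\ sm rho x, rho x = 0, 'D_(fld F x) rho x != 0 &
      \forall y \near x, (Om y <-> rho y < 0) /\ (closure Om y <-> rho y <= 0)].

(** All that is kept of the boundary value problem; the boundary condition survives only as
    transversality of the kernel field. *)
Definition setting (Om : set rV) (F : rV -> rV) (Phi : R -> rV -> rV) :=
  [/\ [/\ open Om, lconn Om, compact (closure Om) & (0 < n)%N],
      (forall x, smv F x) /\ is_flow (fld F) Phi,
      forall x, closure Om x -> reg F x &
      forall x, closure Om x -> ~ Om x -> boundary_point Om F x].

(** The local picture where orbits leave: [th] is a smooth signed exit time, negative for points
    already outside the closure. For the reversed flow it describes entrance. *)
Definition outbox (Om : set rV) (Phi : R -> rV -> rV) x0 :=
  exists (U : set rV) (th : rV -> R) (d : R), [/\ open U, U x0, 0 < d & th x0 = 0] /\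
   forall x, U x -> [/\ sm th x, `|th x| < d & forall s, - d <= s <= d ->
      (Om (Phi s x) <-> s < th x) /\ (closure Om (Phi s x) <-> s <= th x)].

Definition revmx : 'M[R]_n := \matrix_(a, b) if a == b then (if a == 0%N :> nat then -1 else 1) else 0.
(* A reflection of the target preserves regularity and reverses the field, hence
   the time of its flow. *)
Definition rev (F : rV -> rV) x : rV := F x *m revmx.

Lemma revmx_diag : revmx = diag_mx (\row_a (if a == 0%N :> nat then -1 else 1)).
Proof. by apply/matrixP => a b; rewrite !mxE; case: eqP => [->|]; rewrite ?mulr1n ?mulr0n. Qed.

Lemma revmxK : revmx *m revmx = 1%:M.
Proof.
rewrite revmx_diag mulmx_diag; apply/matrixP => a b; rewrite !mxE.
by case: (a == b); case: (_ == 0%N); rewrite ?mulr1n ?mulr0n ?mulrNN ?mulr1.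
Qed.

Lemma det_revmx : (0 < n)%N -> \det revmx = -1.
Proof.
move=> n0; rewrite revmx_diag det_diag (bigD1 (Ordinal n0)) //= mxE /= big1 ?mulr1 // => i.
by rewrite mxE -val_eqE /= => /negbTE ->.
Qed.

Lemma revK F x : rev (rev F) x = F x.
Proof. by rewrite /rev -mulmxA revmxK mulmx1. Qed.

Lemma smv_rev F x : smv F x -> smv (rev F) x.
Proof.
move=> sF j; have -> : (fun y => rev F y 0 j) = (fun y => \sum_i F y 0 i * revmx i j).
  by rewrite funeqE => y; rewrite mxE.
by apply: sm_sum => i _; apply: smM; [exact: sF|exact: sm_cst].
Qed.

Lemma jac_rev F x : smv F x -> jac (rev F) x = jac F x *m revmx.
Proof.
move=> sF; apply/matrixP => i j; rewrite !mxE.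
have -> : (fun y => rev F y 0 j) = (fun y => (\row_k (revmx k j)) 0 j *+ 0 + dot (F y) (\row_k revmx k j)).
  by rewrite funeqE => y; rewrite mulr0n add0r mxE /dot; apply: eq_bigr => k _; rewrite mxE.
under [X in 'D__ X _ = _]eq_fun do rewrite mulr0n add0r.
rewrite derive_dot; [|exact: smv_differentiable|exact: differentiable_cst].
rewrite derive_cst_ dot0r addr0 /dot; apply: eq_bigr => k _.
by rewrite !mxE derive_rowE //; exact: smv_differentiable.
Qed.

Lemma fld_rev F x : (0 < n)%N -> smv F x -> fld (rev F) x = - fld F x.
Proof.
move=> n0 sF; apply/rowP => i; rewrite [RHS]mxE !fld_row jac_rev //.
rewrite (_ : \matrix_(a, b) _ = (\matrix_(a, b) if a == i then F x 0 b else jac F x a b) *m revmx).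
  by rewrite det_mulmx det_revmx // mulrN1.
apply/matrixP => a b; rewrite [LHS]mxE [RHS]mxE; case: (a =P i) => [->|ai].
  by rewrite /rev mxE; apply: eq_bigr => k _; rewrite !mxE eqxx.
by rewrite mxE; apply: eq_bigr => k _; rewrite [in RHS]mxE; case: (a =P i).
Qed.

Lemma reg_rev F x : smv F x -> reg F x -> reg (rev F) x.
Proof.
move=> sF rF v; rewrite /rev jac_rev // !trmx_mul !mulmxA => h1 h2.
have := rF (v *m revmx^T) h1 h2 => h3.
have rT : revmx^T = revmx by rewrite revmx_diag tr_diag_mx.
by rewrite -(mulmx1 v) -revmxK mulmxA -rT h3 mul0mx.
Qed.

Lemma is_flow_rev (W : rV -> rV) Phi : is_flow W Phi -> is_flow (fun x => - W x) (fun t => Phi (- t)).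
Proof.
move=> H; have [h0 hd hD hu hK] := H; split.
- by move=> x; rewrite oppr0.
- move=> t x; have := @is_derive_lin R rV (Phi^~ x) (-1) 0 t (W (Phi (- t) x)).
  rewrite mulN1r addr0 scaleN1r => H1.
  have -> : (fun s => Phi (- s) x) = (fun s => Phi (-1 * s + 0) x).
    by rewrite funeqE => s; rewrite mulN1r addr0.
  by apply: H1; exact: hd.
- by move=> s t x; rewrite opprD hD.
- move=> g t Hg; have := hu (fun s => g (- s)) (- t).
  rewrite opprK oppr0; apply => s; rewrite normrN => hs.
  have := @is_derive_lin R rV g (-1) 0 s (- W (g (- s))).
  rewrite mulN1r addr0 scaleN1r opprK => H1.
  have -> : (fun s => g (- s)) = (fun s => g (-1 * s + 0)).
    by rewrite funeqE => r; rewrite mulN1r addr0.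
  by apply: H1; apply: Hg; rewrite normrN.
- move=> T; have [K K0 HK] := hK T; exists K => // s t x y sT.
  have := HK (- s) (- t) x y; rewrite normrN => /(_ sT); rewrite opprK.
  have -> : - t + s = - (t - s) by ring.
  by rewrite normrN.
Qed.

Lemma setting_rev Om F Phi : setting Om F Phi -> setting Om (rev F) (fun t => Phi (- t)).
Proof.
move=> [[h1 h2 h3 n0] [sF fP] rF bP].
have fE x : fld (rev F) x = - fld F x by exact: fld_rev.
split; first by split.
- split; first by move=> x; exact: smv_rev.
  have -> : fld (rev F) = (fun x => - fld F x) by rewrite funeqE.
  exact: is_flow_rev.
- by move=> x Mx; apply: reg_rev => //; exact: rF.
- move=> x Mx nx; have [F0 [rho [s1 s2 s3 s4]]] := bP x Mx nx.
  split; first by apply: contra_neq F0 => E; have := revK F x; rewrite {1}/rev E mul0mx => <-.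
  exists rho; split; [exact: s1|exact: s2| |exact: s4].
  have -> : fld (rev F) x = (-1) *: fld F x by rewrite fE scaleN1r.
  rewrite deriveZv; last exact: sm_differentiable.
  by rewrite scaleN1r oppr_eq0.
Qed.

Lemma flow_period (W : rV -> rV) Phi x (T : R) : is_flow W Phi -> 0 < T -> Phi T x = x ->
  forall t, exists2 s, 0 <= s < T & Phi t x = Phi s x.
Proof.
move=> H T0 PT t.
have Pk (k : nat) s : Phi (s + k%:R * T) x = Phi s x.
  elim: k => [|k IH]; first by rewrite mul0r addr0.
  by rewrite -natr1 mulrDl mul1r addrA (flowD H) PT.
pose m := Num.floor (t / T).
have /andP[f1 f2] := floor_itv (t / T); rewrite -/m in f1 f2.
have d1 : m%:~R * T <= t by rewrite -ler_pdivlMr.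
have d2 : t < m%:~R * T + T by move: f2; rewrite ltr_pdivrMr // intrD mulrDl mul1r.
exists (t - m%:~R * T); first by apply/andP; split; lra.
case: (intP m) d1 d2 => [|k|k] d1 d2; first by rewrite mul0r subr0.
  by rewrite -{1}(subrK (k.+1%:R * T) t) Pk.
by rewrite mulrNz mulNr opprK Pk.
Qed.

End Dynamics.

(** * Orbits that leave, close up, or converge *)

Section Partition.
Context {R : realType} {n : nat}.
Local Notation rV := 'rV[R]_n.

Definition exits (Om : set rV) (Phi : R -> rV -> rV) x := exists2 t, 0 <= t & ~ closure Om (Phi t x).
Definition periodic (Om : set rV) (Phi : R -> rV -> rV) x :=
  (exists2 T, 0 < T & Phi T x = x) /\ forall t, Om (Phi t x).
Definition converges (P : R -> rV -> rV) z x :=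
  forall e : R, 0 < e -> exists T, forall t, T <= t -> `|z - P t x| < e.

Lemma converges_unique (P : R -> rV -> rV) z1 z2 x : converges P z1 x -> converges P z2 x -> z1 = z2.
Proof.
move=> a1 a2; apply/eqP; rewrite -subr_eq0 -normr_le0; apply/ler_addgt0Pl => e e0; rewrite addr0.
have e2 : 0 < e / 2 by rewrite divr_gt0.
have [T1 H1] := a1 _ e2; have [T2 H2] := a2 _ e2.
pose T := Num.max T1 T2.
have h1 : T1 <= T by rewrite le_max lexx.
have h2 : T2 <= T by rewrite le_max lexx orbT.
have -> : z1 - z2 = (z1 - P T x) - (z2 - P T x) by rewrite opprB addrA subrK.
apply: le_trans (ler_normB _ _) _.
by have := H1 T h1; have := H2 T h2; lra.
Qed.

Definition attracted (Om : set rV) (Phi : R -> rV -> rV) p x :=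
  (forall t, 0 <= t -> Om (Phi t x)) /\ converges Phi p x.

(* 'D_(fld F) F = det (jac F) F, so the sign of the determinant at a zero of F
   decides whether nearby orbits are attracted or repelled. *)
Definition sink (Om : set rV) (F : rV -> rV) p := [/\ Om p, F p = 0 & \det (jac F p) < 0].

(** In a chart [K] is a subspace of codimension at least 2, so its complement in a small ball is
    connected, and points off [K] are reached by moving in the chart along the image of [B]. *)
Lemma lconn_remove_chart (Om : set rV) (K : rV -> Prop) : open Om -> lconn Om ->
  (forall x, Om x -> K x -> exists (G : rV -> rV) k (A : 'M[R]_(n, k)) (B : 'M[R]_(k, n)),
     [/\ (2 <= k)%N, B *m A = 1%:M, smv G x, \det (jac G x) != 0 &
         \forall y \near x, K y <-> G y *m A = 0]) ->
  lconn (fun x => Om x /\ ~ K x) /\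
  (forall x, Om x -> forall B : set rV, nbhs x B -> exists y, [/\ B y, Om y & ~ K y]).
Proof.
move=> oO cO loc.
have dn x : Om x -> forall B : set rV, nbhs x B -> exists y, [/\ B y, Om y & ~ K y].
  move=> Ox C nC; have [Kx|Kx] := pselect (K x); last by exists x; split=> //; exact: nbhs_singleton.
  have [G [k [A [B [k2 BA sG dG KG]]]]] := loc x Ox Kx.
  have [A0 [B0 [g [[oA A0x oB HA] [fA gB sg]]]]] := inverse_function (nearI (open_near oO Ox) (nearI nC KG)) sG dG.
  have [r r0 Hr] := near_ballP (open_near oB (fA x A0x).1).
  have k0 : (0 < k)%N by exact: ltnW.
  pose v : rV := delta_mx 0 (Ordinal k0) *m B.
  pose e := r / (`|v| + 1).
  have v1 : 0 < `|v| + 1 by rewrite ltr_wpDl.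
  have e0 : 0 < e by rewrite divr_gt0.
  have Bz : B0 (G x + e *: v).
    apply: Hr; rewrite opprD addrA subrr sub0r normrN normrZ gtr0_norm //.
    by rewrite /e mulrAC ltr_pdivrMr // ltr_pM2l // ltrDl.
  have [Ag Eg] := gB _ Bz; have [[Og [Cg Kg]] _ _] := HA _ Ag.
  exists (g (G x + e *: v)); split=> // /Kg; rewrite Eg mulmxDl (nbhs_singleton KG).1 // add0r.
  rewrite -scalemxAl /v -mulmxA BA mulmx1 => /rowP /(_ (Ordinal k0)); rewrite !mxE !eqxx mulr1 => E.
  by rewrite E ltxx in e0.
split=> //; apply: lconn_remove => // x Ox Kx.
have [G [k [A [B [k2 BA sG dG KG]]]]] := loc x Ox Kx.
have [A0 [B0 [g [[oA A0x oB HA] [fA gB sg]]]]] := inverse_function (nearI (open_near oO Ox) KG) sG dG.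
have [r r0 Hr] := near_ballP (open_near oB (fA x A0x).1).
have GA0 : G x *m A = 0 by apply/(nbhs_singleton KG).
exists [set y | A0 y /\ `|G x - G y| < r]; split.
- apply: nearI; first exact: open_near.
  by have /(@cont_distP R rV rV) h := smv_continuous sG; exact: h.
- by move=> y [/HA [[]]].
have := lconn_image (lconn_codim k2 BA GA0 r0) (f := g).
have cg y : `|G x - y| < r /\ y *m A <> 0 -> {for y, continuous g}.
  by move=> [/Hr By _]; apply: smv_continuous; exact: (sg y By).1.
move=> /(_ cg); apply: lconn_eq => y; split.
  move=> [z [zr zA] <-]; have Bz := Hr _ zr; have [Ag Eg] := gB z Bz.
  have [[_ HK] _ _] := HA _ Ag.
  by split; [split=> //; rewrite Eg|move=> /HK; rewrite Eg].
move=> [[A0y yr] Ky]; exists (G y); last exact: (fA y A0y).2.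
by split=> // E; apply: Ky; have [[_ H] _ _] := HA y A0y; apply/H.
Qed.

Section Projections.
Variables (Om : set rV) (F : rV -> rV) (Phi : R -> rV -> rV).
Hypothesis HS : setting Om F Phi.
Lemma setting_open : open Om. Proof. by have [[]] := HS. Qed.
Lemma setting_conn : lconn Om. Proof. by have [[]] := HS. Qed.
Lemma setting_compact : compact (closure Om). Proof. by have [[]] := HS. Qed.
Lemma setting_pos : (0 < n)%N. Proof. by have [[]] := HS. Qed.
Lemma setting_smv x : smv F x. Proof. by have [_ [h _] _ _] := HS; exact: h. Qed.
Lemma setting_flow : is_flow (fld F) Phi. Proof. by have [_ [_ h] _ _] := HS. Qed.
Lemma setting_reg x : closure Om x -> reg F x. Proof. by have [_ _ h _] := HS; exact: h. Qed.
Lemma setting_boundary x : closure Om x -> ~ Om x -> boundary_point Om F x.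
Proof. by have [_ _ _ h] := HS; exact: h. Qed.
End Projections.

Section Setting.
Variables (Om : set rV) (F : rV -> rV) (Phi : R -> rV -> rV).
Hypothesis HS : setting Om F Phi.
Let M := closure Om.
Let w := fld F.

Let sF := setting_smv HS.
Let HPhi := setting_flow HS.
Let rF := setting_reg HS.

Lemma near_notM x : ~ M x -> \forall y \near x, ~ M y.
Proof.
by move=> nx; apply: (@open_near R rV (~` M)) => //; apply: closed_openC; exact: closed_closure.
Qed.

(** Monotonicity of [rho] along short orbits turns its sign into the order of times relative to
    [th]. *)
Lemma outbox_of x0 (rho : rV -> R) : M x0 -> F x0 != 0 -> sm rho x0 -> rho x0 = 0 ->
  0 < 'D_(w x0) rho x0 ->
  (\forall y \near x0, (Om y <-> rho y < 0) /\ (M y <-> rho y <= 0)) -> outbox Om Phi x0.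
Proof.
move=> Mx F0 sr r0 Dr nr.
have [U [th [d [[oU Ux d0 th0] H]]]] := crossing sF HPhi nr F0 (rF Mx) sr r0 Dr.
exists U, th, d; split; first by split.
move=> x Ux'; have [sth thd rth Qs mono] := H x Ux'.
split; [exact: sth|exact: thd|move=> s /andP[s1 s2]].
have [[p1 p2] [m1 m2]] := Qs s s1 s2.
move: thd; rewrite ltr_norml => /andP[t1 t2].
have lt1 : s < th x -> rho (Phi s x) < 0.
  by move=> h; rewrite -rth; apply: mono; [exact: s1|exact: h|exact: ltW].
have lt2 : th x < s -> 0 < rho (Phi s x).
  by move=> h; rewrite -rth; apply: mono; [exact: ltW|exact: h|exact: s2].
split; split.
- move=> /p1; rewrite !ltNge => /negP h; apply/negP; rewrite le_eqVlt => /orP[/eqP E|/lt2 /ltW//].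
  by apply: h; rewrite -E rth.
- by move=> /lt1.
- by move=> /m1; rewrite !leNgt => /negP h; apply/negP => /lt2.
- by rewrite le_eqVlt => /orP[/eqP E|/lt1 h]; apply: m2; [rewrite E rth|exact: ltW].
Qed.

End Setting.

Section SettingOrbits.
Variables (Om : set rV) (F : rV -> rV) (Phi : R -> rV -> rV).
Hypothesis HS : setting Om F Phi.
Let M := closure Om.
Let w := fld F.
Let Phi' := fun t => Phi (- t).

Let oO := setting_open HS.
Let cO := setting_conn HS.
Let cM := setting_compact HS.
Let n0 := setting_pos HS.
Let sF := setting_smv HS.
Let HPhi := setting_flow HS.
Let rF := setting_reg HS.
Let bP := setting_boundary HS.
Let OM := @subset_closure _ Om.

Lemma rev_neq0 x : F x != 0 -> rev F x != 0.
Proof. by apply: contra_neq => E; have := revK F x; rewrite {1}/rev E mul0mx => <-. Qed.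

Lemma boundary_box x : M x -> ~ Om x -> outbox Om Phi x \/ outbox Om Phi' x.
Proof.
move=> Mx nx; have [F0 [rho [s1 s2 s3 s4]]] := bP Mx nx.
have [h|h|h] := ltgtP 0 ('D_(w x) rho x).
- by left; exact: (outbox_of HS Mx F0 s1 s2 h s4).
- right; apply: (outbox_of (setting_rev HS) Mx (rev_neq0 F0) s1 s2 _ s4).
  have -> : fld (rev F) x = (-1) *: fld F x by rewrite fld_rev // scaleN1r.
  rewrite deriveZv; last exact: sm_differentiable.
  by rewrite scaleN1r oppr_gt0.
- by move: s3; rewrite -/(w x) -h eqxx.
Qed.

Lemma outbox_out (P : R -> rV -> rV) x : outbox Om P x -> exists2 d, 0 < d &
  forall s, 0 < s -> s <= d -> ~ M (P s x) /\ Om (P (- s) x).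
Proof.
move=> [U [th [d [[oU Ux d0 th0] H]]]]; exists d => // s s0 sd.
have [_ _ Hs] := H x Ux.
split; first by have [|_ [h _]] := Hs s; [apply/andP; split; lra|move=> /h; rewrite th0; lra].
by have [|[_ h] _] := Hs (- s); [apply/andP; split; lra|apply: h; rewrite th0; lra].
Qed.

(** By transversality an orbit cannot touch the boundary from inside: on one side of a boundary
    point it is outside the closure. *)
Lemma inner x (e : R) : 0 < e -> (forall s, `|s| < e -> M (Phi s x)) -> Om x.
Proof.
move=> e0 H; apply: contrapT => nx.
have Mx : M x by have := H 0; rewrite normr0 (flow0 HPhi) => /(_ e0).
have [/outbox_out|/outbox_out] := boundary_box Mx nx; move=> [d d0 Hd].
  pose s := Num.min d (e / 2).
  have s0 : 0 < s by rewrite lt_min d0 divr_gt0.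
  have sd : s <= d by rewrite ge_min lexx.
  have se : s <= e / 2 by rewrite ge_min lexx orbT.
  by have [] := Hd s s0 sd; move=> []; apply: H; rewrite gtr0_norm //; lra.
pose s := Num.min d (e / 2).
have s0 : 0 < s by rewrite lt_min d0 divr_gt0.
have sd : s <= d by rewrite ge_min lexx.
have se : s <= e / 2 by rewrite ge_min lexx orbT.
by have [] := Hd s s0 sd; move=> []; apply: H; rewrite normrN gtr0_norm //; lra.
Qed.

Lemma exits_open x : exits Om Phi x -> \forall y \near x, exits Om Phi y.
Proof.
move=> [t t0 nM]; have [d d0 Hd] := flow_near HPhi (near_notM nM).
apply: (@ball_nearP R rV _ x d d0) => y xy.
by exists t; [exact: t0|apply: Hd; [rewrite subrr normr0|exact: xy]].
Qed.

(** A neighbouring orbit is back in the box after [N] periods of [x]. Being on the same ray as its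
    start, it differs from it by a flow time below 1, so correcting by that time gives an exact
    period. *)
Lemma periodic_open x : F x != 0 -> periodic Om Phi x -> \forall y \near x, periodic Om Phi y.
Proof.
move=> F0 [[T T0 PT] Ot].
have Ox : Om x by rewrite -(flow0 HPhi x).
have [U [t [d [[oU Ux d0 st] [_ rayE tU]]]]] := timebox sF HPhi F0 (rF (OM Ox)).
have PN (k : nat) : Phi (k%:R * T) x = x.
  elim: k => [|k IH]; first by rewrite mul0r (flow0 HPhi).
  by rewrite -natr1 mulrDl mul1r (flowD HPhi) PT.
(* The total time exceeds 2, so that a correction below 1 leaves a positive period, covered by the
   tube up to [L + 1]. *)
pose N := (Num.truncn (2 / T)).+1.
have hN : 2 < N%:R * T by rewrite -ltr_pdivrMr //; exact: truncnS_gt.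
pose L := N%:R * T; rewrite -/L in hN.
have UL0 : \forall z \near Phi L x, U z by rewrite /L PN; exact: open_near.
have [e e0 He] := flow_near HPhi UL0.
have tube := @flow_tube _ _ _ _ HPhi Om 0 (L + 1) x oO (fun s _ => Ot s).
apply: filterS3 (open_near oU Ux) tube (@ball_nearP R rV (fun y => `|x - y| < e) x e e0 (fun _ h => h)) => y Uy ty xy.
have UL : U (Phi L y) by apply: He => //; rewrite subrr normr0.
have := rayE y (Phi L y) Uy UL (flow_ray sF HPhi y L).
set s := t _ - t _ => E.
have s1 : `|s| < 1 := tU _ _ Uy UL.
move: s1; rewrite ltr_norml => /andP[s1 s2].
have P0 : 0 < L - s by lra.
have PE : Phi (L - s) y = y by rewrite addrC (flowD HPhi) E (flowK HPhi).
split; first by exists (L - s).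
move=> r; have [q /andP[q0 q1] ->] := flow_period HPhi P0 PE r.
by apply: ty; apply/andP; split => //; lra.
Qed.

(** At a sink [F] itself is a chart and its square a Lyapunov function, since its derivative along
    the field is the determinant times [F]. Finite times are handled by a tube. *)
Lemma attracted_open p x : sink Om F p -> attracted Om Phi p x ->
  \forall y \near x, attracted Om Phi p y.
Proof.
move=> [Op Fp dp] [Ot At].
pose c := - \det (jac F p) / 2.
have c0 : 0 < c by rewrite /c; lra.
have cd : {for p, continuous (fun y => \det (jac F y))}.
  by apply: sm_continuous; apply: sm_det => i j; exact: sm_jac.
have ineq : \forall y \near p, True -> dot (F y) ('D_(w y) F y) <= - c * dot (F y) (F y).
  have hc : \det (jac F p) < - c by rewrite /c; lra.
  apply: filterS (near_lt cd hc) => y hy _.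
  by rewrite derive_fld // dotZr ler_wpM2r ?dot_ge0 // ltW.
have [U [oU Up UO Uinv Ucv]] := attractor HPhi (fun x t _ _ => I) (sF p) Fp (ltr0_neq0 dp) c0 ineq (open_near oO Op).
have [r r0 Hr] := near_ballP (open_near oU Up).
have [T HT] := At r r0.
pose T' := Num.max 0 T.
have T0 : 0 <= T' by rewrite le_max lexx.
have UT : U (Phi T' x) by apply: Hr; apply: HT; rewrite le_max lexx orbT.
have [e e0 He] := flow_near HPhi (open_near oU UT).
have tube := @flow_tube _ _ _ _ HPhi Om 0 T' x oO.
have tube' : \forall y \near x, forall s, 0 <= s <= T' -> Om (Phi s y) by apply: tube => s /andP[s0 _]; exact: Ot.
apply: filterS2 tube' (@ball_nearP R rV (fun y => `|x - y| < e) x e e0 (fun _ h => h)) => y ty xy.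
have Uy : U (Phi T' y) by apply: He => //; rewrite subrr normr0.
have sp s : T' <= s -> Phi s y = Phi (s - T') (Phi T' y) by rewrite -(flowD HPhi) subrK.
split=> [t t0|q q0].
  have [h|h] := leP t T'; first by apply: ty; apply/andP.
  by rewrite sp; [apply: UO; apply: Uinv => //; lra|exact: ltW].
have [T2 HT2] := Ucv q q0; exists (T' + Num.max 0 T2) => t ht.
have m1 : 0 <= Num.max 0 T2 by rewrite le_max lexx.
have m2 : T2 <= Num.max 0 T2 by rewrite le_max lexx orbT.
by rewrite sp; [apply: HT2 => //; lra|lra].
Qed.

Lemma attracted_near p : sink Om F p -> \forall y \near p, attracted Om Phi p y.
Proof.
move=> sp; apply: attracted_open => //; case: sp => Op Fp _.
have E t : Phi t p = p by apply: (flow_fix HPhi); exact: fld0.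
split=> [t _|e e0]; first by rewrite E.
by exists 0 => t _; rewrite E subrr normr0.
Qed.

Lemma attracted_shift p x t : (forall s, 0 <= s -> Om (Phi s x)) -> 0 <= t ->
  attracted Om Phi p (Phi t x) -> attracted Om Phi p x.
Proof.
move=> Ox t0 [_ cv]; split=> // e e0; have [T HT] := cv e e0.
exists (T + t) => s hs; rewrite -(subrK t s) (flowD HPhi); apply: HT; lra.
Qed.

Lemma attracted_neq_exits p x : attracted Om Phi p x -> ~ exits Om Phi x.
Proof. by move=> [Ot _] [t t0]; apply; apply: OM; exact: Ot. Qed.

Lemma periodic_neq_exits x : periodic Om Phi x -> ~ exits Om Phi x.
Proof. by move=> [_ Ot] [t t0]; apply; exact: OM. Qed.

Lemma zero_interior z : M z -> F z = 0 -> Om z /\ \det (jac F z) != 0.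
Proof.
move=> Mz Fz; split; first by apply: contrapT => /(bP Mz) []; rewrite Fz eqxx.
rewrite -det_tr; apply: unit_kernel => h hJ; apply: (rF Mz) => //.
by rewrite Fz trmx0 mulmx0.
Qed.

Lemma stays x : Om x -> ~ exits Om Phi x -> forall s, 0 <= s -> Om (Phi s x).
Proof.
move=> Ox nex; have Mt t : 0 <= t -> M (Phi t x).
  by move=> t0; apply: contrapT => h; apply: nex; exists t.
move=> s; rewrite le_eqVlt => /orP[/eqP<-|s0]; first by rewrite (flow0 HPhi).
apply: (inner s0) => r; rewrite ltr_norml => /andP[r1 r2].
by rewrite -(flowD HPhi); apply: Mt; lra.
Qed.

(** The orbit accumulates at some [z] of the compact closure. A zero [z] of negative determinant
    attracts it, one of positive determinant is impossible, and near any other [z] the box forces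
    periodicity. *)
Lemma trapped x : Om x -> F x != 0 -> ~ exits Om Phi x ->
  (exists2 p, sink Om F p & attracted Om Phi p x) \/ periodic Om Phi x.
Proof.
move=> Ox F0 nex; have Ot := stays Ox nex.
(* Sampling times 2 apart exceed the time differences, below 1, inside a box. *)
pose u (k : nat) := Phi (2 * k%:R) x.
have u0 k : 0 <= 2 * k%:R :> R by rewrite mulr_ge0.
have [z Mz cz] := @compact_cluster _ _ M u cM (fun k => OM (Ot _ (u0 k))).
have [Fz|Fz] := eqVneq (F z) 0.
  have [Oz dz] := zero_interior Mz Fz.
  have [dneg|dpos] := ltP (\det (jac F z)) 0.
    left; exists z => //.
    have [r r0 Hr] := near_ballP (attracted_near (And3 Oz Fz dneg)).
    have [k _ zk] := cz r r0 0%N.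
    exact: (attracted_shift Ot (u0 k) (Hr _ zk)).
  have dpos' : 0 < \det (jac F z) by rewrite lt_neqAle eq_sym dz.
  (* The reversed flow is attracted by [z] uniformly near [z]. Started at a late [u k] close to [z],
     it is back at [x] at a time when it must be arbitrarily near [z]; so [x = z], although [F x] is
     not 0. *)
  exfalso.
  pose c := \det (jac F z) / 2.
  have c0 : 0 < c by rewrite divr_gt0.
  have cd : {for z, continuous (fun y => \det (jac F y))}.
    by apply: sm_continuous; apply: sm_det => i j; exact: sm_jac.
  have ineq : \forall y \near z, True -> dot (F y) ('D_(- w y) F y) <= - c * dot (F y) (F y).
    have hc : c < \det (jac F z) by rewrite /c; lra.
    apply: filterS (near_gt cd hc) => y hy _.
    have -> : - w y = (-1) *: w y by rewrite scaleN1r.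
    rewrite deriveZv; last exact: smv_differentiable.
    rewrite scaleN1r dotNr derive_fld // dotZr -mulNr ler_wpM2r ?dot_ge0 // lerN2 ltW //.
  have [U [oU Uz _ Uinv Ucv]] := attractor (is_flow_rev HPhi) (fun x t _ _ => I) (sF z) Fz dz c0 ineq (open_near oO Oz).
  suff E : z = x by rewrite E in Fz; rewrite Fz eqxx in F0.
  apply/eqP; rewrite -subr_eq0 -normr_le0; apply/ler_addgt0Pl => e e0; rewrite addr0.
  have [T HT] := Ucv e e0.
  have [r r0 Hr] := near_ballP (open_near oU Uz).
  have [k Nk zk] := cz r r0 (Num.truncn `|T|).+1.
  have Tk : T <= 2 * k%:R.
    apply: le_trans (ler_norm T) _; apply: le_trans (ltW (truncnS_gt `|T|)) _.
    have h1 : (Num.truncn `|T|).+1%:R <= k%:R :> R by rewrite ler_nat.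
    have h2 : 0 <= k%:R :> R by [].
    by lra.
  have := HT _ _ (Hr _ zk) I (u0 k) Tk; rewrite /u (flowK HPhi) => h; exact: ltW.
right.
(* Two visits to a box around [z], at least 2 apart along the orbit but less than 1 apart inside the
   box. *)
have [U [t [d [[oU Uz d0 st] [_ rayE tU]]]]] := timebox sF HPhi Fz (rF Mz).
have [r r0 Hr] := near_ballP (open_near oU Uz).
have [k _ zk] := cz r r0 0%N; have [l kl zl] := cz r r0 k.+1.
have Uk := Hr _ zk; have Ul := Hr _ zl.
pose L : R := 2 * (l%:R - k%:R).
have L2 : 2 <= L.
  have : k.+1%:R <= l%:R :> R by rewrite ler_nat.
  by rewrite -natr1 /L; lra.
have EL : u l = Phi L (u k) by rewrite /u -(flowD HPhi) /L mulrBr subrK.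
have ry : ray F (u k) (u l) by rewrite EL; exact: flow_ray.
have := rayE _ _ Uk Ul ry; set s := t _ - t _ => E.
have s1 : `|s| < 1 := tU _ _ Uk Ul.
move: s1; rewrite ltr_norml => /andP[s1 s2].
have P0 : 0 < L - s by lra.
have PE : Phi (L - s) (u k) = u k by rewrite addrC (flowD HPhi) -EL E (flowK HPhi).
have PX : Phi (L - s) x = x.
  rewrite -{1}(flowK HPhi (2 * k%:R) x) -(flowD HPhi) addrC (flowD HPhi) -/(u k) PE.
  exact: (flowK HPhi).
split; first by exists (L - s).
by move=> q; have [v /andP[v0 _] ->] := flow_period HPhi P0 PX q; exact: Ot.
Qed.

Lemma punctured : (2 <= n)%N -> lconn (fun x => Om x /\ ~ F x = 0) /\
  (forall x, Om x -> forall B : set rV, nbhs x B -> exists y, [/\ B y, Om y & ~ F y = 0]).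
Proof.
move=> n2; apply: lconn_remove_chart => // x Ox Fx.
exists F, n, 1%:M, 1%:M; split=> //; first by rewrite mulmx1.
  by have [_] := zero_interior (OM Ox) Fx.
by apply: filterE => y; rewrite mulmx1.
Qed.

(** Leaving is open, and so is its negation, which by [trapped] means attraction by a sink or
    periodicity. *)
Lemma exits_all : (2 <= n)%N -> forall x y, Om x -> F x != 0 -> Om y -> F y != 0 ->
  exits Om Phi x -> exits Om Phi y.
Proof.
move=> n2 x y Ox /eqP Fx Oy /eqP Fy; have [cn _] := punctured n2.
apply: (cn (exits Om Phi)) => // z [Oz Fz].
  by move=> h; apply: filterS (exits_open h).
move=> nex; have /eqP Fz' := Fz.
have [[p sp ap]|pz] := trapped Oz Fz' nex.
  by apply: filterS (attracted_open sp ap) => u h _; exact: attracted_neq_exits h.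
by apply: filterS (periodic_open Fz' pz) => u h _; exact: periodic_neq_exits h.
Qed.

End SettingOrbits.

Section Dichotomy.
Variables (Om : set rV) (F : rV -> rV) (Phi : R -> rV -> rV).
Hypothesis HS : setting Om F Phi.
Hypothesis n2 : (2 <= n)%N.
Let M := closure Om.
Let Phi' := fun t => Phi (- t).
Let HPhi := setting_flow HS.
Let sF := setting_smv HS.

Lemma outbox_exits x : M x -> ~ Om x -> outbox Om Phi x ->
  exists y, [/\ Om y, F y != 0 & exits Om Phi y].
Proof.
move=> Mx nx bx; have [d d0 Hd] := outbox_out bx.
have [h1 h2] := Hd d d0 (lexx _).
have [F0 _] := setting_boundary HS Mx nx.
exists (Phi (- d) x); split=> //.
  by apply: ray_neq0 F0; exact: flow_ray.
by exists (d + d); [lra|rewrite -(flowD HPhi) addrK].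
Qed.

(** Just inside a boundary point there is an orbit that leaves, in one of the two time directions;
    connectedness spreads this to all orbits. *)
Lemma exits_either x : M x -> ~ Om x ->
  (forall y, Om y -> F y != 0 -> exits Om Phi y) \/ (forall y, Om y -> F y != 0 -> exits Om Phi' y).
Proof.
move=> Mx nx; have [b|b] := boundary_box HS Mx nx.
  left=> y Oy Fy; have [z [Oz Fz ez]] := outbox_exits Mx nx b.
  exact: (exits_all HS n2 Oz Fz Oy Fy).
right=> y Oy Fy.
have [d d0 Hd] := outbox_out b.
have [h1 h2] := Hd d d0 (lexx _).
have [F0 _] := setting_boundary HS Mx nx.
have Fz : F (Phi (- - d) x) != 0 by apply: ray_neq0 F0; exact: flow_ray.
apply: (exits_all (setting_rev HS) n2 h2 (rev_neq0 Fz) Oy (rev_neq0 Fy)).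
by exists (d + d); [lra|rewrite -(flowD HPhi) opprK opprD addrNK].
Qed.

(** If one orbit does not leave backwards, none does. Periodic orbits are excluded because all leave
    forwards, so each comes from a zero; which zero it is depends on the orbit in a locally constant
    way. *)
Lemma backward : (forall y, Om y -> F y != 0 -> exits Om Phi y) -> (exists y, Om y /\ F y != 0) ->
  (forall y, Om y -> F y != 0 -> exits Om Phi' y) \/
  exists p, [/\ Om p, F p = 0, 0 < \det (jac F p) &
     forall y, Om y -> F y != 0 -> attracted Om Phi' p y].
Proof.
move=> ex [y0 [Oy0 Fy0]].
have HS' := setting_rev HS.
have [e0|ne0] := pselect (exits Om Phi' y0).
  left=> y Oy Fy.
  exact: (exits_all HS' n2 Oy0 (rev_neq0 Fy0) Oy (rev_neq0 Fy)).
right.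
have all_sink y : Om y -> F y != 0 -> exists2 p, sink Om (rev F) p & attracted Om Phi' p y.
  move=> Oy Fy.
  have ney : ~ exits Om Phi' y.
    by move=> ey; apply: ne0; exact: (exits_all HS' n2 Oy (rev_neq0 Fy) Oy0 (rev_neq0 Fy0)).
  have [//|py] := trapped HS' Oy (rev_neq0 Fy) ney.
  exfalso; have [t t0 nM] := ex y Oy Fy; apply: nM; apply: subset_closure.
  by have := py.2 (- t); rewrite opprK.
have [p [Op rFp dp] ap] := all_sink y0 Oy0 Fy0.
have Fp : F p = 0 by have := revK F p; rewrite {1}/rev rFp mul0mx.
exists p; split=> //.
  have n0 : (0 < n)%N by exact: ltnW.
  by move: dp; rewrite jac_rev // det_mulmx det_revmx // mulrN1 oppr_lt0.
move=> y Oy /eqP Fy; have [cn _] := punctured HS n2.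
have /eqP Fy0' := Fy0.
apply: (cn (attracted Om Phi' p) _ _ y0 y) => // z [Oz Fz] az.
  by apply: filterS (attracted_open HS' (And3 Op rFp dp) az).
have /eqP Fz' := Fz.
have [q sq aq] := all_sink z Oz Fz'.
apply: filterS (attracted_open HS' sq aq) => v [_ av] _ [_ av'].
apply: az; suff -> : p = q by [].
exact: converges_unique av' av.
Qed.

End Dichotomy.
End Partition.

(** * The exit time and its smoothness *)

Section ExitTime.
Context {R : realType} {n : nat}.
Local Notation rV := 'rV[R]_n.

(** Time 0 is excluded from the second condition so that the start may lie on the boundary; the
    outbox says that the orbit really leaves at [t]. *)
Definition hit (Om : set rV) (Phi : R -> rV -> rV) x t :=
  [/\ 0 <= t, forall s, 0 < s -> s < t -> Om (Phi s x), closure Om (Phi t x), ~ Om (Phi t x) &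
      outbox Om Phi (Phi t x)].

(** For a boundary point the exit time is defined on one side of its orbit only; this suffices to
    compute the derivative of a smooth extension. *)
Lemma is_derive_one_side (h : R -> R) (l a b e : R) : is_derive (0 : R) (1 : R) h l -> 0 < e ->
  (forall s, 0 < s -> s < e -> h s = a + b * s) -> l = b.
Proof.
move=> Hd e0 H.
have h0 : h 0 = a.
  have ch : {for (0 : R), continuous (fun s => h s - b * s)}.
    apply: (@cvgB R R^o); first exact: (is_derive_continuous Hd).
    by apply: (@cvgMr R); exact: cvg_id.
  apply/eqP; rewrite -subr_eq0 -normr_le0; apply/ler_addgt0Pl => q q0; rewrite addr0.
  have /(@cont_distP R R^o R^o) /(_ q q0) /near_ballP [d d0 Hd'] := ch.
  pose s := Num.min (d / 2) (e / 2).
  have s0 : 0 < s by rewrite lt_min !divr_gt0.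
  have sd : s <= d / 2 by rewrite ge_min lexx.
  have se : s <= e / 2 by rewrite ge_min lexx orbT.
  have := Hd' s; rewrite sub0r normrN gtr0_norm // mulr0 subr0 => /(_ _).
  have Es : h s = a + b * s by apply: H => //; lra.
  have sdd : s < d by lra.
  by rewrite Es addrK => /(_ sdd) /ltW.
have Hq : is_derive (0 : R) (1 : R) (fun s : R => h s - (a + b * s)) (l - b).
  apply: is_deriveB_ => //.
  have := is_deriveD_ (is_derive_cst a (0 : R) (1 : R)) (is_deriveM_ (is_derive_cst b (0 : R) (1 : R)) (is_derive_id (0 : R) (1 : R))).
  by rewrite add0r mulr1 mulr0 addr0.
apply/eqP; rewrite -subr_eq0 -normr_le0; apply/ler_addgt0Pl => q q0; rewrite addr0.
have [dq Dq] := Hq.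
have /cvgrPdist_lt /(_ q q0) := dq.
rewrite -/(derive _ _ _) Dq => /nbhs_ballP [d /= d0 Hd'].
pose s := Num.min (d / 2) (e / 2).
have s0 : 0 < s by rewrite lt_min !divr_gt0.
have sd : s <= d / 2 by rewrite ge_min lexx.
have se : s <= e / 2 by rewrite ge_min lexx orbT.
have := Hd' s; rewrite -ball_normE /= sub0r normrN gtr0_norm // => H1.
have {H1} := H1 _ (lt0r_neq0 s0); rewrite /= [s *: 1]mulr1 addr0 H; [|lra|lra].
rewrite h0 mulr0 addr0 !subrr scaler0 subr0 => H1.
by apply/ltW/H1; lra.
Qed.

Lemma smv_near_neq0 (F : rV -> rV) x : smv F x -> F x != 0 -> \forall y \near x, F y != 0.
Proof.
move=> sF Fx; have := @near_neq0 R rV (fun y => dot (F y) (F y)) x.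
rewrite dot_eq0 => /(_ _ Fx) H.
by apply: filterS (H (sm_continuous (sm_dot sF sF))) => y; rewrite dot_eq0.
Qed.

Section Setting.
Variables (Om : set rV) (F : rV -> rV) (Phi : R -> rV -> rV).
Hypothesis HS : setting Om F Phi.
Hypothesis EX : forall y, Om y -> F y != 0 -> exits Om Phi y.
Let M := closure Om.
Let w := fld F.
Let oO := setting_open HS.
Let sF := setting_smv HS.
Let HPhi := setting_flow HS.
Let rF := setting_reg HS.
Let OM := @subset_closure _ Om.

Lemma flow_left x t (Q : rV -> Prop) : 0 < t -> (\forall y \near Phi t x, Q y) ->
  exists s, [/\ 0 <= s, s < t & Q (Phi s x)].
Proof.
move=> t0 /(flow_near HPhi) [e e0 He].
exists (Num.max 0 (t - e / 2)).
have s0 : 0 <= Num.max 0 (t - e / 2) by rewrite le_max lexx.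
have st : Num.max 0 (t - e / 2) < t by rewrite gt_max t0 /= ltrBlDr ltrDl divr_gt0.
have se : t - e / 2 <= Num.max 0 (t - e / 2) by rewrite le_max lexx orbT.
split=> //; apply: He; last by rewrite subrr normr0.
by rewrite gtr0_norm ?subr_gt0 //; lra.
Qed.

(** Short-time flows are smooth by [timebox]; real induction and the group law compose them up to
    time [t]. *)
Lemma flow_smv x t : 0 <= t ->
  (forall s, 0 <= s <= t -> F (Phi s x) != 0 /\ reg F (Phi s x)) -> smv (Phi t) x.
Proof.
move=> t0 H; suff Q : forall s, 0 <= s -> s <= t -> smv (Phi s) x by exact: Q.
apply: real_induction => s s0 IH.
have [st|ts] := leP s t; last by exists 1 => // r sr _ rt; move: (le_lt_trans rt ts); rewrite ltNge sr.
have [Fs rs] := H s (introT andP (conj s0 st)).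
have [U [tt [d [[oU Ux d0 _] [sm_ _ _]]]]] := timebox sF HPhi Fs rs.
have Phi0 : smv (Phi 0) x.
  apply: smv_eq (@smv_id _ _ x); apply: filterE => y; by rewrite (flow0 HPhi).
have [q [q0 qs sq Uq qd]] : exists q, [/\ 0 <= q, q <= s, smv (Phi q) x, U (Phi q x) & s - d / 2 < q].
  have [s00|sn] := eqVneq s 0.
    exists 0; rewrite s00; split=> //; first by rewrite -s00 in Ux *.
    by rewrite sub0r oppr_lt0 divr_gt0.
  have sp : 0 < s by rewrite lt_neqAle eq_sym sn.
  have [e e0 He] := flow_near HPhi (open_near oU Ux).
  pose q := Num.max 0 (s - Num.min e d / 3).
  have m0 : 0 < Num.min e d by rewrite lt_min e0.
  have m1 : Num.min e d <= e by rewrite ge_min lexx.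
  have m2 : Num.min e d <= d by rewrite ge_min lexx orbT.
  have q0 : 0 <= q by rewrite le_max lexx.
  have q1 : s - Num.min e d / 3 <= q by rewrite le_max lexx orbT.
  have qs : q < s by rewrite gt_max sp /=; lra.
  exists q; split=> //; [exact: ltW|by apply: IH => //; lra| |lra].
  by apply: He; [rewrite gtr0_norm ?subr_gt0 //; lra|rewrite subrr normr0].
exists (d / 2); first by rewrite divr_gt0.
move=> r sr rd rt.
have E y : Phi r y = Phi (r - q) (Phi q y) by rewrite -(flowD HPhi) subrK.
apply: (@smv_eq R rV n (fun y => Phi (r - q) (Phi q y))); first by apply: filterE => y; rewrite E.
apply: (@smv_comp R rV n n (Phi q) (Phi (r - q))); last exact: sq.
by apply: sm_; [exact: Uq|rewrite ger0_norm; lra].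
Qed.

(** Without a hit, real induction would keep the orbit in the domain forever: it cannot reach a
    boundary point of the entering type from inside. A start of that type is first moved inside. *)
Lemma hit_exists x : M x -> F x != 0 -> exists t, hit Om Phi x t.
Proof.
have HO y : Om y -> F y != 0 -> exists t, hit Om Phi y t.
  move=> Oy Fy; apply: contrapT => nh.
  suff H t : 0 <= t -> Om (Phi t y) by have [t t0 []] := EX Oy Fy; apply: OM; exact: H.
  move: t; apply: real_induction => t t0 Ht.
  suff Ot : Om (Phi t y).
    have [e e0 He] := flow_near HPhi (open_near oO Ot).
    by exists e => // s ts se; apply: He; [rewrite distrC ger0_norm; lra|rewrite subrr normr0].
  have [->|tn] := eqVneq t 0; first by rewrite (flow0 HPhi).
  have tp : 0 < t by rewrite lt_neqAle eq_sym tn.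
  have Mt : M (Phi t y).
    by apply: contrapT => /near_notM /(flow_left tp) [s [s0 st]]; apply; exact/OM/Ht.
  apply: contrapT => nO; have [b|/outbox_out [d d0 Hd]] := boundary_box HS Mt nO.
    by apply: nh; exists t; split=> // s s0 st; apply: Ht => //; exact: ltW.
  pose s := Num.min d t.
  have s0 : 0 < s by rewrite lt_min d0.
  have sd : s <= d by rewrite ge_min lexx.
  have st : s <= t by rewrite ge_min lexx orbT.
  have [nM _] := Hd s s0 sd; apply: nM; apply: OM.
  by rewrite -(flowD HPhi); apply: Ht; lra.
move=> Mx Fx; have [Ox|nx] := pselect (Om x); first exact: HO.
have [b|/outbox_out [d d0 Hd]] := boundary_box HS Mx nx.
  by exists 0; split; rewrite ?(flow0 HPhi) // => s s0 /(lt_trans s0); rewrite ltxx.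
have Os s : 0 < s -> s <= d -> Om (Phi s x) by move=> s0 sd; have [_] := Hd s s0 sd; rewrite opprK.
have [|t [t0 Ht h1 h2 h3]] := HO (Phi d x) (Os d d0 (lexx _)).
  by apply: ray_neq0 Fx; exact: flow_ray.
exists (t + d); rewrite -(flowD HPhi) in h1 h2 h3; split=> //; first by lra.
move=> s s0 st; have [sd|sd] := leP s d; first exact: Os.
by rewrite -(subrK d s) (flowD HPhi); apply: Ht; lra.
Qed.

Lemma hit_lt x t s : hit Om Phi x t -> t < s -> exists r, [/\ t < r, r < s & ~ M (Phi r x)].
Proof.
move=> [_ _ _ _ /outbox_out [d d0 Hd]] ts.
pose e := Num.min d ((s - t) / 2).
have e0 : 0 < e by rewrite lt_min d0 /=; lra.
have ed : e <= d by rewrite ge_min lexx.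
have es : e <= (s - t) / 2 by rewrite ge_min lexx orbT.
exists (e + t); split; [lra|lra|rewrite (flowD HPhi); exact: (Hd e e0 ed).1].
Qed.

Lemma hit_inside x t s : M x -> hit Om Phi x t -> 0 <= s -> s <= t -> M (Phi s x).
Proof.
move=> Mx [t0 Ht h1 _ _]; rewrite le_eqVlt => /orP[/eqP<-|s0]; first by rewrite (flow0 HPhi).
by rewrite le_eqVlt => /orP[/eqP->//|st]; apply: OM; exact: Ht.
Qed.

Lemma hit_unique x t1 t2 : M x -> hit Om Phi x t1 -> hit Om Phi x t2 -> t1 = t2.
Proof.
move=> Mx.
have H a b : hit Om Phi x a -> hit Om Phi x b -> a < b -> False.
  move=> ha hb ab; have [r [ar rb]] := hit_lt ha ab; apply.
  by apply: (hit_inside Mx hb); [case: ha => a0 _ _ _ _; lra|exact: ltW].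
by move=> h1 h2; have [/(H _ _ h1 h2)|/(H _ _ h2 h1)|] := ltgtP t1 t2.
Qed.

Lemma hit_shift x t s : M x -> hit Om Phi x t -> 0 <= s -> s <= t -> hit Om Phi (Phi s x) (t - s).
Proof.
move=> Mx [t0 Ht h1 h2 h3] s0 st; split; rewrite -?(flowD HPhi) ?subrK //; first by lra.
by move=> r r0 rt; rewrite -(flowD HPhi); apply: Ht; lra.
Qed.

(** A positive exit time excludes that [x] is a boundary point where orbits leave; if orbits enter
    there, the box of the reversed flow gives an initial time uniform in [y]. *)
Lemma enter_near x t : M x -> hit Om Phi x t -> 0 < t ->
  exists2 e : R, 0 < e & \forall y \near x, M y -> forall s, 0 < s -> s <= e -> Om (Phi s y).
Proof.
move=> Mx Hx t0; have [Ox|nx] := pselect (Om x).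
  have O0 : \forall y \near Phi 0 x, Om y by rewrite (flow0 HPhi); exact: open_near.
  have [e e0 He] := flow_near HPhi O0.
  exists (e / 2); first by rewrite divr_gt0.
  apply: (@ball_nearP R rV _ x e e0) => y xy _ s s0 se; apply: He => //.
  by rewrite sub0r normrN gtr0_norm //; lra.
have [/outbox_out [d d0 Hd]|[U [th [d [[oU Ux d0 th0] H]]]]] := boundary_box HS Mx nx.
  pose s := Num.min d t.
  have s0 : 0 < s by rewrite lt_min d0.
  have sd : s <= d by rewrite ge_min lexx.
  have st : s <= t by rewrite ge_min lexx orbT.
  by have [[]] := Hd s s0 sd; apply: (hit_inside Mx Hx) => //; exact: ltW.
exists d => //; apply: filterS (open_near oU Ux) => y Uy My s s0 sd.
have [_ _ Hs] := H y Uy.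
have [|_ [h _]] := Hs 0; first by rewrite oppr_le0 ltW //= ltW.
rewrite oppr0 (flow0 HPhi) in h; have thy := h My.
have [|[_ h'] _] := Hs (- s); first by apply/andP; split; lra.
by rewrite opprK in h'; apply: h'; lra.
Qed.

(** The candidate is [t + th (Phi t y)]: flow for the exit time of [x], then correct inside the box
    at its exit point. That the orbit of [y] has not left before is shown near time 0 by
    [enter_near], on a compact middle interval by a tube, and at the end by the box. *)
Lemma hit_local x t : M x -> F x != 0 -> hit Om Phi x t ->
  exists2 G : rV -> R, sm G x & \forall y \near x, M y -> hit Om Phi y (G y).
Proof.
move=> Mx Fx Hx; have [t0 Ht Mt nt [U [th [d [[oU Ux d0 th0] H]]]]] := Hx.
have sP : smv (Phi t) x.
  apply: flow_smv => // s /andP[s0 st]; split; last exact/rF/(hit_inside Mx Hx).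
  by apply: ray_neq0 Fx; exact: flow_ray.
have cP := smv_continuous sP.
pose G y := t + th (Phi t y).
have [sth _ _] := H _ Ux.
have sth' : sm (fun y => th (Phi t y)) x by exact: (@sm_comp R rV n (Phi t) th).
exists G; first by apply: smD => //; exact: sm_cst.
have nU := near_comp cP (open_near oU Ux).
have fin y : U (Phi t y) -> 0 <= G y -> (forall s, 0 < s -> s < G y -> Om (Phi s y)) -> hit Om Phi y (G y).
  move=> Uy Gy Hy; have [_ thy Hs] := H _ Uy.
  move: thy; rewrite ltr_norml => /andP[th1 th2].
  have E s : Phi (s + t) y = Phi s (Phi t y) by rewrite (flowD HPhi).
  have GE : Phi (G y) y = Phi (th (Phi t y)) (Phi t y) by rewrite /G addrC E.
  have thd : - d <= th (Phi t y) <= d by apply/andP; split; exact: ltW.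
  have [[h1 _] [_ h2]] := Hs _ thd.
  have MG : M (Phi (G y) y) by rewrite GE; exact: h2.
  have nG : ~ Om (Phi (G y) y) by rewrite GE => /h1; rewrite ltxx.
  split=> //; have [//|/outbox_out [e e0 He]] := boundary_box HS MG nG.
  (* The exit point of [y] cannot be of the entering type, as the box puts slightly earlier points
     of the orbit in the closure. *)
  exfalso; pose s := Num.min e (th (Phi t y) + d).
  have s0 : 0 < s by rewrite lt_min e0 /=; lra.
  have se : s <= e by rewrite ge_min lexx.
  have sd : s <= th (Phi t y) + d by rewrite ge_min lexx orbT.
  have [nM _] := He s s0 se; apply: nM; rewrite GE -(flowD HPhi).
  by have [|_ [_ h3]] := Hs (- s + th (Phi t y)); [apply/andP; split; lra|apply: h3; lra].
have [tz|tn] := eqVneq t 0.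
  apply: filterS nU => y Uy My; have [_ thy Hs] := H _ Uy.
  move: thy; rewrite ltr_norml => /andP[th1 th2].
  have Py : Phi t y = y by rewrite tz (flow0 HPhi).
  have th_ge : 0 <= th y.
    have [|_ [h _]] := Hs 0; first by rewrite oppr_le0 ltW //= ltW.
    by rewrite (flow0 HPhi) Py in h; exact: h.
  apply: fin => //; first by rewrite /G Py tz add0r.
  move=> s s0; rewrite /G {1}tz add0r => sG; have [|[_ h] _] := Hs s.
    by apply/andP; split; [lra|exact/ltW/(lt_trans sG)].
  by rewrite Py in h; apply: h; rewrite Py in sG.
have tp : 0 < t by rewrite lt_neqAle eq_sym tn.
have [e e0 He] := enter_near Mx Hx tp.
pose q := Num.min d t / 2.
have m0 : 0 < Num.min d t by rewrite lt_min d0.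
have m1 : Num.min d t <= d by rewrite ge_min lexx.
have m2 : Num.min d t <= t by rewrite ge_min lexx orbT.
(* After [t - q] the box takes over, because [q] is at most [d / 2]. *)
have tube : \forall y \near x, forall s, Num.min e t <= s <= t - q -> Om (Phi s y).
  apply: (flow_tube HPhi) => // s /andP[s1 s2]; apply: Ht; last by rewrite /q in s2; lra.
  by apply: lt_le_trans s1; rewrite lt_min e0.
have /(@cont_distP R rV R) /(_ t tp) nth := sm_continuous sth'.
apply: filterS3 (nearI nU nth) He tube => y [Uy]; rewrite th0 sub0r normrN => thy Hey Ty My.
move: thy; rewrite ltr_norml => /andP[thy1 thy2].
apply: fin => //; first by rewrite /G; lra.
move=> s s0 sG.
have [se|es] := leP s e; first exact: Hey.
have [sq|qs] := leP s (t - q).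
  by apply: Ty; rewrite sq andbT; apply: le_trans (ltW es); rewrite ge_min lexx.
have [_ thd Hs] := H _ Uy.
move: thd; rewrite ltr_norml => /andP[th1 th2].
have [|[_ h] _] := Hs (s - t); first by apply/andP; split; rewrite /G /q in sG qs *; lra.
by rewrite -(flowD HPhi) subrK in h; apply: h; rewrite /G in sG; lra.
Qed.

(** The derivative of the extension is read off from [T (Phi s x) = T x - s] on whichever side of 0
    the orbit lies in the closure. *)
Lemma exit_time : exists T : rV -> R,
  [/\ forall x, M x -> F x != 0 -> hit Om Phi x (T x),
      forall x s, M x -> F x != 0 -> 0 <= s -> (forall r, 0 <= r <= s -> M (Phi r x)) ->
        s <= T x /\ T (Phi s x) = T x - s &
      forall x, M x -> F x != 0 -> exists2 G : rV -> R, sm G x /\ 'D_(w x) G x = -1 &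
        \forall y \near x, M y -> T y = G y].
Proof.
have /choice [T HT] x : exists t, M x -> F x != 0 -> hit Om Phi x t.
  have [[Mx Fx]|nh] := pselect (M x /\ F x != 0); last by exists 0 => Mx Fx; case: nh.
  by have [t Ht] := hit_exists Mx Fx; exists t.
have Tflow x s : M x -> F x != 0 -> 0 <= s -> (forall r, 0 <= r <= s -> M (Phi r x)) ->
    s <= T x /\ T (Phi s x) = T x - s.
  move=> Mx Fx s0 Hr; have Hx := HT x Mx Fx.
  have sT : s <= T x.
    rewrite leNgt; apply/negP => Ts; have [r [r1 r2]] := hit_lt Hx Ts; apply; apply: Hr.
    by case: Hx => t0 _ _ _ _; apply/andP; split; lra.
  split=> //; have Ms : M (Phi s x) by apply: Hr; rewrite s0 lexx.
  have Fs : F (Phi s x) != 0 by apply: ray_neq0 Fx; exact: flow_ray.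
  exact: hit_unique Ms (HT _ Ms Fs) (hit_shift Mx Hx s0 sT).
exists T; split=> // x Mx Fx.
have [G sG HG] := hit_local Mx Fx (HT x Mx Fx).
have nG : \forall y \near x, M y -> T y = G y.
  have nF := smv_near_neq0 (sF x) Fx.
  by apply: filterS2 HG nF => y h Fy My; exact: hit_unique My (HT y My Fy) (h My).
exists G => //; split=> //.
have [r r0 Hr] := near_ballP nG.
have nr : \forall y \near Phi 0 x, `|x - y| < r.
  by rewrite (flow0 HPhi); exact: (@ball_nearP R rV _ x r r0).
have [d d0 Hd] := flow_near HPhi nr.
have GT s : `|s| < d -> M (Phi s x) -> G (Phi s x) = T (Phi s x).
  by move=> sd Ms; rewrite Hr //; apply: Hd => //; rewrite ?subrr ?normr0 // sub0r normrN.
have dG : differentiable G (Phi 0 x) by rewrite (flow0 HPhi); exact: sm_differentiable.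
have D0 := flow_derf HPhi dG.
have [fwd|bwd] : (exists2 e, 0 < e & forall s, 0 <= s -> s <= e -> M (Phi s x)) \/
    (exists2 e, 0 < e & forall s, 0 <= s -> s <= e -> M (Phi (- s) x)).
  have [Ox|nx] := pselect (Om x).
    left; have O0 : \forall y \near Phi 0 x, Om y by rewrite (flow0 HPhi); exact: open_near.
    have [e e0 He] := flow_near HPhi O0.
    exists (e / 2); first by rewrite divr_gt0.
    by move=> s s0 se; apply: OM; apply: He; [rewrite sub0r normrN ger0_norm //; lra|rewrite subrr normr0].
  have [/outbox_out [e e0 He]|/outbox_out [e e0 He]] := boundary_box HS Mx nx; [right|left]; exists e => // s.
    by rewrite le_eqVlt => /orP[/eqP<-|s0 se]; [rewrite oppr0 (flow0 HPhi)|apply: OM; exact: (He s s0 se).2].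
  rewrite le_eqVlt => /orP[/eqP<-|s0 se]; first by rewrite (flow0 HPhi).
  by have := (He s s0 se).2; rewrite opprK => h; exact: OM.
- have [e e0 He] := fwd.
  have m0 : 0 < Num.min d e by rewrite lt_min d0.
  rewrite (flow0 HPhi) in D0.
  apply: (is_derive_one_side (a := T x) D0 m0) => s s0; rewrite lt_min => /andP[sd se].
  have Ms q : 0 <= q <= s -> M (Phi q x) by move=> /andP[q0 qs]; apply: He => //; lra.
  rewrite GT; last by apply: He; lra.
    by rewrite (Tflow x s Mx Fx (ltW s0) Ms).2 mulN1r.
  by rewrite gtr0_norm.
- have [e e0 He] := bwd.
  have m0 : 0 < Num.min d e by rewrite lt_min d0.
  rewrite (flow0 HPhi) in D0.
  have D1 := @is_derive_lin R R^o (fun s => G (Phi s x)) (-1) 0 0.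
  rewrite mulr0 addr0 in D1.
  have {D1} D1 := D1 _ D0; rewrite -[-1 *: _]/(-1 * _) mulN1r in D1.
  apply: oppr_inj; rewrite opprK.
  apply: (is_derive_one_side (a := T x) D1 m0) => s s0; rewrite lt_min => /andP[sd se].
  rewrite mulN1r addr0 mul1r.
  have Ms : M (Phi (- s) x) by apply: He; lra.
  have Fs : F (Phi (- s) x) != 0 by apply: ray_neq0 Fx; exact: flow_ray.
  rewrite GT //; last by rewrite normrN gtr0_norm.
  have [|_] := Tflow (Phi (- s) x) s Ms Fs (ltW s0).
    move=> q /andP[q0 qs]; rewrite -(flowD HPhi).
    have -> : q - s = - (s - q) by ring.
    by apply: He; lra.
  by rewrite (flowNK HPhi) => ->; rewrite subrK.
Qed.

End Setting.
End ExitTime.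

(** * One source: the ball *)

Section Radial.
Context {R : realType} {n : nat}.
Local Notation rV := 'rV[R]_n.

Definition dnorm (v : rV) : R := Num.sqrt (dot v v).

Lemma enormE (v : rV) : enorm v = dnorm v.
Proof. by rewrite /enorm /dnorm /dot; congr Num.sqrt; apply: eq_bigr => i _; rewrite expr2. Qed.

Lemma dnorm_sqr v : dnorm v ^+ 2 = dot v v.
Proof. by rewrite sqr_sqrtr // dot_ge0. Qed.

Lemma dnorm_ge0 v : 0 <= dnorm v. Proof. exact: sqrtr_ge0. Qed.

Lemma dnorm_gt0 v : (0 < dnorm v) = (v != 0).
Proof. by rewrite sqrtr_gt0 dot_gt0. Qed.

Lemma dnormZ a v : 0 <= a -> dnorm (a *: v) = a * dnorm v.
Proof. by move=> a0; rewrite /dnorm dotZl dotZr mulrA -expr2 sqrtrM ?sqr_ge0 // sqrtr_sqr ger0_norm. Qed.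

Lemma dnorm_lt v (r : R) : 0 < r -> (dnorm v < r) = (dot v v < r ^+ 2).
Proof. by move=> r0; rewrite -dnorm_sqr ltr_pXn2r // nnegrE ?dnorm_ge0 // ltW. Qed.

Lemma dnorm_le v (r : R) : 0 <= r -> (dnorm v <= r) = (dot v v <= r ^+ 2).
Proof. by move=> r0; rewrite -dnorm_sqr ler_pXn2r // nnegrE ?dnorm_ge0. Qed.

Lemma sm_dnorm (V : normedModType R) (f : V -> rV) x : smv f x -> f x != 0 -> sm (fun y => dnorm (f y)) x.
Proof.
move=> sf f0; apply: (sm_comp1 (h := Num.sqrt)); last exact: sm_dot.
by apply: sm_sqrt; rewrite dot_gt0.
Qed.

Lemma dnorm_continuous : continuous (@dnorm).
Proof.
move=> v; apply: (@continuous_comp _ _ _ (fun v => dot v v) Num.sqrt); last exact: sqrt_continuous.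
by apply: sm_continuous; apply: sm_dot; exact: smv_id.
Qed.

Lemma closure_eball (r : R) : 0 < r -> closure (eball0 n r) = [set x | dnorm x <= r].
Proof.
move=> r0; apply/seteqP; split => x /=.
  move=> cx; rewrite leNgt; apply/negP => rx.
  have [y [By ry]] := cx _ (near_gt (dnorm_continuous (x := x)) rx).
  by move: By ry; rewrite /eball0 /= enormE => h1 h2; have := lt_trans h1 h2; rewrite ltxx.
move=> xr B /near_ballP [e e0 He].
pose q := e / (`|x| + e).
have xe : 0 < `|x| + e by rewrite ltr_wpDl.
have q0 : 0 < q by rewrite divr_gt0.
have q1 : q <= 1 by rewrite ler_pdivrMr // mul1r lerDr.
exists ((1 - q / 2) *: x); split.
  rewrite /eball0 /= enormE dnormZ; last by lra.
  apply: le_lt_trans (_ : (1 - q / 2) * r < r); first by apply: ler_wpM2l => //; lra.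
  by rewrite gtr_pMl //; lra.
apply: He; rewrite scalerBl scale1r opprB addrC subrK normrZ ger0_norm; last by lra.
rewrite /q mulrAC ltr_pdivrMr // mulrAC ltr_pdivrMr //.
have : 0 <= `|x| by []. by nra.
Qed.

Lemma psi_norm (F : rV -> rV) (r : R) x : F x != 0 -> 0 <= r -> dnorm ((r / dnorm (F x)) *: F x) = r.
Proof.
move=> Fx r0; rewrite dnormZ ?divr_ge0 ?dnorm_ge0 //.
by rewrite divfK // gt_eqF // dnorm_gt0.
Qed.

(** Polar coordinates. If [h] is in the kernel, differentiating the square of the norm gives
    ['D_h r x = 0]; then [F] changes radially along [h], so [h] is a multiple of the field, along
    which [r] has nonzero derivative. *)
Lemma psi_unit (F : rV -> rV) (r : rV -> R) x : smv F x -> sm r x -> F x != 0 -> reg F x ->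
  r x != 0 -> 'D_(fld F x) r x != 0 ->
  smv (fun y => (r y / dnorm (F y)) *: F y) x /\
  \det (jac (fun y => (r y / dnorm (F y)) *: F y) x) != 0.
Proof.
move=> sF sr Fx rg rx Dr; set G := fun y => _.
pose c y := r y / dnorm (F y).
have nF : dnorm (F x) != 0 by rewrite gt_eqF // dnorm_gt0.
have sc : sm c x by apply: smM => //; apply: smV => //; exact: sm_dnorm.
have sG : smv G x by exact: smvZ.
split=> //; apply: unit_kernel => h; rewrite -jacE; last exact: smv_differentiable.
move=> DG.
have dF := smv_differentiable sF; have dc := sm_differentiable sc; have dr := sm_differentiable sr.
have cx : c x != 0 by rewrite mulf_neq0 ?invr_eq0.
have E1 : 'D_h r x = 0.
  have : 'D_h (fun y => dot (G y) (G y)) x = 0.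
    by rewrite derive_dot; [rewrite DG dot0l dot0r addr0|exact: smv_differentiable..].
  have -> : 'D_h (fun y => dot (G y) (G y)) x = 'D_h (fun y => r y * r y) x.
    have nn := smv_near_neq0 sF Fx.
    apply: near_eq_derive.
    apply: filterS nn => y Fy.
    rewrite /G dotZl dotZr -dnorm_sqr; field.
    by rewrite gt_eqF // dnorm_gt0.
  rewrite deriveM_ // => /eqP.
  have -> : 'D_h r x * r x + r x * 'D_h r x = 2 * r x * 'D_h r x by ring.
  by rewrite !mulf_eq0 (negbTE rx) pnatr_eq0 /= => /eqP.
have : h *m jac F x = - ('D_h c x / c x) *: F x.
  rewrite -jacE //; move: DG; rewrite /G (derive_scale _ dc dF).2 => E.
  have : c x *: 'D_h F x = - ('D_h c x *: F x) by apply/eqP; rewrite -addr_eq0 addrC; apply/eqP.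
  move=> /(congr1 (fun v => (c x)^-1 *: v)); rewrite scalerA mulVf // scale1r => ->.
  by rewrite scalerN scalerA scaleNr mulrC.
move=> /(fld_span rg Fx) [k hk].
move: E1; rewrite hk deriveZv // => /eqP; rewrite mulf_eq0 (negbTE Dr) orbF => /eqP ->.
by rewrite scale0r.
Qed.

Lemma dirac_dnorm (F : rV -> rV) x : smv F x -> F x != 0 ->
  'D_(fld F x) (fun y => dnorm (F y)) x = \det (jac F x) * dnorm (F x).
Proof.
move=> sF Fx; have sd := sm_dnorm sF Fx; have dd := sm_differentiable sd.
have nF : 0 < dnorm (F x) by rewrite dnorm_gt0.
have : 'D_(fld F x) (fun y => dnorm (F y) * dnorm (F y)) x = 'D_(fld F x) (fun y => dot (F y) (F y)) x.
  by congr ('D__ _ _); apply/funext => y; rewrite -expr2 dnorm_sqr.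
have dF := smv_differentiable sF.
rewrite deriveM_ // derive_dot // jacE // fld_jac dotZl dotZr -dnorm_sqr => E.
apply: (mulfI (lt0r_neq0 nF)); move: E.
by set D := 'D__ _ _; set s := dnorm _; set j := \det _ => E; lra.
Qed.

(** Continuity is known only relative to the interval, where [h] agrees with local extensions;
    clamping the variable to [[a, b]] makes it global. *)
Lemma ivt_local (h : R -> R) (a b v : R) : a <= b ->
  (forall q, a <= q <= b -> exists2 k : R -> R, {for q, continuous k} &
     \forall r \near q, a <= r <= b -> h r = k r) ->
  h a <= v <= h b -> exists2 q, a <= q <= b & h q = v.
Proof.
move=> ab loc /andP[hv1 hv2].
pose cl q := Num.max a (Num.min b q).
have cl_in q : a <= cl q <= b by rewrite le_max lexx /= ge_max ab ge_min lexx.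
have cl_id q : a <= q <= b -> cl q = q.
  by move=> /andP[h1 h2]; rewrite /cl; have /min_idPr -> := h2; have /max_idPr -> := h1.
have ccl : continuous cl.
  move=> q; apply: (@continuous_max R R^o (cst a) (fun q => Num.min b q)); first exact: cvg_cst.
  by apply: (@continuous_min R R^o (cst b) id); [exact: cvg_cst|exact: cvg_id].
have ch : continuous (h \o cl).
  move=> q; have [k ck nk] := loc (cl q) (cl_in q).
  have ckc : {for q, continuous (k \o cl)} by apply: continuous_comp; [exact: ccl|exact: ck].
  apply: (@near_continuous R R^o R^o (k \o cl) (h \o cl)) ckc.
  have := @near_comp R R^o R^o cl q _ (@ccl q) nk.
  by apply: filterS => r Hr; rewrite /= Hr.
have [|q hq Eq] := @IVT R (h \o cl) a b v ab (continuous_subspaceT ch).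
  rewrite /= !cl_id ?lexx ?ab //.
  by rewrite ge_min le_max hv1 hv2 orbT.
by exists (cl q).
Qed.

(** No derivative appears, because [h] agrees with smooth functions only on relative neighbourhoods
    that change with [q]. *)
Lemma locally_increasing (h : R -> R) (s : R) : 0 < s ->
  (forall q, 0 <= q <= s -> exists e, 0 < e /\ forall r, 0 <= r <= s ->
     (q < r -> r < q + e -> h q < h r) /\ (r < q -> q - e < r -> h r < h q)) -> h 0 < h s.
Proof.
move=> s0 loc; suff Q : forall q, 0 <= q -> 0 < q -> q <= s -> h 0 < h q by apply: Q => //; exact: ltW.
apply: real_induction => t t0 IH.
have [ts|st] := leP t s; last first.
  by exists 1 => // q tq _ _ qs; move: (lt_le_trans st (le_trans tq qs)); rewrite ltxx.
have [e [e0 He]] := loc t (introT andP (conj t0 ts)).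
have ht : 0 < t -> h 0 < h t.
  move=> tp; pose q := Num.max (t / 2) (t - e / 2).
  have q1 : t / 2 <= q by rewrite le_max lexx.
  have q2 : t - e / 2 <= q by rewrite le_max lexx orbT.
  have q3 : q < t by rewrite gt_max; apply/andP; split; lra.
  have q0 : 0 < q by lra.
  have [|_ h2] := He q; first by apply/andP; split; lra.
  by apply: lt_trans (IH q (ltW q0) q3 q0 _) (h2 q3 _); lra.
exists e => // q tq qe q0 qs.
have [E|qt] := eqVneq q t; first by rewrite E; apply: ht; rewrite -E.
have tq' : t < q by rewrite lt_neqAle eq_sym qt.
have [|h1 _] := He q; first by apply/andP; split; lra.
have [tz|tn] := eqVneq t 0; first by rewrite -tz; exact: h1.
by apply: lt_trans (ht _) (h1 tq' qe); rewrite lt_neqAle eq_sym tn.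
Qed.

Lemma derive_pos_local (g : R -> R) (q l : R) : is_derive q (1 : R) g l -> 0 < l ->
  exists e, 0 < e /\ forall r, (q < r -> r < q + e -> g q < g r) /\ (r < q -> q - e < r -> g r < g q).
Proof.
move=> Hg l0; have [dq Dq] := Hg.
have /cvgrPdist_lt /(_ l l0) := dq.
rewrite -/(derive _ _ _) Dq => /nbhs_ballP [e /= e0 He].
exists e; split=> // r; pose s := r - q.
have rE : r = q + s by rewrite /s addrC subrK.
have key : s != 0 -> `|s| < e -> 0 < s^-1 * (g r - g q).
  move=> sn se; have := He s; rewrite -ball_normE /= sub0r normrN => /(_ se sn).
  rewrite [s *: 1]mulr1 [s + q]addrC -rE -[_ *: _]/(_ * _) ltr_norml => /andP[_ h]; lra.
split=> h1 h2.
  have s0 : 0 < s by rewrite subr_gt0.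
  have := key (lt0r_neq0 s0); rewrite gtr0_norm // => /(_ _).
  by rewrite pmulr_rgt0 ?invr_gt0 // subr_gt0; apply; rewrite /s; lra.
have s0 : s < 0 by rewrite subr_lt0.
have := key (ltr0_neq0 s0); rewrite ltr0_norm // => /(_ _).
by rewrite nmulr_rgt0 ?invr_lt0 // subr_lt0; apply; rewrite /s; lra.
Qed.

End Radial.

Section BallCase.
Context {R : realType} {n : nat}.
Local Notation rV := 'rV[R]_n.
Variables (Om : set rV) (F : rV -> rV) (Phi : R -> rV -> rV).
Hypothesis HS : setting Om F Phi.
Hypothesis n2 : (2 <= n)%N.
Hypothesis EX : forall y, Om y -> F y != 0 -> exits Om Phi y.
Let M := closure Om.
Let w := fld F.
Let oO := setting_open HS.
Let cM := setting_compact HS.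
Let sF := setting_smv HS.
Let HPhi := setting_flow HS.
Let rF := setting_reg HS.
Let OM := @subset_closure _ Om.
Let Phi' := fun t => Phi (- t).

Lemma flow_increasing (rr : rV -> R) x (s : R) :
  (forall x, M x -> F x != 0 -> exists2 G : rV -> R, sm G x /\ 0 < 'D_(w x) G x &
     \forall y \near x, M y -> rr y = G y) ->
  F x != 0 -> 0 < s -> (forall q, 0 <= q <= s -> M (Phi q x)) -> rr x < rr (Phi s x).
Proof.
move=> loc Fx s0 Mq.
suff : rr (Phi 0 x) < rr (Phi s x) by rewrite (flow0 HPhi).
apply: (@locally_increasing R (fun q => rr (Phi q x))) => // q hq.
have Fq : F (Phi q x) != 0 by apply: ray_neq0 Fx; exact: flow_ray.
have [G [sG DG] nG] := loc _ (Mq q hq) Fq.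
have [e1 [e10 H1]] := derive_pos_local (flow_derf HPhi (sm_differentiable sG)) DG.
have [e2 e20 H2] := flow_near HPhi nG.
exists (Num.min e1 e2); split; first by rewrite lt_min e10.
move=> r hr; have [h1 h2] := H1 r.
have Eq : rr (Phi q x) = G (Phi q x) by apply: (nbhs_singleton nG); exact: Mq.
have Er : `|q - r| < e2 -> rr (Phi r x) = G (Phi r x).
  by move=> qr; apply: H2; [exact: qr|rewrite subrr normr0|exact: Mq].
have m1 : Num.min e1 e2 <= e1 by rewrite ge_min lexx.
have m2 : Num.min e1 e2 <= e2 by rewrite ge_min lexx orbT.
split=> k1 k2.
  by rewrite Eq Er; [apply: h1 => //; lra|rewrite ltr0_norm ?subr_lt0 //; lra].
by rewrite Eq Er; [apply: h2 => //; lra|rewrite gtr0_norm ?subr_gt0 //; lra].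
Qed.

(** The sum is the derivative along the field of [(1 - S) * E + S * D], where [- a] is the
    derivative of the weight [S], [b] that of [D], and [E] is its own derivative. *)
Lemma blend_gt0 (a e d s b : R) : 0 < (1 - s) * e + s * b -> 0 <= a * (e - d) ->
  0 < a * e + (1 - s) * e + (- a * d + s * b).
Proof.
move=> h1 h2; have -> : a * e + (1 - s) * e + (- a * d + s * b) = (1 - s) * e + s * b + a * (e - d) by ring.
exact: ltr_wpDr.
Qed.

Section Source.
Variable p : rV.
Hypotheses (Op : Om p) (Fp : F p = 0) (dp : 0 < \det (jac F p)).
Hypothesis Ap : forall y, Om y -> F y != 0 -> attracted Om Phi' p y.

(** Any zero is a sink or a source. Orbits near a sink would not leave; orbits near a source other
    than [p] would not come from [p]. *)
Lemma only_zero x : M x -> F x = 0 -> x = p.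
Proof.
move=> Mx Fx; have [Ox dx] := zero_interior HS Mx Fx.
have [_ dn] := punctured HS n2.
have [dneg|dpos|d0] := ltgtP (\det (jac F x)) 0; last by rewrite d0 eqxx in dx.
  have [y [ay Oy /eqP Fy]] := dn x Ox _ (attracted_near HS (And3 Ox Fx dneg)).
  by have := attracted_neq_exits ay (EX Oy Fy).
have HS' := setting_rev HS.
have sk : sink Om (rev F) x.
  split=> //; first by rewrite /rev Fx mul0mx.
  by rewrite jac_rev // det_mulmx det_revmx ?mulrN1 ?oppr_lt0 //; exact: ltnW.
have [y [ay Oy /eqP Fy]] := dn x Ox _ (attracted_near HS' sk).
exact: converges_unique ay.2 (Ap Oy Fy).2.
Qed.

Lemma backward_in x : M x -> F x != 0 ->
  (forall s, 0 < s -> Om (Phi (- s) x)) /\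
  forall e : R, 0 < e -> exists T : R, forall s, T <= s -> `|p - Phi (- s) x| < e.
Proof.
move=> Mx Fx; have [Ox|nx] := pselect (Om x).
  by have [h1 h2] := Ap Ox Fx; split=> // s s0; apply: h1; exact: ltW.
have [/outbox_out [d d0 Hd]|/outbox_out [d d0 Hd]] := boundary_box HS Mx nx.
  have Od : Om (Phi (- d) x) := (Hd d d0 (lexx _)).2.
  have Fd : F (Phi (- d) x) != 0 by apply: ray_neq0 Fx; exact: flow_ray.
  have [h1 h2] := Ap Od Fd; split=> [s s0|e e0].
    have [sd|ds] := leP s d; first exact: (Hd s s0 sd).2.
    have := h1 (s - d); rewrite /Phi' -(flowD HPhi).
    have -> : - (s - d) + - d = - s by ring.
  by apply; rewrite subr_ge0 ltW.
  have [T HT] := h2 e e0; exists (T + d) => s hs.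
  have := HT (s - d); rewrite /Phi' -(flowD HPhi).
  have -> : - (s - d) + - d = - s by ring.
  by apply; lra.
have [nM Od] := Hd d d0 (lexx _); rewrite opprK in Od.
have Fd : F (Phi d x) != 0 by apply: ray_neq0 Fx; exact: flow_ray.
have [h1 _] := Ap Od Fd.
exfalso; apply: nM; apply: OM.
have := h1 (d + d); rewrite /Phi' -(flowD HPhi).
have -> : - (d + d) + d = - d by ring.
  by apply; lra.
Qed.

(** Near [p] the map [F] is a chart. Both points are moved backwards into it; as [F] tends to 0
    along the orbit of [y], the intermediate value theorem finds a point with the same norm of [F]
    as [X]. Ray and norm being equal, the two points coincide. *)
Lemma same_orbit : forall x y, M x -> F x != 0 -> M y -> F y != 0 -> ray F x y ->
  exists s, 0 <= s /\ ((y = Phi s x /\ forall q, 0 <= q <= s -> M (Phi q x)) \/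
                       (x = Phi s y /\ forall q, 0 <= q <= s -> M (Phi q y))).
Proof.
have [A [B [g [[oA Ap' oB _] [fA gB sg]]]]] := inverse_function (open_near oO Op) (sF p) (lt0r_neq0 dp).
have [r r0 Hr] := near_ballP (open_near oA Ap').
have key x y S : M x -> F x != 0 -> M y -> F y != 0 -> ray F x y -> 0 <= S ->
    (forall s, S <= s -> A (Phi (- s) x)) -> (forall s, S <= s -> A (Phi (- s) y)) ->
    dnorm (F (Phi (- S) x)) <= dnorm (F (Phi (- S) y)) ->
    exists s, 0 <= s /\ (y = Phi s x /\ forall q, 0 <= q <= s -> M (Phi q x)).
  move=> Mx Fx My Fy ry S0 Ax Ay le.
  set X := Phi (- S) x in le *.
  have FX : F X != 0 by apply: ray_neq0 Fx; exact: flow_ray.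
  pose h q := - dnorm (F (Phi (- q) y)).
  have ch q : {for q, continuous h}.
    apply: cvgN; apply: (@continuous_comp _ _ _ (fun q => F (Phi (- q) y)) (@dnorm R n)).
      apply: (@continuous_comp _ _ _ (fun q => Phi (- q) y) F).
        exact: (flow_cont_time (is_flow_rev HPhi)).
      exact: smv_continuous.
    exact: dnorm_continuous.
  have [_ /= cv] := backward_in My Fy.
  have cF0 : {for p, continuous (fun z => dnorm (F z))}.
    by apply: (@continuous_comp _ _ _ F (@dnorm R n)); [exact: smv_continuous|exact: dnorm_continuous].
  have nX : 0 < dnorm (F X) by rewrite dnorm_gt0.
  have np : \forall z \near p, dnorm (F z) < dnorm (F X).
    by apply: near_lt => //; rewrite Fp /dnorm dot0l sqrtr0.
  have [e e0 He] := near_ballP np; have [T HT] := cv e e0.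
  pose b := Num.max S T.
  have Sb : S <= b by rewrite le_max lexx.
  have Tb : T <= b by rewrite le_max lexx orbT.
  have [||q /andP[q1 q2] Eq] := @ivt_local R h S b (- dnorm (F X)) Sb.
  - by move=> q _; exists h; [exact: ch|exact: filterE].
  - by rewrite /h !lerN2 le /=; apply/ltW/He/HT.
  have nE : dnorm (F (Phi (- q) y)) = dnorm (F X) by apply: oppr_inj.
  have [l l0 El] : ray F X (Phi (- q) y).
    apply: ray_trans (flow_ray sF HPhi y (- q)).
    by apply: ray_trans ry; apply: ray_sym; exact: flow_ray.
  have l1 : l = 1.
    move: nE; rewrite El dnormZ ?ltW // => /eqP; rewrite -subr_eq0 -{2}[dnorm (F X)]mul1r -mulrBl mulf_eq0.
    by rewrite subr_eq0 (gt_eqF nX) orbF => /eqP.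
  have EX' : Phi (- q) y = X.
    have A1 : A (Phi (- q) y) by exact: Ay.
    have A2 : A X by exact: Ax.
    by rewrite -(fA _ A1).2 El l1 scale1r (fA _ A2).2.
  have yE : y = Phi (q - S) x by rewrite (flowD HPhi) -/X -EX' (flowNK HPhi).
  exists (q - S); split; first by rewrite subr_ge0.
  split=> // t /andP[t0 tq].
  have -> : Phi t x = Phi (- (q - S - t)) y by rewrite yE -(flowD HPhi); congr Phi; ring.
  move: tq; rewrite le_eqVlt => /orP[/eqP->|tq]; first by rewrite subrr oppr0 (flow0 HPhi).
  by apply: OM; apply: (backward_in My Fy).1; rewrite subr_gt0.
move=> x y Mx Fx My Fy ry.
have [T1 H1] := (backward_in Mx Fx).2 r r0.
have [T2 H2] := (backward_in My Fy).2 r r0.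
pose S := Num.max 0 (Num.max T1 T2).
have S0 : 0 <= S by rewrite le_max lexx.
have S1 : T1 <= S by rewrite !le_max lexx orbT.
have S2 : T2 <= S by rewrite !le_max lexx !orbT.
have A1 s : S <= s -> A (Phi (- s) x) by move=> h; apply: Hr; apply: H1; exact: le_trans h.
have A2 s : S <= s -> A (Phi (- s) y) by move=> h; apply: Hr; apply: H2; exact: le_trans h.
have [le|ge] := leP (dnorm (F (Phi (- S) x))) (dnorm (F (Phi (- S) y))).
  by have [s [s0 H]] := key x y S Mx Fx My Fy ry S0 A1 A2 le; exists s; split=> //; left.
have [s [s0 H]] := key y x S My Fy Mx Fx (ray_sym ry) S0 A2 A1 (ltW ge).
by exists s; split=> //; right.
Qed.

(** The radius must be 1 on the boundary, as [expR (- T)] is, and smooth at [p] after multiplication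
    by the direction of [F], as [c * dnorm (F x)] is. [r] blends the two through [step (T - K0)];
    the constants make it increase along the orbits. Near [p] the map is [c *: F]. *)
Lemma ball_case : diffeomorphic M (closure (eball0 n 1)).
Proof.
have [T [T1 T2 T3]] := exit_time HS EX.
have Fn x : F x != 0 -> 0 < dnorm (F x) by rewrite dnorm_gt0.
have cF x : {for x, continuous (fun z => dnorm (F z))}.
  by apply: (@continuous_comp _ _ _ F (@dnorm R n)); [exact: smv_continuous|exact: dnorm_continuous].
have [C HC] : exists C, forall x, M x -> dnorm (F x) <= C.
  apply: (compact_locbound cM) => x _; exists (dnorm (F x) + 1).
  have h : dnorm (F x) < dnorm (F x) + 1 by rewrite ltrDl.
  by apply: filterS (near_lt (cF x) h) => y hy _; exact: ltW.
have cd : {for p, continuous (fun y => \det (jac F y))}.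
  by apply: sm_continuous; apply: sm_det => i j; exact: sm_jac.
have [r0 r00 Hr0] := near_ballP (near_gt0 cd dp).
(* [T] is unbounded near [p], so the bound concerns the complement of a ball on which the
   determinant is positive. *)
have [K HK] : exists K, forall x, M x -> (if `|p - x| < r0 then 0 else T x) <= K.
  apply: (compact_locbound cM) => x Mx; have [Fx|Fx] := eqVneq (F x) 0.
    rewrite (only_zero Mx Fx); exists 0.
    by apply: (@ball_nearP R rV _ p r0 r00) => y -> _.
  have [G [sG _] nG] := T3 x Mx Fx; exists (Num.max 0 (G x + 1)).
  have h : G x < G x + 1 by rewrite ltrDl.
  apply: filterS2 nG (near_lt (sm_continuous sG) h) => y Ey hy My.
  by case: ifP => _; rewrite le_max ?lexx // Ey // (ltW hy) orbT.
pose K0 := Num.max 0 K.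
have K00 : 0 <= K0 by rewrite le_max lexx.
have KT x : M x -> K0 < T x -> 0 < \det (jac F x).
  move=> Mx Kx; apply: Hr0; rewrite ltNge; apply/negP => rx.
  have := HK x Mx; rewrite ltNge rx /= => h.
  have : K <= K0 by rewrite le_max lexx orbT.
  by lra.
(* [p] is fixed by the flow, so orbits starting near it stay in the domain for time [K0 + 2]. *)
have nT : \forall y \near p, M y -> F y != 0 -> K0 + 1 < T y.
  have tube := @flow_tube _ _ _ _ HPhi Om 0 (K0 + 2) p oO.
  have Pp s : Phi s p = p by apply: (flow_fix HPhi); exact: fld0.
  apply: filterS (tube _) => [y Hy My Fy|s _]; last by rewrite Pp.
  have [] // := T2 y (K0 + 2) My Fy _ _; [lra|by move=> r /Hy /OM|lra].
pose C0 := Num.max 0 C.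
have C00 : 0 <= C0 by rewrite le_max lexx.
(* With this factor the inner radius stays below [expR (- T x)] as long as [T x <= K0 + 1], that is
   throughout the transition zone. *)
pose c := expR (- (K0 + 1)) / (C0 + 1).
have c0 : 0 < c by rewrite divr_gt0 ?expR_gt0 // ltr_wpDl.
have cs x : M x -> c * dnorm (F x) <= expR (- (K0 + 1)).
  move=> Mx; rewrite /c mulrAC ler_pdivrMr ?ltr_wpDl // ler_pM2l ?expR_gt0 //.
  have : C <= C0 by rewrite le_max lexx orbT.
  by have := HC x Mx; lra.
have e1 : expR (- (K0 + 1)) <= 1 by rewrite -[X in _ <= X]expR0 ler_expR; lra.
pose S x := step (T x - K0).
pose r x := (1 - S x) * expR (- T x) + S x * (c * dnorm (F x)).
have S0 x : 0 <= S x by exact: step_ge0.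
have S1 x : S x <= 1 by exact: step_le1.
have r_in x : M x -> F x != 0 -> 0 < r x <= 1.
  move=> Mx Fx; have [T0 _ _ _ _] := T1 x Mx Fx.
  have a0 : 0 < expR (- T x) by exact: expR_gt0.
  have a1 : expR (- T x) <= 1 by rewrite -expR0 ler_expR oppr_le0.
  have b0 : 0 < c * dnorm (F x) by rewrite mulr_gt0 // Fn.
  have b1 : c * dnorm (F x) <= 1 by exact: le_trans (cs x Mx) e1.
  have := S0 x; have := S1 x; rewrite /r; move: (S x) a0 a1 b0 b1 => s.
  move: (expR _) (c * _) => a b a0 a1 b0 b1 s1 s0.
  apply/andP; split; last by nra.
  have [->|sn] := eqVneq s 0; first by rewrite mul0r subr0 mul1r addr0.
  have sp : 0 < s by rewrite lt_neqAle eq_sym sn.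
  by apply: ltr_wpDl; [apply: mulr_ge0; lra|exact: mulr_gt0].
have r_loc x : M x -> F x != 0 -> exists2 rt : rV -> R, sm rt x /\ 0 < 'D_(w x) rt x &
    \forall y \near x, M y -> r y = rt y.
  move=> Mx Fx; have [G [sG DG] nG] := T3 x Mx Fx.
  pose St y := step (G y - K0); pose E y := expR (- G y); pose D y := c * dnorm (F y).
  exists (fun y => (1 - St y) * E y + St y * D y); last first.
    by apply: filterS nG => y Hy My; rewrite /r /S (Hy My).
  have Gx := nbhs_singleton nG Mx.
  have sGK : sm (fun y => G y - K0) x by apply: smB => //; exact: sm_cst.
  have sNG : sm (fun y => - G y) x by exact: smN.
  have sS : sm St x by apply: (sm_comp1 (h := step)) => //; exact: sm_step.
  have sE : sm E x by apply: (sm_comp1 (h := expR)) => //; exact: sm_expR.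
  have sd := sm_dnorm (sF x) Fx.
  have sD : sm D x by apply: smM => //; exact: sm_cst.
  have s1S : sm (fun y => 1 - St y) x by apply: smB => //; exact: sm_cst.
  split; first by apply: smD; exact: smM.
  have dG := sm_differentiable sG.
  have DS : 'D_(w x) St x = - 'D_1 (@step R) (G x - K0).
    rewrite (@derive_comp _ _ _ _ (fun y => G y - K0) step); [|exact: sm_differentiable|by apply: sm_differentiable; exact: sm_step].
    have -> : 'D_(w x) (fun y => G y - K0) x = -1.
      rewrite (_ : (fun y => G y - K0) = G - cst K0) // deriveB; [|exact: diff_derivable|exact: derivable_cst].
      by rewrite DG derive_cst subr0.
    have -> : (-1 : R) = (-1) *: (1 : R) by rewrite -[_ *: _]/(_ * _) mulr1.
    by rewrite deriveZv; [rewrite scaleN1r|apply: sm_differentiable; exact: sm_step].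
  have DE : 'D_(w x) E x = E x.
    rewrite (@derive_comp _ _ _ _ (fun y => - G y) expR); [|exact: sm_differentiable|by apply: sm_differentiable; exact: sm_expR].
    have -> : 'D_(w x) (fun y => - G y) x = 1.
      by rewrite (_ : (fun y => - G y) = - G) // deriveN; [rewrite DG opprK|exact: diff_derivable].
    by have := is_derive_expR (- G x) => -[_ ->].
  have DD : 'D_(w x) D x = c * (\det (jac F x) * dnorm (F x)).
    rewrite deriveM_; [|exact: differentiable_cst|exact: sm_differentiable].
    by rewrite derive_cst_ mul0r add0r dirac_dnorm.
  have D1S : 'D_(w x) (fun y => 1 - St y) x = - 'D_(w x) St x.
    have dS : derivable St x (w x) by apply: diff_derivable; exact: sm_differentiable.
    have := deriveB (@derivable_cst R rV R^o (1 : R) x (w x)) dS.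
    by rewrite derive_cst sub0r.
  rewrite deriveD_; [|by apply: sm_differentiable; exact: smM..].
  rewrite deriveM_; [|exact: sm_differentiable..].
  rewrite deriveM_; [|exact: sm_differentiable..].
  rewrite D1S DS DE DD opprK.
  have St0 : 0 <= St x by exact: step_ge0.
  have St1 : St x <= 1 by exact: step_le1.
  have E0 : 0 < E x by exact: expR_gt0.
  have nF := Fn x Fx.
  (* Where the weight of [D] is not 0 the determinant is positive and [D] grows along the field;
     elsewhere [E] alone contributes. *)
  have main : 0 < (1 - St x) * E x + St x * (c * (\det (jac F x) * dnorm (F x))).
    have [KTx|TK] := ltP K0 (T x).
      have dx := KT x Mx KTx.
      have q0 : 0 < c * (\det (jac F x) * dnorm (F x)) by apply: mulr_gt0 => //; exact: mulr_gt0.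
      have [->|sn] := eqVneq (St x) 0; first by rewrite mul0r subr0 mul1r addr0.
      have sp : 0 < St x by rewrite lt_neqAle eq_sym sn.
      by apply: ltr_wpDl; [apply: mulr_ge0; [rewrite subr_ge0|exact: ltW]|exact: mulr_gt0].
    by rewrite /St step_le0 ?mul0r ?subr0 ?mul1r ?addr0 // -Gx subr_le0.
  (* Along the orbit the weight passes from [D] to [E]. In the transition zone [E] is at least as
     large as [D], and beyond it the weight is constant. *)
  have side : 0 <= 'D_1 (@step R) (G x - K0) * (E x - D x).
    have [TK|KT'] := leP (T x) (K0 + 1).
      apply: mulr_ge0; first exact: step_derive_ge0.
      rewrite subr_ge0; apply: le_trans (cs x Mx) _.
      by rewrite ler_expR lerN2 -Gx.
    suff -> : 'D_1 (@step R) (G x - K0) = 0 by rewrite mul0r.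
    rewrite -(derive_cst (1 : R) (G x - K0) (1 : R)).
    apply: (@near_eq_derive R R^o R^o).
    have h : 1 < G x - K0 by rewrite -Gx ltrBrDl.
    by apply: filterS (@near_gt R R^o id (G x - K0) 1 _ h) => [y hy|]; [rewrite step_ge1 // ltW|exact: cvg_id].
  exact: blend_gt0.
pose f x := if F x == 0 then 0 else (r x / dnorm (F x)) *: F x.
have fE x : F x != 0 -> f x = (r x / dnorm (F x)) *: F x by rewrite /f => /negbTE ->.
have fn x : M x -> F x != 0 -> dnorm (f x) = r x.
  by move=> Mx Fx; rewrite fE // psi_norm //; case/andP: (r_in x Mx Fx) => /ltW.
have f0 x : F x = 0 -> f x = 0 by rewrite /f => ->; rewrite eqxx.
have d00 : dnorm (0 : rV) = 0 by rewrite /dnorm dot0l sqrtr0.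
rewrite closure_eball //; apply: (@diffeomorphic_local R n M _ f cM).
- move=> x Mx; have [Fx|Fx] := eqVneq (F x) 0; first by rewrite /= f0 // d00.
  by rewrite /= fn //; case/andP: (r_in x Mx Fx).
- move=> x y Mx My E; have [Fx|Fx] := eqVneq (F x) 0; have [Fy|Fy] := eqVneq (F y) 0.
  + by rewrite (only_zero Mx Fx) (only_zero My Fy).
  + by have := fn y My Fy; rewrite -E f0 // d00 => h; have := r_in y My Fy; rewrite -h ltxx.
  + by have := fn x Mx Fx; rewrite E f0 // d00 => h; have := r_in x Mx Fx; rewrite -h ltxx.
  have rE : r x = r y by rewrite -fn // -(fn y) // E.
  have ry : ray F x y.
    have /andP[rx _] := r_in x Mx Fx.
    exists (dnorm (F y) / dnorm (F x)); first by rewrite divr_gt0 ?Fn.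
    move: E; rewrite !fE // -rE => /(congr1 (fun v => (dnorm (F y) / r x) *: v)).
    rewrite !scalerA => E.
    have e2 : dnorm (F y) / r x * (r x / dnorm (F y)) = 1 by field; rewrite !gt_eqF ?Fn.
    have e3 : dnorm (F y) / r x * (r x / dnorm (F x)) = dnorm (F y) / dnorm (F x) by field; rewrite !gt_eqF ?Fn.
    by move: E; rewrite e2 e3 scale1r.
  have [s [s0 H]] := same_orbit Mx Fx My Fy ry.
  move: s0; rewrite le_eqVlt => /orP[/eqP s0|s0].
    by case: H => -[-> _]; rewrite -s0 (flow0 HPhi).
  case: H => -[Ey Hq].
    by have := flow_increasing r_loc Fx s0 Hq; rewrite -Ey rE ltxx.
  by have := flow_increasing r_loc Fy s0 Hq; rewrite -Ey rE ltxx.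
- move=> v /= v1; have [->|v0] := eqVneq v 0; first by exists p; [exact: OM|exact: f0].
  have nv : 0 < dnorm v by rewrite dnorm_gt0.
  have [u [nu uv]] : exists u, dnorm u = 1 /\ v = dnorm v *: u.
    exists ((dnorm v)^-1 *: v); rewrite dnormZ ?invr_ge0 ?ltW // mulVf ?gt_eqF //.
    by rewrite scalerA mulfV ?scale1r // gt_eqF.
  (* [F] is onto a neighbourhood of 0 near [p], which provides an orbit in the direction [u]; on it
     the radius runs from values near 0 up to 1. *)
  have [A [B [g [[oA Ap' oB HA] [fA gB sg]]]]] := inverse_function (open_near oO Op) (sF p) (lt0r_neq0 dp).
  have [q q0 Hq] := near_ballP (open_near oB (fA p Ap').1).
  have u1 : 0 < `|u| + 1 by rewrite ltr_wpDl.
  pose e := q / (`|u| + 1).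
  have e0 : 0 < e by rewrite divr_gt0.
  have Be : B (e *: u).
    apply: Hq; rewrite Fp sub0r normrN normrZ gtr0_norm // /e mulrAC ltr_pdivrMr //.
    by rewrite ltr_pM2l // ltrDl.
  have [Ax0 Fx0] := gB _ Be; set x0 := g _ in Ax0 Fx0.
  have [Ox0 _ _] := HA _ Ax0.
  have u0 : u != 0 by rewrite -dnorm_gt0 nu.
  have Fx : F x0 != 0 by rewrite Fx0 scaler_eq0 negb_or gt_eqF.
  have Mx0 := OM Ox0.
  have hx0 := T1 x0 Mx0 Fx.
  have Tx0 : 0 <= T x0 by case: hx0.
  have fin s : M (Phi s x0) -> r (Phi s x0) = dnorm v -> f (Phi s x0) = v.
    move=> Ms rs; have [l l0 El] := flow_ray sF HPhi x0 s.
    have Fs : F (Phi s x0) != 0 by rewrite El scaler_eq0 negb_or gt_eqF.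
    rewrite fE // rs El Fx0 scalerA dnormZ ?mulr_ge0 ?ltW // nu mulr1 scalerA divfK; last by rewrite gt_eqF // mulr_gt0.
    by rewrite -uv.
  have np : \forall z \near p, M z -> F z != 0 -> r z < dnorm v.
    have h : dnorm (F p) < dnorm v / c by rewrite Fp d00 divr_gt0.
    apply: filterS2 nT (near_lt (cF p) h) => z Tz hz Mz Fz.
    have hz' : c * dnorm (F z) < dnorm v by rewrite mulrC -ltr_pdivlMr.
    by rewrite /r /S step_ge1; [rewrite subrr mul0r add0r mul1r|have := Tz Mz Fz; lra].
  have [b1 b2] := backward_in Mx0 Fx.
  have [a a0 Ha] := near_ballP np; have [L HL] := b2 a a0.
  pose N := Num.max 1 L.
  have N1 : 1 <= N by rewrite le_max lexx.
  have NL : L <= N by rewrite le_max lexx orbT.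
  have inM s : - N <= s <= T x0 -> M (Phi s x0).
    move=> /andP[h1 h2]; have [s0|s0] := leP 0 s; first exact: (hit_inside HS Mx0 hx0).
    by apply: OM; have := b1 (- s); rewrite opprK oppr_gt0; exact.
  have [|||s hs Es] := @ivt_local R (fun s => r (Phi s x0)) (- N) (T x0) (dnorm v).
  + by lra.
  + move=> s hs; have Ms := inM s hs.
    have Fs : F (Phi s x0) != 0 by apply: ray_neq0 Fx; exact: flow_ray.
    have [rt [srt _] nr] := r_loc _ Ms Fs.
    exists (fun t => rt (Phi t x0)).
      apply: (@continuous_comp _ _ _ (Phi^~ x0) rt); first exact: (flow_cont_time HPhi).
      exact: sm_continuous.
    have nt := @near_comp R R^o rV (Phi^~ x0) s _ (@flow_cont_time _ _ _ _ HPhi s x0) nr.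
    by apply: filterS nt => t Ht ht; apply: Ht; exact: inM.
  + apply/andP; split.
      have Fs : F (Phi (- N) x0) != 0 by apply: ray_neq0 Fx; exact: flow_ray.
      by apply/ltW/Ha => //; [exact: HL|apply: inM; lra].
    have TT : T (Phi (T x0) x0) = 0.
      by have [|_ ->] := T2 x0 (T x0) Mx0 Fx Tx0; [move=> q' /andP[h1 h2]; exact: (hit_inside HS Mx0 hx0)|rewrite subrr].
    by rewrite /r /S TT sub0r step_le0 ?oppr_le0 // subr0 mul1r mul0r addr0 oppr0 expR0.
  by exists (Phi s x0); [exact: inM|apply: fin => //; exact: inM].
- move=> x Mx; have [Fx|Fx] := eqVneq (F x) 0.
    rewrite (only_zero Mx Fx).
    have dcF : smv (fun y => c *: F y) p by apply: smvZ => //; exact: sm_cst.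
    exists (fun y => c *: F y); first split=> //.
      apply: unit_kernel => h; rewrite -jacE; last exact: smv_differentiable.
      rewrite (derive_scale _ (differentiable_cst _ _) (smv_differentiable (sF p))).2 Fp scaler0 add0r.
      rewrite jacE; last exact: smv_differentiable.
      move=> /eqP; rewrite scaler_eq0 gt_eqF //= => /eqP /(congr1 (mulmx^~ (invmx (jac F p)))).
      by rewrite mulmxK ?mul0mx // unitmxE unitfE lt0r_neq0.
    apply: filterS nT => y Ty My; have [Fy|Fy] := eqVneq (F y) 0; first by rewrite f0 // Fy scaler0.
    rewrite fE // /r /S step_ge1; last by have := Ty My Fy; lra.
    by rewrite subrr mul0r add0r mul1r mulfK // gt_eqF // Fn.
  have [rt [srt Drt] nr] := r_loc x Mx Fx.
  have rx : rt x != 0.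
    by rewrite -(nbhs_singleton nr Mx) gt_eqF //; case/andP: (r_in x Mx Fx).
  have [h1 h2] := psi_unit (sF x) srt Fx (rF Mx) rx (lt0r_neq0 Drt).
  exists (fun y => (rt y / dnorm (F y)) *: F y); first by split.
  by apply: filterS2 nr (smv_near_neq0 (sF x) Fx) => y ry Fy My; rewrite fE // ry.
Qed.

End Source.
End BallCase.

(** The quarter turn of the plane. The last property holds in dimension 2 only; listing properties
    allows [n] to remain a variable. *)
Definition is_rot (R : realType) n (J : 'M[R]_n) :=
  [/\ forall v : 'rV[R]_n, dot v (v *m J) = 0, forall v : 'rV[R]_n, v *m J *m J = - v,
      forall u v : 'rV[R]_n, dot (u *m J) (v *m J) = dot u v &
      forall u y : 'rV[R]_n, dot u u = 1 -> y = dot y u *: u + dot y (u *m J) *: (u *m J)].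

Lemma rot_exists (R : realType) n : n = 2%N -> exists J : 'M[R]_n, is_rot J.
Proof.
move=> ->; pose J : 'M[R]_2 := \matrix_(i, j) if i == j then 0 else if i == ord0 then 1 else -1.
have dE (u v : 'rV[R]_2) : dot u v = u 0 ord0 * v 0 ord0 + u 0 ord_max * v 0 ord_max.
  by rewrite /dot big_ord_recr big_ord1 /=; congr (u 0 _ * v 0 _ + _); apply: val_inj.
have J0 (v : 'rV[R]_2) : (v *m J) 0 ord0 = - v 0 ord_max.
  by rewrite mxE big_ord_recr big_ord1 /= !mxE /= mulr0 add0r mulrN1.
have J1 (v : 'rV[R]_2) : (v *m J) 0 ord_max = v 0 ord0.
  rewrite mxE big_ord_recr big_ord1 /= !mxE /= mulr0 addr0 mulr1.
  by congr (v 0 _); apply: val_inj.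
have rE (u v : 'rV[R]_2) : u 0 ord0 = v 0 ord0 -> u 0 ord_max = v 0 ord_max -> u = v.
  move=> h0 h1; apply/rowP => i.
  have [E|E] : i = ord0 \/ i = ord_max; [|by rewrite E..].
  by case: i => -[|[|//]] p; [left|right]; apply: val_inj.
exists J; split.
- by move=> v; rewrite dE J0 J1; ring.
- by move=> v; apply: rE; rewrite [RHS]mxE !(J0, J1).
- by move=> u v; rewrite !dE !J0 !J1; ring.
move=> u y; rewrite !dE => u1.
have cE (a b : R) (p q : 'rV[R]_2) i : (a *: p + b *: q) 0 i = a * p 0 i + b * q 0 i by rewrite !mxE.
by apply: rE; rewrite cE !(J0, J1) -[LHS]mulr1 -u1; ring.
Qed.

(** * Rotations of the plane and polar coordinates *)

Section Rotation.
Context {R : realType} {n : nat}.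
Local Notation rV := 'rV[R]_n.
Variable J : 'M[R]_n.
Hypothesis HJ : is_rot J.

Let J1 (v : rV) : dot v (v *m J) = 0. Proof. by case: HJ. Qed.
Let J2 (v : rV) : v *m J *m J = - v. Proof. by case: HJ. Qed.
Let J3 (u v : rV) : dot (u *m J) (v *m J) = dot u v. Proof. by case: HJ. Qed.

Definition Rot (t : R) (v : rV) : rV := cos t *: v + sin t *: (v *m J).

Lemma Rot0 v : Rot 0 v = v.
Proof. by rewrite /Rot cos0 sin0 scale1r scale0r addr0. Qed.

Lemma RotD s t v : Rot (s + t) v = Rot s (Rot t v).
Proof.
apply/rowP => j; rewrite /Rot mulmxDl -!scalemxAl J2 !mxE cosD sinD; ring.
Qed.

Lemma RotZ t a v : Rot t (a *: v) = a *: Rot t v.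
Proof. by rewrite /Rot -scalemxAl scalerDr !scalerA ![a * _]mulrC. Qed.

Lemma dot_Rot t u v : dot (Rot t u) (Rot t v) = dot u v.
Proof.
have J4 : dot u (v *m J) = - dot (u *m J) v.
  by rewrite -[dot u _]J3 J2 dotNr.
rewrite /Rot !dotDl !dotDr !dotZl !dotZr J3 J4.
by rewrite -[RHS]mul1r -(cos2Dsin2 t); ring.
Qed.

Lemma dnorm_Rot t v : dnorm (Rot t v) = dnorm v.
Proof. by rewrite /dnorm dot_Rot. Qed.

Lemma Rot_fix t e : dot e e = 1 -> Rot t e = e <-> cos t = 1.
Proof.
move=> e1; split=> [/(congr1 (dot e))|h]; first by rewrite /Rot dotDr !dotZr e1 J1 mulr1 mulr0 addr0.
have s0 : sin t = 0.
  by have := cos2Dsin2 t; rewrite h expr1n => /eqP; rewrite -subr_eq0 addrAC subrr add0r sqrf_eq0 => /eqP.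
by rewrite /Rot h s0 scale1r scale0r addr0.
Qed.

Lemma cos_per (m : nat) (x : R) : cos (x + m%:R * (2 * pi)) = cos x.
Proof.
have <- : pi *+ 2 *+ m = m%:R * (2 * pi) :> R by rewrite !mulr_natl.
exact: (periodicn (@cosD2pi R)).
Qed.

Lemma cos_eq1 (t : R) : cos t = 1 -> exists k : int, t = 2 * pi * k%:~R.
Proof.
have p0 : 0 < 2 * pi :> R by rewrite mulr_gt0 // pi_gt0.
pose k := Num.floor (t / (2 * pi)).
have /andP[f1 f2] := floor_itv (t / (2 * pi)); rewrite -/k in f1 f2.
have d1 : k%:~R * (2 * pi) <= t by rewrite -ler_pdivlMr.
have d2 : t < k%:~R * (2 * pi) + 2 * pi by move: f2; rewrite ltr_pdivrMr // intrD mulrDl mul1r.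
pose s := t - k%:~R * (2 * pi).
have s0 : 0 <= s by rewrite subr_ge0.
have s1 : s < 2 * pi by rewrite /s; lra.
have cs : cos t = cos s.
  rewrite -(subrK (k%:~R * (2 * pi)) t) -/s.
  case: (intP k) => [|m|m]; first by rewrite mul0r addr0.
    by rewrite cos_per.
  by rewrite mulrNz mulNr -(cos_per m.+1 (s - _)) subrK.
rewrite cs => h; exists k.
suff s00 : s = 0 by have := subrK (k%:~R * (2 * pi)) t; rewrite -/s s00 add0r mulrC => ->.
have pp : 0 < pi :> R := pi_gt0 R.
have [sp|ps] := leP s pi.
  by apply: (@cos_inj R); [rewrite in_itv /= s0|rewrite in_itv /= lexx ltW|rewrite cos0].
have h' : cos (2 * pi - s) = 1.
  by have := cos_per 1%N (- s); rewrite mul1r cosN h addrC.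
have E : 2 * pi - s = 0.
  apply: (@cos_inj R); [|by rewrite in_itv /= lexx ltW|by rewrite h' cos0].
  by rewrite in_itv /=; apply/andP; split; lra.
lra.
Qed.

Lemma cos_2pi (k : int) : cos (2 * pi * k%:~R) = 1 :> R.
Proof.
case: (intP k) => [|m|m]; first by rewrite mulr0 cos0.
  by rewrite -[_ * _]add0r [2 * pi * _]mulrC cos_per cos0.
by rewrite mulrNz mulrN cosN -[_ * _]add0r [2 * pi * _]mulrC cos_per cos0.
Qed.

Lemma unit_angle e u : dot e e = 1 -> dot u u = 1 -> exists t, u = Rot t e.
Proof.
move=> e1 u1; have [_ _ _ /(_ e u e1) E] := HJ.
pose c := dot u e; pose s := dot u (e *m J).
have cs : c ^+ 2 + s ^+ 2 = 1.
  rewrite -u1 [in RHS]E dotDl !dotDr !dotZl !dotZr J3 e1 [dot (e *m J) e]dotC J1 -/c -/s; ring.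
have c1 : -1 <= c <= 1 by apply/andP; split; have := sqr_ge0 s; nra.
have [s0|s0] := leP 0 s.
  exists (acos c); rewrite {1}E /Rot acosK ?in_itv // sin_acos // -/c -/s.
  have -> : 1 - c ^+ 2 = s ^+ 2 by lra.
  by rewrite sqrtr_sqr ger0_norm.
exists (- acos c); rewrite {1}E /Rot cosN sinN acosK ?in_itv // sin_acos // -/c -/s.
have -> : 1 - c ^+ 2 = s ^+ 2 by lra.
by rewrite sqrtr_sqr ltr0_norm ?opprK.
Qed.

(** On the half-plane around [e] the angle has a continuous formula, whereas [unit_angle] gives it
    without any continuity. *)
Lemma small_angle e u : dot e e = 1 -> dot u u = 1 -> 0 < dot u e ->
  u = Rot (asin (dot u (e *m J))) e.
Proof.
move=> e1 u1 c0; have [_ _ _ /(_ e u e1) E] := HJ.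
pose c := dot u e; pose s := dot u (e *m J); rewrite -/c in c0.
have cs : c ^+ 2 + s ^+ 2 = 1.
  rewrite -u1 [in RHS]E dotDl !dotDr !dotZl !dotZr J3 e1 [dot (e *m J) e]dotC J1 -/c -/s; ring.
have s1 : -1 <= s <= 1 by apply/andP; split; have := sqr_ge0 c; nra.
rewrite {1}E /Rot asinK ?in_itv // cos_asin // -/c -/s.
have -> : 1 - s ^+ 2 = c ^+ 2 by lra.
by rewrite sqrtr_sqr gtr0_norm.
Qed.

Lemma derive_Rot v t : is_derive t (1 : R) (fun s => Rot s v) (Rot t (v *m J)).
Proof.
apply/is_derive_rowP => j.
have -> : (fun s => Rot s v 0 j) = (fun s => cos s * v 0 j + sin s * (v *m J) 0 j).
  by rewrite funeqE => s; rewrite !mxE.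
have -> : Rot t (v *m J) 0 j = (cos t * 0 + v 0 j * - sin t) + (sin t * 0 + (v *m J) 0 j * cos t).
  by rewrite /Rot J2 !mxE; ring.
by apply: is_deriveD_; apply: is_deriveM_; exact: is_derive_cst.
Qed.

Section Polar.
Variables (e : rV) (c : R).
Hypothesis e1 : dot e e = 1.

(** Cartesian coordinates with respect to [e] and [e *m J] are reinterpreted as radius and angle,
    the angle being scaled by [c]. The factors 1 and [d^-1] together express a root of order [d]. *)
Definition polar (y : rV) : rV := dot y e *: Rot (c * dot y (e *m J)) e.

Lemma smv_polar y : smv polar y.
Proof.
have se (w : rV) : sm (fun y => dot y w) y by apply: sm_dot; [exact: smv_id|exact: smv_cst].
have sb : sm (fun y => c * dot y (e *m J)) y by apply: smM => //; exact: sm_cst.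
apply: smvZ; first exact: se.
apply: smvD; apply: smvZ; try exact: smv_cst.
  by apply: (sm_comp1 (h := cos)) => //; have [] := sm_sin_cos (c * dot y (e *m J)).
by apply: (sm_comp1 (h := sin)) => //; have [] := sm_sin_cos (c * dot y (e *m J)).
Qed.

Lemma polar_unit y : c != 0 -> dot y e != 0 -> \det (jac polar y) != 0.
Proof.
move=> c0 y0; apply: unit_kernel => h; rewrite -jacE; last by exact/smv_differentiable/smv_polar.
have dd (w : rV) : differentiable (fun y : rV => dot y w) y.
  by apply: sm_differentiable; apply: sm_dot; [exact: smv_id|exact: smv_cst].
have Dd (w : rV) : 'D_h (fun y : rV => dot y w) y = dot h w.
  rewrite derive_dot; [|by apply/smv_differentiable/smv_id|exact: differentiable_cst].
  by rewrite derive_cst_ dot0r addr0 derive_id.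
pose b (y : rV) := c * dot y (e *m J).
have db : differentiable b y by apply: differentiableM => //; exact: differentiable_cst.
have Db : 'D_h b y = c * dot h (e *m J).
  by rewrite deriveM_ ?derive_cst_ ?mul0r ?add0r ?Dd //; exact: differentiable_cst.
have dR t : differentiable (fun s => Rot s e) t by apply/derivable1_diffP; case: (derive_Rot e t).
have dRb : differentiable (fun y => Rot (b y) e) y.
  by apply: (@differentiable_comp _ _ _ _ b (fun s => Rot s e)).
have DRb : 'D_h (fun y => Rot (b y) e) y = (c * dot h (e *m J)) *: Rot (b y) (e *m J).
  rewrite (@derive_comp _ _ _ _ b (fun s => Rot s e)) // Db.
  have -> : (c * dot h (e *m J) : R) = (c * dot h (e *m J)) *: (1 : R) by rewrite -[_ *: _]/(_ * _) mulr1.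
  rewrite deriveZv //; congr (_ *: _); last by have [_ ->] := derive_Rot e (b y).
  by rewrite -[_ *: _]/(_ * _) mulr1.
rewrite /polar (derive_scale _ (dd e) dRb).2 Dd DRb scalerA => E.
have o1 : dot (Rot (b y) e) (Rot (b y) (e *m J)) = 0 by rewrite dot_Rot J1.
have n1 : dot (Rot (b y) e) (Rot (b y) e) = 1 by rewrite dot_Rot.
have n2 : dot (Rot (b y) (e *m J)) (Rot (b y) (e *m J)) = 1 by rewrite dot_Rot J3.
have h1 : dot h e = 0.
  by have := congr1 (dot (Rot (b y) e)) E; rewrite dotDr !dotZr o1 n1 dot0r mulr1 mulr0 addr0.
have h2 : dot h (e *m J) = 0.
  have := congr1 (dot (Rot (b y) (e *m J))) E.
  rewrite dotDr !dotZr n2 dot0r h1 mul0r add0r mulr1 => /eqP.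
  by rewrite !mulf_eq0 (negbTE y0) (negbTE c0) => /eqP.
by have [_ _ _ /(_ e h e1) ->] := HJ; rewrite h1 h2 !scale0r addr0.
Qed.

Lemma polar_pt (a b : R) : dot (a *: e + b *: (e *m J)) e = a /\
  dot (a *: e + b *: (e *m J)) (e *m J) = b.
Proof.
by rewrite !dotDl !dotZl J3 e1 J1 [dot (e *m J) e]dotC J1 !mulr0 !mulr1 addr0 add0r.
Qed.

Lemma polar_ptE (a b : R) : polar (a *: e + b *: (e *m J)) = a *: Rot (c * b) e.
Proof. by rewrite /polar; have [-> ->] := polar_pt a b. Qed.

End Polar.

Lemma jac_unit_comp (f g : rV -> rV) x : smv f x -> smv g (f x) -> \det (jac f x) != 0 ->
  \det (jac g (f x)) != 0 -> smv (fun y => g (f y)) x /\ \det (jac (fun y => g (f y)) x) != 0.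
Proof.
move=> sf sg df dg; have s : smv (fun y => g (f y)) x by exact: (@smv_comp R rV n n f g).
split; first exact: s.
apply: unit_kernel => h; rewrite -jacE; last exact: smv_differentiable.
rewrite (derive_comp _ (smv_differentiable sf) (smv_differentiable sg)).
rewrite jacE; last exact: smv_differentiable.
move=> /(congr1 (mulmx^~ (invmx (jac g (f x))))); rewrite mulmxK ?unitmxE ?unitfE // mul0mx.
rewrite jacE; last exact: smv_differentiable.
by move=> /(congr1 (mulmx^~ (invmx (jac f x)))); rewrite mulmxK ?unitmxE ?unitfE // mul0mx.
Qed.

End Rotation.

(** * No zero: the annulus *)

Section Annulus.
Context {R : realType} {n : nat}.
Local Notation rV := 'rV[R]_n.

Section TwoTimes.
Variables (Om : set rV) (F : rV -> rV) (Phi : R -> rV -> rV).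
Hypothesis HS : setting Om F Phi.
Hypothesis n2 : (2 <= n)%N.
Hypothesis EX : forall y, Om y -> F y != 0 -> exits Om Phi y.
Hypothesis EX' : forall y, Om y -> F y != 0 -> exits Om (fun t => Phi (- t)) y.
Let M := closure Om.
Let HPhi := setting_flow HS.
Let sF := setting_smv HS.
Let HS' := setting_rev HS.

(** A zero would attract the orbits near it in one time direction, and these would not leave in that
    direction. *)
Lemma no_zero x : M x -> F x != 0.
Proof.
move=> Mx; apply/eqP => Fx; have [Ox dx] := zero_interior HS Mx Fx.
have [_ dn] := punctured HS n2.
have [dneg|dpos|d0] := ltgtP (\det (jac F x)) 0; last by rewrite d0 eqxx in dx.
  have [y [ay Oy /eqP Fy]] := dn x Ox _ (attracted_near HS (And3 Ox Fx dneg)).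
  by have := attracted_neq_exits ay (EX Oy Fy).
have sk : sink Om (rev F) x.
  split=> //; first by rewrite /rev Fx mul0mx.
  by rewrite jac_rev // det_mulmx det_revmx ?mulrN1 ?oppr_lt0 //; exact: ltnW.
have [y [ay Oy /eqP Fy]] := dn x Ox _ (attracted_near HS' sk).
by have := attracted_neq_exits ay (EX' Oy Fy).
Qed.

Lemma two_times : exists To Ti : rV -> R,
  [/\ forall x, M x -> [/\ 0 <= To x, 0 <= Ti x & 0 < Ti x + To x],
      forall x, M x -> (Om x <-> 0 < To x /\ 0 < Ti x),
      forall x s, M x -> - Ti x <= s <= To x ->
        [/\ M (Phi s x), To (Phi s x) = To x - s & Ti (Phi s x) = Ti x + s] &
      forall x, M x -> exists Go Gi : rV -> R,
        [/\ sm Go x, sm Gi x, 'D_(fld F x) Go x = -1, 'D_(fld F x) Gi x = 1 &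
            \forall y \near x, M y -> To y = Go y /\ Ti y = Gi y]].
Proof.
have [To [e1 e2 e3]] := exit_time HS EX.
have EXr y : Om y -> rev F y != 0 -> exits Om (fun t => Phi (- t)) y.
  by move=> Oy _; apply: EX' => //; apply: no_zero; exact: subset_closure.
have [Ti [i1 i2 i3]] := exit_time HS' EXr.
have nz x : M x -> F x != 0 := @no_zero x.
have nzr x : M x -> rev F x != 0 by move=> Mx; apply: rev_neq0; exact: nz.
exists To, Ti; split.
- move=> x Mx; have [t0 _ _ h1 h2] := e1 x Mx (nz x Mx).
  have [t0' _ _ h1' h2'] := i1 x Mx (nzr x Mx); split=> //.
  have [|le] := ltP 0 (Ti x + To x); first by [].
  have Eo : To x = 0 by lra.
  have Ei : Ti x = 0 by lra.
  rewrite Eo (flow0 HPhi) in h2; rewrite Ei oppr0 (flow0 HPhi) in h2'.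
  have [d d0 Hd] := outbox_out h2; have [e e0 He] := outbox_out h2'.
  pose m := Num.min d e.
  have m0 : 0 < m by rewrite lt_min d0.
  have md : m <= d by rewrite ge_min lexx.
  have me : m <= e by rewrite ge_min lexx orbT.
  have [k1 _] := Hd m m0 md; have [_ k2] := He m m0 me.
  by exfalso; apply: k1; apply: subset_closure; rewrite opprK in k2.
- move=> x Mx; have [t0 _ _ h1 h2] := e1 x Mx (nz x Mx).
  have [t0' _ _ h1' h2'] := i1 x Mx (nzr x Mx); split.
    move=> Ox; split; rewrite lt_neqAle ?t0 ?t0' andbT; apply/eqP => E.
      by apply: h1; rewrite -E (flow0 HPhi).
    by apply: h1'; rewrite -E oppr0 (flow0 HPhi).
  move=> [p1 p2]; apply: contrapT => nx.
  have [b|b] := boundary_box HS Mx nx.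
    have H0 : hit Om Phi x 0.
      by split; rewrite ?(flow0 HPhi) // => s s0 /(lt_trans s0); rewrite ltxx.
    by move: p1; rewrite (hit_unique HS Mx (e1 x Mx (nz x Mx)) H0) ltxx.
  have H0 : hit Om (fun t => Phi (- t)) x 0.
    by split; rewrite ?oppr0 ?(flow0 HPhi) // => s s0 /(lt_trans s0); rewrite ltxx.
  by move: p2; rewrite (hit_unique HS' Mx (i1 x Mx (nzr x Mx)) H0) ltxx.
- move=> x s Mx /andP[s1 s2].
  have ho := e1 x Mx (nz x Mx); have hi := i1 x Mx (nzr x Mx).
  have [s0|s0] := leP 0 s.
    have Mq q : 0 <= q <= s -> M (Phi q x).
      by move=> /andP[q0 qs]; apply: (hit_inside HS Mx ho) => //; exact: le_trans s2.
    have Ms : M (Phi s x) by apply: Mq; rewrite s0 lexx.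
    have [_ ->] := e2 x s Mx (nz x Mx) s0 Mq; split=> //.
    have [|_] := i2 (Phi s x) s Ms (nzr _ Ms) s0.
      by move=> q /andP[q0 qs]; rewrite -(flowD HPhi); apply: Mq; apply/andP; split; lra.
    by rewrite (flowK HPhi) => ->; rewrite subrK.
  have s0' : 0 <= - s by rewrite oppr_ge0 ltW.
  have Mq q : 0 <= q <= - s -> M (Phi (- q) x).
    by move=> /andP[q0 qs]; apply: (hit_inside HS' Mx hi) => //; apply: le_trans qs _; lra.
  have Ms : M (Phi s x) by rewrite -(opprK s); apply: Mq; rewrite s0' lexx.
  have [_] := i2 x (- s) Mx (nzr x Mx) s0' Mq; rewrite opprK => ->; split=> //.
  have [|_] := e2 (Phi s x) (- s) Ms (nz _ Ms) s0'.
    move=> q /andP[q0 qs]; rewrite -(flowD HPhi).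
    have -> : q + s = - (- s - q) by ring.
    by apply: Mq; rewrite subr_ge0 qs lerBlDr lerDl.
  by rewrite (flowK HPhi) => ->; rewrite opprK addrK.
- move=> x Mx; have [Go [so Do] no_] := e3 x Mx (nz x Mx).
  have [Gi [si Di] ni] := i3 x Mx (nzr x Mx).
  exists Go, Gi; split=> //; last by apply: filterS2 no_ ni => y h1 h2 My; rewrite h1 // h2.
  move: Di; rewrite fld_rev //; last by exact: ltnW.
  have -> : - fld F x = (-1) *: fld F x by rewrite scaleN1r.
  rewrite deriveZv; last exact: sm_differentiable.
  by rewrite scaleN1r => /oppr_inj.
Qed.

End TwoTimes.

(** * The core of the domain and flows lifted to it *)

Section Mid.
Variables (Om : set rV) (F : rV -> rV) (Phi : R -> rV -> rV) (To Ti : rV -> R).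
Hypothesis HS : setting Om F Phi.
Let M := closure Om.
Hypothesis nz : forall x, M x -> F x != 0.
Hypothesis T0 : forall x, M x -> [/\ 0 <= To x, 0 <= Ti x & 0 < Ti x + To x].
Hypothesis TOm : forall x, M x -> (Om x <-> 0 < To x /\ 0 < Ti x).
Hypothesis Tflow : forall x s, M x -> - Ti x <= s <= To x ->
        [/\ M (Phi s x), To (Phi s x) = To x - s & Ti (Phi s x) = Ti x + s].
Hypothesis Tloc : forall x, M x -> exists Go Gi : rV -> R,
        [/\ sm Go x, sm Gi x, 'D_(fld F x) Go x = -1, 'D_(fld F x) Gi x = 1 &
            \forall y \near x, M y -> To y = Go y /\ Ti y = Gi y].
Let HPhi := setting_flow HS.
Let sF := setting_smv HS.
Let rF := setting_reg HS.
Let cM := setting_compact HS.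
Let oO := setting_open HS.
Let OM := @subset_closure _ Om.

(** Position on the orbit as a fraction of its duration: 0 at the entrance, 1 at the exit. *)
Definition tau x := Ti x / (Ti x + To x).
(* To and Ti are the times to reach the boundary forwards and backwards: the
   core, a section of the flow, consists of the midpoints in time of its orbits. *)
Definition mid x := Phi ((To x - Ti x) / 2) x.
Definition core x := M x /\ To x = Ti x.
(** Radius from 1 to 2 along each orbit, direction of [F]: a local diffeomorphism to the model
    annulus that may fail to be injective. *)
Definition psi x := ((1 + tau x) / dnorm (F x)) *: F x.

(** The total time is constant along an orbit, so the derivative along the field is its inverse. *)
Lemma tau_loc x : M x -> exists2 r : rV -> R, sm r x /\ 0 < 'D_(fld F x) r x &
  \forall y \near x, M y -> tau y = r y.
Proof.
move=> Mx; have [Go [Gi [so si Do Di nG]]] := Tloc Mx.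
have [Eo Ei] := nbhs_singleton nG Mx.
have [t0 t1 t2] := T0 Mx.
have s0 : Gi x + Go x != 0 by rewrite -Eo -Ei gt_eqF.
have sS : sm (fun y => Gi y + Go y) x by exact: smD.
have sV : sm (fun y => (Gi y + Go y)^-1) x by exact: smV.
exists (fun y => Gi y * (Gi y + Go y)^-1); last first.
  by apply: filterS nG => y Hy My; have [E1 E2] := Hy My; rewrite /tau E1 E2.
split; first exact: smM.
rewrite deriveM_; [|exact: sm_differentiable..].
rewrite deriveV_ //; last exact: sm_differentiable.
rewrite deriveD_; [|exact: sm_differentiable..].
rewrite Do Di subrr mul1r; rewrite ?(mulr0, mul0r, oppr0, addr0).
by rewrite invr_gt0 -Eo -Ei.
Qed.

Lemma tau_in x : M x -> 0 <= tau x <= 1.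
Proof.
move=> Mx; have [t0 t1 t2] := T0 Mx; apply/andP; split.
  by apply: divr_ge0 => //; exact: ltW.
by rewrite /tau ler_pdivrMr // mul1r lerDl.
Qed.

Lemma psi_loc x : M x -> exists2 G : rV -> rV, smv G x /\ \det (jac G x) != 0 &
  \forall y \near x, M y -> psi y = G y.
Proof.
move=> Mx; have [r [sr Dr] nr] := tau_loc Mx.
have s1 : sm (fun y => 1 + r y) x by apply: smD => //; exact: sm_cst.
have r1 : 1 + r x != 0.
  by rewrite -(nbhs_singleton nr Mx) gt_eqF //; have /andP[] := tau_in Mx; lra.
have D1 : 'D_(fld F x) (fun y => 1 + r y) x != 0.
  rewrite deriveD_; [|exact: differentiable_cst|exact: sm_differentiable].
  by rewrite derive_cst_ add0r gt_eqF.
have [h1 h2] := psi_unit (sF x) s1 (nz Mx) (rF Mx) r1 D1.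
exists (fun y => ((1 + r y) / dnorm (F y)) *: F y) => //.
by apply: filterS nr => y ry My; rewrite /psi ry.
Qed.

Lemma dnorm_psi x : M x -> dnorm (psi x) = 1 + tau x.
Proof.
by move=> Mx; rewrite psi_norm ?nz //; have /andP[] := tau_in Mx; lra.
Qed.

Lemma mid_range x : M x -> - Ti x <= (To x - Ti x) / 2 <= To x.
Proof. by move=> /T0 [h1 h2 h3]; apply/andP; split; lra. Qed.

Lemma core_mid x : M x -> core (mid x).
Proof.
move=> Mx; have [h1 h2 h3] := Tflow Mx (mid_range Mx); split=> //.
by rewrite /mid h2 h3; lra.
Qed.

Lemma mid_id x : core x -> mid x = x.
Proof. by move=> [_ E]; rewrite /mid E subrr mul0r (flow0 HPhi). Qed.

Lemma core_Om x : core x -> Om x.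
Proof. by move=> [Mx E]; apply/(TOm Mx); have [h1 h2 h3] := T0 Mx; split; lra. Qed.

Lemma core_tau x : core x -> tau x = 2^-1.
Proof.
move=> [Mx E]; have [h1 h2 h3] := T0 Mx; rewrite /tau E; field.
by apply/eqP; lra.
Qed.

Lemma tau_core x : M x -> tau x = 2^-1 -> core x.
Proof.
move=> Mx; have [h1 h2 h3] := T0 Mx; rewrite /tau => /(congr1 (fun z => z * (Ti x + To x))).
by rewrite divfK ?gt_eqF // => E; split=> //; lra.
Qed.

Lemma mid_near x (P : rV -> Prop) : M x -> (\forall z \near mid x, P z) ->
  \forall y \near x, M y -> P (mid y).
Proof.
move=> Mx /(flow_near HPhi) [d d0 Hd]; have [Go [Gi [so si _ _ nG]]] := Tloc Mx.
have [Eo Ei] := nbhs_singleton nG Mx.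
have sc : sm (fun y => (Go y - Gi y) / 2) x by apply: smM; [exact: smB|exact: sm_cst].
have /(@cont_distP R rV R) /(_ d d0) := sm_continuous sc.
apply: filterS2 (nearI nG (@ball_nearP R rV (fun y => `|x - y| < d) x d d0 (fun _ h => h))) => y [Ey xy] h My.
by have [E1 E2] := Ey My; apply: Hd => //; rewrite E1 E2 Eo Ei.
Qed.

Lemma core_closed x : ~ core x -> \forall y \near x, ~ core y.
Proof.
move=> nx; have [Mx|nM] := pselect (M x); last by apply: filterS (near_notM nM) => y h [].
have [r [sr _] nr] := tau_loc Mx.
have tx : r x - 2^-1 != 0.
  by rewrite subr_eq0 -(nbhs_singleton nr Mx); apply/eqP => /(tau_core Mx).
have sr' : sm (fun y => r y - 2^-1) x by apply: smB => //; exact: sm_cst.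
apply: filterS2 nr (near_neq0 (sm_continuous sr') tx) => y ry h cy.
by move: h; rewrite -ry ?(core_tau cy) ?subrr ?eqxx //; case: cy.
Qed.

Lemma core_cluster (u : nat -> rV) : (forall k, core (u k)) ->
  exists2 z, core z & forall e : R, 0 < e -> forall N, exists2 k, (N <= k)%N & `|z - u k| < e.
Proof.
move=> cu; have [z Mz cz] := @compact_cluster _ _ M u cM (fun k => (cu k).1).
exists z => //; apply: contrapT => /core_closed /near_ballP [r r0 Hr].
by have [k _ zk] := cz r r0 0%N; have := Hr _ zk (cu k).
Qed.

(** [mid] is a continuous retraction of the domain onto the core, so connectedness is inherited,
    also after removal of a set invariant under [mid]. *)
Lemma lconn_core (K : rV -> Prop) : (forall x, M x -> K (mid x) <-> K x) ->
  lconn (fun x => Om x /\ ~ K x) -> lconn (fun x => core x /\ ~ K x).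
Proof.
move=> KM cO; have cm x : Om x /\ ~ K x -> {for x, continuous mid}.
  move=> [Ox _]; apply/(@cont_distP R rV rV) => e e0.
  have := mid_near (OM Ox) (@ball_nearP R rV (fun z => `|mid x - z| < e) _ e e0 (fun _ h => h)).
  by move=> H; apply: filterS2 H (open_near oO Ox) => y h /OM; exact: h.
apply: lconn_eq (lconn_image cO cm) => y; split.
  by move=> [x [Ox Kx] <-]; split; [exact/core_mid/OM|move=> /(KM _ (OM Ox))].
by move=> [cy Ky]; exists y; [split=> //; exact: core_Om|exact: mid_id].
Qed.

Lemma psi_Om x : Om x -> smv psi x /\ \det (jac psi x) != 0.
Proof.
move=> Ox; have [G [sG dG] nG] := psi_loc (OM Ox).
have E : \forall y \near x, G y = psi y.
  by apply: filterS2 nG (open_near oO Ox) => y h /OM My; rewrite h.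
split; first exact: smv_eq sG.
suff -> : jac psi x = jac G x by [].
apply/matrixP => i j; rewrite !mxE; apply: near_eq_derive.
by apply: filterS E => y ->.
Qed.

(** The norm of [psi] is [1 + tau], so a field that moves [psi] orthogonally to itself preserves
    [tau], and the core is the level [2^-1]. Real induction uses that the core is closed and
    contained in the open domain. *)
Lemma core_inv (W : rV -> rV) (P : R -> rV -> rV) : is_flow W P ->
  (forall x, Om x -> dot (psi x) ('D_(W x) psi x) = 0) ->
  forall t x, 0 <= t -> core x -> core (P t x).
Proof.
move=> HP orth t x t0 cx; move: t t0; apply: real_induction => t t0 IH.
have ct : core (P t x).
  have [->|tn] := eqVneq t 0; first by rewrite (flow0 HP).
  have tp : 0 < t by rewrite lt_neqAle eq_sym tn.
  apply: contrapT => /core_closed /(flow_near HP) [e e0 He].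
  pose s := Num.max 0 (t - e / 2).
  have s0 : 0 <= s by rewrite le_max lexx.
  have st : s < t by rewrite gt_max tp /= ltrBlDr ltrDl divr_gt0.
  have se : t - e / 2 <= s by rewrite le_max lexx orbT.
  have ts : `|t - s| < e by rewrite gtr0_norm ?subr_gt0 //; lra.
  have xx : `|x - x| < e by rewrite subrr normr0.
  by have := He s x ts xx (IH s s0 st).
have [e e0 He] := flow_near HP (open_near oO (core_Om ct)).
exists e => // s ts se.
have Os q : `|q| <= `|s - t| -> Om (P (q + t) x).
  rewrite [`|s - t|]ger0_norm ?subr_ge0 // => qs; apply: He; last by rewrite subrr normr0.
  by rewrite opprD addrCA subrr addr0 normrN; lra.
have [E|] := eqVneq (dot (psi (P s x)) (psi (P s x))) (dot (psi (P t x)) (psi (P t x))).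
  apply: tau_core; first by apply: OM; have := Os (s - t) (lexx _); rewrite subrK.
  move: E; rewrite -!dnorm_sqr !dnorm_psi ?(core_tau ct); last 2 first.
  - exact: ct.1.
  - by apply: OM; have := Os (s - t) (lexx _); rewrite subrK.
  have Ms : M (P s x) by apply: OM; have := Os (s - t) (lexx _); rewrite subrK.
  have /andP[h _] := tau_in Ms => E.
  (* The difference of the squares of [1 + tau] and [1 + 2^-1], in factored form; the second factor
     is positive. *)
  have : (tau (P s x) - 2^-1) * (tau (P s x) + 2^-1 + 2) = 0 by lra.
  by move=> /eqP; rewrite mulf_eq0 => /orP[/eqP|/eqP]; lra.
move=> /eqP; case.
have := @derive0_cst R (fun q => dot (psi (P (q + t) x)) (psi (P (q + t) x)))
  (fun q => dot ('D_(W (P (q + t) x)) psi (P (q + t) x)) (psi (P (q + t) x)) + dot (psi (P (q + t) x)) ('D_(W (P (q + t) x)) psi (P (q + t) x))) (s - t).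
rewrite subrK add0r; apply => q qs; last first.
  by rewrite dotC orth ?addr0 //; exact: Os.
have [sp _] := psi_Om (Os q qs); have dp := smv_differentiable sp.
have dN : differentiable (fun y => dot (psi y) (psi y)) (P (q + t) x) by apply: sm_differentiable; exact: sm_dot.
rewrite -derive_dot //.
have := @is_derive_lin R R^o (fun q => dot (psi (P q x)) (psi (P q x))) 1 t q.
rewrite mul1r => /(_ _ (flow_derf HP dN)); rewrite scale1r.
by under eq_fun do rewrite mul1r.
Qed.

(** A cut-off in [tau] that is supported in [[1/4, 3/4]] and equal to 1 on [[3/8, 5/8]]. *)
Lemma core_bump t : (t <= 4^-1 \/ 3 / 4 <= t -> step (8 * t - 2) * step (6 - 8 * t) = 0 :> R) /\
  (t = 2^-1 -> step (8 * t - 2) * step (6 - 8 * t) = 1 :> R).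
Proof.
split=> [[h|h]|->]; first by rewrite step_le0 ?mul0r //; lra.
  by rewrite [step (6 - _)]step_le0 ?mulr0 //; lra.
by rewrite !step_ge1 ?mulr1 //; lra.
Qed.

(* Y is pulled back by the local diffeomorphism psi and cut off away from the core. *)
Lemma lift_flow (Y : rV -> rV) : (forall y, smv Y y) -> (forall y, dot y (Y y) = 0) ->
  exists (X : rV -> rV) (P : R -> rV -> rV),
   [/\ is_flow X P, forall t x, core x -> core (P t x) & forall x, core x -> 'D_(X x) psi x = Y (psi x)].
Proof.
move=> sY oY.
pose kap x := step (8 * tau x - 2) * step (6 - 8 * tau x).
pose X0 x := Y (psi x) *m invmx (jac psi x).
pose X x := if pselect (Om x) then kap x *: X0 x else 0.
have XOm x : Om x -> X x = kap x *: X0 x by rewrite /X; case: pselect.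
have XnOm x : ~ Om x -> X x = 0 by rewrite /X; case: pselect.
have DX x : Om x -> 'D_(X x) psi x = kap x *: Y (psi x).
  move=> Ox; have [sp dp] := psi_Om Ox.
  rewrite XOm // jacE; last exact: smv_differentiable.
  by rewrite -scalemxAl mulmxKV // unitmxE unitfE.
have sX x : smv X x.
  have zero : (\forall y \near x, X y = 0) -> smv X x.
    by move=> h; apply: smv_eq (smv_cst 0 x); apply: filterS h => y ->.
  have [Mx|nM] := pselect (M x); last first.
    by apply: zero; apply: filterS (near_notM nM) => y h; apply: XnOm => /OM.
  have [r [sr _] nr] := tau_loc Mx.
  have [Ox|nx] := pselect (Om x).
    have E : \forall y \near x, kap y *: X0 y = X y.
      by apply: filterS (open_near oO Ox) => y Oy; rewrite XOm.
    apply: smv_eq E _; apply: smvZ.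
      apply: (@sm_eq _ _ (fun y => step (8 * r y - 2) * step (6 - 8 * r y))).
        by apply: filterS2 nr (open_near oO Ox) => y h /OM My; rewrite /kap h.
      have s8 : sm (fun y => 8 * r y) x by apply: smM => //; exact: sm_cst.
      by apply: smM; apply: (sm_comp1 (h := step)); [exact: sm_step|apply: smB => //; exact: sm_cst|exact: sm_step|apply: smB => //; exact: sm_cst].
    have [sp dp] := psi_Om Ox.
    have sj : forall i j, sm (fun y => invmx (jac psi y) i j) x.
      move=> i j; apply: sm_inv => // a b; exact: sm_jac.
    have sYp : smv (fun y => Y (psi y)) x by exact: (@smv_comp R rV n n psi Y).
    move=> j; apply: (@sm_eq _ _ (fun y => \sum_i Y (psi y) 0 i * invmx (jac psi y) i j)).
      by apply: filterE => y; rewrite mxE.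
    by apply: sm_sum => i _; apply: smM; [exact: sYp|exact: sj].
  (* At a boundary point one of the two times vanishes, and nearby the cut-off is 0. *)
  have tx : tau x = 0 \/ tau x = 1.
    have [t0 t1 t2] := T0 Mx; rewrite /tau.
    have [Ei|Ei] := eqVneq (Ti x) 0; first by left; rewrite Ei mul0r.
    have [Eo|Eo] := eqVneq (To x) 0; first by right; rewrite Eo addr0 mulfV.
    by exfalso; apply: nx; apply/(TOm Mx); rewrite !lt_neqAle t0 t1 !andbT ![0 == _]eq_sym.
  apply: zero; have rx := nbhs_singleton nr Mx.
  have bump y : Om y -> (tau y <= 4^-1 \/ 3 / 4 <= tau y) -> X y = 0.
    by move=> Oy h; rewrite XOm // /kap (core_bump (tau y)).1 // scale0r.
  have cr := sm_continuous sr.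
  have [h|h] := tx.
    have h' : r x < 4^-1 by rewrite -rx h invr_gt0.
    apply: filterS2 nr (near_lt cr h') => y ry hy; have [Oy|] := pselect (Om y); last exact: XnOm.
    by apply: bump => //; left; rewrite ry ?ltW //; exact: OM.
  have h' : 3 / 4 < r x by rewrite -rx h; lra.
  apply: filterS2 nr (near_gt cr h') => y ry hy; have [Oy|] := pselect (Om y); last exact: XnOm.
  by apply: bump => //; right; rewrite ry ?ltW //; exact: OM.
have [P HP] : exists P, is_flow X P.
  apply: smooth_flow => //.
  have [B HB] := compact_locbound cM (f := fun x => `|x|) (fun x _ => ex_intro _ (`|x| + 1) (filterS (fun y h _ => ltW h) (near_lt (@norm_continuous _ _ x) (ltr_pwDr ltr01 (lexx _))))).
  by exists B => x Bx; apply: XnOm => /OM /HB; rewrite leNgt Bx.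
exists X, P; split=> //.
- have orth x : Om x -> dot (psi x) ('D_(X x) psi x) = 0.
    by move=> Ox; rewrite DX // dotZr oY mulr0.
  move=> t x cx; have [t0|t0] := leP 0 t; first exact: (core_inv HP orth).
  have orth' x' : Om x' -> dot (psi x') ('D_(- X x') psi x') = 0.
    move=> Ox; have -> : - X x' = (-1) *: X x' by rewrite scaleN1r.
    rewrite deriveZv; first by rewrite dotZr orth // mulr0.
    by apply: smv_differentiable; have [] := psi_Om Ox.
  have t0' : 0 <= - t by rewrite oppr_ge0 ltW.
  by have := core_inv (is_flow_rev HP) orth' t0' cx; rewrite opprK.
- move=> x cx; rewrite DX; last exact: core_Om.
  by rewrite /kap (core_bump (tau x)).2 ?scale1r // core_tau.
Qed.

Lemma tau_flow x s : M x -> - Ti x <= s <= To x -> tau (Phi s x) = tau x + s / (Ti x + To x).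
Proof.
move=> Mx h; have [_ E1 E2] := Tflow Mx h; have [t0 t1 t2] := T0 Mx.
rewrite /tau E1 E2; field; apply/eqP; lra.
Qed.

(** What remains to be found is a unit vector [V], constant along orbits and bijective from the core
    to the sphere: [F / |F|] in dimension at least 3, a root of it in dimension 2. *)
Lemma annulus_final (V : rV -> rV) :
  (forall x, M x -> V (mid x) = V x) -> (forall x, core x -> dnorm (V x) = 1) ->
  (forall x y, core x -> core y -> V x = V y -> x = y) ->
  (forall u, dnorm u = 1 -> exists2 x, core x & V x = u) ->
  (forall x, M x -> exists2 G : rV -> rV, smv G x /\ \det (jac G x) != 0 &
     \forall y \near x, M y -> (1 + tau y) *: V y = G y) ->
  diffeomorphic M (closure (eball0 n 2) `\` eball0 n 1).
Proof.
move=> Vmid Vn Vi Vs Vl.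
have V1 x : M x -> dnorm (V x) = 1 by move=> Mx; rewrite -Vmid // Vn //; exact: core_mid.
have fn x : M x -> dnorm ((1 + tau x) *: V x) = 1 + tau x.
  by move=> Mx; have /andP[h _] := tau_in Mx; rewrite dnormZ ?V1 ?mulr1 //; lra.
apply: (@diffeomorphic_local R n M _ (fun x => (1 + tau x) *: V x) cM) => //.
- move=> x Mx; rewrite closure_eball // /eball0; split=> /=.
    by rewrite fn //; have /andP[_ h] := tau_in Mx; lra.
  by rewrite enormE fn //; have /andP[h _] := tau_in Mx; apply/negP; rewrite -leNgt; lra.
- move=> x y Mx My E.
  have tE : tau x = tau y.
    by have := fn x Mx; rewrite E fn // => h; lra.
  have VE : V x = V y.
    have /andP[h _] := tau_in My; move: E; rewrite tE => /(congr1 (fun v => (1 + tau y)^-1 *: v)).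
    by rewrite !scalerA mulVf ?scale1r //; apply/eqP; lra.
  have mE : mid x = mid y.
    by apply: Vi; [exact: core_mid..|rewrite !Vmid].
  have [_ ox ix] := Tflow Mx (mid_range Mx); have [_ oy iy] := Tflow My (mid_range My).
  rewrite -/(mid x) in ox ix; rewrite -/(mid y) -mE in oy iy.
  have [t0 t1 t2] := T0 Mx; have [t0' t1' t2'] := T0 My.
  (* The total time is constant along an orbit, hence equal for points with the same midpoint; with
     equal [tau] both times agree, and the point is recovered from its midpoint. *)
  have L : Ti x + To x = Ti y + To y by lra.
  have iE : Ti x = Ti y.
    by move: tE; rewrite /tau -L => /(mulIf _); apply; rewrite invr_eq0 gt_eqF.
  have oE : To x = To y by lra.
  have := congr1 (Phi (- ((To x - Ti x) / 2))) mE.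
  by rewrite /mid (flowK HPhi) => ->; rewrite oE iE (flowK HPhi).
- move=> v []; rewrite closure_eball //= /eball0 /= enormE => v2 /negP; rewrite -leNgt => v1.
  have nv : 0 < dnorm v by lra.
  have [|z cz Vz] := Vs ((dnorm v)^-1 *: v).
    by rewrite dnormZ ?invr_ge0 ?ltW // mulVf // gt_eqF.
  have [Mz Ez] := cz; have [t0 t1 t2] := T0 Mz.
  (* [tau] grows at the rate [1 / (Ti + To)], so this time leads from [2^-1] to [dnorm v - 1]. *)
  pose s := (dnorm v - 1 - 2^-1) * (Ti z + To z).
  have hs : - Ti z <= s <= To z by rewrite /s Ez; apply/andP; split; nra.
  have [Ms Eo Ei] := Tflow Mz hs.
  exists (Phi s z) => //; rewrite tau_flow // core_tau // /s mulfK ?gt_eqF //.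
  have Em : mid (Phi s z) = z.
    rewrite /mid Eo Ei -(flowD HPhi) Ez.
    have -> : (Ti z - s - (Ti z + s)) / 2 + s = 0 by field.
    by rewrite (flow0 HPhi).
  rewrite -Vmid // Em Vz scalerA.
  have -> : (1 + (2^-1 + (dnorm v - 1 - 2^-1))) / dnorm v = 1 by field; rewrite gt_eqF.
  by rewrite scale1r.
Qed.

Definition dir x : rV := (dnorm (F x))^-1 *: F x.

Lemma dir_flow x s : F x != 0 -> dir (Phi s x) = dir x.
Proof.
move=> Fx; have [l l0 E] := flow_ray sF HPhi x s.
rewrite /dir E dnormZ ?ltW // scalerA invfM mulrAC mulVf ?mul1r // gt_eqF //.
Qed.

Lemma dnorm_dir x : M x -> dnorm (dir x) = 1.
Proof.
move=> /nz Fx; rewrite dnormZ ?invr_ge0 ?dnorm_ge0 // mulVf // gt_eqF // dnorm_gt0 //.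
Qed.

Lemma psi_dir x : psi x = (1 + tau x) *: dir x.
Proof. by rewrite /psi /dir scalerA. Qed.

Lemma dir_mid x : M x -> dir (mid x) = dir x.
Proof. by move=> Mx; rewrite /mid dir_flow // nz. Qed.

Lemma converges_shift (W : rV -> rV) P z x t : is_flow W P -> converges P z (P t x) -> converges P z x.
Proof.
move=> HP cv e e0; have [T HT] := cv e e0; exists (T + t) => s hs.
by rewrite -(subrK t s) (flowD HP); apply: HT; lra.
Qed.

Lemma expR_small (d b e : R) : 0 < d -> 0 <= b -> 0 < e ->
  exists N : nat, forall k, (N <= k)%N -> expR (- d * k%:R) * b < e.
Proof.
move=> d0 b0 e0; exists (Num.truncn (b / (d * e))).+1 => k Nk.
have h1 : b / (d * e) < k%:R.
  by apply: lt_le_trans (truncnS_gt _) _; rewrite ler_nat.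
rewrite mulNr expRN mulrC ltr_pdivrMr ?expR_gt0 //.
have h2 : b < k%:R * (d * e) by rewrite -ltr_pdivrMr // mulr_gt0.
have h3 : 1 + d * k%:R <= expR (d * k%:R) by exact: expR_ge1Dx.
have : e * (1 + d * k%:R) <= e * expR (d * k%:R) by rewrite ler_pM2l.
by lra.
Qed.

Lemma dot_psi_core x : core x -> dot (psi x) (psi x) = 9 / 4.
Proof.
move=> cx; rewrite -dnorm_sqr dnorm_psi; last by case: cx.
by rewrite core_tau //; field.
Qed.

(** Equations for the line through [q]: [A] is a basis of the orthogonal complement, transposed, and
    [B] a right inverse of the resulting projection. *)
Lemma line_complement (q : rV) : q != 0 -> exists k (A : 'M[R]_(n, k)) (B : 'M[R]_(k, n)),
  [/\ (n.-1 <= k)%N, q *m A = 0, B *m A = 1%:M & forall y : rV, y *m A = 0 -> exists c, y = c *: q].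
Proof.
move=> q0; pose K := kermx q^T; pose A := (row_base K)^T.
have frK : row_free (row_base K) by exact: row_base_free.
exists (\rank K), A, (pinvmx (row_base K))^T; split.
- by rewrite mxrank_ker -subn1 leq_sub2l // rank_leq_col.
- rewrite -[q]trmxK -trmx_mul.
  have : (row_base K <= K)%MS by rewrite eq_row_base.
  by move=> /sub_kermxP ->; rewrite trmx0.
- by rewrite -trmx_mul mulmxVp // trmx1.
move=> y yA; exists (dot y q / dot q q).
have dq : dot q q != 0 by rewrite dot_eq0.
pose u := y - (dot y q / dot q q) *: q.
have uq : dot u q = 0 by rewrite /u dotDl dotNl dotZl divfK // subrr.
have uK : (u <= row_base K)%MS.
  by rewrite eq_row_base; apply/sub_kermxP; rewrite dot_mulmx uq; apply/matrixP => i j; rewrite !mxE mul0rn.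
have [D ED] := submxP uK.
have uy : dot u y = 0.
  have h : u *m y^T = 0 by rewrite ED -mulmxA -[row_base K]trmxK -trmx_mul yA trmx0 mulmx0.
  by have := congr1 (fun M : 'M[R]_1 => M 0 0) h; rewrite dot_mulmx !mxE eqxx mulr1n.
apply/eqP; rewrite -subr_eq0 -/u -dot_eq0; apply/eqP.
by rewrite {2}/u dotDr dotNr dotZr uq uy mulr0 subr0.
Qed.

(** Up to the factor [- dot y y], the component of [q] tangent to the sphere through [y]: a downward
    gradient of the height [dot q], leading away from [q]. *)
Definition pull (q y : rV) : rV := dot q y *: y - dot y y *: q.

Lemma dot_sqD (c : R) (y q : rV) :
  dot (y + c *: q) (y + c *: q) = dot y y + 2 * c * dot q y + c ^+ 2 * dot q q.
Proof. by rewrite dotDl !dotDr !dotZl !dotZr [dot y q]dotC; ring. Qed.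

Lemma dot_pull (q y : rV) : dot y (pull q y) = 0 /\ dot q (pull q y) = dot q y ^+ 2 - dot y y * dot q q.
Proof. by rewrite /pull !dotDr !dotNr !dotZr [dot y q]dotC mulrC subrr expr2. Qed.

Lemma pole_flow q : exists (X : rV -> rV) (P : R -> rV -> rV),
   [/\ is_flow X P, forall t x, core x -> core (P t x) & forall x, core x -> 'D_(X x) psi x = pull q (psi x)].
Proof.
apply: lift_flow => z; last by have [] := dot_pull q z.
have sq : sm (fun y => dot q y) z by apply: sm_dot; [exact: smv_cst|exact: smv_id].
apply: smvB; apply: smvZ; [exact: sq|exact: smv_id| |exact: smv_cst].
by apply: sm_dot; exact: smv_id.
Qed.

(** * The downward gradient flow on the core *)

Section High.
Variables (q : rV) (X : rV -> rV) (P : R -> rV -> rV).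
Hypothesis q1 : dot q q = 1.
Hypothesis HP : is_flow X P.
Hypothesis coreP : forall t x, core x -> core (P t x).
Hypothesis DX : forall x, core x -> 'D_(X x) psi x = pull q (psi x).

Lemma psi_opp z : core z -> dir z = - q <-> psi z = - (3 / 2) *: q.
Proof.
move=> cz; rewrite psi_dir core_tau //.
have -> : (1 + 2^-1 : R) = 3 / 2 by field.
split=> [->|]; first by rewrite scalerN scaleNr.
by rewrite scaleNr -scalerN => /scalerI; apply; rewrite ?mulf_neq0 ?invr_neq0 ?pnatr_eq0.
Qed.

Lemma dot_opp z : core z -> dir z = - q <-> dot q (psi z) = - (3 / 2).
Proof.
move=> cz; split=> [/(psi_opp cz) ->|h]; first by rewrite dotZr q1 mulr1.
apply/(psi_opp cz)/eqP; rewrite -subr_eq0 scaleNr opprK -dot_eq0.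
by rewrite dot_sqD h q1 dot_psi_core //; apply/eqP; field.
Qed.

(** [psi - psi z] is a chart at [z]. On the core, where [dot (psi x) (psi x)] is [9 / 4], the
    inequality required by [attractor] becomes [(a + 3 / 2) * (a - 2^-1) <= 0] for the height
    [a = dot q (psi x)], true near the bottom. *)
Lemma sink_core z : core z -> dir z = - q -> exists U : set rV,
  [/\ open U, U z & forall x, U x -> core x -> converges P z x].
Proof.
move=> cz /(psi_opp cz) Ez; have Oz := core_Om cz.
have [sp dp] := psi_Om Oz.
have pz : - psi z = (3 / 2) *: q by rewrite Ez scaleNr opprK.
pose G x := psi x - psi z.
have sG : smv G z by apply: smvB => //; exact: smv_cst.
have DG x v : Om x -> 'D_v G x = 'D_v psi x.
  move=> Ox; have [sx _] := psi_Om Ox.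
  have dx : derivable psi x v by apply: diff_derivable; exact: smv_differentiable.
  by have := deriveB dx (@derivable_cst R rV rV (psi z) x v); rewrite derive_cst subr0.
have dG : \det (jac G z) != 0.
  have -> : jac G z = jac psi z => //.
  apply/matrixP => i j; rewrite !mxE.
  rewrite derive_rowE; last exact: smv_differentiable.
  by rewrite derive_rowE ?DG //; exact: smv_differentiable.
have nI : \forall x \near z, core x -> dot (G x) ('D_(X x) G x) <= - 2^-1 * dot (G x) (G x).
  have ca : {for z, continuous (fun x => dot q (psi x))}.
    by apply: sm_continuous; apply: sm_dot => //; exact: smv_cst.
  have h : dot q (psi z) < 2^-1 by rewrite Ez dotZr q1; lra.
  apply: filterS (near_lt ca h) => x hx cx.
  rewrite DG; last exact: core_Om.
  rewrite DX // /G pz dotDl (dotZl (3 / 2) q).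
  have [-> ->] := dot_pull q (psi x); rewrite dot_sqD q1 add0r.
  have dd := dot_psi_core cx; have := dot_ge0 (psi x + (3 / 2) *: q); rewrite dot_sqD q1 dd.
  by move: hx; move: (dot q (psi x)) => a; nra.
have h2 : 0 < 2^-1 :> R by rewrite invr_gt0.
have nT : \forall x \near z, True by exact: filterE.
have [U [oU Uz _ _ Ucv]] := attractor HP (fun x t cx _ => coreP t cx) sG (subrr _) dG h2 nI nT.
exists U; split=> // x Ux cx e e0; have [T HT] := Ucv e e0.
exists (Num.max 0 T) => t; rewrite ge_max => /andP[t0 Tt]; exact: HT.
Qed.

(** The height satisfies the Riccati equation [a' = a ^+ 2 - 9 / 4] and starts below [3 / 2], since
    [x] is not over [q]. So it tends to the minimum, a cluster point lies over [- q], and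
    [sink_core] turns accumulation into convergence. *)
Lemma core_converges x : core x -> dir x <> q -> exists z, [/\ core z, dir z = - q & converges P z x].
Proof.
move=> cx nx; pose a t := dot q (psi (P t x)).
have da t : is_derive t (1 : R) a (a t ^+ 2 - 9 / 4).
  have cPt := coreP t cx; have [sp _] := psi_Om (core_Om cPt).
  have sq : sm (fun y => dot q (psi y)) (P t x) by apply: sm_dot => //; exact: smv_cst.
  have := flow_derf HP (sm_differentiable sq).
  rewrite derive_dot; [|exact: differentiable_cst|exact: smv_differentiable].
  by rewrite derive_cst_ dot0l add0r DX // (dot_pull q _).2 q1 dot_psi_core // mulr1.
have al t : a t ^+ 2 <= 9 / 4.
  have := cauchy_schwarz q (psi (P t x)); rewrite q1 mul1r dot_psi_core //; exact: coreP.
have a0 : a 0 < 3 / 2.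
  have a0le : a 0 <= 3 / 2 by have := al 0; nra.
  rewrite lt_neqAle a0le andbT; apply/eqP; rewrite /a (flow0 HP) => h; apply: nx.
  have pE : psi x = (3 / 2) *: q.
    apply/eqP; rewrite -subr_eq0 -scaleNr -dot_eq0 dot_sqD h q1 dot_psi_core //.
    by apply/eqP; field.
  have h2 : (3 / 2 : R) != 0 by rewrite mulf_neq0 ?invr_neq0 ?pnatr_eq0.
  move: pE; rewrite psi_dir core_tau //.
  have -> : (1 + 2^-1 : R) = 3 / 2 by field.
  by move=> /scalerI; apply.
have adec t : 0 <= t -> a t <= a 0.
  move=> t0; have H3 s : a s ^+ 2 - 9 / 4 <= 0 by rewrite subr_le0.
  have := @derive_le R a _ (fun=> 0) (fun=> 0) t t0 (fun s _ => da s)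
    (fun s _ => is_derive_cst (0 : R) s (1 : R)) (fun s _ => H3 s).
  by rewrite subrr subr_le0.
(* The decay rate: [a ^+ 2 - 9 / 4] is the product of [a - 3 / 2], which stays at most [- d], and
   [a + 3 / 2]. *)
pose d := 3 / 2 - a 0.
have d0 : 0 < d by rewrite /d subr_gt0.
have bnd t : 0 <= t -> 3 / 2 + a t <= expR (- d * t) * (3 / 2 + a 0).
  move=> t0; apply: (@gronwall R (fun s => 3 / 2 + a s) (fun s => a s ^+ 2 - 9 / 4) (- d) t t0) => s /andP[s0 _].
    by have := is_deriveD_ (is_derive_cst (3 / 2 : R) s (1 : R)) (da s); rewrite add0r.
  by have := adec s s0; have := al s; rewrite /d; nra.
have b0 : 0 <= 3 / 2 + a 0 by have := al 0; nra.
have [z cz clz] := core_cluster (u := fun k => P k%:R x) (fun k => coreP _ cx).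
have dz : dir z = - q.
  apply/(dot_opp cz).
  have az : - (3 / 2) <= dot q (psi z).
    have := cauchy_schwarz q (psi z); rewrite q1 mul1r dot_psi_core // => h; nra.
  apply/eqP; rewrite eq_le az andbT leNgt; apply/negP => h.
  have [sp _] := psi_Om (core_Om cz).
  have ca : {for z, continuous (fun x => dot q (psi x))}.
    by apply: sm_continuous; apply: sm_dot => //; exact: smv_cst.
  pose b := (3 / 2 + dot q (psi z)) / 2.
  have bp : 0 < b by rewrite divr_gt0 // -(opprK (3 / 2 : R)) addrC subr_gt0.
  have h' : - (3 / 2) + b < dot q (psi z) by rewrite /b; lra.
  have [r r0 Hr] := near_ballP (near_gt ca h').
  have [N HN] := expR_small d0 b0 bp.
  have [k Nk zk] := clz r r0 N.
  have := Hr _ zk; have := HN k Nk; have := bnd k%:R (ler0n _ _); rewrite /a; lra.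
exists z; split=> //.
have [U [oU Uz HU]] := sink_core cz dz.
have [r r0 Hr] := near_ballP (open_near oU Uz).
have [k _ zk] := clz r r0 0%N.
by apply: (converges_shift (t := k%:R) HP); apply: HU; [exact: Hr|exact: coreP].
Qed.

End High.

(** In the chart [psi] the points over [q] form, locally, the line through [q], of codimension at
    least 2 as [3 <= n]. *)
Lemma remove_dir q : (3 <= n)%N -> dot q q = 1 ->
  lconn (fun x => Om x /\ ~ dir x = q) /\
  (forall x, Om x -> forall B : set rV, nbhs x B -> exists y, [/\ B y, Om y & ~ dir y = q]).
Proof.
move=> n3 q1; have q0 : q != 0 by rewrite -dot_eq0 q1 oner_neq0.
apply: lconn_remove_chart => //; first exact: (setting_conn HS).
move=> z Oz Kz; have [k [A [B [nk qA BA yA]]]] := line_complement q0.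
have [sp dp] := psi_Om Oz.
exists psi, k, A, B; split=> //; first by apply: leq_trans nk; rewrite -ltnS prednK //; exact: ltnW (ltnW n3).
have pos : 0 < dot (psi z) q.
  by rewrite psi_dir Kz dotZl q1 mulr1; have /andP[h _] := tau_in (OM Oz); lra.
have cp : {for z, continuous (fun y => dot (psi y) q)}.
  by apply: sm_continuous; apply: sm_dot => //; exact: smv_cst.
apply: filterS2 (near_gt0 cp pos) (open_near oO Oz) => v vp Ov; split=> [Kv|/yA [c Ec]].
  by rewrite psi_dir Kv -scalemxAl qA scaler0.
have c0 : 0 < c by move: vp; rewrite Ec dotZl q1 mulr1.
have Mv := OM Ov; have t1 : 1 + tau v != 0 by have /andP[h _] := tau_in Mv; apply/eqP; lra.
have nq : dnorm q = 1 by rewrite /dnorm q1 sqrtr1.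
have cE : c = 1 + tau v by rewrite -dnorm_psi // Ec dnormZ ?ltW // nq mulr1.
by move: Ec; rewrite psi_dir cE => /scalerI; apply.
Qed.

Lemma dir_inj : (3 <= n)%N -> forall x y, core x -> core y -> dir x = dir y -> x = y.
Proof.
(* The pole is opposite to the common direction, so that [x] and [y] are themselves limits of the
   flow. The set of points converging to [x] is relatively open and closed off the pole. *)
move=> n3 x y cx cy E; pose q := - dir x.
have q1 : dot q q = 1.
  by rewrite dotNl dotNr opprK -dnorm_sqr dnorm_dir ?expr1n //; case: cx.
have [X [P [HP cP DX]]] := pole_flow q.
have Kmid z : M z -> dir (mid z) = q <-> dir z = q by move=> Mz; rewrite dir_mid.
have Kcore := lconn_core Kmid (remove_dir n3 q1).1.
have cv z : core z -> dir z = - q -> converges P z z.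
  by move=> cz dz; have [U [_ Uz HU]] := sink_core q1 HP cP DX cz dz; exact: HU.
have op z p : core p -> dir p = - q -> core z -> converges P p z -> \forall u \near z, core u -> converges P p u.
  move=> cp dp cz pz; have [U [oU Up HU]] := sink_core q1 HP cP DX cp dp.
  have [r r0 Hr] := near_ballP (open_near oU Up).
  have [T HT] := pz r r0.
  have [e e0 He] := flow_near HP (open_near oU (Hr _ (HT T (lexx _)))).
  apply: (@ball_nearP R rV _ z e e0) => u zu cu.
  apply: (converges_shift (t := T) HP); apply: HU; last exact: cP.
  by apply: He => //; rewrite subrr normr0.
have qn v : dir v = - q -> ~ dir v = q.
  by move=> -> h; have := congr1 (dot q) h; rewrite dotNr q1; lra.
have dx : dir x = - q by rewrite opprK.
have dy : dir y = - q by rewrite opprK E.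
have cxy : converges P x y.
  apply: (Kcore (converges P x) _ _ x y) => //.
  - by move=> z [cz _] h; apply: filterS (op z x cx dx cz h) => u hu [cu _]; exact: hu.
  - move=> z [cz Kz] h; have [p [cp dp pz]] := core_converges q1 HP cP DX cz Kz.
    apply: filterS (op z p cp dp cz pz) => u hu [cu _] xu.
    by apply: h; rewrite (converges_unique xu (hu cu)).
  - by split=> //; exact: qn.
  - by split=> //; exact: qn.
  - exact: cv.
exact: converges_unique cxy (cv y cy dy).
Qed.

(** With [- u] as pole, any core point not over the pole flows to a point over [u]. *)
Lemma dir_surj : (3 <= n)%N -> (exists x, Om x) -> forall u, dnorm u = 1 -> exists2 x, core x & dir x = u.
Proof.
move=> n3 [x0 Ox0] u nu; pose q := - u.
have q1 : dot q q = 1 by rewrite dotNl dotNr opprK -dnorm_sqr nu expr1n.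
have [X [P [HP cP DX]]] := pole_flow q.
have [y [_ Oy dy]] := (remove_dir n3 q1).2 x0 Ox0 setT filterT.
have My := OM Oy.
have dm : dir (mid y) <> q by rewrite dir_mid.
have [z [cz dz _]] := core_converges q1 HP cP DX (core_mid My) dm.
by exists z => //; rewrite dz opprK.
Qed.

(* F / |F| maps the core onto the sphere without critical points. Lifting the
   gradient flow of a height function of the sphere, every point of the core over
   a point other than the pole q flows to a point over - q; removing the points
   over q keeps Om connected if 3 <= n, so that there is only one limit and
   F / |F| is injective on the core. *)
Lemma annulus_high : (3 <= n)%N -> (exists x, Om x) ->
  diffeomorphic M (closure (eball0 n 2) `\` eball0 n 1).
Proof.
move=> n3 ex; apply: (annulus_final dir_mid).
- by move=> x [Mx _]; exact: dnorm_dir.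
- exact: dir_inj.
- exact: dir_surj.
move=> x Mx; have [G sG nG] := psi_loc Mx; exists G => //.
by apply: filterS nG => y h My; rewrite -psi_dir h.
Qed.

Lemma comb_lt (p q s w r : R) : 0 <= p -> 0 <= q -> 0 <= s -> 0 <= w ->
  p * (s + w + 1) < r -> q * (s + w + 1) < r -> p * s + q * w < r.
Proof.
move=> p0 q0 s0 w0 h1 h2; have [pq|qp] := leP p q.
  by have := ler_wpM2r s0 pq; lra.
by have := ler_wpM2r w0 (ltW qp); lra.
Qed.

(** * The rotation flow on the core in the plane *)

Section Low.
Variables (J : 'M[R]_n) (X : rV -> rV) (P : R -> rV -> rV) (x0 : rV).
Hypothesis HJ : is_rot J.
Hypothesis HP : is_flow X P.
Hypothesis coreP : forall t x, core x -> core (P t x).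
Hypothesis DX : forall x, core x -> 'D_(X x) psi x = psi x *m J.
Hypothesis cx0 : core x0.
Let e := dir x0.

Lemma dir_core y : core y -> psi y = (3 / 2) *: dir y.
Proof.
by move=> cy; rewrite psi_dir core_tau //; congr (_ *: _); field.
Qed.

Lemma dir_sqr y : core y -> dot (dir y) (dir y) = 1.
Proof. by move=> cy; rewrite -dnorm_sqr dnorm_dir ?expr1n //; case: cy. Qed.

(** Rotating [psi] back by the elapsed time gives a constant along the orbit, as the derivatives of
    the rotation and of [psi] cancel. *)
Lemma dir_rot t x : core x -> dir (P t x) = Rot J t (dir x).
Proof.
move=> cx; have [_ J2 _ _] := HJ.
have J2' : forall v : rV, v *m J *m J = - v := J2.
suff E : Rot J (- t) (psi (P t x)) = psi x.
  have E2 : psi (P t x) = Rot J t (psi x) by rewrite -E -(RotD HJ) addrN Rot0.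
  have h2 : (3 / 2 : R) != 0 by rewrite mulf_neq0 ?invr_neq0 ?pnatr_eq0.
  apply: (scalerI h2); rewrite -dir_core; last exact: coreP.
  by rewrite E2 dir_core // RotZ.
have dpsi s : is_derive s (1 : R) (fun r => psi (P r x)) (psi (P s x) *m J).
  have cs := coreP s cx; have [sp _] := psi_Om (core_Om cs).
  by have := flow_derf HP (smv_differentiable sp); rewrite DX.
have dpsiJ s : is_derive s (1 : R) (fun r => psi (P r x) *m J) (- psi (P s x)).
  have [dm Dm] := derive_mulmx J (psi (P s x)) (psi (P s x) *m J).
  have dd := dpsi s.
  by have := is_derive_comp dm dd; rewrite Dm J2.
apply/rowP => j.
pose h s := cos s * psi (P s x) 0 j - sin s * (psi (P s x) *m J) 0 j.
have hE s : Rot J (- s) (psi (P s x)) 0 j = h s.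
  by rewrite /Rot cosN sinN scaleNr [LHS]mxE [X in X + _]mxE [X in _ + X]mxE [X in - X]mxE.
rewrite hE; have -> : psi x 0 j = h 0.
  by rewrite /h cos0 sin0 (flow0 HP) mul1r mul0r subr0.
apply: (@derive0_cst R h (fun s => (cos s * (psi (P s x) *m J) 0 j + psi (P s x) 0 j * - sin s) -
   (sin s * (- psi (P s x)) 0 j + (psi (P s x) *m J) 0 j * cos s))) => s _.
  apply: is_deriveB_; apply: is_deriveM_.
    by have /is_derive_rowP := dpsi s.
  by have /is_derive_rowP := dpsiJ s.
by rewrite [X in sin s * X]mxE; ring.
Qed.

(** A core point [y] near [z] has a direction at a small angle from that of [z]. The orbit of [z] at
    that angle is still near [z] and has the same [psi] as [y]; local injectivity of [psi]
    identifies the two. *)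
Lemma orbit_near z (q : R) : core z -> 0 < q ->
  \forall y \near z, core y -> exists2 a, `|a| < q & y = P a z.
Proof.
move=> cz q0; have Oz := core_Om cz; have [sp dp] := psi_Om Oz.
have [A [B [g [[oA Az oB HA] [fA gB sg]]]]] := inverse_function (open_near oO Oz) sp dp.
have A0 : \forall y \near P 0 z, A y by rewrite (flow0 HP); exact: open_near.
have [d d0 Hd] := flow_near HP A0.
(* The factor normalizes the two vectors [psi], both of norm [3 / 2], so that [s y] is the sine of
   the angle. *)
pose s y := 4 / 9 * dot (psi y) (psi z *m J).
have ss : sm s z.
  by apply: smM; [exact: sm_cst|apply: sm_dot => //; exact: smv_cst].
have s0 : s z = 0 by rewrite /s; have [-> _ _ _] := HJ; rewrite mulr0.
have m0 : 0 < Num.min q d by rewrite lt_min q0.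
have ca : {for s z, continuous (@asin R)} by rewrite s0; apply: continuous_asin; lra.
have cas : {for z, continuous (fun y => asin (s y))}.
  by apply: (@continuous_comp _ _ _ s (@asin R)); [exact: sm_continuous|].
have as0 : asin (0 : R) = 0.
  by have := @sinK R 0; rewrite sin0; apply; rewrite in_itv /= oppr_le0 divr_ge0 ?pi_ge0.
have pos : 0 < dot (psi z) (psi z) by rewrite dot_psi_core //; lra.
have cp : {for z, continuous (fun y => dot (psi y) (psi z))}.
  by apply: sm_continuous; apply: sm_dot => //; exact: smv_cst.
have /(@cont_distP R rV R) /(_ _ m0) nas := cas.
apply: filterS3 nas (near_gt0 cp pos) (open_near oA Az) => y; rewrite s0 as0 sub0r normrN lt_min => /andP[a1 a2] yp Ay cy.
have sE : dot (dir y) (dir z *m J) = s y.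
  by rewrite /s !dir_core // -(scalemxAl (3 / 2)) (dotZl (3 / 2)) (dotZr (3 / 2)); field.
have dyz : 0 < dot (dir y) (dir z).
  by move: yp; rewrite !dir_core // dotZl dotZr; lra.
have := small_angle HJ (dir_sqr cz) (dir_sqr cy) dyz; rewrite sE -dir_rot // => dE.
exists (asin (s y)) => //.
have A1 : A (P (asin (s y)) z).
  by apply: Hd; [rewrite sub0r normrN|rewrite subrr normr0].
have E3 : psi y = psi (P (asin (s y)) z) by rewrite !dir_core ?dE //; exact: coreP.
by rewrite -[RHS](fA _ A1).2 -E3 (fA _ Ay).2.
Qed.

Lemma orbit_all y : core y -> exists t, y = P t x0.
Proof.
move=> cy.
have lO : lconn (fun x => Om x /\ ~ False).
  by apply: lconn_eq (setting_conn HS) => x; split=> [h|[]//]; split.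
have lc := lconn_core (K := fun=> False) (fun x _ => iff_refl _) lO.
have h1 : core x0 /\ ~ False by split.
have h2 : core y /\ ~ False by split.
have h3 : exists t, x0 = P t x0 by exists 0; rewrite (flow0 HP).
apply: (lc (fun y => exists t, y = P t x0) _ _ x0 y h1 h2 h3).
  move=> z [cz _] [t Et]; apply: filterS (orbit_near cz ltr01) => v hv [cv _].
  by have [a _ ->] := hv cv; exists (a + t); rewrite (flowD HP) -Et.
move=> z [cz _] nz'; apply: filterS (orbit_near cz ltr01) => v hv [cv _] [t Et].
have [a _ Ev] := hv cv; apply: nz'; exists (- a + t).
by rewrite (flowD HP) -Et Ev (flowK HP).
Qed.

(** At the times [2 * pi * k] the orbit lies over the direction of [x0]. These points accumulate in
    the compact core, and local injectivity of [psi] makes two of them equal. The least return is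
    the degree of the covering. *)
Lemma period : exists d : nat, [/\ (0 < d)%N, P (2 * pi * d%:R) x0 = x0 &
  forall k : nat, (0 < k)%N -> P (2 * pi * k%:R) x0 = x0 -> (d <= k)%N].
Proof.
pose u (k : nat) := P (2 * pi * k%:R) x0.
have [z cz clz] := core_cluster (u := u) (fun k => coreP _ cx0).
have Oz := core_Om cz; have [sp dp] := psi_Om Oz.
have [A [B [g [[oA Az oB HA] [fA gB sg]]]]] := inverse_function (open_near oO Oz) sp dp.
have [r r0 Hr] := near_ballP (open_near oA Az).
have [k _ zk] := clz r r0 0%N; have [l kl zl] := clz r r0 k.+1.
have du m : dir (u m) = e.
  by rewrite /u dir_rot //; apply/(Rot_fix HJ _ (dir_sqr cx0)); exact: (cos_2pi (Posz m)).
have E : u k = u l.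
  have cu m : core (u m) by exact: coreP.
  by rewrite -(fA _ (Hr _ zk)).2 -(fA _ (Hr _ zl)).2 !dir_core // !du.
have ex : exists m : nat, `[< (0 < m)%N /\ P (2 * pi * m%:R) x0 = x0 >].
  exists (l - k)%N; apply/asboolP; split; first by rewrite subn_gt0.
  have -> : 2 * pi * (l - k)%N%:R = - (2 * pi * k%:R) + 2 * pi * l%:R :> R.
    by rewrite natrB; [ring|exact: ltnW].
  by rewrite (flowD HP) -/(u l) -E (flowK HP).
case: (ex_minnP ex) => d /asboolP [d0 Pd] dmin; exists d; split=> // m m0 Pm.
by apply: dmin; apply/asboolP.
Qed.

Lemma period_int (T : R) : P T x0 = x0 -> forall k : int, P (T * k%:~R) x0 = x0.
Proof.
move=> PT k; have H (m : nat) : P (T * m%:R) x0 = x0.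
  elim: m => [|m IH]; first by rewrite mulr0 (flow0 HP).
  by rewrite -natr1 mulrDr mulr1 (flowD HP) PT.
case: (intP k) => [|m|m]; [exact: (H 0%N)|exact: H|].
by rewrite mulrNz mulrN -{1}(H m.+1) (flowK HP).
Qed.

Section Period.
Variable d : nat.
Hypotheses (d0 : (0 < d)%N) (Pd : P (2 * pi * d%:R) x0 = x0).
Hypothesis dmin : forall k : nat, (0 < k)%N -> P (2 * pi * k%:R) x0 = x0 -> (d <= k)%N.

(** A return time is [2 * pi * k], because the direction returns. The remainder of [k] modulo [d] is
    then a return as well, and minimality of [d] makes it 0. *)
Lemma stab t : P t x0 = x0 <-> Rot J (t / d%:R) e = e.
Proof.
have dR : d%:R != 0 :> R by rewrite pnatr_eq0 -lt0n.
have e1 := dir_sqr cx0.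
split=> [Pt|/(Rot_fix HJ _ e1) /cos_eq1 [k Ek]]; last first.
  have -> : t = 2 * pi * d%:R * k%:~R.
    by rewrite -mulrA [d%:R * _]mulrC mulrA -Ek divfK.
  exact: period_int.
have /(Rot_fix HJ _ e1) /cos_eq1 [k Ek] : Rot J t e = e by rewrite /e -dir_rot // Pt.
apply/(Rot_fix HJ _ e1).
have d00 : (d : int) != 0 by rewrite -lt0n.
have [a [r [kE r0 rd]]] : exists a r : int, [/\ k = a * d + r, 0 <= r & r < d].
  exists (k %/ d)%Z, (k %% d)%Z; split; [exact: divz_eq|exact: modz_ge0|by rewrite ltz_pmod].
have Pr : P (2 * pi * r%:~R) x0 = x0.
  have -> : 2 * pi * r%:~R = - (2 * pi * d%:R * a%:~R) + t :> R.
    by rewrite Ek kE intrD intrM /=; ring.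
  by rewrite (flowD HP) Pt -{1}(period_int Pd a) (flowK HP).
have r00 : r = 0.
  case: r r0 rd Pr {kE} => // m _ md Pm.
  have [->//|m0] := posnP m.
  by have := dmin m0 Pm; rewrite leqNgt -ltz_nat md.
have -> : t / d%:R = 2 * pi * a%:~R.
  by rewrite Ek kE r00 addr0 intrM /=; field.
exact: cos_2pi.
Qed.

Lemma stab2 s t : P t x0 = P s x0 <-> Rot J (t / d%:R) e = Rot J (s / d%:R) e.
Proof.
have -> : t / d%:R = s / d%:R + (- s + t) / d%:R by rewrite -mulrDl addrA addrN add0r.
rewrite (RotD HJ); split=> [E|E].
  have /stab -> // : P (- s + t) x0 = x0 by rewrite (flowD HP) E (flowK HP).
have /stab h : Rot J ((- s + t) / d%:R) e = e.
  have RK v : Rot J (- (s / d%:R)) (Rot J (s / d%:R) v) = v by rewrite -(RotD HJ) addNr Rot0.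
  by have := congr1 (Rot J (- (s / d%:R))) E; rewrite !RK.
by rewrite -{2}h -(flowD HP) addrA addrN add0r.
Qed.

(* In the plane the core is a single periodic orbit of the lifted rotation field,
   and F / |F| winds d times around the circle along it: the diffeomorphism is
   built from a d-th root of F / |F|. *)
Lemma annulus_low_period : diffeomorphic M (closure (eball0 n 2) `\` eball0 n 1).
Proof.
have dR : d%:R != 0 :> R by rewrite pnatr_eq0 -lt0n.
have e1 : dot e e = 1 := dir_sqr cx0.
have /choice [tt Htt] x : exists t, M x -> mid x = P t x0.
  have [Mx|nM] := pselect (M x); last by exists 0.
  by have [t ->] := orbit_all (core_mid Mx); exists t.
(* Time on the orbit is determined up to multiples of [2 * pi * d], so its quotient by [d] is a well
   defined angle. *)
pose V x := Rot J (tt x / d%:R) e.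
have VP x t : M x -> mid x = P t x0 -> V x = Rot J (t / d%:R) e.
  by move=> Mx Ex; apply/stab2; rewrite -Ex Htt.
apply: (annulus_final (V := V)).
- move=> x Mx; have cm := core_mid Mx; apply: VP; first by case: cm.
  by rewrite mid_id // Htt.
- by move=> x _; rewrite dnorm_Rot // /dnorm e1 sqrtr1.
- move=> x y cx cy E; have Mx := cx.1; have My := cy.1.
  by rewrite -(mid_id cx) -(mid_id cy) !Htt //; apply/stab2.
- move=> u nu; have u1 : dot u u = 1 by rewrite -dnorm_sqr nu expr1n.
  have [t ->] := unit_angle HJ e1 u1.
  have ct : core (P (d%:R * t) x0) by exact: coreP.
  exists (P (d%:R * t) x0) => //; rewrite (VP _ (d%:R * t)); [|by case: ct|exact: mid_id].
  by rewrite mulrAC mulfV // mul1r.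
move=> x1 Mx1; have [G [sG dG] nG] := psi_loc Mx1.
pose t1 := tt x1; have E1 := Htt x1 Mx1; rewrite -/t1 in E1.
have t01 := tau_in Mx1.
pose pt (a b : R) : rV := a *: e + b *: (e *m J).
pose p1 := pt (1 + tau x1) t1.
have dirm x t : M x -> mid x = P t x0 -> psi x = (1 + tau x) *: Rot J t e.
  by move=> Mx Ex; rewrite psi_dir -dir_mid // Ex dir_rot.
have pE : polar J e 1 p1 = G x1.
  by rewrite polar_ptE // mul1r -(nbhs_singleton nG Mx1) (dirm _ t1).
have pa : dot p1 e != 0 by rewrite (polar_pt HJ e1 _ _).1; apply/eqP; case/andP: t01; lra.
have nT : \forall x \near p1, True by exact: filterE.
(* Near [x1] the local inverse [g] reads radius and time off [psi]; [polar] with the factor [d^-1]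
   then rebuilds the vector with its angle divided by [d]. *)
have [A [B [g [[oA Ap oB HA] [fA gB sg]]]]] := inverse_function nT (smv_polar J e 1 p1) (polar_unit HJ e1 (oner_neq0 _) pa).
have Bx : B (G x1) by rewrite -pE; exact: (fA _ Ap).1.
have gx : g (G x1) = p1 by rewrite -pE; exact: (fA _ Ap).2.
have [sgx Dgx] := sg _ Bx.
have dg : \det (jac g (G x1)) != 0.
  have -> : jac g (G x1) = invmx (jac (polar J e 1) p1).
    apply/row_matrixP => i; rewrite !rowE -jacE; last exact: smv_differentiable.
    by rewrite Dgx gx.
  by rewrite det_inv invr_eq0; have [_ _] := HA _ Ap.
have [s2 d2] := jac_unit_comp sG sgx dG dg.
have dV : (d%:R)^-1 != 0 :> R by rewrite invr_eq0.
have sp : smv (polar J e (d%:R)^-1) (g (G x1)) by exact: smv_polar.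
have dp : \det (jac (polar J e (d%:R)^-1) (g (G x1))) != 0.
  by apply: polar_unit => //; rewrite gx.
have [s3 d3] := jac_unit_comp s2 sp d2 dp.
exists (fun y => polar J e (d%:R)^-1 (g (G y))) => //.
(* A neighbourhood in radius and time on which [g] is the right branch of the inverse. *)
have nA : exists q : R, 0 < q /\ forall a b, `|a - (1 + tau x1)| < q -> `|b - t1| < q -> A (pt a b).
  have [r r0 Hr] := near_ballP (open_near oA Ap).
  have h0 : 0 < `|e| + `|e *m J| + 1 by rewrite ltr_wpDl.
  exists (r / (`|e| + `|e *m J| + 1)); split; first by rewrite divr_gt0.
  move=> a b ha hb; apply: Hr.
  have -> : p1 - pt a b = - ((a - (1 + tau x1)) *: e + (b - t1) *: (e *m J)).
    by apply/rowP => j; rewrite !mxE; ring.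
  rewrite normrN; apply: le_lt_trans (ler_normD _ _) _.
  rewrite (normrZ (a - (1 + tau x1)) e) (normrZ (b - t1) (e *m J)).
  move: ha hb; rewrite !ltr_pdivlMr //.
  have := normr_ge0 e; have := normr_ge0 (e *m J); have := normr_ge0 (a - (1 + tau x1)); have := normr_ge0 (b - t1).
  move=> hq hp hw hs h1 h2; exact: comb_lt.
have [q [q0 Hq]] := nA.
have [rt [srt _] nr] := tau_loc Mx1.
have /(@cont_distP R rV R) /(_ q q0) nt := sm_continuous srt.
have no := mid_near Mx1 (orbit_near (core_mid Mx1) q0).
apply: filterS3 (nearI nG nr) nt no => y [Gy ry] ht hy My.
have [a aq Ey] := hy My (core_mid My).
have Et : mid y = P (t1 + a) x0 by rewrite Ey E1 -(flowD HP) addrC.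
have Apt : A (pt (1 + tau y) (t1 + a)).
  apply: Hq; last by rewrite addrC addKr.
  by rewrite ry // (nbhs_singleton nr Mx1) distrC opprD addrACA subrr add0r.
rewrite (VP _ _ My Et) -Gy // (dirm _ _ My Et).
have -> : (1 + tau y) *: Rot J (t1 + a) e = polar J e 1 (pt (1 + tau y) (t1 + a)).
  by rewrite polar_ptE // mul1r.
rewrite (fA _ Apt).2 polar_ptE // mulrC //.
Qed.

End Period.
End Low.

Lemma annulus_low : n = 2%N -> (exists x, Om x) ->
  diffeomorphic M (closure (eball0 n 2) `\` eball0 n 1).
Proof.
move=> n2 [x0 Ox0]; have [J HJ] := @rot_exists R n n2.
have [J1 _ _ _] := HJ.
have sJ z : smv (fun y : rV => y *m J) z.
  move=> j; have -> : (fun y : rV => (y *m J) 0 j) = (fun y : rV => \sum_i y 0 i * J i j).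
    by rewrite funeqE => y; rewrite mxE.
  by apply: sm_sum => i _; apply: smM; [exact: sm_coord|exact: sm_cst].
have [X [P [HP cP DX]]] := lift_flow sJ J1.
have cm := core_mid (OM Ox0).
have [d [d0 Pd dmin]] := period HJ HP cP DX cm.
exact: (annulus_low_period HJ HP cP DX cm d0 Pd dmin).
Qed.

End Mid.
End Annulus.

(** * From the boundary value problem to the flow *)

Section Forward.
Context {R : realType} {n : nat}.
Local Notation rV := 'rV[R]_n.

Lemma setting_diffeomorphic (Om : set rV) (F : rV -> rV) (Phi : R -> rV -> rV) :
  setting Om F Phi -> (2 <= n)%N -> Om !=set0 ->
  (forall y, Om y -> F y != 0 -> exits Om Phi y) ->
  diffeomorphic (closure Om) (closure (eball0 n 1)) \/
  diffeomorphic (closure Om) (closure (eball0 n 2) `\` eball0 n 1).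
Proof.
move=> HS n2 [x0 Ox0] EX.
have [_ dn] := punctured HS n2.
have [y [_ Oy /eqP Fy]] := dn x0 Ox0 setT filterT.
have [EX'|[p [Op Fp dp Ap]]] := backward HS n2 EX (ex_intro _ y (conj Oy Fy)).
  right; have [To [Ti [T0 TOm Tflow Tloc]]] := two_times HS n2 EX EX'.
  have nz := no_zero HS n2 EX EX'.
  have [n3|n3] := leqP 3 n.
    exact: (annulus_high HS nz T0 TOm Tflow Tloc n3 (ex_intro _ x0 Ox0)).
  have n22 : n = 2%N by apply/eqP; rewrite eqn_leq n2 -ltnS n3.
  exact: (annulus_low HS nz T0 TOm Tflow Tloc n22 (ex_intro _ x0 Ox0)).
by left; exact: (ball_case HS n2 EX Op Fp dp Ap).
Qed.

Lemma smv_derive (f : rV -> rV) (x v : rV) : smv f x -> smv ('D_v f) x.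
Proof.
move=> sf j; apply: (sm_eq (f := 'D_v (fun z => f z 0 j))); last by apply: sm_der; exact: sf.
by apply: filterS (smv_near sf) => y sy; rewrite derive_rowE //; exact: smv_differentiable.
Qed.

Lemma dist_le2 (a b c : rV) : `|a - b| <= `|a - c| + `|b - c|.
Proof. by rewrite -[`|b - c|]normrN opprB; exact: ler_distD. Qed.

Lemma closure_eq (Om : set rV) (f g : rV -> rV) (x : rV) : closure Om x ->
  {for x, continuous f} -> {for x, continuous g} ->
  (\forall y \near x, Om y -> f y = g y) -> f x = g x.
Proof.
move=> cx cf cg fg; apply/eqP; rewrite -subr_eq0 -normr_le0 leNgt; apply/negP => h.
have h2 : 0 < `|f x - g x| / 2 by rewrite divr_gt0.
have /(@cont_distP R rV rV) /(_ _ h2) df := cf.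
have /(@cont_distP R rV rV) /(_ _ h2) dg := cg.
have [y [Oy [hy [hz hfg]]]] := cx _ (nearI df (nearI dg fg)).
suff : `|f x - g x| < `|f x - g x| by rewrite ltxx.
rewrite [ltRHS]splitr; apply: le_lt_trans (ltrD hy hz).
by rewrite (hfg Oy); exact: dist_le2.
Qed.

(** The derivatives agree on the open set and are continuous, hence agree on the closure:
    derivatives at a boundary point do not depend on the extension. *)
Lemma closure_derive_eq (Om : set rV) (f g : rV -> rV) (x v : rV) : open Om -> closure Om x ->
  smv f x -> smv g x -> (\forall y \near x, Om y -> f y = g y) -> 'D_v f x = 'D_v g x.
Proof.
move=> oO cx sf sg fg; have [cf cg] := (smv_continuous (smv_derive v sf), smv_continuous (smv_derive v sg)).
apply: (closure_eq cx cf cg).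
apply: filterS (near_join fg) => y h Oy.
by apply: near_eq_derive; apply: filterS2 h (open_near oO Oy) => z h; exact: h.
Qed.

Lemma derive_closureE (Om : set rV) (F G : rV -> rV) (x v : rV) : open Om -> closure Om x -> smv G x ->
  (\forall y \near x, Om y -> F y = G y) -> derive_closure Om F v x = 'D_v G x.
Proof.
move=> oO cx sG FG.
have cD : {for x, continuous ('D_v G)} by exact/smv_continuous/smv_derive.
have PF : ProperFilter (within Om (nbhs x)) by exact: within_nbhs_proper.
apply: cvg_lim; first exact: norm_hausdorff.
apply/cvgrPdist_lt => e e0.
have /(@cont_distP R rV rV) /(_ _ e0) cg := cD.
rewrite near_withinE; apply: filterS2 cg (near_join FG) => y hy hFG Oy.
suff -> : 'D_v F y = 'D_v G y by [].
by apply: near_eq_derive; apply: filterS2 hFG (open_near oO Oy) => z h; exact: h.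
Qed.

Lemma regP (f : rV -> rV) x : smv f x ->
  reg f x <-> forall v : rV, dot v (f x) = 0 -> (forall h, dot v ('D_h f x) = 0) -> v = 0.
Proof.
move=> sf; have df := smv_differentiable sf.
have E1 (v u : rV) : v *m u^T = 0 <-> dot v u = 0.
  split=> [h|h]; last by rewrite dot_mulmx h; apply/matrixP => i j; rewrite !mxE mul0rn.
  by have := congr1 (fun M : 'M[R]_1 => M 0 0) h; rewrite dot_mulmx !mxE eqxx mulr1n.
have E2 (v : rV) : v *m (jac f x)^T = 0 <-> forall h, dot v ('D_h f x) = 0.
  split=> [h0 h|h]; first by apply/E1; rewrite jacE // trmx_mul mulmxA h0 mul0mx.
  apply/rowP => i; have := h (delta_mx 0 i); rewrite jacE // -rowE => hi.
  by rewrite [RHS]mxE -hi mxE; apply: eq_bigr => k _; rewrite !mxE.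
by split=> H v h1 h2; apply: H; [exact/E1|exact/E2|exact/E1|exact/E2].
Qed.

Lemma reg_unit (f : rV -> rV) x : reg f x -> f x = 0 -> \det (jac f x) != 0.
Proof.
move=> rf fx; rewrite -det_tr; apply: unit_kernel => h hJ; apply: rf => //.
by rewrite fx trmx0 mulmx0.
Qed.

(** * Smooth domains and the boundary condition *)

Section Domain.
Variable Om : set rV.
Hypothesis hOm : bounded_smooth_domain Om.
Hypothesis n0 : (0 < n)%N.

Lemma domain_open : open Om. Proof. by case: hOm. Qed.

Lemma domain_bound : exists B : R, forall x, closure Om x -> `|x| <= B.
Proof.
have [_ _ _ [B [_ HB]] _] := hOm.
exists (B + 1) => x cx; rewrite leNgt; apply/negP => xB.
have [y [Oy]] := cx _ (near_gt (@norm_continuous _ rV x) xB).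
by rewrite ltNge; apply/negP; rewrite negbK; apply: HB => //; rewrite ltrDl.
Qed.

Lemma domain_compact : compact (closure Om).
Proof.
have [B HB] := domain_bound.
apply: bounded_closed_compact; last exact: closed_closure.
exists B; split; first exact: num_real.
by move=> C BC x /= /HB h; apply: le_trans h _; exact: ltW.
Qed.

(** Otherwise the set would be open and closed in the connected space, hence everything, against
    boundedness in positive dimension. *)
Lemma domain_boundary : exists2 x, closure Om x & ~ Om x.
Proof.
apply: contrapT => H.
have cO x : closure Om x -> Om x by move=> cx; apply: contrapT => nx; apply: H; exists x.
have [[x0 Ox0] oO _ _ _] := hOm.
have lT : lconn (fun _ : rV => True) by apply: lconn_convex.
have all_ y : Om y.
  apply: (lT Om _ _ x0 y) => // x _ Px; first by apply: filterS (open_near oO Px) => z.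
  have ncx : ~ closure Om x by move=> /cO.
  by apply: filterS (near_notM ncx) => z h _ Oz; apply: h; exact: subset_closure.
have [B HB] := domain_bound.
have B0 : 0 <= B by apply: le_trans (HB x0 _); [exact: normr_ge0|exact: subset_closure].
have := HB ((B + 1) *: delta_mx 0 (Ordinal n0)) (subset_closure (all_ _)).
rewrite leNgt => /negP; apply.
apply: lt_le_trans (coord_le_norm _ (Ordinal n0)); rewrite !mxE !eqxx mulr1 ger0_norm; lra.
Qed.

Lemma derive_line_pos (f : rV -> R) (y k : rV) : differentiable f y -> 0 < 'D_k f y ->
  exists2 e, 0 < e & forall t, 0 < t -> t < e -> f y < f (y + t *: k) /\ f (y - t *: k) < f y.
Proof.
move=> df v0; have H := @is_derive_line R rV R^o f y k 0; rewrite scale0r addr0 in H.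
have dv : derivable f y k by exact: diff_derivable.
have {}H := H dv.
have [e [e0 He]] := derive_pos_local H v0; exists e => // t t0 te.
have [h1 _] := He t; have [_ h2] := He (- t); rewrite !scale0r !addr0 scaleNr in h1 h2.
split; first by apply: h1 => //; rewrite add0r.
by apply: h2; rewrite ?oppr_lt0 // sub0r ltrN2.
Qed.

Lemma near_line (y k : rV) (P : rV -> Prop) : (\forall z \near y, P z) ->
  exists2 e, 0 < e & forall t, `|t| < e -> P (y + t *: k).
Proof.
move=> nP; have cc : {for (0 : R), continuous (fun t : R => y + t *: k)}.
  by apply: cvgD; [exact: cvg_cst|apply: cvgZl; exact: cvg_id].
have nP' : \forall z \near (y + (0 : R) *: k), P z by rewrite scale0r addr0.
have [d d0 Hd] := near_ballP (near_comp cc nP').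
by exists d => // t td; apply: Hd; rewrite sub0r normrN.
Qed.

Lemma derive_gradient (f : rV -> R) (x h : rV) : differentiable f x -> 'D_h f x = dot (gradient f x) h.
Proof.
by move=> df; rewrite derive_delta // /dot; apply: eq_bigr => i _; rewrite [in RHS]mxE mulrC.
Qed.

(** A defining function describes only the open set. Moving against the nonzero gradient, points
    with [rho = 0] are limits of points with [rho < 0], which gives the closure as well. *)
Lemma boundary_rho x rho : closure Om x -> ~ Om x -> local_defining_function Om x rho ->
  [/\ sm rho x, rho x = 0, gradient rho x != 0 &
     \forall y \near x, (Om y <-> rho y < 0) /\ (closure Om y <-> rho y <= 0)].
Proof.
move=> cx nx [U [oU Ux sU gU OU]].
have sm_rho y : U y -> sm rho y.
  by move=> Uy; apply: (sm_open oU) => // z Uz; exact: (smooth_on_open_smo oU sU).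
have c1 y : U y -> closure Om y -> rho y <= 0.
  move=> Uy cy; rewrite leNgt; apply/negP => h.
  have [z [Oz [hz Uz]]] := cy _ (nearI (near_gt (sm_continuous (sm_rho y Uy)) h) (open_near oU Uy)).
  by move: (OU z Uz).1 => /(_ Oz) h'; have := lt_trans hz h'; rewrite ltxx.
have c2 y : U y -> rho y <= 0 -> closure Om y.
  move=> Uy; rewrite le_eqVlt => /orP[/eqP ry|h]; last by apply: subset_closure; apply/(OU y Uy).
  have dr := sm_differentiable (sm_rho y Uy).
  pose v := gradient rho y.
  have v0 : 0 < 'D_v rho y by rewrite derive_gradient // dot_gt0; exact: gU.
  have [e e0 He] := derive_line_pos dr v0.
  move=> C nC; have [d d0 Hd] := near_line v (nearI nC (open_near oU Uy)).
  pose t := Num.min d e / 2.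
  have m0 : 0 < Num.min d e by rewrite lt_min d0.
  have m1 : Num.min d e <= d by rewrite ge_min lexx.
  have m2 : Num.min d e <= e by rewrite ge_min lexx orbT.
  have t0 : 0 < t by rewrite divr_gt0.
  have [|Ct Ut] := Hd (- t); first by rewrite normrN gtr0_norm // /t; lra.
  rewrite scaleNr in Ct Ut; exists (y - t *: v); split=> //; apply/(OU _ Ut).
  have te : t < e by rewrite /t; lra.
  by have [_] := He t t0 te; rewrite ry.
split.
- exact: sm_rho.
- apply/eqP; rewrite eq_le c1 //= leNgt; apply/negP => h; apply: nx; exact/(OU x Ux).
- exact: gU.
- by apply: filterS (open_near oU Ux) => y Uy; split; [exact: OU|split; [exact: c1|exact: c2]].
Qed.

(** For the extension of [b *: F] the derivative along the normal is a multiple of the value, since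
    that of [F] vanishes; by [fld_span] the normal is then along the field. The value is not 0 on
    the boundary: at a zero the Jacobian is invertible, yet it would kill the normal. *)
Lemma neumann_setting (F : rV -> rV) : smooth_on (closure Om) F ->
  (forall x, closure Om x -> \rank (value_jacobian Om F x) = n) ->
  (forall x nu, boundary Om x -> outer_unit_normal Om x nu -> derive_closure Om F nu x = 0) ->
  exists H Phi, setting Om H Phi.
Proof.
move=> sF rk neu; have oO := domain_open; have cM := domain_compact.
have [H [b [sH cH sb HbF]]] := global_extension cM sF.
have [Phi HPhi] := fld_flow sH cH.
move: sF => /smooth_on_rowP sF.
have key x : closure Om x -> exists G : rV -> rV,
  [/\ smv G x, F x = G x, forall v, derive_closure Om F v x = 'D_v G x, reg G x &
      0 < b x /\ H x = b x *: G x /\ forall v, 'D_v H x = 'D_v b x *: G x + b x *: 'D_v G x].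
  move=> cx; have [G sG nG] := sF x cx; exists G.
  have FG : \forall y \near x, Om y -> F y = G y.
    by apply: filterS nG => y h /subset_closure.
  have DE v := derive_closureE v oO cx sG FG.
  have Fx := nbhs_singleton nG cx.
  have [b0 Hx] := HbF x cx.
  have sbx : sm b x by exact: sm_T.
  split=> //; last first.
    split=> //; split=> [|v]; first by rewrite Hx Fx.
    rewrite -(derive_scale v (sm_differentiable sbx) (smv_differentiable sG)).2.
    have := @closure_derive_eq Om H (fun y => b y *: G y) x v oO cx (sH x) (smvZ sbx sG); apply.
    by apply: filterS FG => y h Oy; rewrite -h // (HbF y _).2 //; exact: subset_closure.
  move=> v h1 h2.
  have E : v *m value_jacobian Om F x = 0.
    rewrite /value_jacobian mul_mx_row Fx h1.
    rewrite (_ : \matrix_(i, j) _ = (jac G x)^T) ?h2 ?row_mx0 //.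
    apply/matrixP => i j; rewrite !mxE DE derive_rowE //; exact: smv_differentiable.
  have fr : row_free (value_jacobian Om F x) by rewrite /row_free rk.
  by apply: (row_free_inj fr); rewrite E mul0mx.
exists H, Phi; split=> //.
- split=> //; apply: connected_lconn; by case: hOm.
- move=> x cx; have [G [sG _ _ rG [b0 [Hx DH]]]] := key x cx.
  apply/(regP (sH x)) => v h1 h2; move/(regP sG): rG; apply.
    by move: h1; rewrite Hx dotZr => /eqP; rewrite mulf_eq0 gt_eqF //= => /eqP.
  have v1 : dot v (G x) = 0.
    by move: h1; rewrite Hx dotZr => /eqP; rewrite mulf_eq0 gt_eqF //= => /eqP.
  move=> h; have := h2 h; rewrite DH dotDr !dotZr v1 mulr0 add0r => /eqP.
  by rewrite mulf_eq0 gt_eqF //= => /eqP.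
- move=> x cx nx; have [G [sG Fx DE rG [b0 [Hx DH]]]] := key x cx.
  have bx : boundary Om x by split=> // /interior_subset.
  have [_ _ _ _ /(_ x bx) [rho lr]] := hOm.
  have [sr r0 g0 nr] := boundary_rho cx nx lr.
  pose g := gradient rho x; pose nu := (enorm g)^-1 *: g.
  have on : outer_unit_normal Om x nu by exists rho.
  have := neu x nu bx on; rewrite DE => DG.
  have eg : 0 < enorm g by rewrite enormE dnorm_gt0.
  have Dnu : 'D_nu rho x != 0.
    rewrite derive_gradient; last exact: sm_differentiable.
    by rewrite dotZr mulf_neq0 ?invr_eq0 ?dot_eq0 // gt_eqF.
  have nu0 : nu != 0.
    by apply: contra_neq Dnu => ->; rewrite derive_gradient ?dot0r //; exact: sm_differentiable.
  have H0 : H x != 0.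
    rewrite Hx scaler_eq0 gt_eqF //=; apply/eqP => Gx.
    have := reg_unit rG Gx => dG; move: DG; rewrite jacE; last exact: smv_differentiable.
    move=> /(congr1 (mulmx^~ (invmx (jac G x)))); rewrite mulmxK ?unitmxE ?unitfE // mul0mx.
    by move=> nu00; rewrite nu00 eqxx in nu0.
  split=> //; exists rho; split=> //.
  have rH : reg H x.
    apply/(regP (sH x)) => v h1 h2; move/(regP sG): rG; apply.
      by move: h1; rewrite Hx dotZr => /eqP; rewrite mulf_eq0 gt_eqF //= => /eqP.
    have v1 : dot v (G x) = 0.
      by move: h1; rewrite Hx dotZr => /eqP; rewrite mulf_eq0 gt_eqF //= => /eqP.
    move=> h; have := h2 h; rewrite DH dotDr !dotZr v1 mulr0 add0r => /eqP.
    by rewrite mulf_eq0 gt_eqF //= => /eqP.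
  have sp : nu *m jac H x = ('D_nu b x / b x) *: H x.
    rewrite -jacE; last exact/smv_differentiable/sH.
    by rewrite DH DG scaler0 addr0 Hx scalerA divfK // gt_eqF.
  have [c Ec] := fld_span rH H0 sp.
  apply: contra_neq Dnu => D0; rewrite Ec deriveZv ?D0 ?scaler0 //.
  exact: sm_differentiable.
Qed.

End Domain.

Lemma forward (Om : set rV) (F : rV -> rV) : (2 <= n)%N -> bounded_smooth_domain Om ->
  smooth_on (closure Om) F -> (forall x, closure Om x -> \rank (value_jacobian Om F x) = n) ->
  (forall x nu, boundary Om x -> outer_unit_normal Om x nu -> derive_closure Om F nu x = 0) ->
  diffeomorphic (closure Om) (closure (eball0 n 1)) \/
  diffeomorphic (closure Om) (closure (eball0 n 2) `\` eball0 n 1).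
Proof.
move=> n2 hOm sF rk neu; have n0 : (0 < n)%N by exact: ltnW.
have [H [Phi HS]] := neumann_setting hOm n0 sF rk neu.
have [x cx nx] := domain_boundary hOm n0.
have ne : Om !=set0 by case: hOm.
have [EX|EX] := exits_either HS n2 cx nx.
  exact: (setting_diffeomorphic HS n2 ne EX).
apply: (setting_diffeomorphic (setting_rev HS) n2 ne) => y Oy Fy; apply: EX => //.
by apply: contra_neq Fy => Hy; rewrite /rev Hy mul0mx.
Qed.

End Forward.

(** * Solutions on the ball and the annulus *)

Section Reverse.
Context {R : realType} {n : nat}.
Local Notation rV := 'rV[R]_n.

Lemma le0_pert (p q : R) : (forall e, 0 < e -> p + e * q <= 0) -> p <= 0.
Proof.
move=> H; rewrite leNgt; apply/negP => p0.
have d0 : 0 < 2 * (`|q| + 1) by have := normr_ge0 q; lra.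
have := H (p / (2 * (`|q| + 1))) (divr_gt0 p0 d0); rewrite leNgt => /negP; apply.
have -> : p + p / (2 * (`|q| + 1)) * q = (p / (2 * (`|q| + 1))) * (2 * (`|q| + 1) + q).
  by field; have := normr_ge0 q; lra.
apply: mulr_gt0; first exact: divr_gt0.
have := ler_norm (- q); rewrite normrN; have := normr_ge0 q; lra.
Qed.

(** The test vector is the part of [b] orthogonal to [a], tilted by a small multiple of [a] to meet
    the strict hypothesis. *)
Lemma colinear_grad (a b : rV) : a != 0 ->
  (forall h, 0 < dot a h -> dot b h <= 0) -> exists c, b = c *: a.
Proof.
move=> a0 H; have A0 : 0 < dot a a by rewrite dot_gt0.
pose c := dot b a / dot a a; exists c; pose b' := b - c *: a.
have ab : dot a b' = 0.
  by rewrite dotDr dotNr dotZr (dotC a b) /c divfK ?subrr // gt_eqF.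
have bb : dot b b' = dot b' b'.
  by rewrite {2}/b' dotDl dotNl dotZl ab mulr0 subr0.
have : dot b' b' <= 0.
  apply: (@le0_pert _ (dot b a)) => e e0; rewrite -bb -dotZr -dotDr; apply: H.
  by rewrite dotDr ab add0r dotZr mulr_gt0.
move=> h; have /eqP : dot b' b' = 0 by apply/eqP; rewrite eq_le h dot_ge0.
by rewrite dot_eq0 /b' subr_eq0 => /eqP.
Qed.

(** A crude bound: [K i j ^+ 2 + 1] dominates the absolute value and, unlike it, depends smoothly on
    the matrix. *)
Lemma quad_bound (u : rV) (K : 'M[R]_n) :
  `|dot u (u *m K)| <= (\sum_i \sum_j (K i j ^+ 2 + 1)) * dot u u.
Proof.
have uu i : u 0 i ^+ 2 <= dot u u.
  rewrite /dot (bigD1 i) //= -expr2 lerDl; apply: sumr_ge0 => j _; rewrite -expr2; exact: sqr_ge0.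
have -> : dot u (u *m K) = \sum_i \sum_j u 0 i * (u 0 j * K i j).
  rewrite exchange_big /=; apply: eq_bigr => j _; rewrite mxE mulr_sumr; apply: eq_bigr => i _; ring.
rewrite mulr_suml; apply: le_trans (ler_norm_sum _ _ _) _; apply: ler_sum => i _.
rewrite mulr_suml; apply: le_trans (ler_norm_sum _ _ _) _; apply: ler_sum => j _.
have hi := uu i; have hj := uu j; have hu := dot_ge0 u.
have h1 : `|u 0 i * u 0 j| <= dot u u.
  rewrite ler_norml; move: hi hj; set a := u 0 i; set b := u 0 j => ha hb.
  have := sqr_ge0 (a + b); have := sqr_ge0 (a - b); rewrite !expr2 in ha hb *.
  by move=> p q; apply/andP; split; nra.
have h2 : `|K i j| <= K i j ^+ 2 + 1.
  rewrite ler_norml; have := sqr_ge0 (K i j + 1); have := sqr_ge0 (K i j - 1); rewrite !expr2 => p q.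
  by apply/andP; split; nra.
by rewrite mulrA normrM mulrC; apply: ler_pM.
Qed.

(** [U] is the square of a vector orthogonal to value and derivatives of the corrected map, [p0] and
    [q] are its products with [phi] and the twist, and [s] is the boundary layer factor.
    Orthogonality to the value turns [p0] into a term of size [e], so the whole equation reads
    [U <= e * C * U]. *)
Lemma pert_unit (u p0 q k s e U K C : R) : 0 <= s <= 1 -> 0 < e -> e * C < 1 -> 0 < C ->
  p0 = - (e * (1 - s) * q) -> U + s * k * p0 * q + e * (1 - s) * K = 0 ->
  (k ^+ 2 + 1) * q ^+ 2 + `|K| <= C * U -> 0 <= U -> U = 0.
Proof.
move=> /andP[s0 s1] e0 eC C0 -> EU HC U0.
have k1 : `|k| <= k ^+ 2 + 1.
  rewrite ler_norml; have := sqr_ge0 (k + 1); have := sqr_ge0 (k - 1); rewrite !expr2 => a b.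
  by apply/andP; split; nra.
have -> : U = 0; last by [].
have E : U = e * ((1 - s) * (s * k * q ^+ 2 - K)) by rewrite -[U]subr0 -EU; ring.
have B : (1 - s) * (s * k * q ^+ 2 - K) <= C * U.
  apply: le_trans HC; apply: le_trans (ler_norm _) _; rewrite normrM.
  apply: le_trans (_ : 1 * `|s * k * q ^+ 2 - K| <= _).
    by apply: ler_wpM2r; [exact: normr_ge0|rewrite ger0_norm; lra].
  rewrite mul1r; apply: le_trans (ler_normB _ _) _; rewrite lerD2r normrM (ger0_norm (sqr_ge0 q)).
  apply: ler_wpM2r; first exact: sqr_ge0.
  rewrite normrM (ger0_norm s0); apply: le_trans k1; rewrite ler_piMl //.
have : U <= e * C * U by rewrite {1}E -[e * C * U]mulrA ler_pM2l.
move=> h; apply/eqP; rewrite eq_le U0 andbT.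
have : (1 - e * C) * U <= 0 by rewrite mulrBl mul1r subr_le0.
by rewrite pmulr_rle0 // subr_gt0.
Qed.

(** * Correction of a diffeomorphism to a model with a radial defining function *)

Variable Om : set rV.
Hypothesis hOm : bounded_smooth_domain Om.
Let oO := domain_open hOm.
Let cM := domain_compact hOm.
Let M := closure Om.

Variables (B : set rV) (delta kappa : rV -> R).
Hypothesis sdel : forall y, sm delta y.
Hypothesis skap : forall y, sm kappa y.
Hypothesis Ddel : forall y k, 'D_k delta y = kappa y * dot y k.
Hypothesis Bge : forall y, B y -> 0 <= delta y.
Hypothesis Bnz : forall y, B y -> delta y = 0 -> kappa y != 0 /\ y != 0.
Hypothesis Bin : forall y, B y -> 0 < delta y -> \forall z \near y, B z.

(** Dividing the global extension by its positive factor gives one formula, smooth near the closure,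
    in place of a map with local extensions only. *)
Lemma diffeo_smv : diffeomorphic M B -> exists phi : rV -> rV,
  forall x, M x -> smv phi x /\ B (phi x) /\ exists G : rV -> rV,
    [/\ smv G (phi x), G (phi x) = x, \forall z \near x, M z -> G (phi z) = z &
        \forall y \near phi x, B y -> M (G y)].
Proof.
move=> [f [g [sf sg fB gA]]].
have [H [b [sH _ sb HbF]]] := global_extension cM sf.
have E x : M x -> (b x)^-1 *: H x = f x.
  by move=> Mx; have [b0 ->] := HbF x Mx; rewrite scalerA mulVf ?scale1r // gt_eqF.
exists (fun x => (b x)^-1 *: H x) => x Mx; have [b0 _] := HbF x Mx.
have sphi : smv (fun x => (b x)^-1 *: H x) x.
  by apply: smvZ; [apply: smV; [rewrite gt_eqF|exact: sm_T]|exact: sH].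
have [Bf gf] := fB x Mx.
move: sg => /smooth_on_rowP /(_ (f x) Bf) [G sG nG].
split=> //; split; first by rewrite E.
exists G; have cphi := smv_continuous sphi.
have EG y : (B y -> g y = G y) -> B y -> M (G y).
  by move=> h By; rewrite -h //; have [] := gA y By.
split.
- by rewrite E.
- by rewrite E // -(nbhs_singleton nG) // gf.
- have nG' : \forall y \near (b x)^-1 *: H x, B y -> g y = G y by rewrite E.
  apply: filterS (near_comp cphi nG') => z hz Mz; have [Bz gz] := fB z Mz.
  by rewrite -hz E.
- by rewrite E //; apply: filterS nG => y; exact: EG.
Qed.

Section Phi.
Variable phi : rV -> rV.
Hypothesis Hphi : forall x, M x -> smv phi x /\ B (phi x) /\ exists G : rV -> rV,
    [/\ smv G (phi x), G (phi x) = x, \forall z \near x, M z -> G (phi z) = z &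
        \forall y \near phi x, B y -> M (G y)].

Let sphi x : M x -> smv phi x. Proof. by case/Hphi. Qed.
Let dphi x : M x -> differentiable phi x. Proof. by move=> /sphi /smv_differentiable. Qed.
Let Bphi x : M x -> B (phi x). Proof. by case/Hphi => _ []. Qed.

Lemma inverse_jac x : M x -> exists2 G : rV -> rV,
  smv G (phi x) /\ G (phi x) = x /\ (forall h, 'D_('D_h phi x) G (phi x) = h) &
  \forall y \near phi x, B y -> M (G y).
Proof.
move=> Mx; have [_ [_ [G [sG Gx GE BM]]]] := Hphi Mx; exists G => //; split=> //; split=> // h.
rewrite -(derive_comp h (dphi Mx) (smv_differentiable sG)).
have := @closure_derive_eq R n Om (fun z => G (phi z)) (fun z => z) x h oO Mx.
move=> ->.
- by rewrite derive_id.
- exact: smv_comp (sphi Mx).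
- exact: smv_id.
- by apply: filterS GE => z hz /subset_closure; exact: hz.
Qed.

Lemma phi_unit x : M x -> \det (jac phi x) != 0.
Proof.
move=> Mx; have [G [sG [_ GD]] _] := inverse_jac Mx; apply: unit_kernel => h.
rewrite -jacE; last exact: dphi.
move=> h0; rewrite -(GD h) h0 jacE ?mul0mx //; exact: smv_differentiable.
Qed.

Lemma phi_onto x k : M x -> 'D_(k *m invmx (jac phi x)) phi x = k.
Proof.
by move=> Mx; rewrite jacE ?mulmxKV ?unitmxE ?unitfE //; [exact: phi_unit|exact: dphi].
Qed.

Definition depth x := delta (phi x).

Lemma sm_depth x : M x -> sm depth x.
Proof. by move=> Mx; apply: (@sm_comp R rV n phi delta); [exact: sdel|exact: sphi]. Qed.

Lemma depth_derive x h : M x -> 'D_h depth x = kappa (phi x) * dot (phi x) ('D_h phi x).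
Proof.
move=> Mx; rewrite -Ddel -(derive_comp h (dphi Mx)) //; exact/sm_differentiable/sdel.
Qed.

Lemma depth_grad x h : M x -> 'D_h depth x = dot (gradient depth x) h.
Proof. by move=> Mx; apply: derive_gradient; exact/sm_differentiable/sm_depth. Qed.

Lemma depth_ge0 x : M x -> 0 <= depth x.
Proof. by move=> /Bphi /Bge. Qed.

Lemma depth_crit x : M x -> depth x = 0 -> gradient depth x != 0.
Proof.
move=> Mx d0; have [k0 p0] := Bnz (Bphi Mx) d0.
apply/eqP => g0; have := depth_grad (phi x *m invmx (jac phi x)) Mx.
rewrite depth_derive // phi_onto // g0 dot0l => /eqP; rewrite mulf_eq0 (negbTE k0) /=.
by rewrite dot_eq0 (negbTE p0).
Qed.

(** If [phi x] were interior to the model, [G] would map a neighbourhood of it into the closure. But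
    [G] follows the outward direction [gradient rho x] across the boundary. *)
Lemma depth_boundary x : M x -> ~ Om x -> depth x = 0.
Proof.
move=> Mx nx; apply/eqP; rewrite eq_le depth_ge0 // andbT leNgt; apply/negP => d0.
have nB := Bin (Bphi Mx) d0.
have [G [sG [Gx GD]] BM] := inverse_jac Mx.
have bx : boundary Om x by split=> // /interior_subset.
have [_ _ _ _ /(_ x bx) [rho lr]] := hOm.
have [sr r0 g0 nr] := boundary_rho Mx nx lr.
pose k := 'D_(gradient rho x) phi x.
have dG := smv_differentiable sG.
have sr' : sm rho (G (phi x)) by rewrite Gx.
have sG' : sm (fun y => rho (G y)) (phi x) by apply: sm_comp sG.
have Dk : 0 < 'D_k (fun y => rho (G y)) (phi x).
  rewrite (derive_comp k dG); last exact: sm_differentiable.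
  by rewrite /k GD Gx derive_gradient ?dot_gt0 //; exact: sm_differentiable.
have [e e0 He] := derive_line_pos (sm_differentiable sG') Dk.
have nr' : \forall y \near G (phi x), (Om y <-> rho y < 0) /\ (closure Om y <-> rho y <= 0) by rewrite Gx.
have [d dd Hd] := near_line k (nearI nB (nearI BM (near_comp (smv_continuous sG) nr'))).
pose t := Num.min d e / 2.
have m0 : 0 < Num.min d e by rewrite lt_min dd.
have m1 : Num.min d e <= d by rewrite ge_min lexx.
have m2 : Num.min d e <= e by rewrite ge_min lexx orbT.
have t0 : 0 < t by rewrite divr_gt0.
have te : t < e by rewrite /t; lra.
have td : `|t| < d by rewrite gtr0_norm // /t; lra.
have [Bt [Mt [_ Rt]]] := Hd t td; have [+ _] := He t t0 te.
by rewrite Gx r0 ltNge => /negP; apply; apply/Rt/Mt.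
Qed.

(** On the closure the depth is at least its boundary value 0, so it cannot increase in an outward
    direction. *)
Lemma depth_normal x rho : M x -> ~ Om x -> local_defining_function Om x rho ->
  exists c, gradient depth x = c *: gradient rho x.
Proof.
move=> Mx nx lr; have [sr r0 g0 nr] := boundary_rho Mx nx lr.
apply: colinear_grad => // h; rewrite -derive_gradient; last exact: sm_differentiable.
move=> Dr; rewrite -depth_grad // leNgt; apply/negP => Dd.
have [e1 e10 H1] := derive_line_pos (sm_differentiable sr) Dr.
have [e2 e20 H2] := derive_line_pos (sm_differentiable (sm_depth Mx)) Dd.
have [d dd Hd] := near_line h nr.
pose m := Num.min d (Num.min e1 e2).
have m0 : 0 < m by rewrite !lt_min dd e10.
have [m1 m2 m3] : [/\ m <= d, m <= e1 & m <= e2] by rewrite !ge_min !lexx !orbT.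
pose t := m / 2.
have t0 : 0 < t by rewrite divr_gt0.
have [t1 t2] : t < e1 /\ t < e2 by rewrite /t; split; lra.
have td : `|- t| < d by rewrite normrN gtr0_norm // /t; lra.
have [_ h1] := H1 t t0 t1; have [_ h2] := H2 t t0 t2.
have [hO _] := Hd (- t) td; rewrite scaleNr in hO.
rewrite r0 in h1; move: h2; rewrite (depth_boundary Mx nx) ltNge => /negP; apply.
by apply: depth_ge0; apply: subset_closure; apply/hO.
Qed.

(** Adding the depth keeps the denominator positive at interior critical points of the depth and
    changes nothing on the boundary. *)
Definition twist_denom x := dot (gradient depth x) (gradient depth x) + depth x.

(* On the boundary, where the depth vanishes and its gradient is normal, the
   derivative of phi + depth *: twist in the normal direction vanishes. *)
Definition twist x : rV :=
  - (twist_denom x)^-1 *: (gradient depth x *m jac phi x).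

Lemma twist_denom_gt0 x : M x -> 0 < twist_denom x.
Proof.
move=> Mx; have := depth_ge0 Mx; rewrite le_eqVlt => /orP[/eqP d0|d0].
  by rewrite /twist_denom -d0 addr0 dot_gt0 depth_crit.
by rewrite /twist_denom ltr_wpDl // dot_ge0.
Qed.

Lemma sm_twist x : M x -> smv twist x.
Proof.
move=> Mx; have sg : smv (gradient depth) x.
  move=> j; apply: (sm_eq (f := 'D_(delta_mx 0 j) depth)); last exact/sm_der/sm_depth.
  by apply: filterE => y; rewrite mxE.
apply: (@smvZ R rV n (fun x => - (twist_denom x)^-1) (fun x => gradient depth x *m jac phi x)).
  apply/smN/smV; first by rewrite gt_eqF // twist_denom_gt0.
  by apply: smD; [exact: sm_dot|exact: sm_depth].
move=> j; apply: sm_eq (sm_sum (index_enum _) (P := xpredT)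
    (F := fun k y => gradient depth y 0 k * jac phi y k j) _).
  by apply: filterE => y; rewrite [RHS]mxE.
by move=> k _; apply: smM; [exact: sg|exact/sm_jac/sphi].
Qed.

(** To first order the depth at the boundary, but at most [e] on the closure; the derivative is that
    of the depth times a factor in [[0, 1]] that decays inwards. *)
Definition twist_amp (e : R) x := e * (1 - expR (- (e^-1 * depth x))).
Definition twisted (e : R) x : rV := phi x + twist_amp e x *: twist x.

Lemma sm_amp e x : M x -> sm (twist_amp e) x.
Proof.
move=> Mx; apply: smM; first exact: sm_cst.
apply: smB; first exact: sm_cst.
apply: sm_comp1; first exact: sm_expR.
by apply/smN/smM; [exact: sm_cst|exact: sm_depth].
Qed.

Lemma amp_derive e x h : e != 0 -> M x ->
  'D_h (twist_amp e) x = expR (- (e^-1 * depth x)) * 'D_h depth x.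
Proof.
move=> e0 Mx; have dd := sm_differentiable (sm_depth Mx).
have EE : twist_amp e = (fun y => (fun t : R => e * (1 - expR (- (e^-1 * t)))) (depth y)) by [].
pose k := fun t : R => e * (1 - expR (- (e^-1 * t))).
have Dk (t : R) : is_derive t (1 : R) k (expR (- (e^-1 * t))).
  have DN : is_derive t (1 : R) (fun t : R => - (e^-1 * t)) (- e^-1).
    apply: is_deriveN_; have := @is_deriveZ R R R^o id e^-1 t (1 : R) 1 (is_derive_id _ _).
    by rewrite [_ *: _]mulr1.
  have DE := @is_derive1_comp R (@expR R) (fun t : R => - (e^-1 * t)) t _ _ (is_derive_expR _) DN.
  have D1 : is_derive t (1 : R) (fun t : R => 1 - expR (- (e^-1 * t))) (0 - expR (- (e^-1 * t)) * - e^-1).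
    exact: is_deriveB (is_derive_cst _ _ _) DE.
  have := @is_deriveZ R R R^o _ e t (1 : R) _ D1.
  by rewrite (_ : e *: _ = expR (- (e^-1 * t))) // /GRing.scale /=; field.
have dk : differentiable k (depth x).
  by apply/derivable1_diffP; case: (Dk (depth x)).
rewrite EE (derive_comp h dd dk).
have -> : 'D_h depth x = 'D_h depth x *: (1 : R) by rewrite [_ *: _]mulr1.
rewrite deriveZv //; case: (Dk (depth x)) => _ ->.
by rewrite /GRing.scale /= mulr1 mulrC.
Qed.

Lemma sm_twisted e x : M x -> smv (twisted e) x.
Proof.
by move=> Mx; apply: smvD; [exact: sphi|apply: smvZ; [exact: sm_amp|exact: sm_twist]].
Qed.

Lemma twisted_derive e x h : e != 0 -> M x -> 'D_h (twisted e) x =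
  'D_h phi x + ((expR (- (e^-1 * depth x)) * 'D_h depth x) *: twist x + twist_amp e x *: 'D_h twist x).
Proof.
move=> e0 Mx; have da := sm_differentiable (sm_amp e Mx).
have dt := smv_differentiable (sm_twist Mx).
have [d1 D1] := derive_scale h da dt.
by rewrite -amp_derive // -D1 -(deriveD_ h (dphi Mx) d1).
Qed.

Lemma twisted_normal e x rho : e != 0 -> M x -> ~ Om x -> local_defining_function Om x rho ->
  'D_(gradient rho x) (twisted e) x = 0.
Proof.
move=> e0 Mx nx lr; have d0 := depth_boundary Mx nx.
have [c Ec] := depth_normal Mx nx lr.
have g0 := depth_crit Mx d0.
have c0 : c != 0 by apply: contra_neq g0 => c0; rewrite Ec c0 scale0r.
rewrite twisted_derive // /twist_amp d0 mulr0 oppr0 expR0 subrr mulr0 scale0r addr0 mul1r.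
rewrite depth_grad // Ec dotZl /twist scalerA Ec -scalemxAl -jacE; last exact: dphi.
rewrite scalerA -[X in X + _]scale1r -scalerDl.
have r0 : dot (gradient rho x) (gradient rho x) != 0.
  by rewrite dot_eq0; apply: contra_neq g0 => r0; rewrite Ec r0 scaler0.
rewrite (_ : 1 + _ = 0) ?scale0r // /twist_denom d0 addr0 Ec dotZl dotZr.
by field; rewrite c0 r0.
Qed.

(** The gradient of the depth is pulled back from a multiple of the radial covector [phi x], so the
    large term of the derivative contains the product of the test vector with [phi x], which is
    small by orthogonality to the value. Compactness bounds the remaining coefficients by [D'], and
    [e] is chosen with [e * D' = 1 / 2]. *)
Lemma twisted_reg : exists2 e, 0 < e & forall x, M x -> reg (twisted e) x.
Proof.
pose K x := invmx (jac phi x) *m jac twist x.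
pose C x := (kappa (phi x) ^+ 2 + 1) * dot (twist x) (twist x) + \sum_i \sum_j (K x i j ^+ 2 + 1).
have sC x : M x -> sm C x.
  move=> Mx; apply: smD; last first.
    apply: sm_sum => i _; apply: sm_sum => j _; apply: smD; last exact: sm_cst.
    apply: smX; apply: sm_eq (sm_sum (index_enum _) (P := xpredT)
      (F := fun k y => invmx (jac phi y) i k * jac twist y k j) _).
      by apply: filterE => y; rewrite [RHS]mxE.
    move=> k _; apply: smM; last exact/sm_jac/sm_twist.
    by apply: sm_inv; [exact: phi_unit|move=> a b; exact/sm_jac/sphi].
  apply: smM; last by apply: sm_dot; exact: sm_twist.
  apply: smD; last exact: sm_cst.
  by apply: smX; apply: (@sm_comp R rV n phi kappa); [exact: skap|exact: sphi].
have [D HD] : exists D : R, forall x, M x -> C x <= D.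
  apply: compact_locbound cM _ => x Mx; exists (C x + 1).
  have h : C x < C x + 1 by rewrite ltrDl.
  by apply: filterS (near_lt (sm_continuous (sC x Mx)) h) => y hy _; exact: ltW.
pose D' := `|D| + 1; have D'0 : 0 < D' by rewrite ltr_wpDl.
exists (2 * D')^-1; first by rewrite invr_gt0 mulr_gt0.
set e := (2 * D')^-1; have e0 : 0 < e by rewrite invr_gt0 mulr_gt0.
move=> x Mx; apply/(regP (sm_twisted e Mx)) => u h1 h2.
have en : e != 0 by rewrite gt_eqF.
pose s := expR (- (e^-1 * depth x)).
have s01 : 0 <= s <= 1.
  rewrite expR_ge0 -(@expR0 R) ler_expR oppr_le0 mulr_ge0 ?depth_ge0 // invr_ge0 ltW //.
have E1 : dot u (phi x) = - (e * (1 - s) * dot u (twist x)).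
  by move: h1; rewrite dotDr dotZr => /eqP; rewrite addr_eq0 => /eqP.
have E2 : dot u u + s * kappa (phi x) * dot u (phi x) * dot u (twist x) + e * (1 - s) * dot u (u *m K x) = 0.
  (* The test direction is the one that the derivative of [phi] maps to [u]. *)
  have := h2 (u *m invmx (jac phi x)); rewrite twisted_derive // depth_derive // phi_onto //.
  rewrite jacE; last exact/smv_differentiable/sm_twist.
  rewrite -mulmxA -/(K x) !dotDr !dotZr (dotC (phi x) u) => h.
  by rewrite -[RHS]h /s /twist_amp; ring.
have HC : (kappa (phi x) ^+ 2 + 1) * dot u (twist x) ^+ 2 + `|dot u (u *m K x)| <= D' * dot u u.
  have h : C x <= D' by apply: le_trans (HD x Mx) _; apply: le_trans (ler_norm _) _; rewrite lerDl.
  apply: le_trans (ler_wpM2r (dot_ge0 u) h); rewrite [C x * _]mulrDl; apply: lerD; last exact: quad_bound.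
  rewrite -mulrA; apply: ler_wpM2l; first by rewrite addr_ge0 // sqr_ge0.
  by rewrite mulrC; exact: cauchy_schwarz.
have eD : e * D' < 1 by rewrite /e invfM -mulrA mulVf ?gt_eqF // mulr1; lra.
apply/eqP; rewrite -dot_eq0; apply/eqP.
exact: (pert_unit 0 s01 e0 eD D'0 E1 E2 HC (dot_ge0 u)).
Qed.

End Phi.

Lemma reverse : diffeomorphic M B -> exists F : rV -> rV,
     [/\ smooth_on (closure Om) F,
         (forall x, closure Om x -> \rank (value_jacobian Om F x) = n) &
         (forall x nu, boundary Om x -> outer_unit_normal Om x nu ->
            derive_closure Om F nu x = 0)].
Proof.
move=> /diffeo_smv [phi Hphi]; have [e e0 rF] := twisted_reg Hphi.
pose F := twisted phi e; have sF x : M x -> smv F x by exact: sm_twisted.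
have DE x v : M x -> derive_closure Om F v x = 'D_v F x.
  by move=> Mx; apply: (derive_closureE v oO Mx (sF x Mx)); exact: filterE.
exists F; split.
- by apply/smooth_on_rowP => x Mx; exists F; [exact: sF|exact: filterE].
- move=> x Mx; apply/eqP; rewrite -/(row_free _); apply: inj_row_free => v Ev.
  have dF := smv_differentiable (sF x Mx).
  move: Ev; rewrite /value_jacobian mul_mx_row -[RHS]row_mx0 => /eq_row_mx [E1 E2].
  apply: (rF x Mx) => //; rewrite -E2; congr (_ *m _).
  by apply/matrixP => i j; rewrite !mxE DE // derive_rowE.
- move=> x nu [Mx ni] [rho lr ->]; rewrite DE // deriveZv; last exact/smv_differentiable/sF.
  rewrite (twisted_normal Hphi _ Mx _ lr) ?scaler0 // ?gt_eqF //.
  by move=> Ox; apply: ni; exact: (open_near oO Ox).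
Qed.

End Reverse.

Section Targets.
Context {R : realType} {n : nat}.
Local Notation rV := 'rV[R]_n.

Lemma sm_dot_self (y : rV) : sm (fun y : rV => dot y y) y.
Proof. by apply: (@sm_dot R n rV id id); exact: smv_id. Qed.

Lemma derive_dot_self (y k : rV) : 'D_k (fun y : rV => dot y y) y = 2 * dot y k.
Proof.
have di : differentiable (fun y : rV => y) y by exact/smv_differentiable/smv_id.
have -> := @derive_dot R n rV id id y k di di; rewrite derive_id dotC; lra.
Qed.

Lemma deriveB_ (f g : rV -> R) (x v : rV) : differentiable f x -> differentiable g x ->
  'D_v (fun y => f y - g y) x = 'D_v f x - 'D_v g x.
Proof. by move=> df dg; apply: deriveB; exact: diff_derivable. Qed.

Lemma reverse_ball (Om : set rV) : bounded_smooth_domain Om ->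
  diffeomorphic (closure Om) (closure (eball0 n 1)) -> exists F : rV -> rV,
     [/\ smooth_on (closure Om) F,
         (forall x, closure Om x -> \rank (value_jacobian Om F x) = n) &
         (forall x nu, boundary Om x -> outer_unit_normal Om x nu ->
            derive_closure Om F nu x = 0)].
Proof.
move=> hOm; rewrite closure_eball //.
have sB y : sm (fun y : rV => 1 - dot y y) y by apply: smB; [exact: sm_cst|exact: sm_dot_self].
have BE (y : rV) : (dnorm y <= 1) = (0 <= 1 - dot y y) by rewrite dnorm_le // expr1n subr_ge0.
(* The gradient of [1 - dot y y] is [-2 *: y]. *)
apply: (@reverse R n Om hOm _ (fun y => 1 - dot y y) (fun=> -2)) => //.
- by move=> y; exact: sm_cst.
- move=> y k; have ds := sm_differentiable (sm_dot_self y).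
  have -> := deriveB_ k (sm_differentiable (sm_cst 1 y)) ds.
  by rewrite derive_cst_ derive_dot_self sub0r mulNr.
- by move=> y /=; rewrite BE.
- move=> y _ /eqP; rewrite subr_eq0 => /eqP h; split; first by rewrite oppr_eq0 pnatr_eq0.
  by rewrite -dot_eq0 -h oner_eq0.
- move=> y _ h; apply: filterS (near_gt (sm_continuous (sB y)) h) => z hz.
  by rewrite /= BE ltW.
Qed.

Lemma reverse_annulus (Om : set rV) : bounded_smooth_domain Om ->
  diffeomorphic (closure Om) (closure (eball0 n 2) `\` eball0 n 1) -> exists F : rV -> rV,
     [/\ smooth_on (closure Om) F,
         (forall x, closure Om x -> \rank (value_jacobian Om F x) = n) &
         (forall x nu, boundary Om x -> outer_unit_normal Om x nu ->
            derive_closure Om F nu x = 0)].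
Proof.
move=> hOm; rewrite closure_eball //.
pose del := fun y : rV => (dot y y - 1) * (4 - dot y y).
have sB y : sm del y.
  by apply: smM; apply: smB; try exact: sm_cst; exact: sm_dot_self.
have BE (y : rV) : ([set x | dnorm x <= 2] `\` eball0 n 1) y <-> (1 <= dot y y <= 4).
  rewrite /eball0 /setD /= enormE dnorm_lt // expr1n dnorm_le // (_ : 2 ^+ 2 = 4 :> R); last by rewrite expr2; lra.
  split=> [[h1 /negP]|/andP[h1 h2]]; first by rewrite -leNgt h1 => ->.
  by split=> //; apply/negP; rewrite -leNgt.
(* The radial factor of the gradient of [del]; it equals 6 on the inner sphere and -6 on the outer
   one. *)
apply: (@reverse R n Om hOm _ del (fun y => 2 * (5 - 2 * dot y y))) => //.
- by move=> y; apply: smM; [exact: sm_cst|apply: smB; [exact: sm_cst|apply: smM; [exact: sm_cst|exact: sm_dot_self]]].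
- move=> y k; have ds := sm_differentiable (sm_dot_self y).
  have d1 := sm_differentiable (smB (sm_dot_self y) (sm_cst 1 y)).
  have d2 := sm_differentiable (smB (sm_cst 4 y) (sm_dot_self y)).
  have -> := deriveM_ k d1 d2.
  have -> := deriveB_ k ds (sm_differentiable (sm_cst 1 y)).
  have -> := deriveB_ k (sm_differentiable (sm_cst 4 y)) ds.
  rewrite !derive_cst_ derive_dot_self; ring.
- by move=> y /BE /andP[h1 h2]; apply: mulr_ge0; rewrite subr_ge0.
- move=> y /BE /andP[h1 h2] /eqP; rewrite mulf_eq0 !subr_eq0 => h; split; last first.
    by rewrite -dot_eq0 gt_eqF //; lra.
  rewrite mulf_neq0 ?pnatr_eq0 //.
  by move: h => /orP[/eqP -> | /eqP <-]; apply/eqP => h; lra.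
- move=> y /BE /andP[h1 h2] h.
  have [h3 h4] : 1 < dot y y /\ dot y y < 4.
    split; rewrite lt_neqAle ?h1 ?h2 andbT; apply/eqP => E; move: h; rewrite /del.
      by rewrite -E subrr mul0r ltxx.
    by rewrite E subrr mulr0 ltxx.
  apply: filterS2 (near_gt (sm_continuous (sm_dot_self y)) h3) (near_lt (sm_continuous (sm_dot_self y)) h4) => z z1 z2.
  by apply/BE; rewrite !ltW.
Qed.

End Targets.

Theorem theorem1 (R : realType) (n : nat) (hn : (2 <= n)%N)
    (Omega : set 'rV[R]_n) (hOmega : bounded_smooth_domain Omega) :
  (exists F : 'rV[R]_n -> 'rV[R]_n,
     [/\ smooth_on (closure Omega) F,
         (forall x, closure Omega x ->
            \rank (value_jacobian Omega F x) = n) &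
         (forall x nu, boundary Omega x -> outer_unit_normal Omega x nu ->
            derive_closure Omega F nu x = 0)])
  <->
  (diffeomorphic (closure Omega) (closure (eball0 n 1)) \/
   diffeomorphic (closure Omega) (closure (eball0 n 2) `\` eball0 n 1)).
Proof.
split=> [[F [sF rF nF]]|[hB|hA]]; first exact: (forward hn hOmega sF rF nF).
- exact: reverse_ball hOmega hB.
- exact: reverse_annulus hOmega hA.
Qed.
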